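(* Let $z_1<\dots<z_p$ be real numbers, $p\ge2$, and $\alpha_1,\dots,\alpha_p,\gamma$ complex numbers with positive real parts. Then, with the rows and columns indexed by $\mathcal Z_n^{p-1}$ in the same order, $$\det\Big[\int_{\mathbb U_{\mathbf l}}\Phi(t,z)\,\omega_{\mathbf m}(t,z)\Big]_{\mathbf l,\mathbf m\in\mathcal Z_n^{p-1}} =\prod_{s=0}^{n-1}\Big[\frac{\Gamma((s+1)\gamma)^{p-1}}{\Gamma(\gamma)^{p-1}}\frac{\Gamma(1+\alpha_p+s\gamma)\prod_{j=1}^{p-1}\Gamma(\alpha_j+s\gamma)}{\Gamma(1+\sum_{j=1}^p\alpha_j+(2n-2-s)\gamma)}\Big]^{\binom{p+n-s-3}{p-2}}$$ $$\times\exp\Big(i\pi\binom{p+n-2}{p-1}\sum_{s=1}^p(s-1)\alpha_s\Big)\prod_{1\le a<b\le p}(z_b-z_a)^{(\alpha_a+\alpha_b)\binom{p+n-2}{p-1}+2\gamma\binom{p+n-2}{p}}.$$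
   Context: For $t\in\mathbb R^n$, $$\Phi(t,z)=\prod_{s=1}^p\prod_{i=1}^n(t_i-z_s)^{\alpha_s}\prod_{1\le i<j\le n}(t_j-t_i)^{2\gamma},$$ where every power $x^{\alpha_s}$ and $x^{2\gamma}$ uses the branch with $-\pi/2<\arg x<3\pi/2$. $\mathcal Z_n^p=\{\mathbf l=(l_1,\dots,l_p)\in\mathbb Z^p: l_i\ge0,\ l_1+\dots+l_p=n\}$. Set $\mathbf l^s=l_1+\dots+l_s$ and $\mathbf l^0=0$, and $\Gamma_{\mathbf m,s}=\{\mathbf m^{s-1}+1,\dots,\mathbf m^s\}$. For $\mathbf m\in\mathcal Z_n^p$, $$\omega_{\mathbf m}=\Big(\sum_{\sigma\in S_n}\prod_{s=1}^p\frac{1}{m_s!}\prod_{j\in\Gamma_{\mathbf m,s}}\frac{1}{t_{\sigma_j}-z_s}\Big)dt_1\wedge\dots\wedge dt_n,$$ and $\mathbf m\in\mathcal Z_n^{p-1}$ is identified with $(\mathbf m,0)\in\mathcal Z_n^p$. For $\mathbf l\in\mathcal Z_n^{p-1}$, $$\mathbb U_{\mathbf l}=\{t\in\mathbb R^n: z_s\le t_{\mathbf l^{s-1}+1}\le\dots\le t_{\mathbf l^s}\le z_{s+1}\text{ for }s=1,\dots,p-1\},$$ with the standard orientation of $\mathbb R^n$. *)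

(* Defs.v *)
From HB Require Import structures.
From mathcomp Require Import all_boot all_order all_algebra.
From mathcomp Require Import fingroup perm.
From mathcomp Require Import all_classical all_reals all_analysis.
From mathcomp.real_closed Require Import complex.

Set Implicit Arguments.
Unset Strict Implicit.
Unset Printing Implicit Defensive.
Import Order.TTheory GRing.Theory Num.Theory.
Import numFieldNormedType.Exports.
Local Open Scope classical_set_scope.
Local Open Scope ring_scope.
Local Open Scope complex_scope.

Definition ReC {R : Type} (w : complex R) : R := complex.Re w.
Definition ImC {R : Type} (w : complex R) : R := complex.Im w.

Section Defs.
Variable R : realType.

Definition cexp (w : R[i]) : R[i] :=
  (expR (ReC w) * cos (ImC w)) +i* (expR (ReC w) * sin (ImC w)).

(* x^a for real x and complex a, branch -pi/2 < arg x < 3pi/2: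
   arg x = 0 for x > 0, arg x = pi for x < 0; 0^a := 0 (Re a > 0). *)
Definition cpowR (x : R) (a : R[i]) : R[i] :=
  if x == 0 then 0
  else cexp (a * ((ln `|x|) +i* (if x < 0 then pi else 0))).

Definition cint (D : set R) (f : R -> R[i]) : R[i] :=
  (Rintegral lebesgue_measure D (fun x => ReC (f x)))
  +i* (Rintegral lebesgue_measure D (fun x => ImC (f x))).

Definition Gamma (z : R[i]) : R[i] :=
  cint `]0%R, +oo[ (fun t => cpowR t (z - 1) * (expR (- t))%:C).

(* Integral over R^n (coordinates t_1, ..., t_n, 1-based; a point is
   represented by t : nat -> R, other coordinates being irrelevant),
   computed as the iterated Lebesgue integral dt_n ... dt_1. *)
Fixpoint intRn (n : nat) (f : (nat -> R) -> R[i]) : R[i] :=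
  match n with
  | 0 => f (fun _ => 0)
  | n'.+1 => cint setT (fun x =>
               intRn n' (fun t => f (fun j => if j == n'.+1 then x else t j)))
  end.

Definition intRn_on (n : nat) (U : set (nat -> R)) (f : (nat -> R) -> R[i]) :=
  intRn n (fun t => if `[< U t >] then f t else 0).

End Defs.

Definition compb (n k : nat) (l : {ffun 'I_k -> 'I_n.+1}) : bool :=
  \sum_(i < k) (l i : nat) == n.
Definition Zc (n k : nat) := {l : {ffun 'I_k -> 'I_n.+1} | compb l}.

(* 1-based access l_s (s = 1..k) *)
Definition cget (n k : nat) (l : Zc n k) (s : nat) : nat :=
  if insub s.-1 is Some i then (val l i : nat) else 0.
Definition lsum (n k : nat) (l : Zc n k) (s : nat) : nat :=
  \sum_(1 <= i < s.+1) cget l i.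

Unset Implicit Arguments.
Section Defs2.
Context {R : realType}.
Local Open Scope ring_scope.
Local Open Scope complex_scope.

Definition Phi (p n : nat) (z : nat -> R) (alpha : nat -> R[i]) (gamma : R[i])
  (t : nat -> R) : R[i] :=
  (\prod_(1 <= s < p.+1) \prod_(1 <= i < n.+1) cpowR (t i - z s) (alpha s))
  * \prod_(1 <= i < n.+1) \prod_(i.+1 <= j < n.+1)
      cpowR (t j - t i) (2%:R * gamma).

(* coefficient of dt_1 ^ ... ^ dt_n in omega_m, m in Z_n^{p-1}
   identified with (m,0) in Z_n^p (so the factor s = p is empty) *)
Definition omega (p n : nat) (z : nat -> R) (m : Zc n p.-1) (t : nat -> R)
  : R[i] :=
  \sum_(sigma : 'S_n)
    \prod_(1 <= s < p)
      ((((cget m s)`!)%:R)^-1 *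
       \prod_(j < n | (lsum m s.-1 < j.+1 <= lsum m s)%N)
          ((t (sigma j).+1 - z s)%:C)^-1).

Definition Ucell (p n : nat) (z : nat -> R) (l : Zc n p.-1) : set (nat -> R) :=
  [set t | forall s, (1 <= s <= p.-1)%N ->
     forall j, (lsum l s.-1 < j <= lsum l s)%N ->
       (j = (lsum l s.-1).+1 -> z s <= t j)%R /\
       (j = lsum l s -> t j <= z s.+1)%R /\
       ((j < lsum l s)%N -> t j <= t j.+1)%R].

Definition period_matrix (p n : nat) (z : nat -> R) (alpha : nat -> R[i])
  (gamma : R[i]) : 'M[R[i]]_#|{: Zc n p.-1}| :=
  \matrix_(a, b) intRn_on n (Ucell p n z (enum_val a))
      (fun t => Phi p n z alpha gamma t * omega p n z (enum_val b) t).

End Defs2.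

(* Main.v *)
Require Import Defs.
From HB Require Import structures.
From mathcomp Require Import all_boot all_order all_algebra.
From mathcomp Require Import fingroup perm.
From mathcomp Require Import all_classical all_reals all_analysis measurable_realfun.
From mathcomp.real_closed Require Import complex.
From mathcomp Require Import ring lra zify.
Set Implicit Arguments.
Unset Strict Implicit.
Unset Printing Implicit Defensive.
Import Order.TTheory GRing.Theory Num.Theory.
Import numFieldNormedType.Exports.
Local Open Scope classical_set_scope.
Local Open Scope ring_scope.
Local Open Scope complex_scope.

(* Order the cells and the forms by compositions and let [D alpha] be the determinant.
   Total derivatives of the master function give linear relations between the integrals
   of [Phi * u_{f 1}(t_1) * ... * u_{f n}(t_n)], where [u_0 = 1] and
   [u_s(t) = 1/(t - z_s)].  Through these relations the forms with [u_1] replaced by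
   [u_0], respectively by [u_p], are triangular in the [omega_m], which makes
   [D (alpha + e_p) / D alpha] an explicit product.  Iterating,
   [D alpha = D (alpha + N e_p) * (a ratio of Gamma products)].  As [N] grows, the factor
   [prod_i (t_i - z_p)^N] concentrates the integral over each cell at the left endpoints
   [z_s]: after the substitution [t_i = z_s + u_i (z_p - z_s) / N] the rescaled matrix
   tends to a diagonal one, whose entries are powers of the [z_b - z_a] times the integrals
   [LL gam l a] of [prod_i u_i^(a-1) exp(-u_i) prod_(i<j) (u_j - u_i)^(2 gam)] over
   [0 < u_1 < ... < u_l].  These are evaluated from the case [p = 2] of the formula so
   obtained: the reflection [t -> 1 - t] exchanges [alpha_1] and [alpha_2], hence
   [LL gam l a] is a constant times [prod_k Gamma (a + k gam)], and integrating out the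
   smallest variable at [a = 1] gives a recursion in [l] for that constant. *)

(** * Complex powers *)

(** The derivatives used are those of $(t_i-z_c)\Phi\prod_{j\ne i}u_{f(j)}(t_j)$ in $t_i$. The
    linear factor is what tames the terms with $(t_i-t_k)^{-1}$: symmetrized in $i$ and $k$ they
    become polynomials in the $u_s$, so after summation over all labellings with prescribed
    multiplicities only integrals of the same kind remain. The choice $c=p$ removes label $p$ and
    leads from $u_1$ to $u_0$; subtracting the relation for $c=1$ removes $u_0$ and leads from $u_1$
    to $u_p$. The determinants for $\alpha$ and $\alpha+e_p$ meet because $(t-z_p)u_p=u_0$: up to a
    triangular matrix, forms in $u_p$ for $\alpha+e_p$ are forms in $u_0$ for $\alpha$. No pole is
    integrable by itself when exponents have small positive real part, so every estimate pairs
    $x^{-1}$ with its own power $x^a$. In the limit, each row is divided by the leading behaviour of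
    its diagonal entry, and one bound uniform in $N$ must serve the off-diagonal entries too. The
    Gamma quotients then converge as Gauss products, because the total powers of $N$ cancel by a
    binomial identity. *)

Section ComplexBasics.
Context {R : realType}.
Implicit Types (w a b : R[i]) (x y : R).

Definition nc (w : R[i]) : R := ComplexField.Normc.normc w.

Lemma complex_eq w w' : ReC w = ReC w' -> ImC w = ImC w' -> w = w'.
Proof. by case: w w' => a b [c d] /= -> ->. Qed.
Lemma ReCD w w' : ReC (w + w') = ReC w + ReC w'. Proof. by case: w w' => ? ? []. Qed.
Lemma ImCD w w' : ImC (w + w') = ImC w + ImC w'. Proof. by case: w w' => ? ? []. Qed.
Lemma ReCN w : ReC (- w) = - ReC w. Proof. by case: w. Qed.
Lemma ImCN w : ImC (- w) = - ImC w. Proof. by case: w. Qed.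
Lemma ReCM w w' : ReC (w * w') = ReC w * ReC w' - ImC w * ImC w'.
Proof. by case: w w' => ? ? []. Qed.
Lemma ImCM w w' : ImC (w * w') = ReC w * ImC w' + ImC w * ReC w'.
Proof. by case: w w' => ? ? []. Qed.
Lemma ReC_real x : ReC x%:C = x. Proof. by []. Qed.
Lemma ImC_real x : ImC x%:C = 0. Proof. by []. Qed.

Lemma ReC1 : ReC (1 : R[i]) = 1. Proof. by []. Qed.

Lemma natC n : (n%:R : R[i]) = (n%:R : R)%:C.
Proof. by rewrite rmorph_nat. Qed.
Lemma ReC_nat n : ReC (n%:R : R[i]) = n%:R. Proof. by rewrite natC. Qed.
Lemma ImC_nat n : ImC (n%:R : R[i]) = 0. Proof. by rewrite natC. Qed.
Lemma ReC_natM n w : ReC (n%:R * w) = n%:R * ReC w.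
Proof. by rewrite ReCM ReC_nat ImC_nat mul0r subr0. Qed.
Lemma ReC_realM x w : ReC (x%:C * w) = x * ReC w.
Proof. by rewrite ReCM ReC_real ImC_real mul0r subr0. Qed.
Lemma ImC_realM x w : ImC (x%:C * w) = x * ImC w.
Proof. by rewrite ImCM ReC_real ImC_real mul0r addr0. Qed.
Lemma realCM x y : (x * y)%:C = x%:C * y%:C. Proof. by rewrite rmorphM. Qed.
Lemma realCV x : (x^-1)%:C = x%:C^-1. Proof. by rewrite fmorphV. Qed.

Lemma nc_norm w : `|w| = (nc w)%:C. Proof. by case: w. Qed.
Lemma nc_ge0 w : 0 <= nc w. Proof. by case: w => a b; exact: sqrtr_ge0. Qed.
Lemma nc0 : nc 0 = 0. Proof. exact: ComplexField.Normc.normc0. Qed.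
Lemma nc1 : nc 1 = 1. Proof. exact: ComplexField.Normc.normc1. Qed.
Lemma ncM w w' : nc (w * w') = nc w * nc w'.
Proof. exact: ComplexField.Normc.normcM. Qed.
Lemma ncV w : nc w^-1 = (nc w)^-1. Proof. exact: ComplexField.Normc.normcV. Qed.
Lemma ncD w w' : nc (w + w') <= nc w + nc w'.
Proof. by rewrite -lecR rmorphD /= -!nc_norm ler_normD. Qed.

Lemma nc_real x : nc x%:C = `|x|.
Proof. by rewrite /nc /= expr0n /= addr0 sqrtr_sqr. Qed.

Lemma nc_prod (I : Type) (r : seq I) (P : pred I) (F : I -> R[i]) :
  nc (\prod_(i <- r | P i) F i) = \prod_(i <- r | P i) nc (F i).
Proof. by apply: (big_morph nc); [exact: ncM|exact: nc1]. Qed.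
Lemma nc_sum (I : Type) (r : seq I) (P : pred I) (F : I -> R[i]) :
  nc (\sum_(i <- r | P i) F i) <= \sum_(i <- r | P i) nc (F i).
Proof.
elim/big_rec2: _ => [|i y w _ h]; first by rewrite nc0.
by apply: (le_trans (ncD _ _)); rewrite lerD2l.
Qed.
Lemma ncX w n : nc (w ^+ n) = nc w ^+ n.
Proof. by elim: n => [|n IH]; rewrite ?expr0 ?nc1// !exprS ncM IH. Qed.
Lemma ReC_le_nc w : `|ReC w| <= nc w.
Proof.
case: w => a b /=; rewrite -sqrtr_sqr; apply: ler_wsqrtr.
by rewrite lerDl sqr_ge0.
Qed.
Lemma ImC_le_nc w : `|ImC w| <= nc w.
Proof.
case: w => a b /=; rewrite -sqrtr_sqr; apply: ler_wsqrtr.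
by rewrite lerDr sqr_ge0.
Qed.
Lemma nc_le w : nc w <= `|ReC w| + `|ImC w|.
Proof.
have i1 : nc (0 +i* 1) = 1 by rewrite /nc /= expr0n expr1n add0r sqrtr1.
have {1}-> : w = (ReC w)%:C + (0 +i* 1) * (ImC w)%:C.
  by case: w => a b; apply: complex_eq => /=; ring.
by apply: (le_trans (ncD _ _)); rewrite ncM !nc_real i1 mul1r.
Qed.
Lemma Re_neq0 w : 0 < ReC w -> w != 0.
Proof. by move=> h; apply: contraTneq h => ->; rewrite ltxx. Qed.

(** Stated on real and imaginary parts, so that limit theorems for real integrals apply to each part
    separately. *)
Definition clim (u : nat -> R[i]) (w : R[i]) :=
  (fun n => ReC (u n)) @ \oo --> ReC w /\ (fun n => ImC (u n)) @ \oo --> ImC w.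

Lemma clim_cst w : clim (fun=> w) w.
Proof. by split; exact: cvg_cst. Qed.
Lemma climD u v a b : clim u a -> clim v b -> clim (fun n => u n + v n) (a + b).
Proof.
move=> [u1 u2] [v1 v2]; split.
  by under eq_fun do rewrite ReCD; rewrite ReCD; exact: cvgD.
by under eq_fun do rewrite ImCD; rewrite ImCD; exact: cvgD.
Qed.
Lemma climM u v a b : clim u a -> clim v b -> clim (fun n => u n * v n) (a * b).
Proof.
move=> [u1 u2] [v1 v2]; split.
  by under eq_fun do rewrite ReCM; rewrite ReCM; apply: cvgB; exact: cvgM.
by under eq_fun do rewrite ImCM; rewrite ImCM; apply: cvgD; exact: cvgM.
Qed.
Lemma clim_sum (I : Type) (r : seq I) (P : pred I) (u : I -> nat -> R[i]) (a : I -> R[i]) :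
  (forall i, P i -> clim (u i) (a i)) ->
  clim (fun n => \sum_(i <- r | P i) u i n) (\sum_(i <- r | P i) a i).
Proof.
move=> h; elim: r => [|i r IH].
  by under eq_fun do rewrite big_nil; rewrite big_nil; exact: clim_cst.
under eq_fun do rewrite big_cons; rewrite big_cons; case: ifP => // Pi.
by apply: climD => //; exact: h.
Qed.
Lemma clim_prod (I : Type) (r : seq I) (P : pred I) (u : I -> nat -> R[i]) (a : I -> R[i]) :
  (forall i, P i -> clim (u i) (a i)) ->
  clim (fun n => \prod_(i <- r | P i) u i n) (\prod_(i <- r | P i) a i).
Proof.
move=> h; elim: r => [|i r IH].
  by under eq_fun do rewrite big_nil; rewrite big_nil; exact: clim_cst.
under eq_fun do rewrite big_cons; rewrite big_cons; case: ifP => // Pi.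
by apply: climM => //; exact: h.
Qed.

Lemma clim_unique u a b : clim u a -> clim u b -> a = b.
Proof.
move=> [a1 a2] [b1 b2]; apply: complex_eq.
  exact: cvg_unique a1 b1.
exact: cvg_unique a2 b2.
Qed.
Lemma clim_near u v a : (\forall n \near \oo, u n = v n) -> clim u a -> clim v a.
Proof.
move=> h [a1 a2]; split; [move: a1|move: a2]; apply: cvg_trans;
  by apply: near_eq_cvg; move: h; apply: filterS => n /= ->.
Qed.
Lemma clim_nc u a : clim u a -> (fun n => nc (u n)) @ \oo --> nc a.
Proof.
move=> [a1 a2].
have E w : nc w = Num.sqrt (ReC w ^+ 2 + ImC w ^+ 2) by case: w.
under eq_fun do rewrite E; rewrite E.
apply: (@cvg_comp _ _ _ (fun n => ReC (u n) ^+ 2 + ImC (u n) ^+ 2) Num.sqrt); last first.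
  exact: sqrt_continuous.
by apply: cvgD; rewrite expr2; under eq_fun do rewrite expr2; exact: cvgM.
Qed.
Lemma clim_nc0 u : (fun n => nc (u n)) @ \oo --> (0 : R) -> clim u 0.
Proof.
move=> h; split; apply/cvgrPdist_lt => e e0;
move/cvgrPdist_lt/(_ _ e0) : h; apply: filterS => n;
rewrite !sub0r !normrN => /(le_lt_trans _); apply;
rewrite [leRHS]ger0_norm ?nc_ge0//; [exact: ReC_le_nc|exact: ImC_le_nc].
Qed.
Lemma clim_real (u : nat -> R) (x : R) : u @ \oo --> x -> clim (fun n => (u n)%:C) x%:C.
Proof. by move=> h; split => //=; exact: cvg_cst. Qed.

Lemma cexpD a b : cexp (a + b) = cexp a * cexp b.
Proof.
apply: complex_eq; rewrite /cexp ?ReCM ?ImCM /= ReCD ImCD expRD.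
  by rewrite cosD; ring.
by rewrite sinD; ring.
Qed.
Lemma cexp0 : cexp (0 : R[i]) = 1.
Proof. by rewrite /cexp /= expR0 cos0 sin0 mul1r mulr0. Qed.
Lemma nc_cexp a : nc (cexp a) = expR (ReC a).
Proof.
rewrite /cexp /nc /= !exprMn -mulrDr cos2Dsin2 mulr1 sqrtr_sqr.
by rewrite ger0_norm ?expR_ge0.
Qed.
Lemma cexp_neq0 a : cexp a != 0.
Proof.
apply/negP => /eqP h; have := nc_cexp a; rewrite h nc0 => /esym/eqP.
by rewrite gt_eqF ?expR_gt0.
Qed.
Lemma cexpMn a n : cexp (n%:R * a) = cexp a ^+ n.
Proof.
elim: n => [|n IH]; first by rewrite mul0r cexp0 expr0.
by rewrite exprS -IH -cexpD; congr cexp; rewrite -natr1; ring.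
Qed.
Lemma cexp_sum (I : Type) (r : seq I) (P : pred I) (F : I -> R[i]) :
  cexp (\sum_(i <- r | P i) F i) = \prod_(i <- r | P i) cexp (F i).
Proof. by elim/big_rec2: _ => [|i y w _ <-]; rewrite ?cexp0 ?cexpD. Qed.
Lemma cexp_real x : cexp x%:C = (expR x)%:C.
Proof. by rewrite /cexp /= cos0 sin0 mulr1 mulr0. Qed.
Lemma cexp_pi : cexp (0 +i* pi : R[i]) = -1.
Proof.
by apply: complex_eq; rewrite /cexp /= expR0 ?cospi ?sinpi ?mulr0 ?mul1r ?oppr0.
Qed.

Lemma cpow0 a : cpowR 0 a = 0. Proof. by rewrite /cpowR eqxx. Qed.
Lemma cpowD x a b : cpowR x (a + b) = cpowR x a * cpowR x b.
Proof. by rewrite /cpowR; case: ifP => _; rewrite ?mul0r// mulrDl cexpD. Qed.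
Lemma cpow_pos x a : 0 < x -> cpowR x a = cexp (a * (ln x)%:C).
Proof.
move=> x0; rewrite /cpowR gt_eqF// ltNge ltW// gtr0_norm//.
Qed.
Lemma cpow_neg x a : x < 0 -> cpowR x a = cexp (a * (0 +i* pi)) * cpowR (- x) a.
Proof.
move=> x0; rewrite [in RHS]cpow_pos ?oppr_gt0// /cpowR lt_eqF// x0 ltr0_norm//.
by rewrite -cexpD -mulrDr; congr (cexp (_ * _)); apply: complex_eq; rewrite /= ?add0r ?addr0.
Qed.
Lemma cpow_x0 x : x != 0 -> cpowR x 0 = 1.
Proof. by move=> /negbTE x0; rewrite /cpowR x0 mul0r cexp0. Qed.
Lemma cpow_neq0 x a : x != 0 -> cpowR x a != 0.
Proof. by move=> /negbTE x0; rewrite /cpowR x0 cexp_neq0. Qed.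
Lemma cpow1 x : cpowR x 1 = x%:C.
Proof.
have [->|x0] := eqVneq x 0; first exact: cpow0.
have [xn|xp] := ltP x 0; last first.
  have xp' : 0 < x by rewrite lt_neqAle eq_sym x0.
  by rewrite cpow_pos// mul1r cexp_real lnK.
rewrite cpow_neg// cpow_pos ?oppr_gt0// !mul1r cexp_real lnK ?posrE ?oppr_gt0//.
by rewrite cexp_pi rmorphN mulN1r opprK.
Qed.
Lemma cpowDn x a n : cpowR x (a + n%:R) = cpowR x a * (x%:C) ^+ n.
Proof.
elim: n => [|n IH]; first by rewrite addr0 expr0 mulr1.
by rewrite -natr1 addrA cpowD IH cpow1 exprSr mulrA.
Qed.
(** A nonnegative scale does not move the argument of [y], so the branch is respected; for two
    negative factors this would fail. When a factor vanishes both sides are 0 by convention. *)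
Lemma cpowM x y a : 0 <= x -> cpowR (x * y) a = cpowR x a * cpowR y a.
Proof.
rewrite le_eqVlt => /predU1P[<-|x0]; first by rewrite mul0r cpow0 mul0r.
have [y0|y0|->] := ltgtP y 0; last by rewrite mulr0 cpow0 mulr0.
  rewrite cpow_neg ?pmulr_rlt0// [cpowR y a]cpow_neg// -mulrN.
  rewrite !cpow_pos ?mulr_gt0 ?oppr_gt0// lnM ?posrE ?oppr_gt0//.
  by rewrite rmorphD mulrDr cexpD; ring.
by rewrite !cpow_pos ?mulr_gt0// lnM// rmorphD mulrDr cexpD.
Qed.
Lemma cpowX x a n : x != 0 -> cpowR x (n%:R * a) = cpowR x a ^+ n.
Proof. by move=> /negbTE x0; rewrite /cpowR x0 -cexpMn mulrA. Qed.
Lemma cpow1x a : cpowR 1 a = 1.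
Proof. by rewrite cpow_pos// ln1 mulr0 cexp0. Qed.
Lemma cpowV x a : x != 0 -> cpowR x (- a) = (cpowR x a)^-1.
Proof.
move=> x0; apply: (mulfI (cpow_neq0 a x0)).
by rewrite mulfV ?cpow_neq0// -cpowD subrr cpow_x0.
Qed.

(** Bounds the modulus of the phase $e^{i\pi a}$ carried by negative bases and is at least 1, so
    that one estimate $|x^a|\le C|x|^{\Re a}$ covers both signs. *)
Definition argc (a : R[i]) := expR (pi * `|ImC a|).
Lemma argc_ge1 a : 1 <= argc a.
Proof. by rewrite -expR0 ler_expR mulr_ge0 ?pi_ge0. Qed.
Lemma argc_ge0 a : 0 <= argc a. Proof. exact: le_trans (argc_ge1 a). Qed.

Lemma nc_cpow_pos x a : 0 < x -> nc (cpowR x a) = x `^ (ReC a).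
Proof.
move=> x0; rewrite cpow_pos// nc_cexp ReCM /= mulr0 subr0 /powR gt_eqF//.
Qed.
Lemma nc_cpow_le x a : nc (cpowR x a) <= argc a * `|x| `^ (ReC a).
Proof.
have [x0|x0|->] := ltgtP x 0; last by rewrite cpow0 nc0 mulr_ge0 ?argc_ge0 ?powR_ge0.
  rewrite cpow_neg// ncM nc_cpow_pos ?oppr_gt0// nc_cexp ReCM /= mulr0 sub0r.
  rewrite ltr0_norm// ler_wpM2r ?powR_ge0// /argc ler_expR mulrC -mulrN.
  by rewrite ler_wpM2l ?pi_ge0// -normrN ler_norm.
rewrite nc_cpow_pos// gtr0_norm// -[leLHS]mul1r ler_wpM2r ?powR_ge0 ?argc_ge1//.
Qed.
End ComplexBasics.

(** * Complex-valued integrals *)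

Section CMeasurable.
Context {R : realType} {d : measure_display} {T : measurableType d}.
Implicit Types (f g : T -> R[i]) (h : T -> R).

Definition cmeas f := measurable_fun [set: T] (fun x => ReC (f x)) /\
  measurable_fun [set: T] (fun x => ImC (f x)).

Lemma cmeas_cst w : cmeas (fun=> w). Proof. by split; exact: measurable_cst. Qed.
Lemma cmeas_real h : measurable_fun [set: T] h -> cmeas (fun x => (h x)%:C).
Proof. by move=> mh; split => //=; exact: measurable_cst. Qed.
Lemma cmeasD f g : cmeas f -> cmeas g -> cmeas (fun x => f x + g x).
Proof.
by move=> [f1 f2] [g1 g2]; split;
  under eq_fun do rewrite ?ReCD ?ImCD; exact: measurable_funD.
Qed.
Lemma cmeasM f g : cmeas f -> cmeas g -> cmeas (fun x => f x * g x).
Proof.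
move=> [f1 f2] [g1 g2]; split.
  under eq_fun do rewrite ReCM; apply: measurable_funB; exact: measurable_funM.
under eq_fun do rewrite ImCM; apply: measurable_funD; exact: measurable_funM.
Qed.
Lemma cmeas_sum (I : Type) (r : seq I) (P : pred I) (F : I -> T -> R[i]) :
  (forall i, P i -> cmeas (F i)) -> cmeas (fun x => \sum_(i <- r | P i) F i x).
Proof.
move=> h; elim: r => [|i r IH].
  by under eq_fun do rewrite big_nil; exact: cmeas_cst.
by under eq_fun do rewrite big_cons; case Pi: (P i) => //; apply: cmeasD => //; exact: h.
Qed.
Lemma cmeas_prod (I : Type) (r : seq I) (P : pred I) (F : I -> T -> R[i]) :
  (forall i, P i -> cmeas (F i)) -> cmeas (fun x => \prod_(i <- r | P i) F i x).
Proof.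
move=> h; elim: r => [|i r IH].
  by under eq_fun do rewrite big_nil; exact: cmeas_cst.
by under eq_fun do rewrite big_cons; case Pi: (P i) => //; apply: cmeasM => //; exact: h.
Qed.
Lemma measurable_fun_prodr (I : Type) (r : seq I) (P : pred I) (F : I -> T -> R) :
  (forall i, P i -> measurable_fun [set: T] (F i)) ->
  measurable_fun [set: T] (fun x => \prod_(i <- r | P i) F i x).
Proof.
move=> h; elim: r => [|i r IH].
  by under eq_fun do rewrite big_nil; exact: measurable_cst.
by under eq_fun do rewrite big_cons; case Pi: (P i) => //; apply: measurable_funM => //; exact: h.
Qed.

Lemma cmeas_if (A : set T) f g : measurable A -> cmeas f -> cmeas g ->
  cmeas (fun x => if `[< A x >] then f x else g x).
Proof.
move=> mA [f1 f2] [g1 g2].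
have mb : measurable_fun [set: T] (fun x => `[< A x >]).
  apply: (measurable_fun_bool true); rewrite setTI.
  by rewrite (_ : _ @^-1` _ = A)//; apply/seteqP; split => x /= /asboolP.
split.
  rewrite (_ : (fun x => _) = (fun x => if `[< A x >] then ReC (f x) else ReC (g x))).
    exact: measurable_fun_ifT.
  by apply/funext => x; case: ifP.
rewrite (_ : (fun x => _) = (fun x => if `[< A x >] then ImC (f x) else ImC (g x))).
  exact: measurable_fun_ifT.
by apply/funext => x; case: ifP.
Qed.
End CMeasurable.

Section CMeasurable2.
Context {R : realType} {d : measure_display} {T : measurableType d}.
Context {d' : measure_display} {T' : measurableType d'}.

Lemma cmeas_comp (f : T -> R[i]) (g : T' -> T) : cmeas f ->
  measurable_fun [set: T'] g -> cmeas (fun x => f (g x)).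
Proof. by move=> [f1 f2] mg; split; [apply: (measurableT_comp f1)|apply: (measurableT_comp f2)]. Qed.

Lemma measurable_cosR : measurable_fun [set: R] (cos : R -> R).
Proof. by apply: continuous_measurable_fun; exact: continuous_cos. Qed.
Lemma measurable_sinR : measurable_fun [set: R] (sin : R -> R).
Proof. by apply: continuous_measurable_fun; exact: continuous_sin. Qed.

Lemma cmeas_cexp (f : T -> R[i]) : cmeas f -> cmeas (fun x => cexp (f x)).
Proof.
move=> [f1 f2]; split => /=; apply: measurable_funM.
- exact: (measurableT_comp (@measurable_expR R) f1).
- exact: (measurableT_comp measurable_cosR f2).
- exact: (measurableT_comp (@measurable_expR R) f1).
- exact: (measurableT_comp measurable_sinR f2).
Qed.

Lemma cmeas_cpow (h : T -> R) a : measurable_fun [set: T] h -> cmeas (fun x => cpowR (h x) a).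
Proof.
move=> mh.
have -> : (fun x => cpowR (h x) a) = (fun x => if `[< h x = 0 >] then 0 else
    cexp (a * (ln `|h x| +i* (if h x < 0 then pi else 0)))).
  by apply/funext => x; rewrite /cpowR; case: eqP => h0; [rewrite asboolT|rewrite asboolF].
apply: cmeas_if.
- rewrite -[X in measurable X]setTI.
  exact: (mh measurableT [set 0] (measurable_set1 0)).
- exact: cmeas_cst.
- apply: cmeas_cexp; apply: cmeasM; first exact: cmeas_cst.
  split => /=.
    exact: (measurableT_comp (@measurable_ln R)
      (measurableT_comp (@normr_measurable R setT) mh)).
  apply: measurable_fun_ifT; [|exact: measurable_cst|exact: measurable_cst].
  by apply: measurable_fun_ltr => //; exact: measurable_cst.
Qed.

Lemma measurable_funV (h : T -> R) : measurable_fun [set: T] h ->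
  measurable_fun [set: T] (fun x => (h x)^-1).
Proof.
(* Writing $1/h$ as $h\,(h^2)^{-1}$ reduces the claim to a real power of a nonnegative function; at
   zeros of [h] both sides are 0. *)
move=> mh; rewrite (_ : (fun x => _) = (fun x => h x * ((h x ^+ 2) `^ (- 1)))).
  apply: measurable_funM => //.
  exact: (measurableT_comp (@measurable_powR R (-1)) (measurable_funX 2 mh)).
apply/funext => x; rewrite powR_inv1 ?sqr_ge0//.
have [->|h0] := eqVneq (h x) 0; first by rewrite invr0 mul0r.
by rewrite expr2 invfM mulrA divff// mul1r.
Qed.
End CMeasurable2.

Section CIntegral.
Context {R : realType} {d : measure_display} {T : measurableType d}.
Variable mu : {measure set T -> \bar R}.
Implicit Types (f : T -> R[i]).

Definition Cintegrable f := mu.-integrable [set: T] (EFin \o (fun x => ReC (f x))) /\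
  mu.-integrable [set: T] (EFin \o (fun x => ImC (f x))).
Definition CI f : R[i] := (Rintegral mu [set: T] (fun x => ReC (f x))) +i*
  (Rintegral mu [set: T] (fun x => ImC (f x))).

Lemma Cintegrable_dom f (g : T -> R) : cmeas f ->
  mu.-integrable [set: T] (EFin \o g) -> (forall x, nc (f x) <= g x) -> Cintegrable f.
Proof.
move=> [f1 f2] ig fg; split; apply: le_integrable ig => //; try exact/measurable_EFinP;
  move=> x _ /=; rewrite lee_fin (le_trans _ (le_trans (fg x) (ler_norm _)))//.
  exact: ReC_le_nc.
exact: ImC_le_nc.
Qed.

Lemma Cintegrable_cst0 : Cintegrable (fun=> 0).
Proof. by split; exact: integrable0. Qed.
Lemma CintegrableD f g : Cintegrable f -> Cintegrable g -> Cintegrable (fun x => f x + g x).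
Proof.
move=> [f1 f2] [g1 g2]; split.
  rewrite (_ : _ \o _ = ((EFin \o (fun x => ReC (f x))) \+ (EFin \o (fun x => ReC (g x))))%E).
    exact: integrableD.
  by apply/funext => x /=; rewrite ReCD.
rewrite (_ : _ \o _ = ((EFin \o (fun x => ImC (f x))) \+ (EFin \o (fun x => ImC (g x))))%E).
  exact: integrableD.
by apply/funext => x /=; rewrite ImCD.
Qed.
Lemma CintegrableZ w f : Cintegrable f -> Cintegrable (fun x => w * f x).
Proof.
move=> [f1 f2]; split.
  rewrite (_ : _ \o _ = (fun x => (ReC w)%:E * (EFin \o (fun x => ReC (f x))) x -
     (ImC w)%:E * (EFin \o (fun x => ImC (f x))) x)%E).
    by apply: integrableB => //; exact: integrableZl.
  by apply/funext => x /=; rewrite ReCM.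
rewrite (_ : _ \o _ = (fun x => (ReC w)%:E * (EFin \o (fun x => ImC (f x))) x +
   (ImC w)%:E * (EFin \o (fun x => ReC (f x))) x)%E).
  by apply: integrableD => //; exact: integrableZl.
by apply/funext => x /=; rewrite ImCM.
Qed.
Lemma Cintegrable_sum (I : Type) (r : seq I) (P : pred I) (F : I -> T -> R[i]) :
  (forall i, P i -> Cintegrable (F i)) -> Cintegrable (fun x => \sum_(i <- r | P i) F i x).
Proof.
move=> h; elim: r => [|i r IH].
  by under eq_fun do rewrite big_nil; exact: Cintegrable_cst0.
by under eq_fun do rewrite big_cons; case Pi: (P i) => //; apply: CintegrableD => //; exact: h.
Qed.

Lemma CI0 : CI (fun=> 0) = 0.
Proof. by rewrite /CI /Rintegral /= integral0. Qed.
Lemma CID f g : Cintegrable f -> Cintegrable g -> CI (fun x => f x + g x) = CI f + CI g.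
Proof.
move=> [f1 f2] [g1 g2]; rewrite /CI.
under eq_fun do rewrite ReCD; under [in X in _ +i* X]eq_fun do rewrite ImCD.
by rewrite !RintegralD.
Qed.
Lemma CIZ w f : Cintegrable f -> CI (fun x => w * f x) = w * CI f.
Proof.
move=> [f1 f2]; apply: complex_eq; rewrite ?ReCM ?ImCM /CI /=.
  under eq_fun do rewrite ReCM.
  rewrite RintegralB//; first by rewrite !RintegralZl.
    exact: (@integrableZl _ _ _ mu setT measurableT (ReC w) _ f1).
  exact: (@integrableZl _ _ _ mu setT measurableT (ImC w) _ f2).
under eq_fun do rewrite ImCM.
rewrite RintegralD//; first by rewrite !RintegralZl.
  exact: (@integrableZl _ _ _ mu setT measurableT (ReC w) _ f2).
exact: (@integrableZl _ _ _ mu setT measurableT (ImC w) _ f1).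
Qed.

Lemma CI_sum (I : Type) (r : seq I) (P : pred I) (F : I -> T -> R[i]) :
  (forall i, P i -> Cintegrable (F i)) ->
  CI (fun x => \sum_(i <- r | P i) F i x) = \sum_(i <- r | P i) CI (F i).
Proof.
move=> h; elim: r => [|i r IH].
  by under eq_fun do rewrite big_nil; rewrite big_nil CI0.
under eq_fun do rewrite big_cons; rewrite big_cons; case: ifP => // Pi.
by rewrite CID ?IH//; [exact: h|exact: Cintegrable_sum].
Qed.

(** The factor 2 comes from estimating the real and imaginary parts separately. Only the finiteness
    of the bound matters later. *)
Lemma CI_bound f (g : T -> R) : cmeas f ->
  mu.-integrable [set: T] (EFin \o g) -> (forall x, nc (f x) <= g x) ->
  nc (CI f) <= 2 * Rintegral mu [set: T] g.
Proof.
move=> mf ig fg; have [f1 f2] := Cintegrable_dom mf ig fg.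
apply: (le_trans (nc_le _)); rewrite mulr_natl mulr2n; apply: lerD => /=.
  apply: (le_trans (le_normr_Rintegral _ f1)) => //.
  apply: le_Rintegral => //; first exact: integrable_norm.
  by move=> x _; apply: le_trans (fg x); exact: ReC_le_nc.
apply: (le_trans (le_normr_Rintegral _ f2)) => //.
apply: le_Rintegral => //; first exact: integrable_norm.
by move=> x _; apply: le_trans (fg x); exact: ImC_le_nc.
Qed.

Lemma CI_dct (F : nat -> T -> R[i]) f (g : T -> R) :
  (forall n, cmeas (F n)) -> cmeas f -> mu.-integrable [set: T] (EFin \o g) ->
  (forall n x, nc (F n x) <= g x) -> (forall x, clim (F ^~ x) (f x)) ->
  clim (fun n => CI (F n)) (CI f).
Proof.
move=> mF mf ig Fg Ff.
have key (p : R[i] -> R) : (forall w, `|p w| <= nc w) ->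
    (forall n, measurable_fun setT (fun x => p (F n x))) ->
    measurable_fun setT (fun x => p (f x)) ->
    (forall x, (fun n => p (F n x)) @ \oo --> p (f x)) ->
    (fun n => Rintegral mu setT (fun x => p (F n x))) @ \oo -->
      Rintegral mu setT (fun x => p (f x)).
  move=> pn mpF mpf pFf.
  have h1 : {ae mu, forall x, setT x -> (fun n => (p (F n x))%:E) @ \oo --> (p (f x))%:E}.
    by apply: aeW => x _; apply: cvg_EFin; [exact: nearW|exact: pFf].
  have h2 : {ae mu, forall x (n : nat), setT x -> (`|(p (F n x))%:E| <= (EFin \o g) x)%E}.
    by apply: aeW => x n _; rewrite lee_fin; apply: le_trans (Fg n x).
  have [i1 _ i3] := @dominated_convergence _ T R mu setT measurableT
    (fun n x => (p (F n x))%:E) (fun x => (p (f x))%:E) (EFin \o g)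
    (fun n => (measurable_EFinP _ _).2 (mpF n)) ((measurable_EFinP _ _).2 mpf) h1 ig h2.
  apply: fine_cvg; rewrite fineK//; exact: integrable_fin_num.
split => /=.
  apply: key => //; first exact: ReC_le_nc.
  - by move=> n; case: (mF n).
  - by case: mf.
  - by move=> x; case: (Ff x).
apply: key => //; first exact: ImC_le_nc.
- by move=> n; case: (mF n).
- by case: mf.
- by move=> x; case: (Ff x).
Qed.

End CIntegral.

(** * Image measures *)

Section PushMeasure.
Context {R : realType} {d1 d2 : measure_display} {T1 : measurableType d1} {T2 : measurableType d2}.
Variables (m : {measure set T1 -> \bar R}) (f : T1 -> T2) (mf : measurable_fun [set: T1] f).

Definition pushm_fun := pushforward m f.
Let pushm0 : pushm_fun set0 = 0%E. Proof. by rewrite /pushm_fun /pushforward preimage_set0 measure0. Qed.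
Let pushm_ge0 A : (0 <= pushm_fun A)%E. Proof. exact: measure_ge0. Qed.
Let pushm_sa : semi_sigma_additive pushm_fun.
Proof. exact: (@measure_semi_sigma_additive _ _ _ (measure_function_pushforward__canonical__measure_function_Measure m mf)). Qed.
HB.instance Definition _ := isMeasure.Build _ _ _ pushm_fun pushm0 pushm_ge0 pushm_sa.
Definition pushm : {measure set T2 -> \bar R} := pushm_fun.

Lemma ge0_integral_pushm (g : T2 -> \bar R) : measurable_fun [set: T2] g ->
  (forall y, 0 <= g y)%E -> (\int[pushm]_y g y = \int[m]_x g (f x))%E.
Proof. by move=> mg g0; rewrite ge0_integral_pushforward. Qed.

End PushMeasure.

(** * Integration over finitely many coordinates *)

Section Env.
Context {R : realType}.

(** The statement represents a point of $\mathbb R^n$ by a function on all of [nat]. Working on this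
    one space with the product sigma-algebra allows coordinates to be integrated in any order, split
    into groups and renamed. *)
Definition coord_cylinders : set (set (nat -> R)) :=
  [set A | exists i (B : set R), measurable B /\ A = (fun t : nat -> R => t i) @^-1` B].
Definition envT := g_sigma_algebraType coord_cylinders.
HB.instance Definition _ := Measurable.on envT.

Definition upd (t : nat -> R) (i : nat) (x : R) : nat -> R :=
  fun j => if j == i then x else t j.

Lemma updE t i x : upd t i x i = x. Proof. by rewrite /upd eqxx. Qed.
Lemma updN t i x j : j != i -> upd t i x j = t j.
Proof. by rewrite /upd => /negbTE ->. Qed.
Lemma updC t i j x y : i != j -> upd (upd t i x) j y = upd (upd t j y) i x.
Proof.
move=> ij; apply/funext => k; rewrite /upd; case: eqP => [->|//].
by case: eqP => // ji; rewrite ji eqxx in ij.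
Qed.

Lemma meas_coord i : measurable_fun [set: envT] (fun t : envT => t i).
Proof.
move=> _ B mB; rewrite setTI; apply: sub_sigma_algebra.
by exists i, B.
Qed.

Lemma meas_env {d} {T : measurableType d} (f : T -> envT) :
  (forall i, measurable_fun [set: T] (fun x => f x i)) -> measurable_fun [set: T] f.
Proof.
move=> mf; apply: (@measurability _ _ _ envT _ _ coord_cylinders) => // _ [_ [i [B [mB ->]]] <-].
exact: mf.
Qed.

Lemma meas_upd {d} {T : measurableType d} i (f : T -> envT) (g : T -> R) :
  measurable_fun [set: T] f -> measurable_fun [set: T] g ->
  measurable_fun [set: T] (fun x => upd (f x) i (g x) : envT).
Proof.
move=> mf mg; apply: meas_env => j; rewrite /upd; case: (j == i) => //.
exact: (measurableT_comp (meas_coord j) mf).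
Qed.

Definition updf i (tx : envT * R) : envT := upd tx.1 i tx.2.
Lemma meas_updf i : measurable_fun [set: envT * R] (updf i).
Proof. by apply: meas_upd; [exact: measurable_fst|exact: measurable_snd]. Qed.

(** Exhausting sets for sigma-finiteness. Only the coordinates in [s] are bounded, since the
    measures built below are point masses in the others. *)
Definition box (s : seq nat) (k : nat) : set envT :=
  [set t | forall j, j \in s -> `|t j| <= k%:R].

Lemma meas_ball i k : measurable ([set t : envT | `|t i| <= k]).
Proof.
rewrite -[X in measurable X]setTI.
have -> : [set t : envT | `|t i| <= k] = (fun t : envT => t i) @^-1` `[- k, k]%classic.
  by apply/seteqP; split => t /=; rewrite in_itv /= ler_norml.
exact: (meas_coord i) (measurable_itv _).
Qed.

Lemma meas_box s k : measurable (box s k).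
Proof.
elim: s => [|i s IH]; first by rewrite (_ : box _ _ = setT)//; apply/seteqP; split.
rewrite (_ : box _ _ = [set t : envT | `|t i| <= k%:R] `&` box s k).
  by apply: measurableI => //; exact: meas_ball.
apply/seteqP; split => [t h|t [h1 h2] j].
  split; first by apply: h; rewrite inE eqxx.
  by move=> j js; apply: h; rewrite inE js orbT.
by rewrite inE => /orP[/eqP ->//|/h2].
Qed.

Lemma box_cover s : [set: envT] = \bigcup_k box s k.
Proof.
apply/seteqP; split => // t _.
elim: s => [|i s [k _ IH]]; first by exists 0%N.
have [m hm] : exists m : nat, `|t i| <= m%:R.
  by exists (Num.bound `|t i|); apply: ltW; apply: le_lt_trans (archi_boundP _); rewrite ?ler_norm ?normr_ge0// ger0_norm.
exists (maxn k m) => // j; rewrite inE => /orP[/eqP ->|js].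
  by apply: (le_trans hm); rewrite ler_nat leq_maxr.
by apply: (le_trans (IH j js)); rewrite ler_nat leq_maxl.
Qed.

Definition box_finite (m : set envT -> \bar R) s := forall k, (m (box s k) < +oo)%E.

Section MkSF.
Variables (m : {measure set envT -> \bar R}) (s : seq nat) (H : box_finite m s).
Definition sfm : set envT -> \bar R := m.
HB.instance Definition _ := Measure.on sfm.
Lemma sfm_sf : sigma_finite setT sfm.
Proof.
exists (box s); first exact: box_cover.
by move=> k; split; [exact: meas_box|exact: H].
Qed.
HB.instance Definition _ := Measure_isSigmaFinite.Build _ _ _ sfm sfm_sf.
Definition mkSF : {sigma_finite_measure set envT -> \bar R} := sfm.
End MkSF.

Section Step.
Variables (m : {sigma_finite_measure set envT -> \bar R}) (i : nat).
(** Overwrites coordinate [i] by an independent Lebesgue variable; the previous content of that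
    coordinate is forgotten. *)
Definition stepm : {measure set envT -> \bar R} :=
  pushm (m \x (@lebesgue_measure R))%E (@meas_updf i).
Lemma step_box s : i \notin s -> box_finite m s -> box_finite stepm (i :: s).
Proof.
move=> ins H k; rewrite /stepm /= /pushm_fun /pushforward.
rewrite (_ : _ @^-1` _ = box s k `*` `[- k%:R, k%:R]%classic).
  rewrite product_measure1E//; last exact: meas_box.
  apply: lte_mul_pinfty => //.
    by rewrite ge0_fin_numE ?measure_ge0//; exact: H.
  by have := @lebesgue_measure_itv R `[- k%:R, k%:R]; rewrite /= => ->; case: ifP => _; rewrite ltry.
apply/seteqP; split => [[t x] /= h|[t x] /= [h1 h2] j].
  split => [j js|].
    have := h j; rewrite inE js orbT => /(_ isT).
    by rewrite /updf updN//; apply: contraNneq ins => <-.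
  by have := h i; rewrite inE eqxx /updf updE in_itv /= ler_norml; exact.
rewrite inE => /orP[/eqP ->|js].
  by rewrite /updf updE ler_norml; move: h2; rewrite in_itv.
by rewrite /updf updN; [exact: h1|apply: contraNneq ins => <-].
Qed.
End Step.

Definition env0 : envT := fun=> 0.
Lemma dirac_box : box_finite (dirac env0 : set envT -> \bar R) [::].
Proof. by move=> n; rewrite /dirac indicE; case: (_ \in _); rewrite ltry. Qed.

Lemma box_finite_cons (m : {measure set envT -> \bar R}) i s :
  box_finite m s -> box_finite m (i :: s).
Proof.
move=> mP k; apply: le_lt_trans (mP k); apply: le_measure; rewrite ?inE.
- exact: meas_box.
- exact: meas_box.
- by move=> t h j js; apply: h; rewrite inE js orbT.
Qed.

(* A repeated coordinate is skipped, which keeps the measure sigma-finite. *)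
Fixpoint muP (s : seq nat) : {m : {sigma_finite_measure set envT -> \bar R} | box_finite m s} :=
  match s with
  | [::] => exist _ (mkSF dirac_box) dirac_box
  | i :: s' => let: exist m mP := muP s' in
     match decP (@idP (i \notin s')) with
     | left h => exist _ (mkSF (step_box h mP)) (step_box h mP)
     | right _ => exist _ m (@box_finite_cons m i s' mP)
     end
  end.

(* Lebesgue measure in the coordinates listed in [s], Dirac mass at 0 in the others. *)
Definition mu s : {sigma_finite_measure set envT -> \bar R} := proj1_sig (muP s).

Lemma mu_cons i s A : i \notin s ->
  mu (i :: s) A = pushm (mu s \x (@lebesgue_measure R))%E (@meas_updf i) A.
Proof.
move=> ins; rewrite /mu /=; case: (muP s) => m mP /=.
by case: decP => [h|/(_ ins)].
Qed.

Lemma mu_integral_nil f : measurable_fun [set: envT] f ->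
  (\int[mu [::]]_t f t = f env0)%E.
Proof. by move=> mf; rewrite integral_dirac// diracT mul1e. Qed.

Opaque mu.

Section NonNeg.
Local Open Scope ereal_scope.
Implicit Types f : envT -> \bar R.

Lemma mu_consE i s f : i \notin s -> measurable_fun setT f -> (forall t, 0 <= f t) ->
  \int[mu (i :: s)]_t f t = \int[mu s]_t \int[lebesgue_measure]_x f (upd t i x).
Proof.
move=> ins mf f0.
rewrite (eq_measure_integral (pushm (mu s \x (@lebesgue_measure R)) (@meas_updf i))); last first.
  by move=> A _ _; exact: mu_cons.
rewrite ge0_integral_pushm// fubini_tonelli1//.
exact: (measurableT_comp mf (@meas_updf i)).
Qed.

Lemma mu_consE2 i s f : i \notin s -> measurable_fun setT f -> (forall t, 0 <= f t) ->
  \int[mu (i :: s)]_t f t = \int[lebesgue_measure]_x \int[mu s]_t f (upd t i x).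
Proof.
move=> ins mf f0; rewrite mu_consE//.
apply: (fubini_tonelli (m1 := mu s) (m2 := @lebesgue_measure R) (fun tx => f (updf i tx))) => //.
exact: (measurableT_comp mf (@meas_updf i)).
Qed.
End NonNeg.

(** With the remaining coordinates integrated out first, both measures iterate the same function of
    two real variables, in opposite orders; Tonelli identifies them. *)
Lemma mu_swap i j s A : i != j -> i \notin s -> j \notin s -> measurable A ->
  mu (i :: j :: s) A = mu (j :: i :: s) A.
Proof.
move=> ij ins jns mA.
have iA (m : {measure set envT -> \bar R}) : m A = (\int[m]_t (\1_A t)%:E)%E.
  by rewrite integral_indic// setIT.
have mI : measurable_fun setT (fun t : envT => (\1_A t : R)%:E).
  by apply/measurable_EFinP; exact: measurable_indic.
have I0 (t : envT) : (0 <= (\1_A t : R)%:E)%E by rewrite lee_fin.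
have mu1 k x : measurable_fun [set: envT] (fun t : envT => upd t k x : envT).
  by apply: meas_upd; [exact: measurable_id|exact: measurable_cst].
pose G (xy : R * R) := (\int[mu s]_t (\1_A (upd (upd t j xy.2) i xy.1) : R)%:E)%E.
have mG : measurable_fun [set: R * R] G.
  apply: (measurable_fun_fubini_tonelli_F (m2 := mu s)
    (fun xyt : (R * R) * envT => (\1_A (upd (upd xyt.2 j xyt.1.2) i xyt.1.1) : R)%:E)%E) => //.
  have mm : measurable_fun [set: (R * R) * envT]
      (fun xyt : (R * R) * envT => upd (upd xyt.2 j xyt.1.2) i xyt.1.1 : envT).
    apply: meas_upd; last exact: (measurableT_comp measurable_fst measurable_fst).
    apply: meas_upd; first exact: measurable_snd.
    exact: (measurableT_comp measurable_snd measurable_fst).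
  exact: (measurableT_comp mI mm).
have G0 xy : (0 <= G xy)%E by apply: integral_ge0 => t _; exact: I0.
have E1 : mu (i :: j :: s) A = (\int[lebesgue_measure]_x \int[lebesgue_measure]_y G (x, y))%E.
  rewrite iA mu_consE2//; last by rewrite inE negb_or ij.
  apply: eq_integral => x _; rewrite mu_consE2//.
  exact: (measurableT_comp mI (mu1 i x)).
have E2 : mu (j :: i :: s) A = (\int[lebesgue_measure]_y \int[lebesgue_measure]_x G (x, y))%E.
  have jis : j \notin i :: s by rewrite inE negb_or (eq_sym j i) ij jns.
  rewrite iA (mu_consE2 jis mI I0).
  apply: eq_integral => x _; rewrite (mu_consE2 ins (measurableT_comp mI (mu1 j x)) (fun=> I0 _)).
  apply: eq_integral => y _; apply: eq_integral => t _ /=.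
  by rewrite updC// (eq_sym j i).
rewrite E1 E2; exact: (fubini_tonelli (m1 := @lebesgue_measure R) (m2 := @lebesgue_measure R) G).
Qed.

(** Brings a chosen coordinate to the head of the list by transpositions, so that Fubini can
    integrate it before all others. *)
Lemma mu_front i s A : i \in s -> uniq s -> measurable A ->
  mu s A = mu (i :: rem i s) A.
Proof.
elim: s A => // j s IH A; rewrite inE /=; have [->|ij /=] := eqVneq i j; first by [].
move=> si /andP[js us] mA.
have nir : i \notin rem i s by rewrite mem_rem_uniq// inE eqxx.
have jr : j \notin rem i s by apply: contra js; exact: mem_rem.
have ji : (j == i) = false by rewrite eq_sym (negbTE ij).
have jir : j \notin i :: rem i s by rewrite inE negb_or ji jr.
rewrite (mu_swap ij nir jr mA) (mu_cons _ js) (mu_cons _ jir) /= /pushm_fun /pushforward /product_measure1.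
apply: eq_measure_integral => B mB _.
exact: IH.
Qed.

End Env.
Arguments envT R : clear implicits.

(** * Change of variables: from nonnegative to complex integrands *)

Section Transport.
Context {R : realType} {d1 d2 : measure_display} {T1 : measurableType d1} {T2 : measurableType d2}.
Variables (m1 : {measure set T1 -> \bar R}) (m2 : {measure set T2 -> \bar R}).
Variables (phi : T2 -> T1) (r : R).
Hypothesis r0 : 0 <= r.
Hypothesis tr : forall f : T1 -> \bar R, measurable_fun [set: T1] f -> (forall x, 0 <= f x)%E ->
  (\int[m1]_x f x = r%:E * \int[m2]_y f (phi y))%E.

(** The formula for nonnegative functions is applied to $|h|$ for integrability, and to the positive
    and negative parts of $h$ for the value. *)
Lemma RI_transport (h : T1 -> R) : measurable_fun [set: T1] h ->
  m2.-integrable [set: T2] (EFin \o (fun y => h (phi y))) ->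
  m1.-integrable [set: T1] (EFin \o h) /\
  Rintegral m1 [set: T1] h = r * Rintegral m2 [set: T2] (fun y => h (phi y)).
Proof.
move=> mh ih; have mE : measurable_fun [set: T1] (EFin \o h) by exact/measurable_EFinP.
have ih1 : m1.-integrable [set: T1] (EFin \o h).
  apply/integrableP; split => //.
  rewrite (tr (f := fun x => `|(EFin \o h) x|%E))//; last exact: measurableT_comp.
  by apply: lte_mul_pinfty => //; case/integrableP : ih.
split => //; rewrite /Rintegral.
have I2 := integrable_fin_num measurableT ih.
rewrite integralE (tr (f := (EFin \o h)^\+%E))//; last exact: measurable_funepos.
rewrite (tr (f := (EFin \o h)^\-%E))//; last exact: measurable_funeneg.
have P1 : (fun y => (EFin \o h)^\+ (phi y))%E = ((EFin \o (fun y => h (phi y)))^\+)%E.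
  by apply/funext => y; rewrite !funeposE.
have P2 : (fun y => (EFin \o h)^\- (phi y))%E = ((EFin \o (fun y => h (phi y)))^\-)%E.
  by apply/funext => y; rewrite !funenegE.
rewrite P1 P2 [in RHS]integralE.
have F1 := integrable_pos_fin_num measurableT ih.
have F2 := integrable_neg_fin_num measurableT ih.
rewrite -muleBr//.
  by rewrite fineM// fin_numB F1 F2.
by apply: fin_num_adde_defr.
Qed.

Lemma CI_transport (f : T1 -> R[i]) : cmeas f -> Cintegrable m2 (fun y => f (phi y)) ->
  Cintegrable m1 f /\ CI m1 f = r%:C * CI m2 (fun y => f (phi y)).
Proof.
move=> [f1 f2] [i1 i2]; have [a1 a2] := RI_transport f1 i1; have [b1 b2] := RI_transport f2 i2.
by split => //; rewrite /CI a2 b2; apply: complex_eq; rewrite ?ReC_realM ?ImC_realM.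
Qed.
End Transport.

Section TransportEq.
Context {R : realType} {d1 : measure_display} {T1 : measurableType d1}.
Variables (m1 m2 : {measure set T1 -> \bar R}).
Hypothesis E : forall A, measurable A -> m1 A = m2 A.

Lemma CI_meas_eq (f : T1 -> R[i]) : CI m1 f = CI m2 f.
Proof.
by rewrite /CI /Rintegral; congr (fine _ +i* fine _);
  apply: eq_measure_integral => A mA _; exact: E.
Qed.
Lemma integrable_meas_eq (f : T1 -> \bar R) : m2.-integrable setT f -> m1.-integrable setT f.
Proof.
move=> /integrableP[a b]; apply/integrableP; split => //.
by rewrite (eq_measure_integral m2)// => A mA _; exact: E.
Qed.
Lemma Cintegrable_meas_eq (f : T1 -> R[i]) : Cintegrable m2 f -> Cintegrable m1 f.
Proof. by move=> [a b]; split; exact: integrable_meas_eq. Qed.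
End TransportEq.

Section EnvIntegral.
Context {R : realType}.
Local Notation E := (envT R).
Local Notation lam := (@lebesgue_measure R).

Lemma mu_prod_nneg (s : seq nat) (g : nat -> R -> R) : uniq s ->
  (forall j x, 0 <= g j x) -> (forall j, lam.-integrable setT (EFin \o g j)) ->
  (\int[mu s]_t (\prod_(j <- s) g j (t j))%:E = (\prod_(j <- s) Rintegral lam setT (g j))%:E)%E.
Proof.
move=> + g0 ig; have mg j : measurable_fun setT (g j).
  by have /measurable_int /measurable_EFinP := ig j.
have mP s' : measurable_fun [set: E] (fun t : E => \prod_(j <- s') g j (t j)).
  by apply: measurable_fun_prodr => j _; exact: (measurableT_comp (mg j) (meas_coord j)).
have P0 s' (t : E) : (0 <= (\prod_(j <- s') g j (t j))%:E)%E.
  by rewrite lee_fin prodr_ge0.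
elim: s => [_|i s IH /= /andP[ins us]].
  rewrite mu_integral_nil ?big_nil//; apply/measurable_EFinP; exact: mP.
rewrite (mu_consE ins ((measurable_EFinP _ _).2 (mP _)) (P0 _)) big_cons.
have inner (t : E) : (\int[lam]_x (\prod_(j <- i :: s) g j (upd t i x j))%:E =
    (Rintegral lam setT (g i))%:E * (\prod_(j <- s) g j (t j))%:E)%E.
  transitivity (\int[lam]_x ((g i x)%:E * (\prod_(j <- s) g j (t j))%:E))%E.
    apply: eq_integral => x _; rewrite big_cons updE -EFinM; congr (_ * _)%:E.
    rewrite !big_seq; apply: eq_bigr => j js; rewrite updN//.
    by apply: contraNneq ins => <-.
  rewrite (integralZr measurableT (ig i)); congr (_ * _)%E.
  by rewrite /Rintegral fineK//; exact: (integrable_fin_num measurableT (ig i)).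
under eq_integral do rewrite inner.
rewrite ge0_integralZl//.
- by rewrite IH.
- by apply/measurable_EFinP; exact: mP.
- by rewrite lee_fin Rintegral_ge0.
Qed.

(** Domination by a product of integrable functions of one variable each. Unlike plain
    integrability, this survives fixing or integrating out any coordinate, which is what iterated
    integrals and factorizations require. *)
Definition pdom (s : seq nat) (f : E -> R[i]) (C : R) (g : nat -> R -> R) :=
  [/\ cmeas f, (forall j x, 0 <= g j x), (forall j, lam.-integrable setT (EFin \o g j)) &
    forall t, nc (f t) <= C * \prod_(j <- s) g j (t j)].

Lemma pdom_integrable_prod s C (g : nat -> R -> R) : uniq s ->
  (forall j x, 0 <= g j x) -> (forall j, lam.-integrable setT (EFin \o g j)) ->
  (mu s).-integrable setT (EFin \o (fun t : E => C * \prod_(j <- s) g j (t j))) /\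
  Rintegral (mu s) setT (fun t : E => C * \prod_(j <- s) g j (t j)) =
  C * \prod_(j <- s) Rintegral lam setT (g j).
Proof.
move=> us g0 ig.
have mg j : measurable_fun setT (g j).
  by have /measurable_int /measurable_EFinP := ig j.
have mP s' : measurable_fun [set: E] (fun t : E => \prod_(j <- s') g j (t j)).
  by apply: measurable_fun_prodr => j _; exact: (measurableT_comp (mg j) (meas_coord j)).
have ip : (mu s).-integrable setT (EFin \o (fun t : E => \prod_(j <- s) g j (t j))).
  apply/integrableP; split; first exact/measurable_EFinP.
  under eq_integral => t _.
    rewrite /= ger0_norm ?prodr_ge0//; over.
  by rewrite mu_prod_nneg// ltry.
split; first exact: (integrableZl measurableT C ip).
by rewrite RintegralZl// /Rintegral mu_prod_nneg.
Qed.

Lemma pdom_integrable s f C g : uniq s -> pdom s f C g -> Cintegrable (mu s) f.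
Proof.
move=> us [mf g0 ig fg]; apply: (Cintegrable_dom mf _ fg).
by case: (pdom_integrable_prod C us g0 ig).
Qed.

Lemma cmeas_upd_env (f : E -> R[i]) i x : cmeas f -> cmeas (fun t : E => f (upd t i x)).
Proof.
move=> mf; apply: (cmeas_comp (T := E) mf).
by apply: meas_upd; [exact: measurable_id|exact: measurable_cst].
Qed.
Lemma cmeas_upd_x (f : E -> R[i]) i (t : E) : cmeas f -> cmeas (fun x : R => f (upd t i x)).
Proof.
move=> mf; apply: (cmeas_comp (T := E) mf).
by apply: meas_upd; [exact: measurable_cst|exact: measurable_id].
Qed.

Lemma prod_upd s i x (g : nat -> R -> R) (t : E) : i \notin s ->
  \prod_(j <- s) g j (upd t i x j) = \prod_(j <- s) g j (t j).
Proof.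
move=> ins; rewrite !big_seq; apply: eq_bigr => j js; rewrite updN//.
by apply: contraNneq ins => <-.
Qed.

Lemma pdom_slice i s f C g x : i \notin s -> pdom (i :: s) f C g ->
  pdom s (fun t => f (upd t i x)) (C * g i x) g.
Proof.
move=> ins [mf g0 ig fg]; split => //; first exact: cmeas_upd_env.
move=> t; apply: (le_trans (fg _)); rewrite big_cons updE prod_upd//.
by rewrite mulrA.
Qed.

Lemma pdom_fiber i s f C g t : i \notin s -> pdom (i :: s) f C g ->
  Cintegrable lam (fun x => f (upd t i x)).
Proof.
move=> ins [mf g0 ig fg].
apply: (@Cintegrable_dom R _ _ lam _ (fun x : R => (C * \prod_(j <- s) g j (t j)) * g i x)).
- exact: cmeas_upd_x.
- exact: (integrableZl measurableT (C * \prod_(j <- s) g j (t j)) (ig i)).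
- move=> x; apply: (le_trans (fg _)); rewrite big_cons updE prod_upd//.
  by rewrite -mulrA [g i x * _]mulrC mulrA.
Qed.

(** The two orders of Fubini. Slices are required to be integrable everywhere, not just almost
    everywhere, so that the real-valued inner integral agrees at every point with the extended
    one. *)
Lemma RI_consG i s (h : E -> R) : i \notin s ->
  (mu (i :: s)).-integrable setT (EFin \o h) ->
  ((forall t : E, lam.-integrable setT (EFin \o (fun x => h (upd t i x)))) ->
  Rintegral (mu (i :: s)) setT h =
    Rintegral (mu s) setT (fun t => Rintegral lam setT (fun x => h (upd t i x)))) /\
  ((forall x : R, (mu s).-integrable setT (EFin \o (fun t => h (upd t i x)))) ->
  Rintegral (mu (i :: s)) setT h =
    Rintegral lam setT (fun x => Rintegral (mu s) setT (fun t => h (upd t i x)))).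
Proof.
move=> ins ih; have /integrableP[mh fh] := ih.
have mhu : measurable_fun [set: E * R] (EFin \o h \o updf i).
  exact: (measurableT_comp mh (@meas_updf R i)).
have ihu : (mu s \x lam)%E.-integrable setT (EFin \o h \o updf i).
  apply/integrableP; split => //.
  rewrite (mu_consE ins) in fh; [|exact: measurableT_comp|by []].
  by rewrite (fubini_tonelli1 (m1 := mu s) (m2 := lam) (fun tx => `|(EFin \o h) (updf i tx)|%E))//;
    exact: (measurableT_comp (@abse_measurable R setT) mhu).
have E1 : (\int[mu (i :: s)]_t (EFin \o h) t = \int[mu s \x lam]_tx (EFin \o h) (updf i tx))%E.
  rewrite (eq_measure_integral (pushm (mu s \x lam)%E (@meas_updf R i))); last first.
    by move=> A _ _; exact: mu_cons.
  by rewrite integral_pushforward//; exact: meas_updf.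
split => hs.
  rewrite /Rintegral E1 -(integral12_prod_meas1 ihu); congr (fine _).
  apply: eq_integral => t _; rewrite fineK//.
  exact: (integrable_fin_num measurableT (hs t)).
rewrite /Rintegral E1 -(integral21_prod_meas1 ihu); congr (fine _).
apply: eq_integral => x _; rewrite fineK//.
exact: (integrable_fin_num measurableT (hs x)).
Qed.

Lemma CI_consG i s (f : E -> R[i]) : i \notin s -> Cintegrable (mu (i :: s)) f ->
  (forall t : E, Cintegrable lam (fun x => f (upd t i x))) ->
  CI (mu (i :: s)) f = CI (mu s) (fun t => CI lam (fun x => f (upd t i x))).
Proof.
move=> ins [h1 h2] hs; rewrite /CI /=.
rewrite (RI_consG ins h1).1 ?(RI_consG ins h2).1//.
  by move=> t; case: (hs t).
by move=> t; case: (hs t).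
Qed.

Lemma CI_consG2 i s (f : E -> R[i]) : i \notin s -> Cintegrable (mu (i :: s)) f ->
  (forall x : R, Cintegrable (mu s) (fun t => f (upd t i x))) ->
  CI (mu (i :: s)) f = CI lam (fun x => CI (mu s) (fun t => f (upd t i x))).
Proof.
move=> ins [h1 h2] hs; rewrite /CI /=.
rewrite (RI_consG ins h1).2 ?(RI_consG ins h2).2//.
  by move=> t; case: (hs t).
by move=> t; case: (hs t).
Qed.

(** Decreasing, so that the head of the list is the outermost variable of [intRn]. *)
Fixpoint sq n := if n is n'.+1 then n :: sq n' else [::].
Lemma mem_sq n j : (j \in sq n) = (1 <= j <= n)%N.
Proof.
elim: n => [|n IH] /=; first by rewrite in_nil; case: j.
by rewrite inE IH; lia.
Qed.
Lemma uniq_sq n : uniq (sq n).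
Proof. by elim: n => //= n ->; rewrite mem_sq ltnn andbF. Qed.
Lemma sqN n : n.+1 \notin sq n. Proof. by rewrite mem_sq ltnn andbF. Qed.

Lemma CI_nil (f : E -> R[i]) : cmeas f -> CI (mu [::]) f = f env0.
Proof.
move=> [f1 f2]; rewrite /CI /Rintegral !mu_integral_nil; try exact/measurable_EFinP.
by case: (f env0).
Qed.

Lemma intRnE n f C g : pdom (sq n) f C g -> intRn n f = CI (mu (sq n)) f.
Proof.
elim: n f C => [|n IH] f C pf; first by case: pf => mf *; rewrite CI_nil.
have ins := sqN n.
rewrite CI_consG2//; first last.
- by move=> x; apply: (pdom_integrable (uniq_sq n)); exact: (pdom_slice x ins pf).
- by apply: (pdom_integrable (uniq_sq n.+1)) pf.
rewrite [LHS]/= /cint /CI; congr (_ +i* _); congr (Rintegral _ _ _); apply/funext => x;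
  by rewrite (IH _ _ (pdom_slice x ins pf)).
Qed.

End EnvIntegral.

(** * Affine substitutions, renaming and factorization *)

Section ChangeOfVariables.
Context {R : realType}.
Local Notation E := (envT R).
Local Notation lam := (@lebesgue_measure R).

Lemma measurable_affine (c d : R) :
  measurable_fun [set: measurableTypeR R] ((fun x => c * x + d) : _ -> measurableTypeR R).
Proof. by apply: measurable_funD => //; exact: measurable_funM. Qed.

(** The image of Lebesgue measure under the affine map, multiplied by [c], gives half-open intervals
    their length, hence is Lebesgue measure. *)
Lemma lebesgue_affine_pos (c d : R) (f : R -> \bar R) : 0 < c ->
  measurable_fun [set: R] f -> (forall x, 0 <= f x)%E ->
  (\int[lam]_x f x = c%:E * \int[lam]_x f (c * x + d)%R)%E.
Proof.
move=> c0 mf f0.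
pose r : {nonneg R} := NngNum (ltW c0).
rewrite (@eq_measure_integral _ _ _ _ (mscale r (pushm lam (measurable_affine c d)))).
  rewrite ge0_integral_mscale//; congr (_ * _)%E.
  by rewrite ge0_integral_pushm.
move=> A mA _; apply: lebesgue_measure_unique => //= _ [[a b]] _ <-.
rewrite /mscale /= /pushm_fun /pushforward.
have -> : (fun x => c * x + d) @^-1` [set` `]a, b]] = [set` `](a - d) / c, (b - d) / c]].
  apply/seteqP; split => x /=; rewrite !in_itv /= ltr_pdivrMr// ler_pdivlMr// ltrBlDr lerBrDr;
  by rewrite [x * c]mulrC.
rewrite !lebesgue_measure_itv /= !lte_fin ltr_pM2r ?invr_gt0// ltrD2r.
case: ifP => _; last by rewrite mule0.
rewrite -!EFinB -EFinM; congr _%:E; rewrite -mulrBl mulrC divfK ?gt_eqF//; ring.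
Qed.

Lemma lebesgue_affine (c d : R) (f : R -> \bar R) : c != 0 ->
  measurable_fun [set: R] f -> (forall x, 0 <= f x)%E ->
  (\int[lam]_x f x = `|c|%:E * \int[lam]_x f (c * x + d)%R)%E.
Proof.
move=> c0 mf f0; have [cn|cp|ce] := ltgtP c 0; last by rewrite ce eqxx in c0.
  have mN : measurable_fun [set: measurableTypeR R] (-%R : _ -> measurableTypeR R).
    exact: oppr_measurable.
  have N (g : R -> \bar R) : measurable_fun [set: R] g -> (forall x, 0 <= g x)%E ->
      (\int[lam]_x g x = \int[lam]_x g (- x)%R)%E.
    move=> mg g0; rewrite -(ge0_integral_pushm lam mN)//.
    by apply: eq_measure_integral => A mA _; apply/esym; exact: lebesgue_measureN.
  rewrite ltr0_norm// (@lebesgue_affine_pos (- c) d)// ?oppr_gt0//; congr (_ * _)%E.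
  rewrite N//.
    by apply: eq_integral => x _; rewrite mulrNN.
  by apply: (measurableT_comp mf); exact: measurable_affine.
by rewrite gtr0_norm//; exact: lebesgue_affine_pos.
Qed.

Definition aff (c d : nat -> R) (s : seq nat) (t : E) : E :=
  fun j => if j \in s then c j * t j + d j else t j.

Lemma meas_aff c d s : measurable_fun [set: E] (aff c d s).
Proof.
apply: meas_env => j; rewrite /aff; case: (j \in s); last exact: meas_coord.
by apply: (measurableT_comp (measurable_affine (c j) (d j))); exact: meas_coord.
Qed.

Lemma meas_fiber_int i (f : E -> \bar R) : measurable_fun [set: E] f ->
  (forall t, 0 <= f t)%E ->
  measurable_fun [set: E] (fun t : E => \int[lam]_x f (upd t i x))%E.
Proof.
move=> mf f0; apply: (measurable_fun_fubini_tonelli_F (m2 := lam) (fun tx => f (updf i tx))) => //.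
exact: (measurableT_comp mf (@meas_updf R i)).
Qed.

Lemma mu_aff c d s (f : E -> \bar R) : uniq s -> (forall j, c j != 0) ->
  measurable_fun [set: E] f -> (forall t, 0 <= f t)%E ->
  (\int[mu s]_t f t = (\prod_(j <- s) `|c j|)%:E * \int[mu s]_t f (aff c d s t))%E.
Proof.
move=> + c0; elim: s f => [|i s IH] f.
  by move=> _ mf f0; rewrite big_nil mul1e.
move=> /= /andP[ins us] mf f0.
have mfa : measurable_fun [set: E] (fun t => f (aff c d (i :: s) t)).
  exact: (measurableT_comp mf (@meas_aff c d (i :: s))).
have fa0 t : (0 <= f (aff c d (i :: s) t))%E by [].
rewrite (mu_consE ins mf f0) (mu_consE ins mfa fa0) big_cons.
rewrite (IH _ us (meas_fiber_int i mf f0)); last by move=> t; exact: integral_ge0.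
rewrite EFinM -muleA muleCA; congr (_ * _)%E.
rewrite -ge0_integralZl//.
- apply: eq_integral => t _.
  rewrite (lebesgue_affine (d i) (c0 i))//; last first.
    apply: (measurableT_comp mf); apply: meas_upd; [exact: measurable_cst|exact: measurable_id].
  congr (_ * _)%E; apply: eq_integral => x _; congr f; apply/funext => j.
  by rewrite /upd /aff inE; have [->|ji] /= := eqVneq j i.
- exact: (meas_fiber_int i mfa fa0).
- by move=> t _; exact: integral_ge0.
Qed.

Lemma CI_aff c d s (f : E -> R[i]) : uniq s -> (forall j, c j != 0) ->
  cmeas f -> Cintegrable (mu s) (fun t => f (aff c d s t)) ->
  Cintegrable (mu s) f /\
  CI (mu s) f = (\prod_(j <- s) `|c j|)%:C * CI (mu s) (fun t => f (aff c d s t)).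
Proof.
move=> us c0 mf intf; apply: (CI_transport (phi := aff c d s)) => //.
  by apply: prodr_ge0 => j _.
by move=> h mh h0; exact: mu_aff.
Qed.

Lemma mu_rename (rho : nat -> nat) s (f : E -> \bar R) : injective rho -> uniq s ->
  measurable_fun [set: E] f -> (forall t, 0 <= f t)%E ->
  (\int[mu s]_t f t = \int[mu (map rho s)]_t f (fun j => t (rho j)))%E.
Proof.
move=> ri.
have mr : measurable_fun [set: E] (fun t : E => (fun j => t (rho j)) : E).
  by apply: meas_env => j; exact: meas_coord.
elim: s f => [|i s IH] f.
  by move=> _ mf f0; rewrite /= !mu_integral_nil//; exact: (measurableT_comp mf mr).
move=> /= /andP[ins us] mf f0.
have rins : rho i \notin map rho s by rewrite mem_map.
have mfa : measurable_fun [set: E] (fun t : E => f (fun j => t (rho j))).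
  exact: (measurableT_comp mf mr).
have fa0 (t : E) : (0 <= f (fun j => t (rho j)))%E by [].
rewrite (mu_consE ins mf f0) (mu_consE rins mfa fa0).
rewrite (IH _ us (meas_fiber_int i mf f0)); last by move=> t; exact: integral_ge0.
apply: eq_integral => t _; apply: eq_integral => x _; congr f; apply/funext => j.
by rewrite /upd (inj_eq ri).
Qed.

Lemma CI_rename (rho : nat -> nat) s (f : E -> R[i]) : injective rho -> uniq s ->
  cmeas f -> Cintegrable (mu (map rho s)) (fun t => f (fun j => t (rho j))) ->
  Cintegrable (mu s) f /\
  CI (mu s) f = CI (mu (map rho s)) (fun t => f (fun j => t (rho j))).
Proof.
move=> ri us mf intf.
have [] := @CI_transport _ _ _ _ _ (mu s) (mu (map rho s)) (fun t j => t (rho j)) 1 ler01 _ f mf intf.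
  by move=> h mh h0; rewrite mul1e; exact: mu_rename.
by rewrite mul1r.
Qed.

Lemma pdom_fiber_int i s f C g : i \notin s -> uniq s -> pdom (i :: s) f C g ->
  pdom s (fun t => CI lam (fun x => f (upd t i x))) (2 * (C * Rintegral lam setT (g i))) g.
Proof.
move=> ins us pf; have [mf g0 ig fg] := pf; split => //.
  have [i1 i2] : Cintegrable (mu (i :: s)) f.
    by apply: pdom_integrable pf; rewrite /= ins.
  have key (h : E -> R) : (mu (i :: s)).-integrable setT (EFin \o h) ->
      measurable_fun [set: E] (fun t => Rintegral lam setT (fun x => h (upd t i x))).
    move=> /integrableP[mh fh].
    have mhu : measurable_fun [set: E * R] (EFin \o h \o updf i).
      exact: (measurableT_comp mh (@meas_updf R i)).
    have ihu : (mu s \x lam)%E.-integrable setT (EFin \o h \o updf i).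
      apply/integrableP; split => //.
      rewrite (mu_consE ins) in fh; [|exact: measurableT_comp|by []].
      by rewrite (fubini_tonelli1 (m1 := mu s) (m2 := lam) (fun tx => `|(EFin \o h) (updf i tx)|%E))//;
        exact: (measurableT_comp (@abse_measurable R setT) mhu).
    exact: (measurableT_comp (fine_measurable measurableT) (measurable_fubini_F ihu)).
  by split; [exact: (key _ i1)|exact: (key _ i2)].
move=> t.
apply: (le_trans (@CI_bound R _ _ lam _ (fun x : R => (C * \prod_(j <- s) g j (t j)) * g i x) _ _ _)).
- exact: cmeas_upd_x.
- exact: (integrableZl measurableT (C * \prod_(j <- s) g j (t j)) (ig i)).
- move=> x; apply: (le_trans (fg _)); rewrite big_cons updE prod_upd//.
  by rewrite -mulrA [g i x * _]mulrC mulrA.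
- by rewrite RintegralZl// le_eqVlt; apply/orP; left; apply/eqP; ring.
Qed.

(** Induction on [s1], integrating its head out of [f1]. The requirement on [f1] is that it sees
    nothing outside [s1], because at the end of the induction it must have become a constant; [f2]
    only has to ignore [s1]. *)
Lemma CI_factor s1 s2 (f1 f2 : E -> R[i]) C1 C2 g : uniq (s1 ++ s2) ->
  pdom s1 f1 C1 g -> pdom s2 f2 C2 g -> 0 <= C1 -> 0 <= C2 ->
  (forall t t' : E, (forall i, i \in s1 -> t i = t' i) -> f1 t = f1 t') ->
  (forall (t : E) i x, i \in s1 -> f2 (upd t i x) = f2 t) ->
  CI (mu (s1 ++ s2)) (fun t => f1 t * f2 t) = CI (mu s1) f1 * CI (mu s2) f2.
Proof.
elim: s1 f1 C1 => [|i s1 IH] f1 C1 /=.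
  move=> us [m1 _ _ _] p2 _ _ loc _; rewrite CI_nil//.
  have -> : (fun t => f1 t * f2 t) = (fun t => f1 env0 * f2 t).
    by apply/funext => t; rewrite (loc t env0).
  by rewrite CIZ//; exact: pdom_integrable p2.
rewrite mem_cat negb_or -andbA => /and3P[is1 is2 us] p1 p2 C10 C20 loc1 loc2.
have [us1 us12 us2] : [/\ uniq s1, i \notin s1 ++ s2 & uniq s2].
  by move: (us); rewrite cat_uniq mem_cat negb_or is1 is2 => /and3P[].
have [m1 g0 ig b1] := p1; have [m2 _ _ b2] := p2.
have p12 : pdom (i :: s1 ++ s2) (fun t => f1 t * f2 t) (C1 * C2) g.
  split => //; first exact: cmeasM.
  move=> t; rewrite ncM -cat_cons big_cat /= mulrACA ler_pM ?nc_ge0//.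
rewrite CI_consG//; last 2 first.
- by apply: pdom_integrable p12; rewrite /= us12.
- by move=> t; exact: (pdom_fiber t us12 p12).
rewrite CI_consG//; last 2 first.
- by apply: pdom_integrable p1; rewrite /= is1.
- by move=> t; exact: (pdom_fiber t is1 p1).
have -> : (fun t => CI lam (fun x => f1 (upd t i x) * f2 (upd t i x))) =
    (fun t => CI lam (fun x => f1 (upd t i x)) * f2 t).
  apply/funext => t; under eq_fun do rewrite loc2 ?inE ?eqxx// mulrC.
  by rewrite CIZ 1?mulrC//; exact: (pdom_fiber t is1 p1).
apply: (IH _ _ us (pdom_fiber_int is1 us1 p1) p2) => //.
- by rewrite !mulr_ge0// Rintegral_ge0.
- move=> t t' tt'; congr (CI lam _); apply/funext => x; apply: loc1 => j.
  by rewrite /upd inE; case: eqP => //= _; exact: tt'.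
- by move=> t j x js; apply: loc2; rewrite inE js orbT.
Qed.

End ChangeOfVariables.

(** * Total derivatives *)

Section Calculus.
Context {R : realType}.
Local Notation lam := (@lebesgue_measure R).

Definition ooR (a b : R) (f : R -> R) (x : R) : R := if (a < x < b) then f x else 0.
Definition ooC (a b : R) (f : R -> R[i]) (x : R) : R[i] := if (a < x < b) then f x else 0.

Lemma measurable_ooR a b f : (forall x, a < x < b -> {for x, continuous f}) ->
  measurable_fun [set: R] (ooR a b f).
Proof.
move=> cf; have mf : measurable_fun `]a, b[%classic f.
  apply: open_continuous_measurable_fun; first exact: interval_open.
  by move=> x; rewrite inE /= in_itv /= => /cf.
have -> : ooR a b f = f \_ `]a, b[%classic.
  apply/funext => x; rewrite /ooR patchE; case: ifP => h.
    by rewrite mem_set// /= in_itv.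
  by rewrite memNset// /= in_itv /= h.
by apply/(measurable_restrictT f).
Qed.

(** Margin by which closed segments exhaust the open interval. A denominator of at least 3 keeps the
    two ends of each segment in strict order. *)
Definition inpt (a b : R) (k : nat) : R := (b - a) / k.+3%:R.

Lemma inpt_gt0 a b k : a < b -> 0 < inpt a b k.
Proof. by move=> ab; rewrite divr_gt0 ?subr_gt0. Qed.
Lemma inpt_lt a b k : a < b -> a + inpt a b k < b - inpt a b k.
Proof.
move=> ab; rewrite -subr_gt0 /inpt.
have -> : b - (b - a) / k.+3%:R - (a + (b - a) / k.+3%:R) = (b - a) * (k.+1%:R / k.+3%:R).
  have -> : k.+1%:R = k.+3%:R - 2 :> R by rewrite -!natr1; ring.
  have : k.+3%:R != 0 :> R by rewrite pnatr_eq0.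
  by move: (k.+3%:R) => q q0; field.
by rewrite mulr_gt0 ?subr_gt0// divr_gt0.
Qed.
Lemma inpt_cvg a b : (inpt a b : nat -> R) @ \oo --> (0 : R).
Proof.
rewrite -(mulr0 (b - a)); apply: cvgM; first exact: cvg_cst.
rewrite (_ : (fun k => _) = (fun k : nat => (k + 2).+1%:R^-1)).
  by rewrite (cvg_shiftn 2 (fun k => k.+1%:R^-1 : R)); exact: cvg_harmonic.
by apply/funext => k; rewrite addn2.
Qed.

Lemma FTC_seg (f F : R -> R) (a b a' b' : R) : a < a' -> a' < b' -> b' < b ->
  (forall x, a < x < b -> is_derive x (1 : R) F (f x)) ->
  (forall x, a < x < b -> {for x, continuous f}) ->
  (\int[lam]_(x in `[a', b']) (f x)%:E = (F b' - F a')%:E)%E.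
Proof.
move=> aa ab bb dF cf.
have sub x : a' <= x <= b' -> a < x < b by lra.
have cF x : a' <= x <= b' -> {for x, continuous F}.
  by move=> /sub /dF [dx _]; apply: differentiable_continuous; exact/derivable1_diffP.
rewrite (@continuous_FTC2 _ f F)//.
- apply: continuous_in_subspaceT => x; rewrite inE /= in_itv /= => /sub; exact: cf.
- split.
  + by move=> x; rewrite in_itv /= => h; have /dF[] : a < x < b by lra.
  + by apply: cvg_at_right_filter; apply: cF; lra.
  + by apply: cvg_at_left_filter; apply: cF; lra.
- move=> x; rewrite in_itv /= => h; rewrite derive1E.
  by have /dF[] : a < x < b by lra.
Qed.

Lemma ooR_seg_cvg (a b : R) x : a < b ->
  (fun k => (\1_(`[a + inpt a b k, b - inpt a b k]%classic) x : R)) @ \oo --> (if (a < x < b) then 1 else 0 : R).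
Proof.
move=> ab; case: ifPn => [/andP[ax xb]|xab]; last first.
  apply: cvg_near_cst; apply: nearW => k; rewrite indicE memNset// /= in_itv /=.
  by move=> h; move: xab; have := inpt_gt0 k ab; lra.
apply: cvg_near_cst.
have e0 : 0 < Num.min (x - a) (b - x) by rewrite lt_min !subr_gt0 ax xb.
have := inpt_cvg a b; move=> /cvgrPdist_lt /(_ _ e0); apply: filterS => k.
rewrite sub0r normrN ger0_norm ?(ltW (inpt_gt0 k ab))// lt_min => /andP[h1 h2].
by rewrite indicE mem_set// /= in_itv /=; lra.
Qed.

(** On each closed segment the integral is a difference of two values of [F], so at most $2M$; the
    segments increase to the open interval and monotone convergence concludes. *)
Lemma ge0_FTC_integrable (f F : R -> R) (a b M : R) : a < b ->
  (forall x, a < x < b -> 0 <= f x) ->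
  (forall x, a < x < b -> is_derive x (1 : R) F (f x)) ->
  (forall x, a < x < b -> {for x, continuous f}) ->
  (forall x, a < x < b -> `|F x| <= M) ->
  lam.-integrable setT (EFin \o ooR a b f).
Proof.
move=> ab f0 dF cf FM.
have mo := measurable_ooR cf.
have o0 x : 0 <= ooR a b f x by rewrite /ooR; case: ifP => // /f0.
apply/integrableP; split; first exact/measurable_EFinP.
under eq_integral => x _ do rewrite /= ger0_norm//.
pose S k := `[a + inpt a b k, b - inpt a b k]%classic : set R.
have SU : \bigcup_k S k = `]a, b[%classic.
  apply/seteqP; split => x.
    by move=> [k _]; rewrite /S /= !in_itv /=; have := inpt_gt0 k ab; lra.
  rewrite /= in_itv /= => h.
  have := @ooR_seg_cvg a b x ab; rewrite h => /cvgrPdist_lt /(_ 1 ltr01) [k _ /(_ k (leqnn k))].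
  rewrite indicE; case: (boolP (x \in S k)) => [|_]; first by rewrite inE; exists k.
  by rewrite subr0 normr1 ltxx.
have ndS : nondecreasing_seq S.
  apply/nondecreasing_seqP => k; rewrite subsetEset => x; rewrite /S /= !in_itv /=.
  have : inpt a b k.+1 <= inpt a b k.
    by rewrite /inpt ler_pM2l ?subr_gt0// lef_pV2 ?posrE// ler_nat.
  lra.
have oE x k : S k x -> ooR a b f x = f x.
  by rewrite /S /ooR /= in_itv /= => h; case: ifPn => //; have := inpt_gt0 k ab; lra.
have cv : (\int[lam]_(x in S k) (EFin \o ooR a b f) x)%E @[k --> \oo] -->
    (\int[lam]_(x in `]a, b[) (EFin \o ooR a b f) x)%E.
  rewrite -SU; apply: ge0_nondecreasing_set_cvg_integral => //.
  - by move=> k; exact: measurable_itv.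
  - by move=> k; apply: measurable_funTS; exact/measurable_EFinP.
  - by move=> k x _; rewrite lee_fin.
rewrite (_ : \int[lam]_x _ = \int[lam]_(x in `]a, b[) (EFin \o ooR a b f) x)%E; last first.
  rewrite [RHS]integral_mkcond; apply: eq_integral => x _; rewrite patchE /ooR /=.
  case: ifPn => h; first by rewrite mem_set// /= in_itv.
  by rewrite if_same.
apply: (@le_lt_trans _ _ (M + M)%:E); last exact: ltry.
apply: (cvge_to_le cv); apply: nearW => k.
have [i0 i1] := (inpt_gt0 k ab, inpt_lt k ab).
rewrite (_ : \int[lam]_(x in S k) _ = \int[lam]_(x in S k) (f x)%:E)%E; last first.
  by apply: eq_integral => x; rewrite inE => /oE /= ->.
rewrite (@FTC_seg f F a b)//; [|lra|lra].
rewrite lee_fin; apply: (le_trans (ler_norm _)); apply: (le_trans (ler_normB _ _)).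
by apply: lerD; apply: FM; lra.
Qed.

(** Dominated convergence over the exhausting segments, with $|f|$ as dominating function. The
    integrand may be unbounded at the ends; the primitive only needs limits along the two sequences
    of end points. *)
Lemma FTC_oo (f F : R -> R) (a b la lb : R) : a < b ->
  (forall x, a < x < b -> is_derive x (1 : R) F (f x)) ->
  (forall x, a < x < b -> {for x, continuous f}) ->
  lam.-integrable setT (EFin \o ooR a b f) ->
  (fun k => F (a + inpt a b k)) @ \oo --> la ->
  (fun k => F (b - inpt a b k)) @ \oo --> lb ->
  Rintegral lam setT (ooR a b f) = lb - la.
Proof.
move=> ab dF cf intf cva cvb.
pose S k := `[a + inpt a b k, b - inpt a b k]%classic : set R.
have mo := measurable_ooR cf.
have mS k : measurable (S k) by exact: measurable_itv.
have mh k : measurable_fun setT (fun x => (ooR a b f x * \1_(S k) x)%:E).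
  by apply/measurable_EFinP; apply: measurable_funM => //; exact: measurable_indic.
have mo' : measurable_fun setT (EFin \o ooR a b f) by exact/measurable_EFinP.
have h1 : {ae lam, forall x, setT x -> (fun k => (ooR a b f x * \1_(S k) x)%:E) @ \oo --> (EFin \o ooR a b f) x}.
  apply: aeW => x _; apply: cvg_EFin; first exact: nearW.
  rewrite [X in _ --> X](_ : _ = ooR a b f x * (if (a < x < b) then 1 else 0)).
    2: by rewrite /ooR; case: ifP => _; rewrite ?mulr1 ?mulr0.
  by apply: cvgM; [exact: cvg_cst|exact: ooR_seg_cvg].
have h2 : {ae lam, forall x (k : nat), setT x ->
    (`|(ooR a b f x * \1_(S k) x)%:E| <= (abse \o (EFin \o ooR a b f)) x)%E}.
  apply: aeW => x k _; rewrite /= lee_fin normrM indicE.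
  by case: (x \in S k); rewrite ?normr1 ?normr0 ?mulr1 ?mulr0.
have [_ _ cv] := @dominated_convergence _ _ R lam setT measurableT _ _ _ mh mo' h1
  (integrable_abse intf) h2.
have E k : (\int[lam]_x (ooR a b f x * \1_(S k) x)%:E = (F (b - inpt a b k) - F (a + inpt a b k))%:E)%E.
  have [i0 i1] := (inpt_gt0 k ab, inpt_lt k ab).
  rewrite -(@FTC_seg f F a b (a + inpt a b k) (b - inpt a b k))//; [|lra|lra].
  rewrite [RHS]integral_mkcond; apply: eq_integral => x _.
  rewrite patchE indicE /ooR /S; case: (boolP (x \in _)) => h; last by rewrite mulr0.
  move: h; rewrite inE /= in_itv /= => h.
  have hx : a < (x : R) < b by move: (x : R) h => y h; lra.
  by rewrite hx mulr1.
have cv2 : (fun k => (F (b - inpt a b k) - F (a + inpt a b k))%:E) @ \oo --> (lb - la)%:E.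
  by apply: cvg_EFin; [exact: nearW|exact: cvgB].
rewrite /Rintegral; rewrite (_ : (\int[lam]_x _)%E = (lb - la)%:E)//.
rewrite -(funext E) in cv2.
by apply: (cvg_unique _ cv cv2); exact: ereal_hausdorff.
Qed.

Definition cderiv (f : R -> R[i]) (x : R) (w : R[i]) :=
  is_derive x (1 : R) (fun y => ReC (f y)) (ReC w) /\ is_derive x (1 : R) (fun y => ImC (f y)) (ImC w).
Definition ccont (f : R -> R[i]) (x : R) :=
  ReC (f y) @[y --> x] --> ReC (f x) /\ ImC (f y) @[y --> x] --> ImC (f x).

Lemma cderiv_cont f x w : cderiv f x w -> ccont f x.
Proof.
by move=> [[d1 _] [d2 _]]; split; apply: differentiable_continuous; exact/derivable1_diffP.
Qed.
Lemma cderiv_cst w x : cderiv (fun=> w) x 0.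
Proof. by split; exact: is_derive_cst. Qed.
Lemma cderivM f g x v w : cderiv f x v -> cderiv g x w ->
  cderiv (fun y => f y * g y) x (v * g x + f x * w).
Proof.
move=> [f1 f2] [g1 g2]; split.
  under eq_fun do rewrite ReCM.
  have := is_deriveB (is_deriveM f1 g1) (is_deriveM f2 g2).
  by move/(@is_derive_eq _ _ _ _ _ _ _); apply; rewrite ReCD !ReCM /GRing.scale /=; ring.
under eq_fun do rewrite ImCM.
have := is_deriveD (is_deriveM f1 g2) (is_deriveM f2 g1).
by move/(@is_derive_eq _ _ _ _ _ _ _); apply; rewrite ImCD !ImCM /GRing.scale /=; ring.
Qed.
Lemma ccontM f g x : ccont f x -> ccont g x -> ccont (fun y => f y * g y) x.
Proof.
move=> [f1 f2] [g1 g2]; split.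
  by under eq_fun do rewrite ReCM; rewrite ReCM; apply: cvgB; exact: cvgM.
by under eq_fun do rewrite ImCM; rewrite ImCM; apply: cvgD; exact: cvgM.
Qed.
Lemma ccontD f g x : ccont f x -> ccont g x -> ccont (fun y => f y + g y) x.
Proof.
move=> [f1 f2] [g1 g2]; split.
  by under eq_fun do rewrite ReCD; rewrite ReCD; apply: cvgD.
by under eq_fun do rewrite ImCD; rewrite ImCD; apply: cvgD.
Qed.
Lemma ccont_cst w x : ccont (fun=> w) x.
Proof. by split; exact: cvg_cst. Qed.

Lemma ccont_inv w x : x != w -> ccont (fun y => (y - w)%:C^-1) x.
Proof.
move=> xw; under eq_fun do rewrite -realCV; split => /=; last exact: cvg_cst.
apply: cvgV; first by rewrite subr_eq0.
by apply: cvgB; [exact: cvg_id|exact: cvg_cst].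
Qed.

Lemma cderiv_near f g x w : (\forall y \near x, f y = g y) -> cderiv f x w -> cderiv g x w.
Proof.
move=> fg [f1 f2]; split; [move: f1|move: f2]; apply: near_eq_is_derive => //;
  by rewrite ?oner_eq0//; move: fg; apply: filterS => y ->.
Qed.

Lemma cderiv_cexp (a b : R[i]) (phi : R -> R) (x d : R) : is_derive x (1 : R) phi d ->
  cderiv (fun y => cexp (a * (phi y)%:C + b)) x (a * d%:C * cexp (a * (phi x)%:C + b)).
Proof.
move=> dp.
have E1 y : ReC (a * (phi y)%:C + b) = ReC a * phi y + ReC b.
  by rewrite ReCD ReCM /= mulr0 subr0.
have E2 y : ImC (a * (phi y)%:C + b) = ImC a * phi y + ImC b.
  by rewrite ImCD ImCM /= mulr0 add0r.
have d1 : is_derive x (1 : R) (fun y => ReC a * phi y + ReC b) (ReC a * d).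
  have := is_deriveD (is_deriveZ (ReC a) dp) (is_derive_cst (ReC b) x (1 : R)).
  by move/(@is_derive_eq _ _ _ _ _ _ _); apply; rewrite addr0.
have d2 : is_derive x (1 : R) (fun y => ImC a * phi y + ImC b) (ImC a * d).
  have := is_deriveD (is_deriveZ (ImC a) dp) (is_derive_cst (ImC b) x (1 : R)).
  by move/(@is_derive_eq _ _ _ _ _ _ _); apply; rewrite addr0.
have de := is_derive1_comp (is_derive_expR _) d1.
have dc := is_derive1_comp (is_derive_cos _) d2.
have ds := is_derive1_comp (is_derive_sin _) d2.
split.
  have := is_deriveM de dc; rewrite /cexp /=.
  under [X in _ -> is_derive _ _ X _]eq_fun do rewrite E1 E2.
  move/(@is_derive_eq _ _ _ _ _ _ _); apply.
  by rewrite ReCM ReCM ImCM /= E1 E2 /GRing.scale /=; ring.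
have := is_deriveM de ds; rewrite /cexp /=.
under [X in _ -> is_derive _ _ X _]eq_fun do rewrite E1 E2.
move/(@is_derive_eq _ _ _ _ _ _ _); apply.
by rewrite ImCM ReCM ImCM /= E1 E2 /GRing.scale /=; ring.
Qed.
End Calculus.

(** * Derivatives and integrability of powers on the line *)

Section Stokes1d.
Context {R : realType}.
Local Notation lam := (@lebesgue_measure R).
Implicit Types (x y w : R) (a b c : R[i]).

Lemma is_derive_lnB x w : x != w -> is_derive x (1 : R) (fun y => ln `|y - w|) (x - w)^-1.
Proof.
move=> xw.
have dB : is_derive x (1 : R) (fun y => y - w) 1.
  have := is_deriveB (is_derive_id x (1 : R)) (is_derive_cst w x (1 : R)).
  by move/(@is_derive_eq _ _ _ _ _ _ _); apply; rewrite subr0.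
have dN : is_derive x (1 : R) (fun y => w - y) (- 1).
  have := is_deriveB (is_derive_cst w x (1 : R)) (is_derive_id x (1 : R)).
  by move/(@is_derive_eq _ _ _ _ _ _ _); apply; rewrite sub0r.
have [xw'|xw'|/eqP] := ltgtP x w; last by rewrite (negbTE xw).
  have := is_derive1_comp (f := @ln R) (g := fun y => w - y) (is_derive1_ln _) dN.
  rewrite subr_gt0 => /(_ xw'); rewrite mulrN1 -invrN opprB.
  apply: near_eq_is_derive.
  by near=> y; rewrite /= ltr0_norm ?opprB// subr_lt0; near: y; exact: lt_nbhsl.
have := is_derive1_comp (f := @ln R) (g := fun y => y - w) (is_derive1_ln _) dB.
rewrite subr_gt0 => /(_ xw'); rewrite mulr1.
apply: near_eq_is_derive.
by near=> y; rewrite /= gtr0_norm// subr_gt0; near: y; exact: lt_nbhsr.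
Unshelve. all: by end_near.
Qed.

Lemma cpowE x a : x != 0 ->
  cpowR x a = cexp (a * (ln `|x|)%:C + (if x < 0 then a * (0 +i* pi) else 0)).
Proof.
move=> /negbTE x0; rewrite /cpowR x0; congr cexp; case: ifP => _; last by rewrite addr0.
rewrite -mulrDr; congr (_ * _); by apply: complex_eq; rewrite /= ?addr0 ?add0r.
Qed.

Lemma near_sign x w : x != w -> \forall y \near x, (y < w) = (x < w) /\ y != w.
Proof.
move=> xw; have [xw'|xw'|/eqP] := ltgtP x w; last by rewrite (negbTE xw).
  near=> y; have yw : y < w by near: y; exact: lt_nbhsl.
  by rewrite yw lt_eqF.
near=> y; have yw : w < y by near: y; exact: lt_nbhsr.
by rewrite gt_eqF// ltNge ltW.
Unshelve. all: by end_near.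
Qed.

Lemma cderiv_cpow x w a : x != w ->
  cderiv (fun y => cpowR (y - w) a) x (a * (x - w)%:C^-1 * cpowR (x - w) a).
Proof.
move=> xw; pose b := if x < w then a * (0 +i* pi) else 0.
have := cderiv_cexp a b (is_derive_lnB xw).
rewrite -realCV cpowE ?subr_eq0// subr_lt0; apply: cderiv_near.
by move: (near_sign xw); apply: filterS => y [yw1 yw2]; rewrite cpowE ?subr_eq0// subr_lt0 yw1.
Qed.

(** Reversing the difference changes the power by a locally constant phase only, so the logarithmic
    derivative is again $a/(x-w)$. Hence the factors of the master function may be oriented either
    way in the boundary argument. *)
Lemma cderiv_cpowN x w a : x != w ->
  cderiv (fun y => cpowR (w - y) a) x (a * (x - w)%:C^-1 * cpowR (w - x) a).
Proof.
move=> xw; have wx : w != x by rewrite eq_sym.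
pose b := if w < x then a * (0 +i* pi) else 0.
have := cderiv_cexp a b (is_derive_lnB xw).
rewrite -realCV [cpowR (w - x) a]cpowE ?subr_eq0// subr_lt0 [`|w - x|]distrC; apply: cderiv_near.
move: (near_sign xw); apply: filterS => y [yw1 yw2].
rewrite cpowE ?subr_eq0 1?eq_sym// subr_lt0 [`|w - y|]distrC /b.
by have [h|h|h] := ltgtP w y; have [h'|h'|h'] := ltgtP w x => //; move: yw1 yw2 xw; rewrite ?h ?h' ?ltxx ?eqxx //;
  rewrite ?(lt_gtF h) ?(lt_gtF h') ?h ?h'.
Qed.

Lemma CFTC (f F : R -> R[i]) (a b : R) la lb : a < b ->
  (forall x, a < x < b -> cderiv F x (f x)) ->
  (forall x, a < x < b -> ccont f x) ->
  Cintegrable lam (ooC a b f) ->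
  clim (fun k => F (a + inpt a b k)) la ->
  clim (fun k => F (b - inpt a b k)) lb ->
  CI lam (ooC a b f) = lb - la.
Proof.
move=> ab dF cf [i1 i2] [a1 a2] [b1 b2].
have E1 : (fun x => ReC (ooC a b f x)) = ooR a b (fun x => ReC (f x)).
  by apply/funext => x; rewrite /ooC /ooR; case: ifP.
have E2 : (fun x => ImC (ooC a b f x)) = ooR a b (fun x => ImC (f x)).
  by apply/funext => x; rewrite /ooC /ooR; case: ifP.
rewrite E1 in i1; rewrite E2 in i2.
rewrite /CI E1 E2.
have r1 := @FTC_oo R (fun x => ReC (f x)) (fun x => ReC (F x)) a b (ReC la) (ReC lb) ab
  (fun x h => (dF x h).1) (fun x h => (cf x h).1) i1 a1 b1.
have r2 := @FTC_oo R (fun x => ImC (f x)) (fun x => ImC (F x)) a b (ImC la) (ImC lb) ab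
  (fun x h => (dF x h).2) (fun x h => (cf x h).2) i2 a2 b2.
by rewrite r1 r2; apply: complex_eq; rewrite ?ReCD ?ImCD ?ReCN ?ImCN.
Qed.

(** Models $|y^{-1}y^a|$ for $\Re a=\rho$, cut off at bounded distance to be integrable over the
    whole line. *)
Definition hpow (M rho y : R) : R := if (`|y| < M) then `|y| `^ (rho - 1) else 0.

Lemma hpow_ge0 M rho y : 0 <= hpow M rho y.
Proof. by rewrite /hpow; case: ifP => // _; exact: powR_ge0. Qed.

Lemma cont_powR (x r : R) : 0 < x -> {for x, continuous (fun y : R => y `^ r)}.
Proof.
move=> x0; have [d _] := is_derive1_powR r x0.
by apply: differentiable_continuous; exact/derivable1_diffP.
Qed.

Lemma measurable_hpow M rho : measurable_fun [set: R] (hpow M rho).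
Proof.
apply: measurable_fun_ifT; last exact: measurable_cst.
  by apply: measurable_fun_ltr; [exact: normr_measurable|exact: measurable_cst].
exact: (measurableT_comp (@measurable_powR R (rho - 1)) (@normr_measurable R setT)).
Qed.

Lemma integrable_affine (c d : R) (f : R -> R) : c != 0 ->
  lam.-integrable setT (EFin \o f) ->
  lam.-integrable setT (EFin \o (fun x => f (c * x + d))).
Proof.
move=> c0 /integrableP[mf intf]; apply/integrableP.
have mf' : measurable_fun [set: R] (EFin \o (fun x => f (c * x + d))).
  exact: (measurableT_comp mf (measurable_affine c d)).
split => //.
have AB := lebesgue_affine d c0 (measurableT_comp (@abse_measurable R setT) mf) (fun=> abse_ge0 _).
set B := (\int[_]_x _)%E; have {}AB : (\int[lam]_x `|(EFin \o f) x| = `|c|%:E * B)%E by [].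
rewrite ltey; apply/negP => /eqP BE; move: intf.
by rewrite AB BE gt0_muley ?ltxx// lte_fin normr_gt0.
Qed.

Lemma integrable_ooR_pow M rho : 0 < rho ->
  lam.-integrable setT (EFin \o ooR 0 M (fun x : R => x `^ (rho - 1))).
Proof.
move=> r0; have [M0|M0] := leP M 0.
  rewrite (_ : ooR _ _ _ = cst 0); first exact: integrable0.
  by apply/funext => x; rewrite /ooR; case: ifP => //; lra.
apply: (@ge0_FTC_integrable _ _ (fun x => rho^-1 * x `^ rho) _ _ (rho^-1 * M `^ rho)) => //.
- by move=> x _; exact: powR_ge0.
- move=> x /andP[x0 _].
  have := is_deriveZ rho^-1 (is_derive1_powR rho x0).
  by move/(@is_derive_eq _ _ _ _ _ _ _); apply; rewrite /GRing.scale /= mulrA mulVf ?mul1r// gt_eqF.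
- by move=> x /andP[x0 _]; exact: cont_powR.
- move=> x /andP[x0 xM]; rewrite ger0_norm; last by rewrite mulr_ge0 ?powR_ge0// invr_ge0 ltW.
  by rewrite ler_pM2l ?invr_gt0// ge0_ler_powR ?nnegrE ?ltW.
Qed.

Lemma integrable_ooR1 (M : R) : lam.-integrable setT (EFin \o ooR (- M) M (fun=> 1)).
Proof.
have [M0|M0] := leP M 0.
  rewrite (_ : ooR _ _ _ = cst 0); first exact: integrable0.
  by apply/funext => x; rewrite /ooR; case: ifP => //; lra.
apply: (@ge0_FTC_integrable _ _ id _ _ M) => //; first by lra.
- by move=> x _; exact: cvg_cst.
- by move=> x /andP[h1 h2]; rewrite ler_norml; lra.
Qed.

Lemma integrable_hpow M rho : 0 < rho -> lam.-integrable setT (EFin \o hpow M rho).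
Proof.
move=> r0; pose p := ooR 0 M (fun x : R => x `^ (rho - 1)).
have ip := integrable_ooR_pow M r0.
have ip' : lam.-integrable setT (EFin \o (fun x => p (-1 * x + 0))).
  by apply: integrable_affine => //; rewrite oppr_eq0 oner_eq0.
(* [p] and its reflection cover the two half-lines; the indicator is added for the point 0 alone,
   where the real power takes the value 0 or 1. *)
have i1 := integrable_ooR1 M.
have := integrableD measurableT (integrableD measurableT ip ip') i1.
apply: le_integrable => //; first by apply/measurable_EFinP; exact: measurable_hpow.
move=> x _ /=; rewrite lee_fin ger0_norm ?hpow_ge0//; apply: le_trans (ler_norm _).
have p0 y : 0 <= p y by rewrite /p /ooR; case: ifP => // _; exact: powR_ge0.
have o0 : 0 <= ooR (- M) M (fun=> 1) x by rewrite /ooR; case: ifP.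
rewrite -/(p x) /hpow; case: ifP; last by move=> _; rewrite !addr_ge0.
rewrite ltr_norml => /andP[x1 x2]; have [xn|xp|->] := ltgtP x 0.
- have -> : p (-1 * x + 0) = `|x| `^ (rho - 1).
    by rewrite /p /ooR mulN1r addr0 ltr0_norm// oppr_gt0 xn /= ltrNl x1.
  by rewrite -addrA -[leLHS]add0r lerD// lerDl.
- have -> : p x = `|x| `^ (rho - 1) by rewrite /p /ooR xp x2 gtr0_norm.
  by rewrite -addrA lerDl addr_ge0.
- rewrite normr0; have -> : ooR (- M) M (fun=> 1) 0 = 1 by rewrite /ooR ifT//; lra.
  apply: (@le_trans _ _ 1); last by rewrite lerDr addr_ge0.
  by rewrite /powR eqxx lern1; case: (_ == _).
Qed.

Lemma integrable_hpowB M rho w : 0 < rho -> lam.-integrable setT (EFin \o (fun x => hpow M rho (x - w))).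
Proof.
move=> r0; rewrite (_ : (fun x => hpow M rho (x - w)) = (fun x => hpow M rho (1 * x + (- w)))).
  by apply: integrable_affine; [rewrite oner_eq0|exact: integrable_hpow].
by apply/funext => x; rewrite mul1r.
Qed.

(** The independence from [w] is what allows a variable to be integrated out when the singularity
    sits at another variable. *)
Lemma integral_hpowB M rho w : (\int[lam]_x (hpow M rho (x - w))%:E = \int[lam]_x (hpow M rho x)%:E)%E.
Proof.
rewrite (@lebesgue_affine _ 1 (- w) (fun x => (hpow M rho x)%:E)) ?oner_eq0//.
- by rewrite normr1 mul1e; apply: eq_integral => x _; rewrite mul1r.
- by apply/measurable_EFinP; exact: measurable_hpow.
- by move=> x; rewrite lee_fin hpow_ge0.
Qed.

End Stokes1d.

(** * Boundary terms in one variable *)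

Section Stokes1.
Context {R : realType} {I : eqType}.
Local Notation lam := (@lebesgue_measure R).
Variables (r : seq I) (q : I -> R -> R[i]) (c : I -> R[i]) (w : I -> R) (a b : R).
Hypothesis ur : uniq r.
Hypothesis ab : a < b.
Hypothesis wout : forall k, k \in r -> w k <= a \/ b <= w k.
Hypothesis qE : forall k, k \in r ->
  q k = (fun y => cpowR (y - w k) (c k)) \/ q k = (fun y => cpowR (w k - y) (c k)).
Hypothesis c0 : forall k, k \in r -> 0 < ReC (c k).

Let M k := `|a - w k| + `|b - w k|.
Let C k := argc (c k) * M k `^ ReC (c k).

Let C_ge0 k : 0 <= C k.
Proof. by rewrite mulr_ge0 ?argc_ge0 ?powR_ge0. Qed.

Let dist_le y k : a < y < b -> `|y - w k| <= M k.
Proof.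
move=> /andP[h1 h2]; rewrite /M ler_norml.
have := ler_norm (a - w k); have := ler_norm (b - w k).
have := ler_norm (- (a - w k)); have := ler_norm (- (b - w k)); rewrite !normrN.
move=> *; apply/andP; split; lra.
Qed.

Let nc_q y k : k \in r -> nc (q k y) <= argc (c k) * `|y - w k| `^ ReC (c k).
Proof.
by move=> /qE[->|->]; [exact: nc_cpow_le|rewrite distrC; exact: nc_cpow_le].
Qed.

Let nc_qC y k : k \in r -> a < y < b -> nc (q k y) <= C k.
Proof.
move=> kr yab; apply: (le_trans (nc_q y kr)); rewrite ler_wpM2l ?argc_ge0//.
by rewrite ge0_ler_powR ?nnegrE ?dist_le ?addr_ge0// ltW// c0.
Qed.

Let nc_rest y k0 : a < y < b ->
  nc (\prod_(k <- r | k != k0) q k y) <= \prod_(k <- r | k != k0) C k.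
Proof.
move=> yab; rewrite nc_prod big_seq_cond [leRHS]big_seq_cond; apply: ler_prod => k /andP[kr _].
by rewrite nc_ge0 nc_qC.
Qed.

(** The pole of the [k0] term of the logarithmic derivative is absorbed by the factor [q k0]; the
    remaining factors are bounded on the interval. *)
Lemma stokes1_bound k0 y : k0 \in r -> a < y < b ->
  nc (c k0 * (y - w k0)%:C^-1 * \prod_(k <- r) q k y) <=
  (nc (c k0) * argc (c k0) * \prod_(k <- r | k != k0) C k) *
  hpow (M k0 + 1) (ReC (c k0)) (y - w k0).
Proof.
move=> k0r yab.
have yw : y != w k0 by have := wout k0r; move: yab => /andP[h1 h2]; apply: contraPneq => <- []; lra.
have yw0 : 0 < `|y - w k0| by rewrite normr_gt0 subr_eq0.
rewrite (bigD1_seq k0)//= !ncM ncV nc_real.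
have -> : hpow (M k0 + 1) (ReC (c k0)) (y - w k0) = `|y - w k0|^-1 * `|y - w k0| `^ ReC (c k0).
  (* The cutoff in [hpow] is strict whereas [M k0] bounds the distance only weakly, hence the added
     1. *)
  rewrite /hpow ifT; last by have := dist_le k0 yab; lra.
  by rewrite powRB ?powRr1 ?ltW// 1?mulrC//; apply/implyP => _; rewrite gt_eqF.
rewrite [leRHS](_ : _ = nc (c k0) * `|y - w k0|^-1 *
   ((argc (c k0) * `|y - w k0| `^ ReC (c k0)) * \prod_(k <- r | k != k0) C k)); last by ring.
by rewrite ler_wpM2l ?mulr_ge0 ?nc_ge0 ?invr_ge0// ler_pM ?nc_ge0 ?nc_q ?nc_rest.
Qed.

Let f x := (\sum_(k <- r) c k * (x - w k)%:C^-1) * \prod_(k <- r) q k x.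
Let F x := \prod_(k <- r) q k x.

Let yw k y : k \in r -> a < y < b -> y != w k.
Proof. by move=> /wout + /andP[h1 h2]; apply: contraPneq => <- []; lra. Qed.

Let dq k y : k \in r -> a < y < b -> cderiv (q k) y (c k * (y - w k)%:C^-1 * q k y).
Proof.
move=> kr yab; have := yw kr yab.
by case: (qE kr) => ->; [exact: cderiv_cpow|exact: cderiv_cpowN].
Qed.

Let dF y : a < y < b -> cderiv F y (f y).
Proof.
move=> yab; rewrite /F /f.
have h r' : {subset r' <= r} -> cderiv (fun y => \prod_(k <- r') q k y) y
    ((\sum_(k <- r') c k * (y - w k)%:C^-1) * \prod_(k <- r') q k y).
  elim: r' => [|k r' IH] sub.
    by under eq_fun do rewrite big_nil; rewrite !big_nil mul0r; exact: cderiv_cst.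
  under eq_fun do rewrite big_cons; rewrite !big_cons.
  have sub' : {subset r' <= r} by move=> x xr; apply: sub; rewrite inE xr orbT.
  have := cderivM (dq (sub k (mem_head _ _)) yab) (IH sub').
  by congr (cderiv _ _ _); ring.
exact: h.
Qed.

Let cf y : a < y < b -> ccont f y.
Proof.
move=> yab; apply: ccontM; last exact: cderiv_cont (dF yab).
have h r' : {subset r' <= r} -> ccont (fun x => \sum_(k <- r') c k * (x - w k)%:C^-1) y.
  elim: r' => [|k r' IH] sub.
    by under eq_fun do rewrite big_nil; exact: ccont_cst.
  under eq_fun do rewrite big_cons; apply: ccontD.
    by apply: ccontM; [exact: ccont_cst|apply: ccont_inv; apply: yw => //; apply: sub; rewrite mem_head].
  by apply: IH => x xr; apply: sub; rewrite inE xr orbT.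
exact: h.
Qed.

Lemma stokes1_integrable : Cintegrable lam (ooC a b f).
Proof.
pose g k (x : R) := (nc (c k) * argc (c k) * \prod_(k' <- r | k' != k) C k') *
  hpow (M k + 1) (ReC (c k)) (x - w k).
apply: (@Cintegrable_dom R _ _ lam _ (fun x => \sum_(k <- r) g k x)).
- split.
    rewrite (_ : (fun x => _) = ooR a b (fun x => ReC (f x))).
      by apply: measurable_ooR => x /cf[].
    by apply/funext => x; rewrite /ooC /ooR; case: ifP.
  rewrite (_ : (fun x => _) = ooR a b (fun x => ImC (f x))).
    by apply: measurable_ooR => x /cf[].
  by apply/funext => x; rewrite /ooC /ooR; case: ifP.
- rewrite (_ : EFin \o _ = (fun x : R => \sum_(k <- r) (g k x)%:E)%E); last first.
    by apply/funext => x; rewrite /= sumEFin.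
  rewrite (_ : (fun x : R => _) = (fun x : R => \sum_(k <- r | k \in r) (g k x)%:E)%E); last first.
    by apply/funext => x; rewrite -big_seq.
  apply: (integrable_sum measurableT) => k kr.
  exact: (integrableZl measurableT _ (integrable_hpowB (M k + 1) (w k) (c0 kr))).
- move=> x; have g0 k : 0 <= g k x.
    by rewrite mulr_ge0 ?hpow_ge0 ?mulr_ge0 ?nc_ge0 ?argc_ge0 ?prodr_ge0.
  rewrite /ooC; case: ifP => [xab|_]; last by rewrite nc0 sumr_ge0.
  rewrite /f mulr_suml; apply: (le_trans (nc_sum _ _ _)).
  by rewrite [leLHS]big_seq [leRHS]big_seq; apply: ler_sum => k kr; exact: stokes1_bound.
Qed.

Let F_cvg0 k0 (u : nat -> R) : k0 \in r -> (forall k, a < u k < b) ->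
  (fun k => u k - w k0) @ \oo --> (0 : R) -> clim (fun k => F (u k)) 0.
Proof.
move=> k0r uab ucv; apply: clim_nc0.
pose K := argc (c k0) * \prod_(k <- r | k != k0) C k.
have K0 : 0 <= K by rewrite mulr_ge0 ?argc_ge0 ?prodr_ge0.
have bd k : nc (F (u k)) <= K * `|u k - w k0| `^ ReC (c k0).
  rewrite /F (bigD1_seq k0)//= ncM [leRHS](_ : _ = (argc (c k0) * `|u k - w k0| `^ ReC (c k0)) *
    \prod_(k <- r | k != k0) C k); last by rewrite /K; ring.
  by rewrite ler_pM ?nc_ge0 ?nc_q ?nc_rest.
have rho0 := c0 k0r.
apply/cvgrPdist_lt => e e0.
(* Radius within which $|u-w|^{\Re c}<e/(K+1)$; dividing by $K+1$ instead of $K$ covers $K=0$. *)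
have e1 : 0 < (e / (K + 1)) `^ (ReC (c k0))^-1.
  by rewrite powR_gt0// divr_gt0// ltr_wpDl.
move/cvgrPdist_lt/(_ _ e1) : ucv; apply: filterS => k.
rewrite !sub0r !normrN => h; rewrite ger0_norm ?nc_ge0//.
apply: (le_lt_trans (bd k)).
have h2 : `|u k - w k0| `^ ReC (c k0) < e / (K + 1).
  have := @gt0_ltr_powR R (ReC (c k0)) rho0 `|u k - w k0| ((e / (K + 1)) `^ (ReC (c k0))^-1).
  rewrite !nnegrE => /(_ (normr_ge0 _) (ltW e1) h).
  by rewrite -powRrM mulVf ?gt_eqF// powRr1// divr_ge0 ?ltW// ltr_wpDl.
apply: (@le_lt_trans _ _ (K * (e / (K + 1)))); first by rewrite ler_wpM2l// ltW.
by rewrite mulrA ltr_pdivrMr ?ltr_wpDl// [ltRHS]mulrC ltr_pM2r//; lra.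
Qed.

(** Each end of the interval is a zero of one of the powers, whose exponent has positive real part,
    so the primitive tends to 0 there although its derivative may be unbounded. *)
Lemma stokes1 : (exists2 k, k \in r & w k = a) -> (exists2 k, k \in r & w k = b) ->
  CI lam (ooC a b f) = 0.
Proof.
move=> [ka kar wa] [kb kbr wb].
rewrite (@CFTC _ f F a b 0 0 ab dF cf stokes1_integrable) ?subrr//.
- apply: (F_cvg0 kar); first by move=> k; have := inpt_gt0 k ab; have := inpt_lt k ab; lra.
  by rewrite wa; under eq_fun do rewrite addrC addKr; exact: inpt_cvg.
- apply: (F_cvg0 kbr); first by move=> k; have := inpt_gt0 k ab; have := inpt_lt k ab; lra.
  rewrite wb; under eq_fun do rewrite addrC addKr.
  by rewrite -oppr0; apply: cvgN; exact: inpt_cvg.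
Qed.

End Stokes1.

(** * Cells, integrands and their domination *)

Section Cells.
Context {R : realType}.
Variables (p n : nat) (z : nat -> R) (gam : R[i]).
Local Notation E := (envT R).
Local Notation lam := (@lebesgue_measure R).
Implicit Types (al : nat -> R[i]) (b F : nat -> nat) (t : E).

(* A point of a cell is described by [b]: [t_j] lies between [z (b j)] and [z (b j).+1].
   A labelling [F] selects the form [prod_j uu (F j) (t j)]. *)
Definition uu (s : nat) (x : R) : R[i] := if s == 0%N then 1 else (x - z s)%:C^-1.
Definition col al (x : R) : R[i] := \prod_(s <- iota 1 p) cpowR (x - z s) (al s).
Definition prs t : R[i] := \prod_(j <- sq n) \prod_(k <- sq n | (k < j)%N) cpowR (t j - t k) (2%:R * gam).
Definition term al F t : R[i] := (\prod_(j <- sq n) (uu (F j) (t j) * col al (t j))) * prs t.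
(** All pairs of variables are compared, also across blocks. For nondecreasing [b] this adds no
    condition, and it lets the derivative argument treat every variable alike. *)
Definition cell b : set E := [set t | (forall j, j \in sq n -> z (b j) <= t j <= z (b j).+1) /\
  (forall j k, j \in sq n -> k \in sq n -> (j < k)%N -> t j <= t k)].
Definition cut b (f : E -> R[i]) t : R[i] := if `[< cell b t >] then f t else 0.
Definition J al b F : R[i] := CI (mu (sq n)) (cut b (term al F)).
Definition setl F i s : nat -> nat := fun j => if j == i then s else F j.

Lemma cmeas_uu s : cmeas (uu s).
Proof.
rewrite /uu; case: (s == 0%N); first exact: cmeas_cst.
under eq_fun do rewrite -realCV; apply: cmeas_real; apply: measurable_funV.
by apply: measurable_funB => //; exact: measurable_cst.
Qed.
Lemma cmeas_col al : cmeas (col al).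
Proof.
apply: cmeas_prod => s _; apply: cmeas_cpow.
by apply: measurable_funB => //; exact: measurable_cst.
Qed.
Lemma meas_diff j k : measurable_fun [set: E] (fun t : E => t j - t k).
Proof. by apply: measurable_funB; exact: meas_coord. Qed.
Lemma cmeas_prs : cmeas prs.
Proof.
apply: cmeas_prod => j _; apply: cmeas_prod => k _; apply: cmeas_cpow; exact: meas_diff.
Qed.
Lemma cmeas_term al F : cmeas (term al F).
Proof.
apply: cmeasM; last exact: cmeas_prs.
apply: cmeas_prod => j _; apply: cmeasM.
  exact: (cmeas_comp (cmeas_uu _) (meas_coord j)).
exact: (cmeas_comp (cmeas_col _) (meas_coord j)).
Qed.

Lemma meas_cell b : measurable (cell b).
Proof.
pose B (t : E) := all (fun j => (z (b j) <= t j) && (t j <= z (b j).+1)) (sq n) &&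
  all (fun j => all (fun k => (j < k)%N ==> (t j <= t k)) (sq n)) (sq n).
have mall (s : seq nat) (f : nat -> E -> bool) : (forall j, measurable_fun [set: E] (f j)) ->
    measurable_fun [set: E] (fun t => all (fun j => f j t) s).
  move=> mf; elim: s => [|j s IH]; first exact: measurable_cst.
  exact: measurable_and.
have mB : measurable_fun [set: E] B.
  apply: measurable_and.
    apply: (mall _ (fun j (t : E) => (z (b j) <= t j) && (t j <= z (b j).+1))) => j; apply: measurable_and.
      by apply: measurable_fun_ler; [exact: measurable_cst|exact: meas_coord].
    by apply: measurable_fun_ler; [exact: meas_coord|exact: measurable_cst].
  apply: (mall _ (fun j (t : E) => all (fun k => (j < k)%N ==> (t j <= t k)) (sq n))) => j.
  apply: (mall _ (fun k (t : E) => (j < k)%N ==> (t j <= t k))) => k.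
  case: (j < k)%N => /=; last exact: measurable_cst.
  by apply: measurable_fun_ler; exact: meas_coord.
rewrite -[X in measurable X]setTI (_ : cell b = B @^-1` [set true]); first exact: mB.
apply/seteqP; split => t.
  move=> [h1 h2]; rewrite /= /B; apply/andP; split; apply/allP => j jn; first exact: h1.
  by apply/allP => k kn; apply/implyP; exact: h2.
rewrite /= /B => /andP[/allP h1 /allP h2]; split => [j /h1//|j k /h2/allP + kn jk].
by move=> /(_ k kn)/implyP; exact.
Qed.

Lemma cmeas_cut b f : cmeas f -> cmeas (cut b f).
Proof. by move=> mf; apply: cmeas_if; [exact: meas_cell|exact: mf|exact: cmeas_cst]. Qed.

Lemma cutD b f g t : cut b (fun t => f t + g t) t = cut b f t + cut b g t.
Proof. by rewrite /cut; case: ifP; rewrite ?addr0. Qed.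
Lemma cut_sum b (I : Type) (r : seq I) (P : pred I) (f : I -> E -> R[i]) t :
  cut b (fun t => \sum_(i <- r | P i) f i t) t = \sum_(i <- r | P i) cut b (f i) t.
Proof. by rewrite /cut; case: ifP => // _; rewrite big1. Qed.

Hypothesis p2 : (2 <= p)%N.
Hypothesis zlt : forall s, (1 <= s < p)%N -> z s < z s.+1.

Lemma z_le s s' : (1 <= s)%N -> (s <= s')%N -> (s' <= p)%N -> z s <= z s'.
Proof.
move=> s1 ss sp; rewrite -(subnKC ss); have : (s + (s' - s) <= p)%N by lia.
elim: (s' - s)%N => [|d IH] h; first by rewrite addn0.
rewrite addnS in h *; apply: (le_trans (IH _)); first by lia.
by apply: ltW; apply: zlt; lia.
Qed.
Lemma z_lt s s' : (1 <= s)%N -> (s < s')%N -> (s' <= p)%N -> z s < z s'.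
Proof.
move=> s1 ss sp; apply: (@lt_le_trans _ _ (z s.+1)); first by apply: zlt; lia.
by apply: z_le; lia.
Qed.

(** Strictly larger than every difference occurring in a cell, and at least 1, so that its powers
    grow with the exponent and the constants built from it are at least 1. *)
Definition ML : R := z p - z 1 + 1.
Lemma ML1 : 1 <= ML.
Proof. by rewrite /ML lerDr subr_ge0 z_le//; lia. Qed.
Lemma ML0 : 0 < ML. Proof. exact: lt_le_trans ltr01 ML1. Qed.

Definition posal al := forall s, (1 <= s <= p)%N -> 0 < ReC (al s).
Definition okb b := forall j, j \in sq n -> (1 <= b j < p)%N.
Definition okF F := forall j, (F j <= p)%N.

Lemma cell_range b t j : okb b -> cell b t -> j \in sq n -> z 1 <= t j <= z p.
Proof.
move=> ob [h _] jn; have bj := ob j jn; have /andP[h1 h2] := h j jn.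
by apply/andP; split; [apply: le_trans h1|apply: (le_trans h2)]; apply: z_le; lia.
Qed.

(** Dominates $u_s$ times the product of the powers at the $z_r$. Label 0 has no pole: exponent 1
    reduces [hpow] to a mere cutoff. *)
Definition gl al (s : nat) (x : R) : R :=
  if s == 0%N then hpow ML 1 (x - z 1) else hpow ML (ReC (al s)) (x - z s).
Lemma gl_ge0 al s x : 0 <= gl al s x.
Proof. by rewrite /gl; case: ifP => _; exact: hpow_ge0. Qed.
Lemma gl_int al s : posal al -> (s <= p)%N -> lam.-integrable setT (EFin \o gl al s).
Proof.
move=> pa sp; rewrite /gl; have [s0|s0] := eqVneq s 0%N; apply: integrable_hpowB => //.
by apply: pa; lia.
Qed.

Definition Cs al s : R := argc (al s) * ML `^ ReC (al s).
Lemma Cs_ge1 al s : 0 <= ReC (al s) -> 1 <= Cs al s.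
Proof.
move=> h; rewrite -[1]mulr1 ler_pM// ?argc_ge1//.
by rewrite -(powRr0 ML) ler_powR// ML1.
Qed.
Lemma Cs_ge0 al s : 0 <= Cs al s.
Proof. by rewrite mulr_ge0 ?argc_ge0 ?powR_ge0. Qed.

Lemma nc_cpow_ML (x : R) (a : R[i]) : `|x| <= ML -> 0 <= ReC a -> nc (cpowR x a) <= argc a * ML `^ ReC a.
Proof.
move=> xM a0; apply: (le_trans (nc_cpow_le _ _)); rewrite ler_wpM2l ?argc_ge0//.
by rewrite ge0_ler_powR// nnegrE// ltW// ML0.
Qed.

Lemma nc_inv_cpow (x : R) (a : R[i]) : `|x| < ML -> nc (x%:C^-1 * cpowR x a) <= argc a * hpow ML (ReC a) x.
Proof.
move=> xM; rewrite /hpow xM; have [->|x0] := eqVneq x 0.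
  by rewrite cpow0 mulr0 nc0 mulr_ge0 ?argc_ge0 ?powR_ge0.
have x0' : 0 < `|x| by rewrite normr_gt0.
rewrite ncM ncV nc_real powRB; last by apply/implyP => _; rewrite gt_eqF.
have -> : `|x| `^ 1 = `|x| by rewrite powRr1// ltW.
rewrite mulrA [X in _ <= X]mulrC ler_wpM2l ?invr_ge0//.
exact: nc_cpow_le.
Qed.

Definition Ccol al : R := \prod_(s <- iota 1 p) Cs al s.
Lemma Ccol_ge0 al : 0 <= Ccol al.
Proof. by rewrite prodr_ge0// => s _; exact: Cs_ge0. Qed.

Lemma rangeML x s : z 1 <= x <= z p -> (1 <= s <= p)%N -> `|x - z s| < ML.
Proof.
move=> /andP[x1 x2] /andP[s1 s2]; have := z_le (leqnn 1) s1 s2; have := z_le s1 s2 (leqnn p).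
by rewrite ltr_norml /ML => *; lra.
Qed.

Lemma uc_bound al s x : posal al -> (s <= p)%N -> z 1 <= x <= z p ->
  nc (uu s x * col al x) <= Ccol al * gl al s x.
Proof.
move=> pa sp xr.
have inr' k : k \in iota 1 p -> (1 <= k <= p)%N by rewrite mem_iota add1n ltnS.
have bd k : k \in iota 1 p -> nc (cpowR (x - z k) (al k)) <= Cs al k.
  move=> /inr' kp; apply: nc_cpow_ML; first by apply: ltW; exact: rangeML.
  by apply: ltW; exact: pa.
rewrite /uu /gl; case: ifPn => s0.
  rewrite mul1r /hpow ifT; last by apply: rangeML => //; lia.
  rewrite subrr powRr0 mulr1 /col nc_prod big_seq [leRHS]big_seq.
  by apply: ler_prod => k kp; rewrite nc_ge0 bd.
have si : s \in iota 1 p by rewrite mem_iota; lia.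
rewrite /col (bigD1_seq s) ?iota_uniq//= mulrA ncM.
rewrite /Ccol (bigD1_seq s) ?iota_uniq//= mulrAC.
apply: ler_pM; rewrite ?nc_ge0//.
  apply: (le_trans (nc_inv_cpow _ _)); first by apply: rangeML => //; lia.
  rewrite ler_wpM2r ?hpow_ge0// /Cs -[leLHS]mulr1 ler_wpM2l ?argc_ge0//.
  by rewrite -(powRr0 ML) ler_powR ?ML1// ltW// pa//; lia.
rewrite nc_prod big_seq_cond [leRHS]big_seq_cond; apply: ler_prod => k /andP[kp _].
by rewrite nc_ge0 bd.
Qed.

Hypothesis gam0 : 0 < ReC gam.
Lemma gam20 : 0 < ReC (2%:R * gam).
Proof. by rewrite ReC_natM mulr_gt0. Qed.

Definition Cg : R := argc (2%:R * gam) * ML `^ ReC (2%:R * gam).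
Lemma Cg_ge1 : 1 <= Cg.
Proof.
rewrite -[1]mulr1 ler_pM// ?argc_ge1//.
by rewrite -(powRr0 ML) ler_powR ?ML1// ltW// gam20.
Qed.
Lemma Cg_ge0 : 0 <= Cg. Proof. exact: le_trans Cg_ge1. Qed.
Definition Cprs : R := \prod_(j <- sq n) \prod_(k <- sq n | (k < j)%N) Cg.
Lemma Cprs_ge0 : 0 <= Cprs.
Proof. by apply: prodr_ge0 => j _; apply: prodr_ge0 => k _; exact: Cg_ge0. Qed.

Lemma diffML b t j k : okb b -> cell b t -> j \in sq n -> k \in sq n -> `|t j - t k| < ML.
Proof.
move=> ob ct jn kn; have := cell_range ob ct jn; have := cell_range ob ct kn.
by rewrite ltr_norml /ML => *; lra.
Qed.

Lemma prs_bound b t : okb b -> cell b t -> nc (prs t) <= Cprs.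
Proof.
move=> ob ct; rewrite /prs nc_prod big_seq /Cprs [leRHS]big_seq; apply: ler_prod => j jn.
rewrite nc_ge0 /= nc_prod big_seq_cond [leRHS]big_seq_cond; apply: ler_prod => k /andP[kn _].
rewrite nc_ge0 nc_cpow_ML//; last by rewrite ltW// gam20.
by apply: ltW; exact: diffML ct jn kn.
Qed.

Lemma term_bound al b F t : posal al -> okb b -> okF F ->
  nc (cut b (term al F) t) <= (\prod_(j <- sq n) Ccol al * Cprs) * \prod_(j <- sq n) gl al (F j) (t j).
Proof.
move=> pa ob oF; rewrite /cut; case: asboolP => ct; last first.
  rewrite nc0 mulr_ge0 ?prodr_ge0// => [|j _]; last exact: gl_ge0.
  by rewrite mulr_ge0 ?Cprs_ge0// prodr_ge0// => j _; exact: Ccol_ge0.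
rewrite /term ncM mulrAC ler_pM ?nc_ge0 ?(prs_bound ob ct)//.
rewrite nc_prod -big_split big_seq [leRHS]big_seq; apply: ler_prod => j jn.
by rewrite nc_ge0 /= uc_bound ?(cell_range ob ct).
Qed.

Lemma term_pdom al b F : posal al -> okb b -> okF F ->
  pdom (sq n) (cut b (term al F)) (\prod_(j <- sq n) Ccol al * Cprs) (fun j => gl al (F j)).
Proof.
move=> pa ob oF; split.
- by apply: cmeas_cut; exact: cmeas_term.
- by move=> j x; exact: gl_ge0.
- by move=> j; exact: gl_int.
- by move=> t; exact: term_bound.
Qed.

Lemma term_int al b F : posal al -> okb b -> okF F ->
  Cintegrable (mu (sq n)) (cut b (term al F)).
Proof. by move=> pa ob oF; apply: pdom_integrable (uniq_sq n) (term_pdom pa ob oF). Qed.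

(* The factor (t_i - t_k)^-1 is absorbed by (t_i - t_k)^(2 gamma); integrating t_i first
   leaves a bounded function of t_k. *)
Lemma pair_int i k (f : E -> R[i]) (C rho : R) (g : nat -> R -> R) :
  i \in sq n -> k \in sq n -> i != k -> cmeas f -> 0 < rho -> 0 <= C ->
  (forall j x, 0 <= g j x) -> (forall j, lam.-integrable setT (EFin \o g j)) ->
  (forall t, nc (f t) <= C * (hpow ML rho (t i - t k) * \prod_(j <- rem i (sq n)) g j (t j))) ->
  Cintegrable (mu (sq n)) f.
Proof.
move=> inn kn ik mf r0 C0 g0 ig fb.
have us := uniq_sq n.
have ir : i \notin rem i (sq n) by rewrite mem_rem_uniq// inE eqxx.
have ur : uniq (rem i (sq n)) by rewrite rem_uniq.
apply: (@Cintegrable_meas_eq _ _ _ _ (mu (i :: rem i (sq n)))).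
  by move=> A mA; exact: mu_front.
pose G (t : E) := C * (hpow ML rho (t i - t k) * \prod_(j <- rem i (sq n)) g j (t j)).
have mg j : measurable_fun setT (g j).
  by have /measurable_int /measurable_EFinP := ig j.
have mP : measurable_fun [set: E] (fun t : E => \prod_(j <- rem i (sq n)) g j (t j)).
  by apply: measurable_fun_prodr => j _; exact: (measurableT_comp (mg j) (meas_coord j)).
have mG : measurable_fun [set: E] G.
  apply: measurable_funM; first exact: measurable_cst.
  apply: measurable_funM => //.
  exact: (measurableT_comp (measurable_hpow ML rho) (meas_diff i k)).
have G0 t : 0 <= G t by rewrite !mulr_ge0 ?hpow_ge0// prodr_ge0.
apply: (Cintegrable_dom mf _ fb).
apply/integrableP; split; first exact/measurable_EFinP.
have e1 : (fun t => `|(EFin \o G) t|%E) = (fun t => (G t)%:E).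
  by apply/funext => t /=; rewrite ger0_norm.
rewrite -/G e1 (mu_consE ir ((measurable_EFinP _ _).2 mG)); last by move=> t; rewrite lee_fin.
set H := (\int[lam]_x (hpow ML rho x)%:E)%E.
have Hfin : H \is a fin_num by apply: (integrable_fin_num measurableT (integrable_hpow ML r0)).
have H0 : (0 <= H)%E by apply: integral_ge0 => x _; rewrite lee_fin hpow_ge0.
have inner (t : E) : (\int[lam]_x (G (upd t i x))%:E =
    (C * fine H)%:E * (\prod_(j <- rem i (sq n)) g j (t j))%:E)%E.
  transitivity (\int[lam]_x ((C * \prod_(j <- rem i (sq n)) g j (t j))%:E * (hpow ML rho (x - t k))%:E))%E.
    apply: eq_integral => x _; rewrite /G updE (@updN _ t i x k) 1?eq_sym// prod_upd//.
    by rewrite -EFinM; congr (_%:E); ring.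
  rewrite integralZl//; last exact: (integrable_hpowB ML (t k) r0).
  by rewrite integral_hpowB -/H -[X in (_ * X)%E](fineK Hfin) -!EFinM; congr (_%:E); ring.
under eq_integral do rewrite inner.
rewrite ge0_integralZl//.
- by rewrite mu_prod_nneg// -EFinM ltry.
- exact/measurable_EFinP.
- by move=> t _; rewrite lee_fin prodr_ge0.
- by rewrite lee_fin mulr_ge0// fine_ge0.
Qed.

End Cells.

(** Gives the lower end of a one-variable slice of a cell: the largest of a fixed point [z0] and the
    smaller-indexed variables. It records where the maximum is attained, since that singularity
    makes the boundary term vanish. *)
Lemma seq_max_exists {R : realType} (r : seq nat) (P : pred nat) (t : nat -> R) (z0 : R) :
  exists a, [/\ a = z0 \/ exists2 j, j \in r & P j /\ a = t j, z0 <= a &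
    forall j, j \in r -> P j -> t j <= a].
Proof.
elim: r => [|j r [a [h1 h2 h3]]]; first by exists z0; split => //; left.
have h1' : a = z0 \/ exists2 k, k \in j :: r & P k /\ a = t k.
  by case: h1 => [->|[k kr kP]]; [left|right; exists k => //; rewrite inE kr orbT].
case Pj: (P j); last first.
  exists a; split => // k; rewrite inE => /orP[/eqP ->|]; [by rewrite Pj|exact: h3].
have [aj|ja] := leP a (t j).
  exists (t j); split; [|exact: le_trans aj|].
    by right; exists j; rewrite ?inE ?eqxx.
  move=> k; rewrite inE => /orP[/eqP ->//|kr] Pk; exact: le_trans (h3 k kr Pk) aj.
exists a; split => // k; rewrite inE => /orP[/eqP -> _|]; [exact: ltW|exact: h3].
Qed.

Lemma seq_min_exists {R : realType} (r : seq nat) (P : pred nat) (t : nat -> R) (z0 : R) :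
  exists a, [/\ a = z0 \/ exists2 j, j \in r & P j /\ a = t j, a <= z0 &
    forall j, j \in r -> P j -> a <= t j].
Proof.
have [a [h1 h2 h3]] := seq_max_exists r P (fun j => - t j) (- z0).
exists (- a); split.
- case: h1 => [->|[j jr [Pj ->]]]; rewrite opprK; first by left.
  by right; exists j.
- by rewrite lerNl.
- by move=> j jr Pj; rewrite lerNl h3.
Qed.

(** * Total derivatives over a cell *)

Section StokesN.
Context {R : realType}.
Variables (p n : nat) (z : nat -> R) (gam : R[i]).
Local Notation E := (envT R).
Local Notation lam := (@lebesgue_measure R).
Local Notation uu := (uu z).
Local Notation col := (col p z).
Local Notation prs := (prs n gam).
Local Notation term := (term p n z gam).
Local Notation cell := (cell n z).
Local Notation cut := (cut n z).
Local Notation J := (J p n z gam).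
Local Notation ML := (ML p z).
Local Notation posal := (posal p).
Local Notation okb := (okb p n).
Local Notation okF := (okF p).
Hypothesis p2 : (2 <= p)%N.
Hypothesis zlt : forall s, (1 <= s < p)%N -> z s < z s.+1.
Hypothesis gam0 : 0 < ReC gam.
Variables (al : nat -> R[i]) (b F : nat -> nat) (i c : nat).
Hypothesis pa : posal al.
Hypothesis ob : okb b.
Hypothesis oF : okF F.
Hypothesis inn : i \in sq n.
Hypothesis c1p : (1 <= c <= p)%N.
Hypothesis Fi : F i = 0%N.

(** The function differentiated in $t_i$ is the master function times $t_i-z_c$, and the extra
    factor is stored as an increased exponent. The list [rr] gathers all singularities seen by
    $t_i$: the fixed points on the left, the other variables on the right. *)
Let bump s := if s == c then al s + 1 else al s.
Let rr : seq (nat + nat) := [seq inl s | s <- iota 1 p] ++ [seq inr k | k <- sq n & k != i].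
Let cc (k : nat + nat) : R[i] := match k with inl s => bump s | inr _ => 2%:R * gam end.
Let ww (t : E) (k : nat + nat) : R := match k with inl s => z s | inr k => t k end.
Let pq (t : E) (k : nat) (y : R) : R[i] :=
  if (k < i)%N then cpowR (y - t k) (2%:R * gam) else cpowR (t k - y) (2%:R * gam).
Let qq (t : E) (k : nat + nat) (y : R) : R[i] :=
  match k with inl s => cpowR (y - z s) (bump s) | inr k => pq t k y end.
Let ff (t : E) (x : R) := (\sum_(k <- rr) cc k * (x - ww t k)%:C^-1) * \prod_(k <- rr) qq t k x.
Let rest (t : E) := \prod_(j <- sq n | j != i)
  \prod_(k <- sq n | (k < j)%N && (k != i)) cpowR (t j - t k) (2%:R * gam).
Let KG (t : E) := (\prod_(j <- sq n | j != i) (uu (F j) (t j) * col al (t j))) * rest t.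
Let H (t : E) := ff t (t i) * KG t.
Let T0 (t : E) := col al (t i) * (\prod_(k <- sq n | k != i) pq t k (t i)) * KG t.

Lemma prs_split t : prs t = (\prod_(k <- sq n | k != i) pq t k (t i)) * rest t.
Proof.
rewrite /prs (bigD1_seq i) ?uniq_sq//=.
have -> : \prod_(k <- sq n | (k < i)%N) cpowR (t i - t k) (2%:R * gam) =
    \prod_(k <- sq n | k != i) (if (k < i)%N then cpowR (t i - t k) (2%:R * gam) else 1).
  rewrite [RHS]big_mkcond [LHS]big_mkcond; apply: eq_bigr => k _.
  by case: ltngtP => //.
have -> : \prod_(j <- sq n | j != i) \prod_(k <- sq n | (k < j)%N) cpowR (t j - t k) (2%:R * gam) =
    (\prod_(j <- sq n | j != i) (if (i < j)%N then cpowR (t j - t i) (2%:R * gam) else 1)) * rest t.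
  rewrite -big_split; apply: eq_bigr => j ji /=.
  case: ifPn => ij.
    rewrite -big_filter (bigD1_seq i) ?mem_filter ?ij ?filter_uniq ?uniq_sq//=.
    by rewrite big_filter_cond.
  rewrite mul1r; apply: eq_bigl => k; case: (k < j)%N / idP => //= kj.
  by apply/esym/eqP => ki; rewrite -ki kj in ij.
rewrite mulrA -big_split; congr (_ * _); apply: eq_bigr => k ki /=; rewrite /pq.
by have [h|h|h] := ltngtP k i; rewrite ?mulr1 ?mul1r//; rewrite h eqxx in ki.
Qed.

Lemma term_split G t : (forall j, j != i -> G j = F j) ->
  term al G t = uu (G i) (t i) * T0 t.
Proof.
move=> GF; rewrite /term prs_split (bigD1_seq i) ?uniq_sq//= /T0 /KG.
have -> : \prod_(j <- sq n | j != i) (uu (G j) (t j) * col al (t j)) =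
    \prod_(j <- sq n | j != i) (uu (F j) (t j) * col al (t j)).
  by apply: eq_bigr => j ji; rewrite GF.
ring.
Qed.

Lemma T0E t : term al F t = T0 t.
Proof. by rewrite (term_split (G := F))// Fi /uu eqxx mul1r. Qed.

Lemma term_set s t : term al (setl F i s) t = uu s (t i) * T0 t.
Proof.
rewrite (term_split (G := setl F i s)) ?/setl ?eqxx//.
by move=> j ji; rewrite (negbTE ji).
Qed.

Lemma col_bump y : \prod_(s <- iota 1 p) cpowR (y - z s) (bump s) = (y - z c)%:C * col al y.
Proof.
have ci : c \in iota 1 p by rewrite mem_iota; lia.
rewrite /col (bigD1_seq c) ?iota_uniq//= [in RHS](bigD1_seq c) ?iota_uniq//= /bump eqxx.
rewrite cpowD cpow1 [_ * (y - z c)%:C]mulrC mulrA; congr (_ * _).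
by apply: eq_bigr => s /negbTE ->.
Qed.

Lemma prod_qq t y : \prod_(k <- rr) qq t k y =
  (y - z c)%:C * col al y * \prod_(k <- sq n | k != i) pq t k y.
Proof. by rewrite /rr big_cat !big_map /= big_filter col_bump. Qed.

(** Each logarithmic derivative is rewritten by $(t_i-z_c)/(t_i-z_s)=1+(z_s-z_c)u_s(t_i)$; the
    isolated 1 comes from the increased exponent at $z_c$. *)
Lemma H_expand t : H t = (1 + \sum_(s <- iota 1 p) al s) * term al F t +
   \sum_(s <- iota 1 p) al s * (z s - z c)%:C * term al (setl F i s) t +
   2%:R * gam * \sum_(k <- sq n | k != i) (t i - z c)%:C * (t i - t k)%:C^-1 * term al F t.
Proof.
have ci : c \in iota 1 p by rewrite mem_iota; lia.
rewrite /H /ff prod_qq T0E; under [\sum_(s <- _) al s * _ * _]eq_bigr do rewrite term_set.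
(* Where $t_i$ meets some $z_s$ the inverses take the default value 0 and the algebra breaks down,
   but there the product of powers vanishes and so do both sides. *)
have [/hasP[s0 s0i /eqP ts]|/hasPn nz] := boolP (has (fun s => t i == z s) (iota 1 p)).
  have c0 : col al (t i) = 0.
    by rewrite /col (bigD1_seq s0) ?iota_uniq//= ts subrr cpow0 mul0r.
  have T00 : T0 t = 0 by rewrite /T0 c0 !mul0r.
  rewrite c0 T00 !mulr0 !mul0r !mulr0 mul0r !big1; first by ring.
    by move=> k _; rewrite mulr0.
  by move=> k _; rewrite !mulr0.
have nz' s : s \in iota 1 p -> (t i - z s)%:C != 0 :> R[i].
  by move=> /nz h; rewrite eq_complex /= negb_and subr_eq0 h.
rewrite /rr big_cat !big_map /= big_filter.
have e1 : (\sum_(s <- iota 1 p) bump s * (t i - z s)%:C^-1) * (t i - z c)%:C =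
    1 + \sum_(s <- iota 1 p) al s + \sum_(s <- iota 1 p) al s * (z s - z c)%:C * uu s (t i).
  rewrite -addrA -big_split mulr_suml /=.
  rewrite (bigD1_seq c) ?iota_uniq//= [in RHS](bigD1_seq c) ?iota_uniq//= /bump eqxx addrA.
  congr (_ + _).
    by rewrite -mulrA mulVf ?nz'// subrr mulr0 mul0r addr0 mulr1 addrC.
  rewrite big_seq_cond [RHS]big_seq_cond; apply: eq_bigr => s /andP[si sc].
  rewrite (negbTE sc) /uu ifN; last by move: si; rewrite mem_iota; lia.
  have -> : (t i - z c)%:C = (t i - z s)%:C + (z s - z c)%:C :> R[i].
    by rewrite -rmorphD /=; congr (_%:C); ring.
  by have := nz' s si; move: (t i - z s)%:C (z s - z c)%:C => u v u0; field.
have e2 : \sum_(k <- sq n | k != i) (t i - z c)%:C * (t i - t k)%:C^-1 * T0 t =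
    (t i - z c)%:C * (\sum_(k <- sq n | k != i) (t i - t k)%:C^-1) * T0 t.
  by rewrite mulr_sumr mulr_suml.
have e3 : \sum_(s <- iota 1 p) al s * (z s - z c)%:C * (uu s (t i) * T0 t) =
    (\sum_(s <- iota 1 p) al s * (z s - z c)%:C * uu s (t i)) * T0 t.
  by rewrite mulr_suml; apply: eq_bigr => s _; rewrite mulrA.
rewrite e2 e3 -mulrDl -e1 /T0 -mulr_sumr; ring.
Qed.

(** With the other variables fixed, the cell meets the line of $t_i$ in an interval (possibly empty
    or a point) whose ends are singularities of the integrand, so [stokes1] applies slice by
    slice. *)
Lemma slice_zero t : Cintegrable lam (fun x => cut b H (upd t i x)) /\
  CI lam (fun x => cut b H (upd t i x)) = 0.
Proof.
pose s0 := b i.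
have bi : (1 <= s0 < p)%N by exact: ob.
have [lo [lo1 lo2 lo3]] := seq_max_exists (sq n) (fun j => (j < i)%N) t (z s0).
have [hi [hi1 hi2 hi3]] := seq_min_exists (sq n) (fun j => (i < j)%N) t (z s0.+1).
(* [Q] collects the conditions of the cell that do not involve $t_i$. *)
have [Q QP] : exists Q : bool, forall x, cell b (upd t i x) <-> (Q /\ lo <= x <= hi).
  exists `[< (forall j, j \in sq n -> j != i -> z (b j) <= t j <= z (b j).+1) /\
    (forall j k, j \in sq n -> k \in sq n -> j != i -> k != i -> (j < k)%N -> t j <= t k) >] => x.
  split.
    move=> [h1 h2]; split.
      apply/asboolP; split => [j jn ji|j k jn kn ji ki jk].
        by have := h1 j jn; rewrite updN.
      by have := h2 j k jn kn jk; rewrite !updN.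
    have /andP[x1 x2] := h1 i inn; rewrite updE in x1 x2; apply/andP; split.
      case: lo1 => [->//|[j jn [ji ->]]].
      by have := h2 j i jn inn ji; rewrite updE updN// ltn_eqF.
    case: hi1 => [->//|[j jn [ij ->]]].
    by have := h2 i j inn jn ij; rewrite updE updN// gtn_eqF.
  move=> [/asboolP[h1 h2] /andP[x1 x2]]; split => [j jn|j k jn kn jk].
    have [->|ji] := eqVneq j i; last by rewrite updN// h1.
    by rewrite updE (le_trans lo2 x1) (le_trans x2 hi2).
  have [ji|ji] := eqVneq j i; have [ki|ki] := eqVneq k i.
  - by rewrite ji ki ltnn in jk.
  - by rewrite ji updE updN// (le_trans x2)// hi3// -ji.
  - by rewrite ki updE updN// (le_trans _ x1)// lo3// -ki.
  - by rewrite !updN// h2.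
have ur : uniq rr.
  rewrite /rr cat_uniq !map_inj_uniq ?iota_uniq ?filter_uniq ?uniq_sq//; [|by move=> ? ? []|by move=> ? ? []].
  by rewrite andbT; apply/hasPn => x /mapP[k _ ->]; apply/negP => /mapP[].
have inl_r s : (inl s \in rr) = (1 <= s <= p)%N.
  rewrite mem_cat mem_map; last by move=> ? ? [].
  by rewrite mem_iota add1n ltnS; case: (inl s \in _) / mapP => [[? ?]|]; rewrite ?orbF.
have inr_r k : (inr k \in rr) = (k != i) && (k \in sq n).
  rewrite mem_cat [X in _ || X]mem_map; last by move=> ? ? [].
  by rewrite mem_filter; case: (inr k \in map inl _) / mapP => [[? ?]|].
have wout k : k \in rr -> ww t k <= lo \/ hi <= ww t k.
  case: k => k; rewrite ?inl_r ?inr_r /=.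
    move=> kp; have [ks|ks] := leqP k s0.
      by left; apply: le_trans lo2; apply: (z_le p2 zlt); lia.
    by right; apply: (le_trans hi2); apply: (z_le p2 zlt); lia.
  move=> /andP[ki kn]; have [h|h|h] := ltngtP k i; last by rewrite h eqxx in ki.
    by left; exact: lo3.
  by right; exact: hi3.
have qE k : k \in rr -> qq t k = (fun y => cpowR (y - ww t k) (cc k)) \/
    qq t k = (fun y => cpowR (ww t k - y) (cc k)).
  case: k => k _ /=; first by left.
  by rewrite /qq /pq; case: (k < i)%N; [left|right].
have cc0 k : k \in rr -> 0 < ReC (cc k).
  case: k => k; rewrite ?inl_r ?inr_r /= => h; last exact: gam20.
  rewrite /bump; case: ifP => _; last exact: pa.
  by rewrite ReCD ReC1 addr_gt0// pa.
have ea : exists2 k, k \in rr & ww t k = lo.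
  case: lo1 => [->|[j jn [ji ->]]]; first by exists (inl s0); rewrite ?inl_r//; lia.
  by exists (inr j); rewrite ?inr_r// jn andbT ltn_eqF.
have eb : exists2 k, k \in rr & ww t k = hi.
  case: hi1 => [->|[j jn [ji ->]]]; first by exists (inl s0.+1); rewrite ?inl_r//; lia.
  by exists (inr j); rewrite ?inr_r// jn andbT gtn_eqF.
have ffu x : ff (upd t i x) = ff t.
  apply/funext => y; rewrite /ff; congr (_ * _); rewrite big_seq [RHS]big_seq; apply: eq_bigr => k;
  by case: k => k //; rewrite inr_r /= /pq => /andP[ki _]; rewrite updN.
have KGu x : KG (upd t i x) = KG t.
  rewrite /KG /rest; congr (_ * _).
    by apply: eq_bigr => j ji; rewrite updN.
  by apply: eq_bigr => j ji; apply: eq_bigr => k /andP[_ ki]; rewrite !updN.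
(* The cell is closed while the boundary argument uses open intervals; at the end points themselves
   the integrand is 0 because a power of 0 occurs as a factor. *)
have edge k x : k \in rr -> ww t k = x -> ff t x = 0.
  move=> kr wx; rewrite /ff [X in _ * X](bigD1_seq k)//=.
  by case: (qE k kr) => ->; rewrite wx subrr cpow0 mul0r mulr0.
have -> : (fun x => cut b H (upd t i x)) =
   (fun x => (if Q then KG t else 0) * ooC lo hi (ff t) x).
  apply/funext => x; rewrite /cut /H updE ffu KGu /ooC.
  case: asboolP => [/QP[-> /andP[x1 x2]]|nc].
    case: ifPn => [_|h]; first by rewrite mulrC.
    rewrite mulr0; have : x = lo \/ x = hi.
      have [->|xlo] := eqVneq x lo; first by left.
      have [->|xhi] := eqVneq x hi; first by right.
      by move: h; rewrite !lt_neqAle x1 x2 xhi eq_sym xlo.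
    by case=> ->; [case: ea|case: eb] => k kr wk; rewrite (edge k _ kr wk) mul0r.
  case: (boolP (lo < x < hi)) => [/andP[x1 x2]|_]; last by rewrite mulr0.
  case: (boolP Q) => hQ; last by rewrite mul0r.
  by exfalso; apply: nc; apply/QP; split => //; rewrite !ltW.
have [lohi|hilo] := ltP lo hi.
  have i1 := stokes1_integrable ur wout qE cc0.
  split; first exact: CintegrableZ.
  by rewrite CIZ// (stokes1 ur lohi wout qE cc0 ea eb) mulr0.
have -> : ooC lo hi (ff t) = (fun=> 0).
  apply/funext => x; rewrite /ooC; case: ifP => // /andP[h1 h2].
  by have := lt_trans h1 h2; rewrite ltNge hilo.
under eq_fun do rewrite mulr0.
by split; [exact: Cintegrable_cst0|exact: CI0].
Qed.

(** Here [F i = 0] is essential: the integrability in $t_i$ is spent on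
    $(t_i-t_k)^{-1}(t_i-t_k)^{2\gamma}$, so $t_i$ must carry no pole of its own. All other factors
    containing $t_i$ are bounded. *)
Lemma X_int k : k \in sq n -> k != i ->
  Cintegrable (mu (sq n)) (cut b (fun t => (t i - z c)%:C * (t i - t k)%:C^-1 * term al F t)).
Proof.
move=> kn ki.
have mX : cmeas (fun t : E => (t i - z c)%:C * (t i - t k)%:C^-1 * term al F t).
  apply: cmeasM; last exact: cmeas_term.
  apply: cmeasM.
    by apply: cmeas_real; apply: measurable_funB; [exact: meas_coord|exact: measurable_cst].
  have -> : (fun t : E => (t i - t k)%:C^-1) = (fun t : E => ((t i - t k)^-1)%:C).
    by apply/funext => t; rewrite realCV.
  by apply: cmeas_real; apply: measurable_funV; exact: meas_diff.
pose Cg := Cg p z gam; pose Cc := Ccol p z al.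
have Cg0 : 0 <= Cg by exact: Cg_ge0.
have Cc0 : 0 <= Cc by exact: Ccol_ge0.
have C0 : 0 <= ML * (Cc * (argc (2%:R * gam) * \prod_(k' <- sq n | (k' != i) && (k' != k)) Cg) *
   ((\prod_(j <- sq n | j != i) Cc) * \prod_(j <- sq n | j != i) \prod_(k <- sq n | (k < j)%N && (k != i)) Cg)).
  have n3 : 0 <= \prod_(j <- sq n | j != i) \prod_(k <- sq n | (k < j)%N && (k != i)) Cg.
    by apply: prodr_ge0 => j _; exact: prodr_ge0.
  have n1 : 0 <= \prod_(k' <- sq n | (k' != i) && (k' != k)) Cg by exact: prodr_ge0.
  have n2 : 0 <= \prod_(j <- sq n | j != i) Cc by exact: prodr_ge0.
  have n4 := ltW (ML0 p2 zlt); have n5 := argc_ge0 (2%:R * gam).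
  by rewrite !mulr_ge0.
apply: (@pair_int _ p n z i k _ _ (ReC (2%:R * gam)) (fun j => gl p z al (F j)) inn kn _ _ _ C0).
- by rewrite eq_sym.
- exact: cmeas_cut.
- exact: gam20.
- by move=> j x; exact: gl_ge0.
- by move=> j; exact: gl_int.
move=> t; rewrite rem_filter ?uniq_sq// big_filter /cut; case: asboolP => ct; last first.
  by rewrite nc0 mulr_ge0// mulr_ge0 ?hpow_ge0// prodr_ge0// => j _; exact: gl_ge0.
have rg j jn := cell_range p2 zlt ob ct (j := j) jn.
have dm j j' jn jn' := diffML p2 zlt ob ct (j := j) (k := j') jn jn'.
have d2g : 0 <= ReC (2%:R * gam) by rewrite ltW// gam20.
have b1 : nc (t i - z c)%:C <= ML by rewrite nc_real ltW// rangeML// rg.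
have b2 : nc (col al (t i)) <= Cc.
  have := @uc_bound _ p z p2 zlt al 0%N (t i) pa (leq0n _) (rg i inn).
  rewrite /uu eqxx mul1r /gl eqxx /hpow ifT; last by rewrite rangeML ?rg//; lia.
  by rewrite subrr powRr0 mulr1.
have b3 : nc ((t i - t k)%:C^-1 * pq t k (t i)) <=
    argc (2%:R * gam) * hpow ML (ReC (2%:R * gam)) (t i - t k).
  rewrite /pq; case: ifP => _; first by apply: nc_inv_cpow; exact: dm.
  have := @nc_inv_cpow _ p z (t k - t i) (2%:R * gam) (dm _ _ kn inn).
  by rewrite !ncM !ncV !nc_real /hpow [`|t k - t i|]distrC.
have b4 : nc (\prod_(k' <- sq n | (k' != i) && (k' != k)) pq t k' (t i)) <=
    \prod_(k' <- sq n | (k' != i) && (k' != k)) Cg.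
  rewrite nc_prod big_seq_cond [leRHS]big_seq_cond; apply: ler_prod => j /andP[jn _].
  rewrite nc_ge0 /pq; case: ifP => _; apply: (nc_cpow_ML p2 zlt) => //; apply: ltW; exact: dm.
have b5 : nc (\prod_(j <- sq n | j != i) (uu (F j) (t j) * col al (t j))) <=
    (\prod_(j <- sq n | j != i) Cc) * \prod_(j <- sq n | j != i) gl p z al (F j) (t j).
  rewrite -big_split nc_prod big_seq_cond [leRHS]big_seq_cond; apply: ler_prod => j /andP[jn _].
  by rewrite nc_ge0 uc_bound ?rg.
have b6 : nc (rest t) <= \prod_(j <- sq n | j != i) \prod_(k <- sq n | (k < j)%N && (k != i)) Cg.
  rewrite nc_prod big_seq_cond [leRHS]big_seq_cond; apply: ler_prod => j /andP[jn _].
  rewrite nc_ge0 /= nc_prod big_seq_cond [leRHS]big_seq_cond; apply: ler_prod => j' /andP[jn' _].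
  by rewrite nc_ge0 /= (nc_cpow_ML p2 zlt)//; apply: ltW; exact: dm.
have sp : \prod_(k' <- sq n | k' != i) pq t k' (t i) =
    pq t k (t i) * \prod_(k' <- sq n | (k' != i) && (k' != k)) pq t k' (t i).
  rewrite -big_filter (bigD1_seq k) ?mem_filter ?ki ?filter_uniq ?uniq_sq//=.
  by rewrite big_filter_cond.
rewrite T0E /T0 /KG sp.
set P4 := (X in pq t k (t i) * X); set P5 := (X in X * rest t).
rewrite [X in nc X](_ : _ = (t i - z c)%:C * (col al (t i) * (((t i - t k)%:C^-1 * pq t k (t i)) * P4) * (P5 * rest t))); last by ring.
rewrite [leRHS](_ : _ = ML * (Cc * ((argc (2%:R * gam) * hpow ML (ReC (2%:R * gam)) (t i - t k)) *
   \prod_(k' <- sq n | (k' != i) && (k' != k)) Cg) *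
   (((\prod_(j <- sq n | j != i) Cc) * \prod_(j <- sq n | j != i) gl p z al (F j) (t j)) *
    \prod_(j <- sq n | j != i) \prod_(k <- sq n | (k < j)%N && (k != i)) Cg))); last by ring.
rewrite ncM ler_pM ?nc_ge0// ncM ler_pM ?nc_ge0//.
  by rewrite ncM ler_pM ?nc_ge0// ncM ler_pM ?nc_ge0.
by rewrite ncM ler_pM ?nc_ge0.
Qed.

(* The contribution of the factor [(t_i - t_k)^(2 gam)] to the total derivative in [t_i]. *)
Definition XX k : R[i] :=
  CI (mu (sq n)) (cut b (fun t => (t i - z c)%:C * (t i - t k)%:C^-1 * term al F t)).

Lemma okF_setl s : (s <= p)%N -> okF (setl F i s).
Proof. by move=> sp j; rewrite /setl; case: ifP. Qed.

(** Integrates [H_expand] term by term over the cell; the left-hand side vanishes because $t_i$ may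
    be integrated first, where [slice_zero] applies. *)
Theorem stokes_rel :
  (1 + \sum_(s <- iota 1 p) al s) * J al b F +
  \sum_(s <- iota 1 p) al s * (z s - z c)%:C * J al b (setl F i s) +
  2%:R * gam * \sum_(k <- sq n | k != i) XX k = 0.
Proof.
have iF := term_int p2 zlt gam0 pa ob oF.
have iS s : s \in iota 1 p -> Cintegrable (mu (sq n)) (cut b (term al (setl F i s))).
  by rewrite mem_iota => sp; apply: (term_int p2 zlt gam0) => //; apply: okF_setl; lia.
have i1 : Cintegrable (mu (sq n)) (fun t => (1 + \sum_(s <- iota 1 p) al s) * cut b (term al F) t).
  exact: CintegrableZ.
have i2 : Cintegrable (mu (sq n)) (fun t => \sum_(s <- iota 1 p | s \in iota 1 p)
    al s * (z s - z c)%:C * cut b (term al (setl F i s)) t).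
  by apply: Cintegrable_sum => s si; apply: CintegrableZ; exact: iS.
have i3 : Cintegrable (mu (sq n)) (fun t => \sum_(k <- sq n | (k \in sq n) && (k != i))
    cut b (fun t => (t i - z c)%:C * (t i - t k)%:C^-1 * term al F t) t).
  by apply: Cintegrable_sum => k /andP[kn ki]; exact: X_int.
have i3' := CintegrableZ (2%:R * gam) i3.
have cH : cut b H = (fun t => (1 + \sum_(s <- iota 1 p) al s) * cut b (term al F) t +
   (\sum_(s <- iota 1 p | s \in iota 1 p) al s * (z s - z c)%:C * cut b (term al (setl F i s)) t +
   2%:R * gam * \sum_(k <- sq n | (k \in sq n) && (k != i))
     cut b (fun t => (t i - z c)%:C * (t i - t k)%:C^-1 * term al F t) t)).
  apply/funext => t; rewrite /cut; case: asboolP => ct; last first.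
    by rewrite !mulr0 !big1 ?mulr0 ?addr0//; move=> s _; rewrite mulr0.
  by rewrite H_expand addrA -[in RHS]big_seq -[in RHS]big_seq_cond.
have iH : Cintegrable (mu (sq n)) (cut b H).
  by rewrite cH; apply: CintegrableD => //; exact: CintegrableD.
have ir : i \notin rem i (sq n) by rewrite mem_rem_uniq ?uniq_sq// inE eqxx.
have frontE (A : set E) : measurable A -> mu (sq n) A = mu (i :: rem i (sq n)) A.
  by move=> mA; apply: mu_front; rewrite ?uniq_sq.
have z0 : CI (mu (sq n)) (cut b H) = 0.
  rewrite (CI_meas_eq frontE) CI_consG//; last 2 first.
  - apply: (@Cintegrable_meas_eq _ _ _ _ (mu (sq n))) => // A mA.
    by apply/esym; exact: frontE.
  - by move=> t; case: (slice_zero t).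
  rewrite (_ : (fun t => _) = (fun=> 0)); first exact: CI0.
  by apply/funext => t; case: (slice_zero t).
rewrite -[RHS]z0 cH CID//; last exact: CintegrableD.
rewrite CID// (CIZ _ iF) (CIZ _ i3) addrA; congr (_ + _); first congr (_ + _).
  rewrite CI_sum; last by move=> s si; exact: (CintegrableZ (al s * (z s - z c)%:C) (iS s si)).
  by rewrite big_seq; apply: eq_bigr => s si; rewrite CIZ//; exact: iS.
rewrite CI_sum; last by move=> k /andP[kn ki]; exact: X_int.
by rewrite -[in RHS]big_seq_cond.
Qed.
End StokesN.

Local Close Scope classical_set_scope.

(** * Relations between integrals *)

Section TypeSums.
Variables (C : numFieldType) (n p : nat).
Local Notation L := 'I_p.+1.
Local Notation FF := {ffun 'I_n -> L}.
Implicit Types (f : FF) (i k : 'I_n) (s : L) (M : {ffun L -> nat}).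

Definition ty f : {ffun L -> nat} := [ffun s => #|[set i | f i == s]|].
Definition addM M s : {ffun L -> nat} := [ffun x => (M x + (x == s))%N].
Definition fset f i s : FF := [ffun x => if x == i then s else f x].
Definition ftp f i k : FF := [ffun x => f (tperm i k x)].

Lemma fsetE f i s x : fset f i s x = if x == i then s else f x.
Proof. by rewrite ffunE. Qed.
Lemma fset_id f i : fset f i (f i) = f.
Proof. by apply/ffunP => x; rewrite ffunE; case: eqP => // ->. Qed.
Lemma fset_fset f i s s' : fset (fset f i s) i s' = fset f i s'.
Proof. by apply/ffunP => x; rewrite !ffunE; case: eqP. Qed.
Lemma ftpK i k : involutive (fun f => ftp f i k).
Proof. by move=> f; apply/ffunP => x; rewrite !ffunE tpermK. Qed.

Lemma ty_ftp f i k : ty (ftp f i k) = ty f.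
Proof.
apply/ffunP => s; rewrite !ffunE.
rewrite -(card_imset _ (@perm_inj _ (tperm i k))); apply: eq_card => x.
rewrite inE; apply/imsetP/idP => [[y]|fx]; first by rewrite inE ffunE => + ->.
by exists (tperm i k x); rewrite ?tpermK// inE ffunE tpermK.
Qed.
Lemma ty_fset f i s x : (ty (fset f i s) x + (f i == x) = ty f x + (s == x))%N.
Proof.
rewrite !ffunE [in LHS](cardsD1 i) [in RHS](cardsD1 i) !inE fsetE eqxx.
have -> : [set y | fset f i s y == x] :\ i = [set y | f y == x] :\ i.
  by apply/setP => y; rewrite !inE fsetE; case: (y == i).
lia.
Qed.
Lemma ty_fsetP f i s M : f i = ord0 -> (ty (fset f i s) == addM M s) = (ty f == addM M ord0).
Proof.
move=> fi; have h x := ty_fset f i s x.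
apply/eqP/eqP => /ffunP e; apply/ffunP => x; move: (h x) (e x); rewrite fi !ffunE => h1 e1;
  by move: h1 e1; rewrite ![_ == x]eq_sym; lia.
Qed.

(** Changing the label at [i] from 0 to [s] is a bijection between the labellings with label 0 at
    [i] and those with label [s] there. *)
Lemma sum_fset (G : 'I_n -> FF -> C) s M :
  \sum_i \sum_(f : FF | (f i == ord0) && (ty f == addM M ord0)) G i (fset f i s) =
  \sum_i \sum_(f : FF | (f i == s) && (ty f == addM M s)) G i f.
Proof.
apply: eq_bigr => i _.
rewrite [RHS](reindex_onto (fun f => fset f i s) (fun f => fset f i ord0)); last first.
  by move=> f /andP[/eqP fi _]; rewrite fset_fset -{1}fi fset_id.
apply: eq_bigl => f; rewrite fset_fset fsetE eqxx eqxx /=.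
have -> : (fset f i ord0 == f) = (f i == ord0).
  apply/eqP/eqP => [<-|fi]; first by rewrite fsetE eqxx.
  by rewrite -fi fset_id.
by case: eqP => fi; rewrite ?andbF ?andbT //= ty_fsetP.
Qed.

Definition Om (J : FF -> C) M : C := \sum_(f : FF | ty f == M) J f.

(** Double counting: a labelling of type [M] has exactly [M s] positions with label [s]. *)
Lemma sum_count (J : FF -> C) s M :
  \sum_i \sum_(f : FF | (f i == s) && (ty f == M)) J f = (M s)%:R * Om J M.
Proof.
rewrite /Om mulr_sumr (exchange_big_dep (fun f => ty f == M)) /=; last by move=> i f _ /andP[].
apply: eq_bigr => f /eqP <-; rewrite ffunE.
rewrite (eq_bigl (fun i => f i == s)); last by move=> i; rewrite eqxx andbT.
by rewrite sumr_const mulr_natl; congr (_ *+ _); apply: eq_card => x; rewrite inE.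
Qed.

Lemma sum_count2 (J : FF -> C) s M :
  \sum_i \sum_(f : FF | (f i == s) && (ty f == M)) \sum_(k | (k != i) && (f k == s)) J f =
  (M s)%:R * (M s).-1%:R * Om J M.
Proof.
rewrite -[RHS]mulrA mulrCA -sum_count mulr_sumr; apply: eq_bigr => i _.
rewrite mulr_sumr; apply: eq_bigr => f /andP[fi /eqP <-]; rewrite sumr_const mulr_natl; congr (_ *+ _).
rewrite ffunE (cardsD1 i) inE fi /=; apply: eq_card => x; rewrite !inE //.
Qed.

Lemma sum_count_neq (J : FF -> C) M :
  \sum_i \sum_(f : FF | (f i == ord0) && (ty f == M)) \sum_(k | (k != i) && (f k != ord0)) J f =
  (M ord0)%:R * (n - M ord0)%:R * Om J M.
Proof.
rewrite -[RHS]mulrA mulrCA -sum_count mulr_sumr; apply: eq_bigr => i _.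
rewrite mulr_sumr; apply: eq_bigr => f /andP[fi /eqP <-]; rewrite sumr_const mulr_natl; congr (_ *+ _).
rewrite ffunE; have := cardsC [set j | f j == ord0]; rewrite card_ord.
have -> : #|~: [set j | f j == ord0]| = #|(fun k => (k != i) && (f k != ord0))|.
  2: by move/(congr1 (subn^~ #|[set j | f j == ord0]|)); rewrite addKn.
apply: eq_card => x; rewrite !inE unfold_in; case: (eqVneq x i) => [->|//]; by rewrite fi.
Qed.

Variables (J : FF -> C) (X : 'I_n -> 'I_n -> FF -> C) (A gam : C) (al zz : L -> C) (zc : C).
Hypothesis A1 : forall i f, f i = ord0 ->
  (1 + A) * J f + \sum_(s | s != ord0) al s * (zz s - zc) * J (fset f i s) +
  2%:R * gam * \sum_(k | k != i) X i k f = 0.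
(** The diagonal pole cancels in the sum over both orders. With no form attached,
    $(t_i-z_c)/(t_i-t_k)$ and its mirror image add up to 1. With $u_s$ attached to the opposite
    variable the sum is $u_s(t_k)+u_s(t_i)+(z_s-z_c)u_s(t_i)u_s(t_k)$, which is [A3]. *)
Hypothesis A2 : forall i k f, i != k -> f i = ord0 -> f k = ord0 ->
  X i k f + X k i (ftp f i k) = J f.
Hypothesis A3 : forall i k f, i != k -> f i = ord0 -> f k != ord0 ->
  X i k f + X k i (ftp f i k) = J f + J (ftp f i k) + (zz (f k) - zc) * J (fset f i (f k)).

(** A single relation mixes labellings that are not permutations of one another in a uniform way.
    Summing it over all positions [i] and all labellings of one type closes the system on the sums
    [Om]. *)
Theorem type_relation M : (\sum_s M s).+1 = n ->
  (M ord0).+1%:R * (1 + A + (2 * n - 2 - M ord0)%:R * gam) * Om J (addM M ord0) +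
  \sum_(s | s != ord0) (zz s - zc) * (M s).+1%:R * (al s + (M s)%:R * gam) * Om J (addM M s) = 0.
Proof.
move=> Mn; pose M0 := addM M ord0.
have M00 : M0 ord0 = (M ord0).+1 by rewrite ffunE eqxx addn1.
have Mss s : addM M s s = (M s).+1 by rewrite ffunE eqxx addn1.
pose W := \sum_i \sum_(f : FF | (f i == ord0) && (ty f == M0)) \sum_(k | k != i) X i k f.
have S0 : \sum_i \sum_(f : FF | (f i == ord0) && (ty f == M0)) ((1 + A) * J f +
    \sum_(s | s != ord0) al s * (zz s - zc) * J (fset f i s) +
    2%:R * gam * \sum_(k | k != i) X i k f) = 0.
  by rewrite big1// => i _; rewrite big1// => f /andP[/eqP fi _]; exact: A1.
have S1 : \sum_i \sum_(f : FF | (f i == ord0) && (ty f == M0)) ((1 + A) * J f +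
    \sum_(s | s != ord0) al s * (zz s - zc) * J (fset f i s) +
    2%:R * gam * \sum_(k | k != i) X i k f) =
  (1 + A) * ((M ord0).+1%:R * Om J M0) +
  \sum_(s | s != ord0) al s * (zz s - zc) * ((M s).+1%:R * Om J (addM M s)) + 2%:R * gam * W.
  under eq_bigr => i _.
    rewrite !big_split /= -mulr_sumr exchange_big -[X in _ + _ + X]mulr_sumr /=; over.
  rewrite !big_split /= -!mulr_sumr sum_count M00; congr (_ + _ + _).
  rewrite exchange_big; apply: eq_bigr => s _; rewrite /=.
  under eq_bigr do rewrite -mulr_sumr.
  by rewrite -mulr_sumr (sum_fset (fun=> J)) sum_count Mss.
(* Exchanging [i] and [k] together with their labels permutes the summands of [W]; hence $2W$ is a
   sum of the symmetric expressions that [A2] and [A3] evaluate. *)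
have W2 : W = \sum_i \sum_(f : FF | (f i == ord0) && (ty f == M0)) \sum_(k | k != i) X k i (ftp f i k).
  have e (Y : 'I_n -> 'I_n -> FF -> C) :
      \sum_i \sum_(f : FF | (f i == ord0) && (ty f == M0)) \sum_(k | k != i) Y i k f =
      \sum_i \sum_(k | k != i) \sum_(f : FF | (f i == ord0) && (ty f == M0)) Y i k f.
    by apply: eq_bigr => i _; rewrite exchange_big.
  rewrite /W !e (exchange_big_dep predT) //=; apply: eq_bigr => i _.
  rewrite (eq_bigl (fun k => k != i)); last by move=> k; rewrite eq_sym.
  apply: eq_bigr => k ki.
  rewrite (reindex_inj (inv_inj (@ftpK i k))) /=; apply: eq_big => [f|f _]; last by [].
  by rewrite ty_ftp ffunE tpermR.
have W3 : 2%:R * W = (M ord0).+1%:R * (2 * n - 2 - M ord0)%:R * Om J M0 +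
    \sum_(s | s != ord0) (zz s - zc) * ((M s).+1%:R * (M s)%:R * Om J (addM M s)).
  have -> : 2%:R * W = \sum_i \sum_(f : FF | (f i == ord0) && (ty f == M0)) \sum_(k | k != i)
      (X i k f + X k i (ftp f i k)).
    rewrite mulr_natl mulr2n {2}W2 -big_split; apply: eq_bigr => i _.
    by rewrite -big_split; apply: eq_bigr => f _; rewrite -big_split.
  have -> : \sum_i \sum_(f : FF | (f i == ord0) && (ty f == M0)) \sum_(k | k != i)
      (X i k f + X k i (ftp f i k)) =
    \sum_i \sum_(f : FF | (f i == ord0) && (ty f == M0))
     (\sum_(k | (k != i) && (f k == ord0)) J f +
      (\sum_(k | (k != i) && (f k != ord0)) J f + \sum_(k | (k != i) && (f k != ord0)) J (ftp f i k) +
       \sum_(s | s != ord0) \sum_(k | (k != i) && (fset f i s k == s)) (zz s - zc) * J (fset f i s))).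
    apply: eq_bigr => i _; apply: eq_bigr => f /andP[/eqP fi _].
    rewrite (bigID (fun k => f k == ord0)) /=; congr (_ + _).
      by apply: eq_bigr => k /andP[ki /eqP fk]; rewrite A2 1?eq_sym.
    rewrite -big_split (exchange_big_dep (fun k => (k != i) && (f k != ord0))) /=; last first.
      move=> s k s0 /andP[ki]; rewrite fsetE (negbTE ki) => /eqP ->.
      by rewrite /= s0.
    rewrite -big_split; apply: eq_bigr => k /andP[ki fk].
    have ik : i != k by rewrite eq_sym.
    rewrite (A3 ik fi fk) /=; congr (_ + _).
    rewrite (big_pred1 (f k))// => s /=; rewrite ki fsetE (negbTE ki) /=.
    by apply/andP/eqP => [[_ /eqP ->]//|->].
  under eq_bigr => i _.
    rewrite !big_split /=; over.
  rewrite !big_split /= sum_count2 sum_count_neq M00 /=.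
  have -> : \sum_i \sum_(f : FF | (f i == ord0) && (ty f == M0)) \sum_(k | (k != i) && (f k != ord0)) J (ftp f i k) =
      (M ord0).+1%:R * (n - (M ord0).+1)%:R * Om J M0.
    rewrite -M00 -sum_count_neq.
    have e (Y : 'I_n -> 'I_n -> FF -> C) :
      \sum_i \sum_(f : FF | (f i == ord0) && (ty f == M0)) \sum_(k | (k != i) && (f k != ord0)) Y i k f =
      \sum_i \sum_(k | k != i) \sum_(f : FF | [&& f i == ord0, f k != ord0 & ty f == M0]) Y i k f.
      apply: eq_bigr => i _; rewrite (exchange_big_dep (fun k => k != i)) /=; last by move=> f k _ /andP[].
      apply: eq_bigr => k ki; apply: eq_bigl => f; rewrite ki /=.
      by case: (f i == _); case: (f k == _); case: (_ == M0).
    rewrite !e (exchange_big_dep predT) //=; apply: eq_bigr => i _.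
    rewrite (eq_bigl (fun k => k != i)); last by move=> k; rewrite eq_sym.
    apply: eq_bigr => k ki.
    rewrite (reindex_inj (inv_inj (@ftpK k i))) /=; apply: eq_big => [f|f _]; last by rewrite ftpK.
    by rewrite ty_ftp !ffunE tpermL tpermR andbCA.
  have -> : \sum_i \sum_(f : FF | (f i == ord0) && (ty f == M0)) \sum_(s | s != ord0)
      \sum_(k | (k != i) && (fset f i s k == s)) (zz s - zc) * J (fset f i s) =
      \sum_(s | s != ord0) (zz s - zc) * ((M s).+1%:R * (M s)%:R * Om J (addM M s)).
    under eq_bigr => i _.
      rewrite exchange_big /=; over.
    rewrite exchange_big; apply: eq_bigr => s s0 /=.
    rewrite (sum_fset (fun i f => \sum_(k | (k != i) && (f k == s)) (zz s - zc) * J f)).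
    under eq_bigr => i _.
      under eq_bigr => f _.
        rewrite -mulr_sumr; over.
      rewrite -mulr_sumr; over.
    by rewrite -mulr_sumr sum_count2 Mss.
  rewrite addrA; congr (_ + _).
  have n0 : (M ord0 < n)%N by rewrite -Mn ltnS (bigD1 ord0)//= leq_addr.
  (* A partner [k] with label 0 contributes one copy of the integral, a partner with nonzero label
     contributes two. *)
  have -> : (2 * n - 2 - M ord0)%:R = (M ord0)%:R + 2%:R * (n - (M ord0).+1)%:R :> C.
    by rewrite -natrM -natrD; congr (_%:R); lia.
  ring.
have gW : 2%:R * gam * W = gam * (2%:R * W) by ring.
rewrite S0 gW W3 in S1; rewrite [RHS]S1 [gam * (_ + _)]mulrDr [gam * \sum_(s | _) _]mulr_sumr [RHS](_ : _ =
  ((1 + A) * ((M ord0).+1%:R * Om J M0) + gam * ((M ord0).+1%:R * (2 * n - 2 - M ord0)%:R * Om J M0)) +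
  (\sum_(s | s != ord0) al s * (zz s - zc) * ((M s).+1%:R * Om J (addM M s)) +
   \sum_(s | s != ord0) gam * ((zz s - zc) * ((M s).+1%:R * (M s)%:R * Om J (addM M s))))); last by ring.
rewrite -big_split; congr (_ + _); first by rewrite -/M0; ring.
by apply: eq_bigr => s _ /=; ring.
Qed.

End TypeSums.

Lemma big_sq {T : Type} {idx : T} (op : Monoid.com_law idx) n (P : pred nat) (G : nat -> T) :
  \big[op/idx]_(k <- sq n | P k) G k = \big[op/idx]_(o < n | P o.+1) G o.+1.
Proof.
elim: n => [|n IH]; first by rewrite big_nil big_ord0.
rewrite /= big_cons IH [RHS]big_mkcond big_ord_recr /= -big_mkcond /=.
by case: ifP => _; rewrite ?Monoid.mulm1// Monoid.mulmC.
Qed.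

(** * The relations for integrals over a cell *)

Section Instances.
Context {R : realType}.
Variables (p n : nat) (z : nat -> R) (gam : R[i]).
Local Notation E := (envT R).
Local Notation uu := (uu z).
Local Notation colf := (col p z).
Local Notation prs := (prs n gam).
Local Notation term := (term p n z gam).
Local Notation cut := (cut n z).
Local Notation J := (J p n z gam).
Local Notation FF := {ffun 'I_n -> 'I_p.+1}.
Hypothesis p2 : (2 <= p)%N.
Hypothesis zlt : forall s, (1 <= s < p)%N -> z s < z s.+1.
Hypothesis gam0 : 0 < ReC gam.

(** Passes from labellings of positions counted from 0 to labels of coordinates counted from 1. The
    default label 0 outside the range keeps every label at most [p]. *)
Definition lab (f : FF) (j : nat) : nat :=
  if j is j'.+1 then (if insub j' is Some o then val (f o) else 0%N) else 0%N.

Lemma labE f (o : 'I_n) : lab f o.+1 = f o.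
Proof. by rewrite /lab valK. Qed.
Lemma okF_lab f : okF p (lab f).
Proof. by move=> [|j] //=; case: insub => // o; rewrite -ltnS. Qed.
Lemma lab_out f j : j \notin sq n -> lab f j = 0%N.
Proof.
by case: j => [|j] //=; rewrite mem_sq; case: insubP => // o jn _; rewrite -ltnNge /= ltnS leqNgt jn.
Qed.
Lemma lab_eq (F G : nat -> nat) : (forall j, j \notin sq n -> F j = G j) ->
  (forall o : 'I_n, F o.+1 = G o.+1) -> F = G.
Proof.
move=> h1 h2; apply/funext => j; have [jn|jn] := boolP (j \in sq n); last exact: h1.
by move: jn; rewrite mem_sq; case: j => // j /= jn; exact: (h2 (Ordinal jn)).
Qed.
Lemma sq_ord (o : 'I_n) : o.+1 \in sq n.
Proof. by rewrite mem_sq /= ltn_ord. Qed.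
Lemma lab_fset f (o : 'I_n) s : lab (fset f o s) = setl (lab f) o.+1 s.
Proof.
apply: lab_eq => [j jn|k].
  rewrite /setl lab_out//; case: eqP => [e|_]; last by rewrite lab_out.
  by rewrite e sq_ord in jn.
by rewrite /setl labE fsetE eqSS labE -val_eqE; case: eqP.
Qed.

Section Pair.
Variables (al : nat -> R[i]) (b : nat -> nat) (c : nat).
Hypothesis pa : posal p al.
Hypothesis ob : okb p n b.
Hypothesis c1p : (1 <= c <= p)%N.

Definition Jf (f : FF) : R[i] := J al b (lab f).
Definition Xf (o k : 'I_n) (f : FF) : R[i] := XX p n z gam al b (lab f) o.+1 c k.+1.

Lemma A1_inst (o : 'I_n) (f : FF) : f o = ord0 ->
  (1 + \sum_(s <- iota 1 p) al s) * Jf f +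
  \sum_(s : 'I_p.+1 | s != ord0) al s * ((z s)%:C - (z c)%:C) * Jf (fset f o s) +
  2%:R * gam * \sum_(k | k != o) Xf o k f = 0.
Proof.
move=> fo; have Fo : lab f o.+1 = 0%N by rewrite labE fo.
rewrite -[RHS](stokes_rel p2 zlt gam0 pa ob (okF_lab f) (sq_ord o) c1p Fo).
congr (_ + _ + _ * _).
  have -> : iota 1 p = index_iota 1 p.+1 by rewrite /index_iota subn1.
  rewrite big_add1 big_mkord /= -(big_mkord predT (fun s => al s.+1 * (z s.+1 - z c)%:C * J al b (setl (lab f) o.+1 s.+1))).
  rewrite big_mkord big_mkcond big_ord_recl /= add0r.
  by apply: eq_bigr => s _; rewrite rmorphB /Jf lab_fset.
by rewrite big_sq; apply: eq_bigl => k; rewrite eqSS.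
Qed.

Lemma prs_eq0 (t : E) j k : j \in sq n -> k \in sq n -> j != k -> t j = t k -> prs t = 0.
Proof.
wlog jk : j k / (k < j)%N.
  move=> h jn kn; have [kj|jk|->] := ltngtP k j; last by [].
    by move=> _; apply: h => //; rewrite neq_ltn kj orbT.
  by move=> _ e; apply: (h k j jk kn jn _ (esym e)); rewrite neq_ltn jk orbT.
move=> jn kn _ e; rewrite /prs (bigD1_seq j) ?uniq_sq//=.
rewrite -big_filter (bigD1_seq k) ?mem_filter ?jk ?filter_uniq ?uniq_sq//=.
by rewrite e subrr cpow0 !mul0r.
Qed.

Lemma col_eq0 x s : (1 <= s <= p)%N -> x = z s -> colf al x = 0.
Proof.
move=> sp ->; rewrite /col (bigD1_seq s) ?iota_uniq//=; first by rewrite subrr cpow0 mul0r.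
by move: sp; clear; rewrite mem_iota; lia.
Qed.

Lemma term2 (F G : nat -> nat) (t : E) i k : i \in sq n -> k \in sq n -> i != k ->
  (forall j, j != i -> j != k -> G j = F j) ->
  term al G t = uu (G i) (t i) * uu (G k) (t k) * (colf al (t i) * colf al (t k) *
    (\prod_(j <- sq n | (j != i) && (j != k)) (uu (F j) (t j) * colf al (t j))) * prs t).
Proof.
move=> inn kn ik GF; rewrite /term (bigD1_seq i) ?uniq_sq//=.
have -> : \prod_(j <- sq n | j != i) (uu (G j) (t j) * colf al (t j)) =
    uu (G k) (t k) * colf al (t k) * \prod_(j <- sq n | (j != i) && (j != k)) (uu (F j) (t j) * colf al (t j)).
  rewrite -big_filter (bigD1_seq k) ?mem_filter ?(eq_sym k) ?ik ?filter_uniq ?uniq_sq//=.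
  by rewrite big_filter_cond; congr (_ * _); apply: eq_bigr => j /andP[ji jk]; rewrite GF.
ring.
Qed.

(** Both integrals of the pair converge separately, so they may be added under the integral sign,
    where the identity is one of rational functions. *)
Lemma XX_pair (o k : 'I_n) (f : FF) : o != k -> f o = ord0 ->
  Xf o k f + Xf k o (ftp f o k) =
  (if f k == ord0 then Jf f else Jf f + Jf (ftp f o k) + ((z (f k))%:C - (z c)%:C) * Jf (fset f o (f k))).
Proof.
move=> ok fo.
have okS : o.+1 != k.+1 :> nat by rewrite eqSS val_eqE.
have Fo : lab f o.+1 = 0%N by rewrite labE fo.
have f'k : ftp f o k k = ord0 by rewrite ffunE tpermR.
have Fk' : lab (ftp f o k) k.+1 = 0%N by rewrite labE f'k.
have iX := X_int p2 zlt gam0 pa ob (okF_lab f) (sq_ord o) c1p Fo (sq_ord k).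
have iX' := X_int p2 zlt gam0 pa ob (okF_lab (ftp f o k)) (sq_ord k) c1p Fk' (sq_ord o).
have iJ g := term_int p2 zlt gam0 pa ob (okF_lab g).
have offp j : j != o.+1 -> j != k.+1 -> lab (ftp f o k) j = lab f j.
  move=> jo jk; case: j jo jk => // j jo jk /=; case: insubP => // x xn xj.
  rewrite ffunE tpermD//; apply/eqP => e; move: jo jk; rewrite -e in xj; rewrite !eqSS -xj ?eqxx//.
rewrite /Xf /XX -CID; [|by apply: iX; rewrite eq_sym|by apply: iX'].
set r := f k.
have uz (x y u v : R[i]) : x = 0 \/ y = 0 \/ v = 0 -> x * y * u * v = 0.
  by move=> [->|[->|->]]; rewrite ?mul0r ?mulr0 ?mul0r// ?mul0r.
pose T2 (t : E) := colf al (t o.+1) * colf al (t k.+1) *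
    (\prod_(j <- sq n | (j != o.+1) && (j != k.+1)) (uu (lab f j) (t j) * colf al (t j))) * prs t.
have tf t : term al (lab f) t = uu r (t k.+1) * T2 t.
  rewrite (term2 (F := lab f) t (sq_ord o) (sq_ord k) okS)// labE fo /uu eqxx mul1r.
  by rewrite labE.
have tf' t : term al (lab (ftp f o k)) t = uu r (t o.+1) * T2 t.
  rewrite (term2 (F := lab f) t (sq_ord o) (sq_ord k) okS)// !labE f'k.
  by rewrite {2}/uu eqxx mulr1 ffunE tpermL.
have tf'' t : term al (lab (fset f o r)) t = uu r (t o.+1) * uu r (t k.+1) * T2 t.
  rewrite (term2 (F := lab f) t (sq_ord o) (sq_ord k) okS); last first.
    by move=> j jo jk; rewrite lab_fset /setl (negbTE jo).
  by rewrite !labE !fsetE eqxx eq_sym (negbTE ok).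
(* The common factor vanishes wherever one of the denominators does, so the identity need only be
   checked where all of them are invertible. *)
have T20 t : (t o.+1 = t k.+1 \/ ((r != ord0) && ((t o.+1 == z r) || (t k.+1 == z r)))) -> T2 t = 0.
  case=> [e|/andP[r0 /orP[/eqP e|/eqP e]]]; apply: uz.
  - by right; right; apply: (prs_eq0 (sq_ord o) (sq_ord k)).
  - by left; apply: (col_eq0 _ e); rewrite lt0n r0 -ltnS ltn_ord.
  - by right; left; apply: (col_eq0 _ e); rewrite lt0n r0 -ltnS ltn_ord.
have [r0|r0] := eqVneq r ord0.
  congr (CI _ _); apply/funext => t; rewrite -cutD /cut; case: asboolP => // _.
  rewrite tf tf' r0 /uu eqxx !mul1r.
  have [e|ne] := eqVneq (t o.+1) (t k.+1); first by rewrite T20 ?mulr0 ?addr0//; left.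
  have d0 : (t o.+1 - t k.+1)%:C != 0 :> R[i] by rewrite eq_complex /= negb_and subr_eq0 ne.
  have -> : (t k.+1 - t o.+1)%:C = - (t o.+1 - t k.+1)%:C :> R[i] by rewrite -rmorphN opprB.
  have -> : (t o.+1 - z c)%:C = (t k.+1 - z c)%:C + (t o.+1 - t k.+1)%:C :> R[i].
    by rewrite -rmorphD; congr (_%:C); ring.
  by move: (t o.+1 - t k.+1)%:C d0 (t k.+1 - z c)%:C => u u0 v; field.
rewrite /Jf /J -(CIZ _ (iJ (fset f o r))) -(CID (iJ f) (iJ (ftp f o k))) -CID; first last.
- exact: CintegrableZ (iJ _).
- exact: CintegrableD (iJ f) (iJ (ftp f o k)).
congr (CI _ _); apply/funext => t; rewrite -cutD /cut; case: asboolP => // _; last first.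
  by rewrite mulr0 !addr0.
rewrite tf tf' tf''.
have [T0|T0] := eqVneq (T2 t) 0; first by rewrite T0 !mulr0 !addr0.
have ne : t o.+1 != t k.+1 by apply: contra_neq T0 => e; apply: T20; left.
have no : t o.+1 != z r by apply: contra_neq T0 => e; apply: T20; right; rewrite r0 e eqxx.
have nk : t k.+1 != z r by apply: contra_neq T0 => e; apply: T20; right; rewrite r0 e eqxx orbT.
have d0 : (t o.+1)%:C - (t k.+1)%:C != 0 :> R[i].
  by rewrite -rmorphB eq_complex /= negb_and subr_eq0 ne.
have d1 : (t o.+1)%:C - (z r)%:C != 0 :> R[i].
  by rewrite -rmorphB eq_complex /= negb_and subr_eq0 no.
have d2 : (t k.+1)%:C - (z r)%:C != 0 :> R[i].
  by rewrite -rmorphB eq_complex /= negb_and subr_eq0 nk.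
have d3 : (t k.+1)%:C - (t o.+1)%:C != 0 :> R[i] by rewrite -opprB oppr_eq0.
rewrite /uu (_ : (r == 0%N :> nat) = false); last exact: negbTE.
rewrite !rmorphB /=.
by field; rewrite d0 d1 d2 d3.
Qed.

Definition OmJ (M : {ffun 'I_p.+1 -> nat}) : R[i] := Om Jf M.

Lemma rel_c (M : {ffun 'I_p.+1 -> nat}) : (\sum_s M s).+1 = n ->
  (M ord0).+1%:R * (1 + \sum_(s <- iota 1 p) al s + (2 * n - 2 - M ord0)%:R * gam) * OmJ (addM M ord0) +
  \sum_(s | s != ord0) ((z s)%:C - (z c)%:C) * (M s).+1%:R * (al s + (M s)%:R * gam) * OmJ (addM M s) = 0.
Proof.
apply: (@type_relation _ n p Jf Xf _ gam (fun s => al s) (fun s => (z s)%:C) (z c)%:C).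
- by move=> i f fi; exact: A1_inst.
- by move=> i k f ik fi fk; rewrite XX_pair// fk eqxx.
- by move=> i k f ik fi fk; rewrite XX_pair// (negbTE fk).
Qed.

End Pair.
End Instances.

(** * The shift of the last exponent *)

Section DetTri.
Variable C : comNzRingType.

(** A permutation with nonzero product never lowers the rank; as the total rank is preserved it
    never raises it either, so it is the identity. No ordering of the index set has to be chosen. *)
Lemma det_rank_tri k (r : 'I_k -> nat) (T : 'M[C]_k) :
  (forall i j, T i j != 0 -> i = j \/ (r i < r j)%N) -> \det T = \prod_i T i i.
Proof.
move=> tri; rewrite /determinant (bigD1 1%g) //= [X in _ + X]big1 => [|s s1].
  rewrite odd_perm1 expr0 mul1r addr0; by apply: eq_bigr => i _; rewrite perm1.
have [[i Ti]|hn] := pselect (exists i, T i (s i) = 0); first by rewrite (bigD1 i) //= Ti mul0r mulr0.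
have h i : T i (s i) != 0 by apply/eqP => e; apply: hn; exists i.
  have le i : (r i <= r (s i))%N by case: (tri _ _ (h i)) => [<-|/ltnW].
  case/eqP: s1; apply/permP => i; rewrite perm1.
  case: (tri _ _ (h i)) => // lt.
  have : (\sum_i r i < \sum_i r (s i))%N.
    rewrite (bigD1 i) //= [ltnRHS](bigD1 i) //= -addSn; apply: leq_add => //.
    by apply: leq_sum => j _.
  by rewrite -(reindex_inj (@perm_inj _ s) (P := predT) (F := r)) ltnn.
Qed.

Definition fmx (I : finType) (A : I -> I -> C) : 'M[C]_#|I| :=
  \matrix_(a, b) A (enum_val a) (enum_val b).

Lemma det_change (I : finType) (r : I -> nat) (A B T : I -> I -> C) :
  (forall i j, T i j != 0 -> i = j \/ (r i < r j)%N) ->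
  (forall l m, A l m = \sum_m' T m m' * B l m') ->
  \det (fmx A) = (\prod_m T m m) * \det (fmx B).
Proof.
move=> tri AB; have -> : fmx A = fmx B *m (fmx T)^T.
  apply/matrixP => a b; rewrite !mxE AB (reindex_onto enum_val enum_rank) /=.
    by rewrite [LHS]big_mkcond; apply: eq_bigr => c _; rewrite !mxE enum_valK eqxx mulrC.
  by move=> m _; exact: enum_rankK.
rewrite det_mulmx det_tr mulrC; congr (_ * _).
rewrite (@det_rank_tri _ (fun a => r (enum_val a))).
  rewrite [RHS](reindex_onto enum_val enum_rank) /=; last by move=> m _; exact: enum_rankK.
  by rewrite [RHS]big_mkcond; apply: eq_bigr => c _; rewrite !mxE enum_valK eqxx.
by move=> i j; rewrite mxE => /tri [/enum_val_inj ->|]; [left|right].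
Qed.

Lemma det_colscale (I : finType) (A B : I -> I -> C) (c : I -> C) :
  (forall l m, A l m = c m * B l m) -> \det (fmx A) = (\prod_m c m) * \det (fmx B).
Proof.
move=> AB; rewrite (@det_change _ (fun=> 0%N) A B (fun i j => if i == j then c i else 0)).
- by congr (_ * _); apply: eq_bigr => m _; rewrite eqxx.
- by move=> i j; have [->|ne] := eqVneq i j; [left|rewrite eqxx].
- by move=> l m; rewrite (bigD1 m) //= eqxx big1 ?addr0// => i im; rewrite eq_sym (negbTE im) mul0r.
Qed.
End DetTri.

(** * Compositions as label multiplicities, and triangular elimination *)

Section TypeIndex.
Variables (n p : nat).
Hypothesis p2 : (2 <= p)%N.
Local Notation L := 'I_p.+1.
Implicit Types (s x : L) (M : {ffun L -> nat}) (m : Zc n p.-1).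

Definition i1 : L := inord 1.
Lemma i1E : i1 = 1%N :> nat. Proof. by rewrite inordK // ltnS ltnW. Qed.

Lemma cgetE (k : nat) (m : Zc n k) (i : 'I_k) : cget m i.+1 = val m i.
Proof. by rewrite /cget /= valK. Qed.

Lemma cget_inj (k : nat) (m m' : Zc n k) : (forall s : nat, (0 < s <= k)%N -> cget m s = cget m' s) -> m = m'.
Proof.
move=> h; apply/val_inj/ffunP => i; apply: ord_inj; rewrite -!cgetE; apply: h; exact: ltn_ord.
Qed.

Lemma sum_cget (k : nat) (m : Zc n k) : (\sum_(1 <= s < k.+1) cget m s)%N = n.
Proof.
rewrite big_add1 /= big_mkord; rewrite -[RHS](eqP (valP m)).
by apply: eq_bigr => i _; rewrite cgetE.
Qed.

(* The composition [m] with its first part assigned to the label [x] instead of 1. *)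
Definition tyM x m : {ffun L -> nat} :=
  [ffun s : L => if s == x then cget m 1 else if (1 < s < p)%N then cget m s else 0%N].

Lemma tyM1E m s : tyM i1 m s = if (0 < s < p)%N then cget m s else 0%N.
Proof.
rewrite ffunE -val_eqE /= i1E; case: eqP => [->|/eqP s1]; first by rewrite p2.
by case: (nat_of_ord s) s1 => [|[|k]].
Qed.

Definition supp M := forall s, ~~ (0 < s < p)%N -> M s = 0%N.

Lemma sum_tyM1 m : (\sum_s tyM i1 m s)%N = n.
Proof.
rewrite -[RHS](sum_cget m) big_ord_recl tyM1E /= add0n.
rewrite (eq_bigr (fun i : 'I_p => if (i < p.-1)%N then cget m i.+1 else 0%N)); last first.
  move=> i _; rewrite tyM1E /= /bump /= add1n (_ : (i.+1 < p)%N = (i < p.-1)%N)//.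
  by case: p p2 i.
rewrite -(big_mkord predT (fun i => if (i < p.-1)%N then cget m i.+1 else 0%N)).
have -> q : (\sum_(0 <= i < p) q i)%N = (\sum_(0 <= i < p.-1.+1) q i)%N by rewrite prednK// ltnW.
rewrite big_nat_recr//= ltnn addn0 big_add1 !big_nat; apply: eq_bigr => i /andP[_ ->]//.
Qed.

Lemma tyM1_inj : injective (tyM i1).
Proof.
move=> m m' e; apply: cget_inj => s /andP[s0 sp].
have sp' : (s < p)%N by lia.
move/ffunP: e => /(_ (inord s)); rewrite !tyM1E inordK ?s0 ?sp'//.
by rewrite ltnS ltnW.
Qed.

Lemma tyM1_surj M : supp M -> (\sum_s M s)%N = n -> exists m, tyM i1 m = M.
Proof.
move=> sM Mn.
have le s : (M s < n.+1)%N by rewrite ltnS -Mn (bigD1 s)//= leq_addr.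
pose f : {ffun 'I_p.-1 -> 'I_n.+1} := [ffun i : 'I_p.-1 => inord (M (inord i.+1))].
have cf : compb f.
  apply/eqP; rewrite -[RHS]Mn [RHS]big_ord_recl (sM ord0)// add0n.
  rewrite (eq_bigr (fun i : 'I_p.-1 => M (inord i.+1))); last by move=> i _; rewrite ffunE inordK.
  rewrite -(big_mkord predT (fun i => M (inord i.+1))).
  rewrite (eq_bigr (fun i : 'I_p => M (inord i.+1))); last first.
    by move=> i _; congr (M _); apply: val_inj; rewrite /= inordK /bump /= ?add1n ?ltnS.
  rewrite -(big_mkord predT (fun i => M (inord i.+1))).
  have -> q : (\sum_(0 <= i < p) q i)%N = (\sum_(0 <= i < p.-1.+1) q i)%N by rewrite prednK// ltnW.
  by rewrite big_nat_recr//= sM ?addn0// prednK ?inordK ?ltnn ?andbF// ltnW.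
exists (Sub f cf); apply/ffunP => s; rewrite tyM1E; case: ifP => sp; last first.
  by rewrite sM ?sp.
case/andP: sp => s0 sp; have sp1 : (s.-1 < p.-1)%N by lia.
rewrite -(prednK s0) (cgetE _ (Ordinal sp1)) SubK ffunE inordK//.
by congr (M _); apply: val_inj; rewrite /= inordK prednK// ltnS ltnW.
Qed.

Definition addk M k x : {ffun L -> nat} := [ffun y => (M y + k * (y == x))%N].

Lemma addk0 M x : addk M 0 x = M.
Proof. by apply/ffunP => y; rewrite ffunE addn0. Qed.
Lemma addkS M k x : addk M k.+1 x = addM (addk M k x) x.
Proof. by apply/ffunP => y; rewrite !ffunE; lia. Qed.
Lemma addkC M k x s : addM (addk M k x) s = addk (addM M s) k x.
Proof. by apply/ffunP => y; rewrite !ffunE addnAC. Qed.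
Lemma sum_addM M s : (\sum_y addM M s y)%N = (\sum_y M y).+1.
Proof.
under eq_bigr do rewrite ffunE.
by rewrite big_split /= [X in (_ + X)%N](bigD1 s)//= eqxx [X in (1 + X)%N]big1 ?addn1// => y /negbTE ->.
Qed.
Lemma sum_addk M k s : (\sum_y addk M k s y)%N = (\sum_y M y + k)%N.
Proof.
elim: k => [|k IH]; first by rewrite addk0 addn0.
by rewrite addkS sum_addM IH addnS.
Qed.

Section Tri.
Variables (C : numFieldType) (x : L) (c : L -> C).
Definition relw (w : {ffun L -> nat} -> C) := forall M, (\sum_s M s).+1 = n ->
  w (addM M x) = \sum_(s : L | (0 < s < p)%N) c s * w (addM M s).

(** The [k] copies of label [x] are replaced one after the other by labels between 1 and $p-1$. The
    coefficients are chosen before [w], so the same matrix serves every cell. Only the choice of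
    label 1 at each of the [k] steps reaches the largest possible multiplicity of 1, with
    coefficient [c i1 ^+ k]. *)
Lemma tri_expand k M : supp M -> (\sum_s M s + k)%N = n ->
  exists t : Zc n p.-1 -> C,
   [/\ forall w, relw w -> w (addk M k x) = \sum_m t m * w (tyM i1 m),
       forall m, t m != 0 -> (cget m 1 <= M i1 + k)%N /\
         (cget m 1 = M i1 + k -> tyM i1 m = addk M k i1)%N &
       forall m, tyM i1 m = addk M k i1 -> t m = c i1 ^+ k].
Proof.
elim: k M => [|k IH] M sM Mn.
  have [m0 m0M] : exists m, tyM i1 m = M by apply: tyM1_surj; rewrite // -Mn addn0.
  exists (fun m => if m == m0 then 1 else 0); split.
  - move=> w _; rewrite (bigD1 m0)//= eqxx mul1r addk0 m0M big1 ?addr0// => m /negbTE ->.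
    by rewrite mul0r.
  - move=> m; have [->|ne] := eqVneq m m0; rewrite ?eqxx// => _; rewrite addn0 addk0 -m0M tyM1E i1E p2; split=> //.
  - by move=> m; rewrite addk0 -m0M => /tyM1_inj ->; rewrite eqxx expr0.
have IHs (s : L) : (0 < s < p)%N -> exists t : Zc n p.-1 -> C,
   [/\ forall w, relw w -> w (addk (addM M s) k x) = \sum_m t m * w (tyM i1 m),
       forall m, t m != 0 -> (cget m 1 <= addM M s i1 + k)%N /\
         (cget m 1 = addM M s i1 + k -> tyM i1 m = addk (addM M s) k i1)%N &
       forall m, tyM i1 m = addk (addM M s) k i1 -> t m = c i1 ^+ k].
  move=> sp; apply: IH => [y yp|]; last by rewrite sum_addM -Mn addSnnS.
  rewrite ffunE sM// -val_eqE /=; case: eqP => // e; by rewrite e sp in yp.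
have {IHs} : forall s : L, exists t : Zc n p.-1 -> C, (0 < s < p)%N ->
   [/\ forall w, relw w -> w (addk (addM M s) k x) = \sum_m t m * w (tyM i1 m),
       forall m, t m != 0 -> (cget m 1 <= addM M s i1 + k)%N /\
         (cget m 1 = addM M s i1 + k -> tyM i1 m = addk (addM M s) k i1)%N &
       forall m, tyM i1 m = addk (addM M s) k i1 -> t m = c i1 ^+ k].
  move=> s; case: (boolP (0 < s < p)%N) => [/IHs [t h]|_]; first by exists t.
  by exists (fun=> 0).
move=> /choice [t tP].
have i1p : (0 < i1 < p)%N by rewrite i1E p2.
have Ms1 s : s != i1 -> addM M s i1 = M i1 by rewrite ffunE eq_sym => /negbTE ->; rewrite addn0.
have M11 : addM M i1 i1 = (M i1).+1 by rewrite ffunE eqxx addn1.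
have A1 : addk (addM M i1) k i1 = addk M k.+1 i1 by rewrite addkS addkC.
(* Once a label other than 1 has been chosen, the maximal multiplicity of label 1 is out of
   reach. *)
have big (m : Zc n p.-1) : cget m 1 = (M i1 + k.+1)%N ->
    forall s : L, (0 < s < p)%N -> s != i1 -> t s m = 0.
  move=> e s sp s1; apply/eqP/negPn/negP => tn; have [_ /(_ m tn)[] + _ _] := tP s sp.
  by rewrite Ms1// e; lia.
exists (fun m => \sum_(s : L | (0 < s < p)%N) c s * t s m); split.
- move=> w rw; rewrite addkS rw; last by rewrite sum_addk -addnS.
  under [RHS]eq_bigr do rewrite mulr_suml.
  rewrite exchange_big /=; apply: eq_bigr => s sp; rewrite addkC; have [/(_ w rw) -> _ _] := tP s sp.
  by rewrite mulr_sumr; apply: eq_bigr => m _; rewrite mulrA.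
- move=> m h.
  have [s sp tn] : exists2 s : L, (0 < s < p)%N & t s m != 0.
    apply: contrapT => hn; move: h; rewrite big1 ?eqxx// => s sp.
    have [->|tn] := eqVneq (t s m) 0; first by rewrite mulr0.
    by case: hn; exists s.
  have [_ /(_ m tn)[le _] _] := tP s sp; split.
    by apply: leq_trans le _; rewrite ffunE; lia.
  move=> e; have s1 : s = i1.
    by apply/eqP/negPn/negP => s1; move: tn; rewrite (big m e s sp s1) eqxx.
  subst s; have [_ /(_ m tn)[_ h2] _] := tP i1 sp; rewrite h2 ?A1//.
  by rewrite e M11 addnS addSn.
- move=> m e.
  have e1 : cget m 1 = (M i1 + k.+1)%N.
    by move/ffunP: e => /(_ i1); rewrite tyM1E i1E p2 /= ffunE eqxx muln1.
  rewrite (bigD1 i1)//= big1 ?addr0; last first.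
    by move=> s /andP[sp s1]; rewrite (big m e1 s sp s1) mulr0.
  have [_ _ ->] := tP i1 i1p; first by rewrite exprS.
  by rewrite A1.
Qed.

Hypothesis x1 : ~~ (0 < x < p)%N.

(** Apart from [m] itself, the expansion contains only compositions with a strictly smaller first
    part; this gives the rank for the triangular determinant. *)
Lemma tri_tyM : exists T : Zc n p.-1 -> Zc n p.-1 -> C,
  [/\ forall w, relw w -> forall m, w (tyM x m) = \sum_m' T m m' * w (tyM i1 m'),
      forall m m', T m m' != 0 -> m = m' \/ (n - cget m 1 < n - cget m' 1)%N &
      forall m, T m m = c i1 ^+ cget m 1].
Proof.
pose Mm m := [ffun s : L => if (1 < s < p)%N then cget m s else 0%N].
have Mx m : tyM x m = addk (Mm m) (cget m 1) x.
  apply/ffunP => s; rewrite !ffunE; case: (eqVneq s x) => [->|_]; last by rewrite muln0 addn0.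
  by rewrite muln1 (_ : (1 < x < p)%N = false)//; lia.
have M1 m : tyM i1 m = addk (Mm m) (cget m 1) i1.
  apply/ffunP => s; rewrite tyM1E !ffunE -val_eqE /= i1E.
  case: (nat_of_ord s) => [|[|k]] //=; rewrite ?p2 ?muln1// muln0 addn0//.
have H m : exists t : Zc n p.-1 -> C,
   [/\ forall w, relw w -> w (tyM x m) = \sum_m t m * w (tyM i1 m),
       forall m', t m' != 0 -> (cget m' 1 <= cget m 1)%N /\
         (cget m' 1 = cget m 1 -> tyM i1 m' = tyM i1 m)%N &
       t m = c i1 ^+ cget m 1].
  have [||t [h1 h2 h3]] := @tri_expand (cget m 1) (Mm m).
  - by move=> s sp; rewrite ffunE; case: ifP => // sp'; case/negP: sp; lia.
  - by rewrite -[RHS](sum_tyM1 m) M1 sum_addk.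
  exists t; split; [by rewrite Mx|move=> m' /h2|by apply: h3; rewrite -M1].
  by rewrite -M1 ffunE i1E /= add0n.
have /choice [T TP] := H; exists T; split.
- by move=> w rw m; have [->//] := TP m.
- move=> m m' tn; have [_ /(_ m' tn)[le e] _] := TP m.
  move: le; rewrite leq_eqVlt => /orP[/eqP /e /tyM1_inj ->|lt]; [by left|right].
  have : (cget m 1 <= n)%N by rewrite -[leqRHS](sum_tyM1 m) (bigD1 i1)//= tyM1E i1E p2 leq_addr.
  by lia.
- by move=> m; have [] := TP m.
Qed.
End Tri.
End TypeIndex.

(** * Multiplication of forms by $\prod_i(t_i-z_p)$ *)

Section MultiplyOut.
Variables (C : numFieldType) (n p : nat) (zz : 'I_p.+1 -> C).
Hypothesis p2 : (2 <= p)%N.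
Local Notation L := 'I_p.+1.
Local Notation FF := {ffun 'I_n -> L}.
Implicit Types (s r : L) (M : {ffun L -> nat}) (m : Zc n p.-1) (f g : FF).
Local Notation lp := (ord_max : L).

(* [u_s(t) (t - z_p) = \sum_r Bco s r * u_r(t)], where [u_0 = 1] and [u_s(t) = 1/(t - z_s)] *)
Definition Bco s r : C := (if s == lp then (r == ord0)%:R
  else (r == ord0)%:R + (r == s)%:R * (zz s - zz lp)).
(** Coefficient of the single labelling [g] after multiplying out all forms of type [M]. By [Sm_ty]
    it depends on [g] only through its type, so the result is again a combination of the sums
    [Om]. *)
Definition Sm g M : C := \sum_(f : FF | ty f == M) \prod_o Bco (f o) (g o).

Lemma ty_perm_exists g g' : ty g = ty g' -> exists s : 'S_n, forall o, g' o = g (s o).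
Proof.
move=> e; have pe : perm_eq (fgraph g') (fgraph g).
  apply/allP => x _ /=; apply/eqP; move/ffunP: e => /(_ x); rewrite !ffunE => e.
  have cnt (h : FF) : count_mem x (fgraph h) = #|[set i | h i == x]|.
    rewrite -(codom_ffun h) -sum1_count /codom /image_mem big_map big_enum_cond -sum1_card /=.
    by apply: eq_bigl => i; rewrite inE.
  by rewrite !cnt e.
have /tuple_permP [s es] := pe.
have c : #|{: 'I_n}| = n by rewrite card_ord.
pose s' : 'I_n -> 'I_n := fun o => enum_val (s (enum_rank o)).
have si : injective s' by move=> a b /enum_val_inj /perm_inj /enum_rank_inj.
exists (perm si) => o; rewrite permE /s'.
have : tnth (fgraph g') (enum_rank o) = tnth (fgraph g) (s (enum_rank o)).
  by rewrite (tnth_nth (g o)) es -tnth_nth tnth_mktuple.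
by rewrite !tnth_fgraph enum_rankK.
Qed.

Lemma ty_permE f (s : 'S_n) : ty [ffun o => f (s o)] = ty f.
Proof.
apply/ffunP => x; rewrite !ffunE.
rewrite -(card_imset _ (@perm_inj _ s)); apply: eq_card => y.
rewrite inE; apply/imsetP/idP => [[u]|fx]; first by rewrite inE ffunE => + ->.
by exists ((s^-1)%g y); rewrite ?permKV// inE ffunE permKV.
Qed.

Lemma Sm_ty g g' M : ty g = ty g' -> Sm g M = Sm g' M.
Proof.
move=> /ty_perm_exists [s gs]; rewrite /Sm.
have hi : injective (fun f : FF => [ffun o => f (s o)] : FF).
  move=> f f' /ffunP e; apply/ffunP => o; have := e ((s^-1)%g o); by rewrite !ffunE permKV.
rewrite [RHS](reindex_inj hi) /=; apply: eq_big => [f|f _]; first by rewrite ty_permE.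
rewrite (reindex_inj (@perm_inj _ s)) /=; apply: eq_bigr => o _; by rewrite ffunE gs.
Qed.

Lemma Bco_neq0 s r : Bco s r != 0 -> r = ord0 \/ (r = s /\ s != lp).
Proof.
rewrite /Bco; have [->|r0] := eqVneq r ord0; first by left.
have [_|sp] := eqVneq s lp; first by rewrite eqxx.
rewrite add0r; have [->|] := eqVneq r s; first by right.
by rewrite mul0r eqxx.
Qed.

Definition fill0 g : FF := [ffun o => if g o == ord0 then lp else g o].

Lemma lp1 : ~~ (0 < lp < p)%N.
Proof. by rewrite /= ltnn andbF. Qed.

Lemma tyM_x (x : L) m : tyM x m x = cget m 1.
Proof. by rewrite ffunE eqxx. Qed.

(** Multiplication turns label [p] into 0 and lets any other label either survive or become 0. So
    the zeros of [g] include the positions where [f] has label [p], and equality of the two counts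
    determines [f] from [g]. *)
Lemma Sm_supp g m f : ty f = tyM lp m -> (forall o, Bco (f o) (g o) != 0) ->
  (forall o, [|| g o == ord0 | (1 < g o < p)%N && (g o == f o)]) /\ (cget m 1 <= ty g ord0)%N /\
  (cget m 1 = ty g ord0 -> f = fill0 g).
Proof.
move=> tf h.
have fo o : f o == lp \/ (1 < f o < p)%N.
  apply: contrapT => /not_orP [n1 n2].
  have : ty f (f o) = 0%N by rewrite tf ffunE (negbTE (introN idP n1)) (negbTE (introN idP n2)).
  by rewrite ffunE => /eqP; rewrite cards_eq0 => /eqP/setP/(_ o); rewrite !inE eqxx.
have go o : [|| g o == ord0 | (1 < g o < p)%N && (g o == f o)].
  case: (Bco_neq0 (h o)) => [->|[-> nl]]; first by rewrite eqxx.
  by case: (fo o) => [/eqP e|->]; [rewrite e eqxx in nl|rewrite eqxx orbT].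
have sub : [set o | f o == lp] \subset [set o | g o == ord0].
  apply/fintype.subsetP => o; rewrite !inE => /eqP e; have := go o; case: eqP => //= _ /andP[gp].
  by rewrite e => /eqP e2; move: gp; rewrite e2 /= ltnn andbF.
have c : cget m 1 = #|[set o | f o == lp]| by rewrite -(tyM_x lp m) -tf ffunE.
split=> //; split; first by rewrite c ffunE subset_leq_card.
rewrite c ffunE => ce; have /eqP E : [set o | f o == lp] == [set o | g o == ord0].
  by rewrite eqEcard sub ce leqnn.
apply/ffunP => o; rewrite ffunE; move/setP: E => /(_ o); rewrite !inE.
case: (g o =P ord0) => [_ /eqP//|g0 /eqP fl]; have := go o.
by move/eqP: g0 => /negbTE ->/= /andP[_ /eqP].
Qed.

Lemma tyM0_surj g : (forall o, (g o == ord0) || (1 < g o < p)%N) -> exists m, tyM ord0 m = ty g.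
Proof.
move=> h; pose M : {ffun L -> nat} := [ffun s => if s == i1 p then ty g ord0 else if s == ord0 then 0%N else ty g s].
have g0 s : s != ord0 -> ~~ (1 < s < p)%N -> ty g s = 0%N.
  move=> s0 sp; rewrite ffunE; apply/eqP; rewrite cards_eq0; apply/eqP/setP => o; rewrite !inE.
  by apply/negP => /eqP e; have := h o; rewrite e (negbTE s0) (negbTE sp).
have i10 : i1 p != ord0 by rewrite -val_eqE /= i1E.
have sM : supp M.
  move=> s sp; rewrite ffunE; case: eqP => [e|_]; first by rewrite e i1E ?p2 in sp.
  case: eqP => // /eqP s0; apply: g0 => //; apply: contraNN sp => /andP[s1 ->].
  by rewrite andbT ltnW.
have sumM : (\sum_s M s)%N = n.
  have tot : (\sum_s ty g s)%N = n.
    under eq_bigr do rewrite ffunE.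
    rewrite -[RHS](card_ord n) -sum1_card (partition_big g predT) //=.
    by apply: eq_bigr => s _; rewrite -sum1_card; apply: eq_bigl => o; rewrite inE.
  rewrite -[RHS]tot (bigD1 (i1 p))//= ffunE eqxx [RHS](bigD1 ord0)//=; congr (_ + _)%N.
  rewrite (bigD1 ord0) 1?eq_sym//= ffunE eq_sym (negbTE i10) eqxx add0n.
  rewrite [RHS](bigD1 (i1 p))//= g0 ?i1E//= add0n; apply: eq_big => [s|s /andP[s1 s0]]; first by rewrite andbC.
  by rewrite ffunE (negbTE s1) (negbTE s0).
have [m mM] := tyM1_surj p2 sM sumM; exists m; apply/ffunP => s; rewrite [LHS]ffunE.
have c (s' : nat) : (0 < s' < p)%N -> cget m s' = M (inord s').
  by move=> /andP[s0 sp]; rewrite -mM tyM1E// inordK ?s0 ?sp// ltnS ltnW.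
have [->|s0] := eqVneq s ord0; first by rewrite c ?p2// ffunE eqxx.
case: ifP => sp; last by rewrite g0 ?sp.
rewrite c; last by case/andP: sp => s1 ->; rewrite ltnW.
have -> : inord s = s by apply: val_inj; rewrite /= inordK.
rewrite ffunE (negbTE s0) ifN//; rewrite -val_eqE /= i1E//.
by apply: contraTN sp => /eqP ->.
Qed.

Lemma tyM_inj0 : injective (@tyM n p ord0).
Proof.
move=> m m' e; apply: cget_inj => s /andP[s0 sp].
have sp' : (s < p)%N by lia.
move/ffunP: e => e; have [->|s1] := eqVneq s 1%N; first by have := e ord0; rewrite !ffunE eqxx.
have s2 : (1 < s)%N by rewrite ltn_neqAle eq_sym s1.
have := e (inord s); rewrite !ffunE -val_eqE /= inordK ?s2 ?sp' ?(gtn_eqF s0)//.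
by rewrite ltnS ltnW.
Qed.

(** Triangularity in the number of zeros: no term has fewer zeros than there were labels [p], and
    the only term with equally many keeps every other label [s], each contributing $z_s-z_p$. *)
Lemma multiply_out : exists T : Zc n p.-1 -> Zc n p.-1 -> C,
  [/\ forall J Jb : FF -> C, (forall f, (forall o, f o != ord0) -> Jb f = \sum_(g : FF) (\prod_o Bco (f o) (g o)) * J g) ->
       forall m, Om Jb (tyM lp m) = \sum_m' T m m' * Om J (tyM ord0 m'),
      forall m m', T m m' != 0 -> m = m' \/ (cget m 1 < cget m' 1)%N &
      forall m, T m m = \prod_(s : L | (1 < s < p)%N) (zz s - zz lp) ^+ cget m s].
Proof.
pose dg m := \prod_(s : L | (1 < s < p)%N) (zz s - zz lp) ^+ cget m s.
(* The coefficient is read off at any labelling of the given type. The default branch already has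
   the right diagonal, which avoids exhibiting such a labelling. *)
pose T m m' := if [pick g : FF | ty g == tyM ord0 m'] is Some g then Sm g (tyM lp m) else
   if m == m' then dg m else 0.
have TE m m' g : ty g = tyM ord0 m' -> T m m' = Sm g (tyM lp m).
  move=> e; rewrite /T; case: pickP => [g' /eqP e'|/(_ g)]; last by rewrite e eqxx.
  by apply: Sm_ty; rewrite e e'.
have Sn0 g m : Sm g (tyM lp m) != 0 -> exists f, ty f = tyM lp m /\ forall o, Bco (f o) (g o) != 0.
  move=> h; apply: contrapT => hn; case/eqP: h; apply: big1 => f /eqP tf.
  apply/eqP; apply/negPn/negP => /prodf_neq0 h; apply: hn; exists f; split=> // o; exact: h.
have fill_ty g m : ty g = tyM ord0 m -> ty (fill0 g) = tyM lp m.
  move=> tg; apply/ffunP => s; rewrite [in LHS]ffunE.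
  have gs o : (g o == ord0) || (1 < g o < p)%N.
    apply/negPn/negP => hn; move/norP: hn => [n1 n2].
    have : ty g (g o) = 0%N by rewrite tg ffunE (negbTE n1) (negbTE n2).
    by rewrite ffunE => /eqP; rewrite cards_eq0 => /eqP/setP/(_ o); rewrite !inE eqxx.
  rewrite ffunE; case: eqP => [->|/eqP sl].
    rewrite -(tyM_x ord0 m) -tg ffunE; apply: eq_card => o; rewrite !inE ffunE.
    case: ifP => g0; first by rewrite eqxx.
    apply/negbTE; apply: contraL (gs o) => /eqP e; by rewrite e /= ltnn andbF orbF -val_eqE /=; lia.
  have [->|s0] := eqVneq s ord0.
    apply/eqP; rewrite /= cards_eq0; apply/eqP/setP => o; rewrite !inE ffunE.
    case: ifP => // _; rewrite -val_eqE /=; lia.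
  have := congr1 (fun M : {ffun L -> nat} => M s) tg; rewrite !ffunE (negbTE s0) => <-.
  apply: eq_card => o; rewrite !inE ffunE; case: ifP => // /eqP ->.
  by rewrite eq_sym (negbTE sl) eq_sym (negbTE s0).
exists T; split.
- move=> J Jb JbE m.
  have -> : Om Jb (tyM lp m) = \sum_(g : FF) Sm g (tyM lp m) * J g.
    rewrite /Om /Sm (eq_bigr (fun f : FF => \sum_(g : FF) (\prod_o Bco (f o) (g o)) * J g)); last first.
      move=> f /eqP tf; apply: JbE => o; apply/negP => /eqP e.
      have : ty f (f o) = 0%N.
        by rewrite tf e ffunE /= -val_eqE /= (_ : (0 == p)%N = false)//; case: p p2.
      by rewrite ffunE => /eqP; rewrite cards_eq0 => /eqP/setP/(_ o); rewrite !inE eqxx.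
    by rewrite exchange_big /=; apply: eq_bigr => g _; rewrite mulr_suml.
  rewrite (eq_bigr (fun m' => \sum_(g : FF | ty g == tyM ord0 m') Sm g (tyM lp m) * J g)); last first.
    by move=> m' _; rewrite /Om mulr_sumr; apply: eq_bigr => g /eqP e; rewrite (TE _ _ _ e).
  rewrite (exchange_big_dep predT)//=; apply: eq_bigr => g _.
  have [S0|/Sn0 [f [tf fB]]] := eqVneq (Sm g (tyM lp m)) 0.
    by rewrite S0 mul0r big1.
  have [h _] := Sm_supp tf fB.
  have [m0 e0] : exists m, tyM ord0 m = ty g.
    by apply: tyM0_surj => o; have := h o; case: eqP => //= _ /andP[].
  rewrite (big_pred1 m0)// => m' /=; rewrite -e0 (inj_eq (@tyM_inj0)) eq_sym //.
- move=> m m'; rewrite /T; case: pickP => [g /eqP tg /Sn0 [f [tf fB]]|_]; last first.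
    by have [->|_] := eqVneq m m'; [left|rewrite eqxx].
  have [_ [le e]] := Sm_supp tf fB; move: le e; rewrite tg tyM_x leq_eqVlt => /orP[/eqP ee|]; last by right.
  move=> /(_ ee) ff; left; apply: tyM_inj0; rewrite -tg.
  have := fill_ty _ _ tg; rewrite -ff tf => /ffunP h; rewrite tg; apply/ffunP => s.
  have := h s; rewrite !ffunE; case: (s =P ord0) => [-> _|_]; first by rewrite ee.
  by case: (s =P lp) => [->|//]; rewrite /= ltnn andbF.
- move=> m; rewrite /T; case: pickP => [g /eqP tg|_]; last by rewrite eqxx.
  have tf0 := fill_ty _ _ tg.
  rewrite /Sm (bigD1 (fill0 g)) /= ?tf0// [X in _ + X]big1 ?addr0; last first.
    move=> f /andP[/eqP tf fg]; apply/eqP; apply/negPn/negP => /prodf_neq0 h.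
    have [_ [_ e]] := Sm_supp tf (fun o => h o isT).
    by case/eqP: fg; apply: e; rewrite tg tyM_x.
  rewrite (eq_bigr (fun o => if g o == ord0 then 1 else zz (g o) - zz lp)); last first.
    move=> o _; rewrite ffunE /Bco; have [->|g0] := eqVneq (g o) ord0; first by rewrite !eqxx.
    have [e|_] := eqVneq (g o) lp; last by rewrite eqxx mul1r add0r.
    by rewrite e subrr.
  rewrite (partition_big g predT)//= (bigID (fun s : L => (1 < s < p)%N)) /= [X in _ * X]big1 ?mulr1.
    apply: eq_bigr => s /andP[s1 sp]; rewrite (eq_bigr (fun=> zz s - zz lp)); last first.
      by move=> o /eqP ->; rewrite -val_eqE /= gtn_eqF// ltnW.
    rewrite prodr_const; congr (_ ^+ _).
    have := congr1 (fun M : {ffun L -> nat} => M s) tg; rewrite !ffunE s1 sp -val_eqE /= gtn_eqF 1?ltnW// => <-.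
    by apply: eq_card => o; rewrite inE.
  move=> s sp; rewrite big1// => o /eqP e; case: eqP => // /eqP g0.
  have : ty g (g o) = 0%N by rewrite tg ffunE (negbTE g0) e (negbTE sp).
  by rewrite ffunE => /eqP; rewrite cards_eq0 => /eqP/setP/(_ o); rewrite !inE eqxx.
Qed.
End MultiplyOut.

(** * Comparison of the determinants for $\alpha$ and $\alpha+e_p$ *)

Section Shift.
Context {R : realType}.
Variables (p n : nat) (z : nat -> R) (gam : R[i]).
Local Notation E := (envT R).
Local Notation L := 'I_p.+1.
Local Notation FF := {ffun 'I_n -> L}.
Local Notation lp := (ord_max : L).
Hypothesis p2 : (2 <= p)%N.
Hypothesis zlt : forall s, (1 <= s < p)%N -> z s < z s.+1.
Hypothesis gam0 : 0 < ReC gam.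
Implicit Types (al : nat -> R[i]) (b : nat -> nat) (M : {ffun L -> nat}).

(* The normalization [NM] makes the coefficients of the relations between the integrals
   independent of the numbers of variables carrying each label. *)
Definition qf al (s k : nat) : R[i] :=
  if s == 0%N then 1 + \sum_(s <- iota 1 p) al s + (2 * n - 2 - k)%:R * gam else al s + k%:R * gam.
Definition qN al (s j : nat) : R[i] := \prod_(0 <= k < j) (k.+1%:R * qf al s k).
Definition NM al M : R[i] := \prod_(s : L) qN al s (M s).
Definition wN al b M : R[i] := NM al M * OmJ n z gam al b M.

Lemma NM_add al M s : NM al (addM M s) = NM al M * ((M s).+1%:R * qf al s (M s)).
Proof.
rewrite /NM (bigD1 s)//= ffunE eqxx addn1 /qN big_nat_recr//= [in RHS](bigD1 s)//=.
rewrite (eq_bigr (fun i : L => \prod_(0 <= k < M i) (k.+1%:R * qf al i k))); last first.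
  by move=> i /negbTE h; rewrite ffunE h addn0.
ring.
Qed.

Lemma qf_neq0 al s k : posal p al -> (s <= p)%N -> qf al s k != 0.
Proof.
move=> pa sp; apply: Re_neq0; rewrite /qf; case: eqP => [_|/eqP s0].
  rewrite !ReCD ReC_natM; apply: ltr_wpDr; first by rewrite mulr_ge0// ltW.
  apply: ltr_wpDr; last by rewrite /ReC /= ltr01.
  have -> : ReC (\sum_(s <- iota 1 p) al s) = \sum_(s <- iota 1 p) ReC (al s).
    by elim: (iota 1 p) => [|x r IH]; rewrite ?big_nil// !big_cons ReCD IH.
  rewrite big_seq; apply: sumr_ge0 => i; rewrite mem_iota => ip; apply: ltW; apply: pa; lia.
rewrite ReCD ReC_natM; apply: ltr_wpDr; first by rewrite mulr_ge0// ltW.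
by apply: pa; lia.
Qed.

Lemma qN_neq0 al s j : posal p al -> (s <= p)%N -> qN al s j != 0.
Proof.
move=> pa sp; rewrite /qN big_mkord; apply/prodf_neq0 => k _; rewrite mulf_neq0 ?pnatr_eq0//.
exact: qf_neq0.
Qed.

(** The coefficient of each term is the ratio of the normalizations before and after one label is
    added, so that multiplying through leaves only the constants $z_s-z_c$. This is what makes the
    elimination of labels uniform. *)
Lemma wN_rel al b c M : posal p al -> okb p n b -> (1 <= c <= p)%N -> (\sum_s M s).+1 = n ->
  wN al b (addM M ord0) + \sum_(s : L | s != ord0) ((z s)%:C - (z c)%:C) * wN al b (addM M s) = 0.
Proof.
move=> pa ob cp Mn; have := rel_c p2 zlt gam0 pa ob cp Mn => /(congr1 (fun x => NM al M * x)).
rewrite mulr0 => h; rewrite -[RHS]h mulrDr mulr_sumr; congr (_ + _).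
  by rewrite /wN NM_add /qf /=; ring.
apply: eq_bigr => s s0; rewrite /wN NM_add /qf (_ : (s == 0%N :> nat) = false); last exact: negbTE.
ring.
Qed.

Lemma ord_split (V : zmodType) (G : L -> V) :
  \sum_(s : L | s != ord0) G s = \sum_(s : L | (0 < s < p)%N) G s + G lp.
Proof.
rewrite (bigD1 lp) /=; last by rewrite -val_eqE /=; case: p p2.
rewrite addrC; congr (_ + _); apply: eq_bigl => s; rewrite -!val_eqE /=.
by have := ltn_ord s; lia.
Qed.

(** The choice $c=p$ makes the coefficient of label [p] zero, so label 0 is expressed by labels
    $1,\dots,p-1$ alone. *)
Lemma relw0 al b : posal p al -> okb p n b ->
  relw n ord0 (fun s : L => (z p)%:C - (z s)%:C) (wN al b).
Proof.
move=> pa ob M Mn; have pp : (1 <= p <= p)%N by rewrite leqnn ltnW.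
have := wN_rel pa ob pp Mn; rewrite ord_split /= subrr mul0r addr0 => /eqP.
rewrite addr_eq0 => /eqP ->; rewrite -sumrN; apply: eq_bigr => s _.
by rewrite -mulNr opprB.
Qed.

(** Subtracting the relations for $c=p$ and $c=1$ cancels label 0 and leaves $(z_p-z_1)$ times the
    plain sum over nonzero labels. *)
Lemma relwp al b : posal p al -> okb p n b ->
  relw n lp (fun s : L => -1) (wN al b).
Proof.
move=> pa ob M Mn; have pp : (1 <= p <= p)%N by rewrite leqnn ltnW.
have p1 : (1 <= 1 <= p)%N := ltnW p2.
have h1 := wN_rel pa ob pp Mn; have h2 := wN_rel pa ob p1 Mn.
have : \sum_(s : L | s != ord0) wN al b (addM M s) = 0.
  have zz : (z p)%:C - (z 1%N)%:C != 0 :> R[i].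
    rewrite -rmorphB eq_complex /= eqxx andbT subr_eq0 gt_eqF//.
    exact: (z_lt p2 zlt (ltnSn 0) p2 (leqnn p)).
  apply: (mulfI zz); rewrite mulr0 mulr_sumr.
  apply: (etrans _ (etrans (congr2 (fun x y => x - y) h2 h1) (subrr 0))).
  rewrite opprD addrACA subrr add0r -sumrB; apply: eq_bigr => s _; ring.
rewrite ord_split => /eqP; rewrite addrC addr_eq0 => /eqP ->.
by rewrite -sumrN; apply: eq_bigr => s _; rewrite mulN1r.
Qed.

Definition shp al (k : nat) : nat -> R[i] := fun s => if s == p then al s + k%:R else al s.

Lemma posal_shp al k : posal p al -> posal p (shp al k).
Proof.
move=> pa s sp; rewrite /shp; case: eqP => _; last exact: pa.
by rewrite ReCD natC /ReC /= ltr_wpDr// ?ler0n//; exact: pa.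
Qed.

Lemma col_shp al k x : col p z (shp al k) x = col p z al x * ((x - z p)%:C) ^+ k.
Proof.
rewrite /col (bigD1_seq p) ?iota_uniq ?mem_iota//=; last by lia.
rewrite [in RHS](bigD1_seq p) ?iota_uniq ?mem_iota//=; last by lia.
rewrite {1}/shp eqxx cpowDn [RHS]mulrAC; congr (_ * _).
by apply: eq_bigr => s /negbTE sp; rewrite /shp sp.
Qed.

Lemma Jf_shp al b (f : FF) : posal p al -> okb p n b -> (forall o, f o != ord0) ->
  Jf z gam (shp al 1) b f =
  \sum_(g : FF) (\prod_o Bco (fun s : L => (z s)%:C) (f o) (g o)) * Jf z gam al b g.
Proof.
move=> pa ob f0; rewrite /Jf /J.
have iJ (g : FF) := term_int p2 zlt gam0 pa ob (okF_lab g).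
under [RHS]eq_bigr => g _ do rewrite -(CIZ _ (iJ g)).
rewrite -CI_sum; last by move=> g _; exact: CintegrableZ (iJ g).
congr (CI _ _); apply/funext => t; rewrite /cut; case: asboolP => _; last first.
  by rewrite big1// => g _; rewrite mulr0.
rewrite /term big_sq.
rewrite [RHS](eq_bigr (fun g : FF => \prod_o (Bco (fun s : L => (z s)%:C) (f o) (g o) * uu z (g o) (t o.+1) *
   col p z al (t o.+1)) * prs n gam t)); last first.
  move=> g _; rewrite big_sq mulrA -big_split; congr (_ * _).
  by apply: eq_bigr => o _; rewrite labE; exact: mulrA.
rewrite -mulr_suml; congr (_ * _).
rewrite -(bigA_distr_bigA (fun o r => Bco (fun s : L => (z s)%:C) (f o) r * uu z r (t o.+1) * col p z al (t o.+1))).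
apply: eq_bigr => o _; rewrite -mulr_suml labE col_shp expr1.
(* Off the zeros of [col] the variable avoids every $z_s$, so the partial fractions have invertible
   denominators. *)
have [e|ne] := eqVneq (col p z al (t o.+1)) 0; first by rewrite e mul0r !mulr0.
rewrite mulrCA mulrC; congr (_ * _); set s := f o.
have s0 : s != ord0 by exact: f0.
have sp : (1 <= s <= p)%N by rewrite lt0n s0 -ltnS ltn_ord.
have ns : (t o.+1)%:C - (z s)%:C != 0 :> R[i].
  rewrite -rmorphB eq_complex /= eqxx andbT subr_eq0; apply: contraNneq ne => e.
  by rewrite (col_eq0 al sp e).
rewrite /Bco (bigD1 ord0) //= ?eqxx /uu /= ?mulr1 rmorphB /=.
rewrite (_ : (s == 0%N :> nat) = false); last exact: negbTE.
have [sl|sl] := eqVneq s lp.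
  rewrite big1 ?addr0; last by move=> r /negbTE ->; rewrite mul0r.
  by rewrite rmorphB; rewrite sl in ns *; rewrite /= in ns *; rewrite mulVf.
rewrite (bigD1 s)//= eqxx big1 ?addr0; last first.
  by move=> r /andP[/negbTE -> /negbTE ->]; rewrite mul0r addr0 mul0r.
rewrite (negbTE s0) (_ : (s == 0%N :> nat) = false); last exact: negbTE.
rewrite eq_sym (negbTE s0) mul0r addr0 mul1r add0r rmorphB /=.
by field.
Qed.

Section Determinant.
Variable bl : Zc n p.-1 -> nat -> nat.
Hypothesis obl : forall l, okb p n (bl l).
Definition DO al (x : L) : R[i] := \det (fmx (fun l m => OmJ n z gam al (bl l) (tyM x m))).
Definition Dal al : R[i] := DO al (i1 p).

Lemma DO_change al (x : L) (c : L -> R[i]) : posal p al -> ~~ (0 < x < p)%N ->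
  (forall b, okb p n b -> relw n x c (wN al b)) ->
  (\prod_(m : Zc n p.-1) NM al (tyM x m)) * DO al x =
  (\prod_(m : Zc n p.-1) c (i1 p) ^+ cget m 1) * ((\prod_(m : Zc n p.-1) NM al (tyM (i1 p) m)) * Dal al).
Proof.
move=> pa x1 rw; have [T [h1 h2 h3]] := @tri_tyM n p p2 _ x c x1.
rewrite /DO -(@det_colscale _ _ (fun l m => wN al (bl l) (tyM x m))); last by [].
rewrite /Dal /DO -(@det_colscale _ _ (fun l m => wN al (bl l) (tyM (i1 p) m))); last by [].
rewrite (det_change h2 (B := fun l m => wN al (bl l) (tyM (i1 p) m))); last first.
  by move=> l m; rewrite (h1 _ (rw _ (obl l))).
by congr (_ * _); apply: eq_bigr => m _.
Qed.

Lemma NM_tyM al (x : L) m : ~~ (1 < x < p)%N ->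
  NM al (tyM x m) = qN al x (cget m 1) * \prod_(s : L | (1 < s < p)%N) qN al s (@cget n p.-1 m s).
Proof.
move=> x1; rewrite /NM (bigD1 x)//= ffunE eqxx; congr (_ * _).
rewrite [RHS]big_mkcond [in RHS](bigD1 x)//= (negbTE x1) mul1r; apply: eq_bigr => s /negbTE sx.
by rewrite ffunE sx; case: ifP => // _; rewrite /qN big_nil.
Qed.

Definition qP al (s j : nat) : R[i] := \prod_(0 <= k < j) qf al s k.

Lemma qNE al s j : qN al s j = (\prod_(0 <= k < j) k.+1%:R) * qP al s j.
Proof. by rewrite /qN /qP big_split. Qed.

(** The normalizations of the labels from 2 to $p-1$ and the factorials are the same on both sides
    and cancel; only the factors of the exchanged label remain. *)
Lemma DO_ratio al (x : L) (c : L -> R[i]) : posal p al -> ~~ (0 < x < p)%N ->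
  (forall b, okb p n b -> relw n x c (wN al b)) ->
  (\prod_(m : Zc n p.-1) qP al x (cget m 1)) * DO al x =
  (\prod_(m : Zc n p.-1) (c (i1 p) ^+ cget m 1 * qP al 1 (cget m 1))) * Dal al.
Proof.
move=> pa x1 rw; have := DO_change pa x1 rw.
have x2 : ~~ (1 < x < p)%N by apply: contraNN x1 => /andP[h ->]; rewrite ltnW.
have i2 : ~~ (1 < i1 p < p)%N by rewrite i1E.
pose rest (m : Zc n p.-1) := (\prod_(0 <= k < cget m 1) k.+1%:R) *
   \prod_(s : L | (1 < s < p)%N) qN al s (cget m s).
under eq_bigr => m _ do rewrite (NM_tyM _ _ x2) qNE mulrAC -/(rest m).
under [X in _ = _ * (X * _)]eq_bigr => m _ do rewrite (NM_tyM _ _ i2) qNE mulrAC -/(rest m).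
have r0 : \prod_(m : Zc n p.-1) rest m != 0.
  apply/prodf_neq0 => m _; rewrite mulf_neq0//.
    by rewrite big_mkord; apply/prodf_neq0 => k _; rewrite pnatr_eq0.
  by apply/prodf_neq0 => s _; apply: qN_neq0 => //; rewrite -ltnS.
clearbody rest; rewrite !big_split /= i1E// -!mulrA => h; apply: (mulfI r0); rewrite h; ring.
Qed.

(** Three comparisons are chained: label 0 with label 1 at $\alpha$ ([h0]), label [p] at
    $\alpha+e_p$ with label 0 at $\alpha$ ([hT]), and label [p] with label 1 at $\alpha+e_p$ ([hp]).
    The products of the $z_p-z_1$ and signs from [h0] and [hp] complete the diagonal of [hT] to all
    $z_s-z_p$. *)
Theorem shift_relation al : posal p al ->
  (\prod_(m : Zc n p.-1) \prod_(0 <= k < cget m 1) (1 + \sum_(s <- iota 1 p) al s + (2 * n - 2 - k)%:R * gam)) * Dal (shp al 1) =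
  (\prod_(m : Zc n p.-1) (\prod_(0 <= k < cget m 1) (1 + al p + k%:R * gam) *
     \prod_(1 <= s < p) ((z s)%:C - (z p)%:C) ^+ cget m s)) * Dal al.
Proof.
move=> pa; have pb := posal_shp 1 pa.
have l0 : ~~ (0 < (ord0 : L) < p)%N by [].
have h0 := DO_ratio pa l0 (fun b ob => relw0 pa ob).
have hp := DO_ratio pb (lp1 p) (fun b ob => relwp pb ob).
have [T [t1 t2 t3]] := @multiply_out R[i] n p (fun s : L => (z s)%:C) p2.
have hT : DO (shp al 1) lp = (\prod_(m : Zc n p.-1) T m m) * DO al ord0.
  rewrite /DO -(det_change t2 (A := fun l m => OmJ n z gam (shp al 1) (bl l) (tyM lp m)))// => l m.
  by apply: t1 => f f0; exact: Jf_shp.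
have q1 (m : Zc n p.-1) : qP (shp al 1) 1 (cget m 1) = qP al 1 (cget m 1).
  by apply: eq_bigr => k _; rewrite /qf /= /shp ltn_eqF.
have qp (m : Zc n p.-1) : qP (shp al 1) p (cget m 1) = \prod_(0 <= k < cget m 1) (1 + al p + k%:R * gam).
  by apply: eq_bigr => k _; rewrite /qf /shp eqxx gtn_eqF 1?ltnW// [1 + _]addrC.
have Q1 : \prod_(m : Zc n p.-1) qP al 1 (cget m 1) != 0.
  apply/prodf_neq0 => m _; rewrite /qP big_mkord; apply/prodf_neq0 => k _.
  by apply: qf_neq0 => //; rewrite ltnW.
apply: (mulfI Q1); move: h0 hp; rewrite hT !big_split /= i1E//.
rewrite (eq_bigr _ (fun m _ => q1 m)) (eq_bigr _ (fun m _ => qp m)).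
have -> : \prod_(m : Zc n p.-1) \prod_(0 <= k < cget m 1)
    (1 + \sum_(s <- iota 1 p) al s + (2 * n - 2 - k)%:R * gam) = \prod_(m : Zc n p.-1) qP al 0 (cget m 1).
  by apply: eq_bigr.
have ee : (\prod_(m : Zc n p.-1) (-1) ^+ cget m 1) * (\prod_(m : Zc n p.-1) (-1) ^+ cget m 1) = 1 :> R[i].
  by rewrite -big_split big1// => m _ /=; rewrite -exprMn mulrNN mulr1 expr1n.
have -> : \prod_(m : Zc n p.-1) \prod_(1 <= s < p) ((z s)%:C - (z p)%:C) ^+ cget m s =
  (\prod_(m : Zc n p.-1) (-1) ^+ cget m 1) * (\prod_(m : Zc n p.-1) ((z p)%:C - (z 1%N)%:C) ^+ cget m 1) *
  \prod_(m : Zc n p.-1) T m m.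
  rewrite -!big_split; apply: eq_bigr => m _ /=.
  rewrite -exprMn mulN1r opprB t3 big_ltn//; congr (_ * _).
  rewrite -(big_mkord (fun s => (1 < s < p)%N) (fun s => ((z s)%:C - (z p)%:C) ^+ cget m s)).
  have p1 : (1 < p.+1)%N by rewrite ltnS ltnW.
  rewrite [RHS]big_mkcond [RHS]big_ltn //= mul1r (big_ltn p1) /= mul1r big_nat_recr //= ltnn andbF mulr1.
  by rewrite !big_nat; apply: eq_bigr => i ->.
move: (\prod_(m : Zc n p.-1) (-1) ^+ cget m 1) ee (\prod_(m : Zc n p.-1) qP al 1 (cget m 1)) Q1
 (\prod_(m : Zc n p.-1) ((z p)%:C - (z 1%N)%:C) ^+ cget m 1) (\prod_(m : Zc n p.-1) T m m) {hT}
 (\prod_(m : Zc n p.-1) qP al 0 (cget m 1))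
 (\prod_(m : Zc n p.-1) \prod_(0 <= k < cget m 1) (1 + al p + k%:R * gam)) (DO al ord0) (Dal al) (Dal (shp al 1)).
move=> e ee q _ Z1 T0 Q0 B X D D' h0 hp.
have -> : q * (Q0 * D') = e * Q0 * (e * q * D') - (e * e - 1) * (Q0 * q * D') by ring.
rewrite -hp; have -> : q * (B * (e * Z1 * T0) * D) = e * B * T0 * (Z1 * q * D) by ring.
rewrite -h0 ee; ring.
Qed.
End Determinant.
End Shift.

Lemma pdom_weaken {R : realType} s (f : envT R -> R[i]) C (g g' : nat -> R -> R) :
  0 <= C -> (forall j x, g j x <= g' j x) ->
  (forall j, (@lebesgue_measure R).-integrable setT (EFin \o g' j)) -> pdom s f C g -> pdom s f C g'.
Proof.
move=> C0 gg ig' [mf g0 ig fg]; split => //.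
  by move=> j x; apply: le_trans (gg j x).
move=> t; apply: (le_trans (fg t)); rewrite ler_wpM2l//; apply: ler_prod => j _.
by rewrite g0 gg.
Qed.

Lemma pdom_sum {R : realType} s (I : Type) (r : seq I) (P : pred I) (f : I -> envT R -> R[i]) C (g : nat -> R -> R) :
  (forall j x, 0 <= g j x) -> (forall j, (@lebesgue_measure R).-integrable setT (EFin \o g j)) ->
  (forall i, P i -> pdom s (f i) (C i) g) ->
  pdom s (fun t => \sum_(i <- r | P i) f i t) (\sum_(i <- r | P i) C i) g.
Proof.
move=> g0 ig h; split => //.
  by apply: cmeas_sum => i Pi; have [] := h i Pi.
move=> t; rewrite mulr_suml; elim: r => [|i r IH]; first by rewrite !big_nil nc0.
rewrite !big_cons; case Pi: (P i) => //; apply: (le_trans (ncD _ _)); apply: lerD => //.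
by have [_ _ _] := h i Pi; exact.
Qed.

(** * The period matrix *)

Section CountTypes.
Variables (n p : nat).
Local Notation L := 'I_p.+1.
Local Notation FF := {ffun 'I_n -> L}.
Implicit Types (f : FF) (s : L) (M : {ffun L -> nat}).

Definition Mfact M : nat := \prod_s (M s)`!.

Lemma Mfact_add M s : Mfact (addM M s) = ((M s).+1 * Mfact M)%N.
Proof.
rewrite /Mfact (bigD1 s)//= [in RHS](bigD1 s)//= ffunE eqxx addn1 factS mulnA.
by congr (_ * _)%N; apply: eq_bigr => x /negbTE h; rewrite ffunE h addn0.
Qed.

Lemma sum_ty f : (\sum_s ty f s)%N = n.
Proof.
under eq_bigr do rewrite ffunE.
rewrite -[RHS](card_ord n) -sum1_card (partition_big f predT) //=.
by apply: eq_bigr => s _; rewrite -sum1_card; apply: eq_bigl => o; rewrite inE.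
Qed.

(** The multinomial count. Moving one position from label [s] to label 0 leaves the product of the
    class size and the factorials unchanged, down to the type with label 0 everywhere. *)
Lemma card_ty (C : numFieldType) M : (\sum_s M s)%N = n ->
  (Mfact M)%:R * Om (fun f : FF => 1 : C) M = (n`!)%:R.
Proof.
move=> Mn; pose h M := (Mfact M)%:R * Om (fun f : FF => 1 : C) M.
have hS M' s : h (addM M' s) = h (addM M' ord0).
  have e x : (M' x).+1%:R * Om (fun f : FF => 1 : C) (addM M' x) =
      \sum_(i < n) \sum_(f : FF | (f i == ord0) && (ty f == addM M' ord0)) 1.
    by rewrite (sum_fset (fun=> fun=> 1) x M') sum_count ffunE eqxx addn1.
  by rewrite /h !Mfact_add !natrM mulrAC e [RHS]mulrAC e.
have [k] : exists k, (n - M ord0 <= k)%N by exists (n - M ord0)%N.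
elim: k M Mn => [|k IH] M Mn Mk.
  have M0 : M ord0 = n by apply/eqP; rewrite eqn_leq -[X in (_ <= X)%N]Mn (bigD1 ord0)//= leq_addr /=; lia.
  have Ms s : s != ord0 -> M s = 0%N.
    move=> s0; apply/eqP; rewrite -leqn0 -(leq_add2l n) addn0 -{1}M0 -[leqRHS]Mn.
    by rewrite (bigD1 ord0)//= (bigD1 s)//= addnA leq_addr.
  rewrite /Mfact (bigD1 ord0)//= M0 big1 ?muln1; last by move=> s /Ms ->.
  rewrite /Om (big_pred1 [ffun=> ord0]) ?mulr1// => f /=; apply/eqP/eqP => [e|->].
    apply/ffunP => o; rewrite ffunE; apply/eqP/negPn/negP => fo.
    have := Ms _ fo; rewrite -e ffunE => /eqP; rewrite cards_eq0 => /eqP/setP/(_ o).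
    by rewrite !inE eqxx.
  apply/ffunP => s; rewrite ffunE; have [->|s0] := eqVneq s ord0.
    rewrite M0 -[RHS](card_ord n) -cardsT; congr #|pred_of_set _|; apply/setP => o.
    by rewrite !inE ffunE.
  rewrite Ms//; apply/eqP; rewrite cards_eq0; apply/eqP/setP => o; rewrite !inE ffunE.
  by rewrite eq_sym (negbTE s0).
have [nk|nk] := leqP (n - M ord0)%N k; first exact: IH.
have [s s0 Ms] : exists2 s, s != ord0 & (0 < M s)%N.
  apply: contrapT => hn; have : (\sum_s M s)%N = M ord0.
    rewrite (bigD1 ord0)//= big1 ?addn0// => s s0; apply/eqP; rewrite -leqn0 leqNgt.
    by apply/negP => Ms; apply: hn; exists s.
  by rewrite Mn; lia.
pose M' : {ffun L -> nat} := [ffun x => (M x - (x == s))%N].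
have MM' : M = addM M' s.
  by apply/ffunP => x; rewrite !ffunE; have [->|_] := eqVneq x s; rewrite ?subn0 ?addn0 ?subnK.
have /= hs := hS M' s; rewrite -MM' /h in hs; rewrite hs; apply: IH.
  by move: Mn; rewrite MM' !sum_addM.
by rewrite !ffunE /= eq_sym (negbTE s0) subn0; lia.
Qed.

(** The sum over permutations is the same for every labelling of the class. Summing it over the
    class and exchanging the sums gives $n!$ times [Om G], and [card_ty] supplies the class size. *)
Lemma sum_perm_ty (C : numFieldType) (G : FF -> C) f0 :
  \sum_(s : 'S_n) G [ffun o => f0 (s o)] = (Mfact (ty f0))%:R * Om G (ty f0).
Proof.
pose S (f : FF) := \sum_(s : 'S_n) G [ffun o => f (s o)].
have Sty f f' : ty f = ty f' -> S f = S f'.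
  move=> /ty_perm_exists [s fs]; rewrite /S [LHS](reindex_inj (mulIg s)) /=.
  apply: eq_bigr => u _; congr G; apply/ffunP => o; by rewrite !ffunE permM fs.
have n0 : (n`!)%:R != 0 :> C by rewrite pnatr_eq0 -lt0n fact_gt0.
apply: (mulfI n0).
have e1 : \sum_(f : FF | ty f == ty f0) S f = Om (fun f : FF => 1 : C) (ty f0) * S f0.
  by rewrite /Om mulr_suml; apply: eq_bigr => f /eqP e; rewrite mul1r; exact: Sty.
have e2 : \sum_(f : FF | ty f == ty f0) S f = (n`!)%:R * Om G (ty f0).
  rewrite /S exchange_big /= (eq_bigr (fun=> Om G (ty f0))).
    by rewrite sumr_const mulr_natl; congr (_ *+ _); rewrite -card_Sn; apply: eq_card.
  move=> s _; rewrite /Om.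
  have hi : injective (fun f : FF => [ffun o => f (s o)] : FF).
    move=> f f' /ffunP e; apply/ffunP => o; have := e ((s^-1)%g o); by rewrite !ffunE permKV.
  by rewrite [RHS](reindex_inj hi) /=; apply: eq_big => [f|f _//]; rewrite ty_permE.
rewrite mulrCA -e2 e1 mulrA card_ty ?sum_ty//.
Qed.
End CountTypes.

(** * The matrix of the statement in terms of labellings *)

Section Link.
Context {R : realType}.
Variables (p n : nat) (z : nat -> R) (gam : R[i]) (al : nat -> R[i]).
Local Notation E := (envT R).
Local Notation L := 'I_p.+1.
Local Notation FF := {ffun 'I_n -> L}.
Hypothesis p2 : (2 <= p)%N.
Hypothesis zlt : forall s, (1 <= s < p)%N -> z s < z s.+1.
Hypothesis gam0 : 0 < ReC gam.
Hypothesis pa : posal p al.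
Implicit Types (l m : Zc n p.-1).

(** The block of the composition containing position [j], as a count of the blocks that end before
    [j]; in this form it is defined for every [j] and visibly monotone. *)
Definition blk l (j : nat) : nat := (\sum_(1 <= s < p) (lsum l s < j)).+1.

Lemma lsumS l s : lsum l s.+1 = (lsum l s + cget l s.+1)%N.
Proof. by rewrite /lsum big_nat_recr. Qed.
Lemma lsum0 l : lsum l 0 = 0%N.
Proof. by rewrite /lsum big_geq. Qed.
Lemma lsum_mono l s s' : (s <= s')%N -> (lsum l s <= lsum l s')%N.
Proof.
move=> /subnKC <-; elim: (s' - s)%N => [|d IH]; first by rewrite addn0.
by rewrite addnS lsumS; apply: leq_trans IH (leq_addr _ _).
Qed.
Lemma lsum_n l : lsum l p.-1 = n.
Proof. exact: sum_cget. Qed.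

Lemma blkE l j s : (1 <= s < p)%N -> (lsum l s.-1 < j <= lsum l s)%N -> blk l j = s.
Proof.
case: s => // s /andP[_ sp] /andP[/= h1 h2]; rewrite /blk (@big_cat_nat _ _ _ s.+1)//=; last exact: ltnW.
rewrite [X in (_ + X)%N]big1_seq ?addn0; last first.
  move=> r /=; rewrite mem_index_iota => /andP[rs rp]; apply/eqP; rewrite eqb0 -leqNgt.
  by apply: leq_trans h2 (lsum_mono _ _).
rewrite (eq_big_nat _ _ (F2 := fun=> 1%N)).
  by rewrite sum_nat_const_nat muln1 subn1.
by move=> r /andP[r1 rs]; rewrite (leq_ltn_trans _ h1)//; apply: lsum_mono.
Qed.

Lemma blkP l j : (1 <= j <= n)%N -> (1 <= blk l j < p)%N /\ (lsum l (blk l j).-1 < j <= lsum l (blk l j))%N.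
Proof.
move=> /andP[j1 jn]; have ex : exists s, (j <= lsum l s)%N by exists p.-1; rewrite lsum_n.
case: (ex_minnP ex) => s js smin.
have s0 : (0 < s)%N by case: s js {smin} => //; rewrite lsum0; lia.
have sp : (s < p)%N by have := smin p.-1; rewrite lsum_n jn => /(_ isT); lia.
have ls : (lsum l s.-1 < j)%N by rewrite ltnNge; apply/negP => /smin; lia.
by rewrite (@blkE l j s) ?s0 ?sp ?ls ?js.
Qed.

Lemma okb_blk l : okb p n (blk l).
Proof. by move=> j; rewrite mem_sq => /(blkP l) []. Qed.

Lemma blk_cond l j s : (1 <= j <= n)%N -> (1 <= s < p)%N ->
  (lsum l s.-1 < j <= lsum l s)%N = (blk l j == s).
Proof.
move=> jn sp; apply/idP/eqP => [|<-]; first exact: blkE.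
by have [] := blkP l jn.
Qed.

Lemma blk_mono l j k : (j <= k)%N -> (blk l j <= blk l k)%N.
Proof.
move=> jk; rewrite /blk ltnS; apply: leq_sum => s _.
have : (lsum l s < j)%N -> (lsum l s < k)%N by move=> h; exact: leq_trans h jk.
by case: (lsum l s < j)%N => // ->.
Qed.

(** The statement only compares neighbours inside a block and bounds the first and last variable of
    each. The bounds for the others follow by chaining, and the order across blocks from that of the
    $z_s$. *)
Lemma Ucell_cell l : Ucell p n z l = cell n z (blk l) :> set E.
Proof.
apply/seteqP; split => t; last first.
  move=> [h1 h2] s sp j js.
  have sp' : (1 <= s < p)%N by lia.
  have jn : (1 <= j <= n)%N.
    have : (lsum l s <= n)%N by rewrite -[leqRHS](lsum_n l); apply: lsum_mono; lia.
    by lia.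
  have /andP[a b] := h1 j (eq_trans (mem_sq n j) jn).
  rewrite (blkE sp' js) in a b; split=> [_//|]; split=> [_//|jl].
  apply: h2; rewrite ?mem_sq//.
  have : (lsum l s <= n)%N by rewrite -[leqRHS](lsum_n l); apply: lsum_mono; lia.
  by lia.
move=> h.
have step j s : (1 <= s < p)%N -> (lsum l s.-1 < j <= lsum l s)%N ->
   (j = (lsum l s.-1).+1 -> z s <= t j)%R /\ (j = lsum l s -> t j <= z s.+1)%R /\
       ((j < lsum l s)%N -> t j <= t j.+1)%R.
  by move=> sp js; apply: h => //; lia.
have inb s : (1 <= s < p)%N -> forall d j, (lsum l s.-1 < j)%N -> (j + d <= lsum l s)%N -> t j <= t (j + d)%N.
  move=> sp; elim=> [|d IH] j j1 jd; first by rewrite addn0.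
  apply: (le_trans (IH j j1 _)); first by lia.
  have jb : (lsum l s.-1 < j + d <= lsum l s)%N by lia.
  by rewrite addnS; have [_ [_ h3]] := step (j + d)%N s sp jb; apply: h3; lia.
have rng j : (1 <= j <= n)%N -> z (blk l j) <= t j <= z (blk l j).+1.
  move=> jn; have [bp jb] := blkP l jn; move: jb bp; set s := blk l j => /andP[j1 j2] sp.
  apply/andP; split.
    have fb : (lsum l s.-1 < (lsum l s.-1).+1 <= lsum l s)%N by lia.
    have [/(_ erefl) a _] := step _ s sp fb.
    by apply: (le_trans a); rewrite -(subnKC j1); apply: inb => //; rewrite ?subnKC.
  have lb : (lsum l s.-1 < lsum l s <= lsum l s)%N by lia.
  have [_ [b _]] := step _ s sp lb.
  by apply: le_trans (b erefl); rewrite -(subnKC j2); apply: (inb s sp) => //; rewrite ?subnKC.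
split=> [j|j k]; rewrite !mem_sq; first exact: rng.
move=> jn kn jk; have [bj jb] := blkP l jn; have [bk kb] := blkP l kn.
have [e|ne] := eqVneq (blk l j) (blk l k).
  rewrite -(subnKC (ltnW jk)); apply: (inb _ bj); first by case/andP: jb.
  by rewrite (subnKC (ltnW jk)) e; case/andP: kb.
have blt : (blk l j < blk l k)%N by rewrite ltn_neqAle ne blk_mono// ltnW.
have /andP[_ a] := rng j jn; have /andP[b _] := rng k kn.
apply: (le_trans a); apply: le_trans b; apply: (z_le p2 zlt) => //; lia.
Qed.

Lemma Phi_term (t : E) : Phi p n z al gam t =
  (\prod_(o < n) col p z al (t o.+1)) * prs n gam t.
Proof.
rewrite /Phi; congr (_ * _).
  rewrite exchange_big big_add1 big_mkord /=; apply: eq_bigr => o _.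
  by rewrite /col /index_iota subn1.
rewrite /prs big_sq; under [RHS]eq_bigr do rewrite big_sq.
rewrite big_add1 big_mkord /= [RHS](exchange_big_dep predT) //=; apply: eq_bigr => o _.
by rewrite big_add1 /= (big_nat_widenl _ 0)//= big_mkord; apply: eq_bigl.
Qed.

Definition bf m : FF := [ffun o : 'I_n => inord (blk m o.+1)].

Lemma bfE m (o : 'I_n) : bf m o = blk m o.+1 :> nat.
Proof.
have /andP[_ h] : (1 <= blk m o.+1 < p)%N by apply: okb_blk; exact: sq_ord.
by rewrite ffunE inordK// ltnS ltnW.
Qed.

Lemma ty_bf m : ty (bf m) = tyM (i1 p) m.
Proof.
apply/ffunP => s; rewrite tyM1E//.
have -> : ty (bf m) s = (\sum_(0 <= j < n) (blk m j.+1 == s))%N.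
  rewrite ffunE -sum1_card [LHS]big_mkcond big_mkord; apply: eq_bigr => o _.
  by rewrite inE -val_eqE /= bfE; case: (blk _ _ == _).
case: ifP => sp; last first.
  apply: big1_seq => j /=; rewrite mem_index_iota => jn.
  have [h _] := blkP m (j := j.+1) jn.
  by apply/eqP; rewrite eqb0; apply: contraFN sp => /eqP <-.
rewrite (eq_big_nat _ _ (F2 := fun j => nat_of_bool (lsum m s.-1 < j.+1 <= lsum m s)%N)); last first.
  by move=> j jn; rewrite blk_cond.
have le1 : (lsum m s.-1 <= lsum m s)%N by apply: lsum_mono; rewrite leq_pred.
have le2 : (lsum m s <= n)%N by rewrite -[leqRHS](lsum_n m); apply: lsum_mono; lia.
rewrite (@big_cat_nat _ _ _ (lsum m s))//= [X in (_ + X)%N]big1_seq ?addn0; last first.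
  by move=> j /=; rewrite mem_index_iota; lia.
rewrite (@big_cat_nat _ _ _ (lsum m s.-1))//= big1_seq ?add0n; last first.
  by move=> j /=; rewrite mem_index_iota; lia.
rewrite (eq_big_nat _ _ (F2 := fun=> 1%N)); last by move=> j; lia.
rewrite sum_nat_const_nat muln1; have /andP[s0 _] := sp.
by rewrite -[X in lsum m X](prednK s0) lsumS prednK// addKn.
Qed.

(** The factors $1/m_s!$ compensate the permutations that only rearrange variables inside a block,
    so each labelling occurs exactly once. *)
Lemma omega_sum m (t : E) : omega p n z m t =
  \sum_(f : FF | ty f == tyM (i1 p) m) \prod_(o < n) uu z (f o) (t o.+1).
Proof.
pose G (f : FF) := \prod_(o < n) uu z (f o) (t o.+1).
have MF : (Mfact (ty (bf m)))%:R != 0 :> R[i].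
  by rewrite pnatr_eq0 -lt0n /Mfact prodn_gt0// => s; exact: fact_gt0.
apply: (mulfI MF); rewrite -[X in _ = _ * X]/(Om G (tyM (i1 p) m)) -ty_bf -sum_perm_ty /omega.
(* In [omega] the permutation moves the variables, in [sum_perm_ty] it moves the labels; passing to
   the inverse matches the two. *)
rewrite mulr_sumr (reindex_inj invg_inj) /=; apply: eq_bigr => u _.
rewrite big_split /= mulrA.
have -> : (Mfact (ty (bf m)))%:R * \prod_(1 <= s < p) ((cget m s)`!%:R)^-1 = 1 :> R[i].
  rewrite /Mfact ty_bf natr_prod (eq_bigr (fun s : L => ((if (0 < s < p)%N then cget m s else 0%N)`!)%:R)); last first.
    by move=> s _; rewrite tyM1E.
  rewrite -(big_mkord predT (fun s => ((if (0 < s < p)%N then cget m s else 0%N)`!)%:R)).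
  rewrite (big_ltn (ltn0Sn p)) /= mul1r big_nat_recr /=; last exact: ltnW.
  rewrite ltnn andbF mulr1 -big_split big_nat big1// => s /andP[s0 sp] /=.
  by rewrite s0 sp mulfV// pnatr_eq0 -lt0n fact_gt0.
rewrite mul1r /G.
rewrite (exchange_big_dep predT)//= [RHS](reindex_inj (@perm_inj _ (u^-1)%g)) /=.
apply: eq_bigr => j _; rewrite ffunE permKV bfE.
have jn : (1 <= j.+1 <= n)%N by rewrite /= ltn_ord.
have [bp _] := blkP m jn.
rewrite big_mkcond (bigD1_seq (blk m j.+1)) ?iota_uniq//; last by rewrite mem_index_iota.
rewrite blk_cond// eqxx /uu gtn_eqF; last by case/andP: bp.
rewrite big1_seq; first exact: mulr1.
move=> s /andP[/negbTE sb]; rewrite mem_index_iota => sp.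
by rewrite blk_cond// eq_sym sb.
Qed.

Lemma period_OmJ l m :
  intRn_on n (Ucell p n z l) (fun t => Phi p n z al gam t * omega p n z m t) =
  OmJ n z gam al (blk l) (tyM (i1 p) m).
Proof.
pose Cc : R := \prod_(j <- sq n) Ccol p z al * Cprs p n z gam.
have Cc0 : 0 <= Cc.
  by apply: mulr_ge0; [apply: prodr_ge0 => j _; exact: Ccol_ge0|exact: (Cprs_ge0 n p2 zlt gam0)].
(* A sum of integrands is dominated through [pdom_sum] by one common family, hence the sum over all
   labels. *)
pose gg (j : nat) (x : R) : R := \sum_(s : L) gl p z al s x.
have gg0 j x : 0 <= gg j x by apply: sumr_ge0 => s _; exact: gl_ge0.
have gg_int j : (@lebesgue_measure R).-integrable setT (EFin \o gg j).
  rewrite (_ : EFin \o gg j = (fun x => \sum_(s : L) (EFin \o gl p z al s) x)%E); last first.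
    by apply/funext => x; rewrite /= -sumEFin.
  by apply: integrable_sum => // s _; apply: (gl_int z p2 pa); rewrite -ltnS.
have pd (f : FF) : pdom (sq n) (cut n z (blk l) (term p n z gam al (lab f))) Cc gg.
  apply: (pdom_weaken Cc0 _ gg_int (term_pdom p2 zlt gam0 pa (@okb_blk l) (okF_lab f))) => j x.
  rewrite /gg (bigD1 (inord (lab f j)))//= inordK ?ltnS; last exact: okF_lab.
  by rewrite lerDl; apply: sumr_ge0 => s _; exact: gl_ge0.
rewrite /intRn_on (_ : (fun t => _) = (fun t : E => \sum_(f : FF | ty f == tyM (i1 p) m)
   cut n z (blk l) (term p n z gam al (lab f)) t)).
  rewrite (intRnE (pdom_sum _ gg0 gg_int (fun f _ => pd f))) CI_sum//.
  by move=> f _; exact: pdom_integrable (uniq_sq n) (pd f).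
apply/funext => t; rewrite -cut_sum /cut -Ucell_cell; case: asboolP => // _.
rewrite Phi_term omega_sum mulr_sumr; apply: eq_bigr => f _.
rewrite /term mulrAC big_sq -big_split; congr (_ * _); apply: eq_bigr => o _.
by rewrite labE; exact: mulrC.
Qed.

Lemma period_matrix_Dal : \det (period_matrix p n z al gam) = Dal z gam (@blk) al.
Proof.
rewrite /Dal /DO; congr (\det _); apply/matrixP => a b; rewrite !mxE.
exact: period_OmJ.
Qed.
End Link.

(** * The limit of a large last exponent *)

Section OneVariable.
Local Open Scope classical_set_scope.
Context {R : realType}.
Local Notation lam := (@lebesgue_measure R).

Lemma expX_le_exp (m : nat) (c : R) : 0 < c ->
  exists2 B : R, 1 <= B & forall u, 0 <= u -> (1 + u) ^+ m <= B * expR (c * u).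
Proof.
(* With $K=1+1/d$ one has $1+u\le K(1+du)\le Ke^{du}$, and $md\le c$; dividing by $m+1$ also covers
   $m=0$. *)
move=> c0; pose d := c / m.+1%:R; have d0 : 0 < d by rewrite divr_gt0.
pose K := 1 + d^-1; have K1 : 1 <= K by rewrite lerDl invr_ge0 ltW.
exists (K ^+ m); first by rewrite exprn_ege1.
move=> u u0; have h : 1 + u <= K * expR (d * u).
  apply: (@le_trans _ _ (K * (1 + d * u))).
    have -> : K * (1 + d * u) = 1 + d^-1 + d * u + d^-1 * d * u by rewrite /K; ring.
    rewrite mulVf ?gt_eqF// mul1r; have := mulr_ge0 (ltW d0) u0.
    have : 0 < d^-1 by rewrite invr_gt0.
    by move: (d^-1) (d * u) => x y; lra.
  by rewrite ler_wpM2l ?expR_ge1Dx// (le_trans ler01).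
have h0 : 0 <= 1 + u by rewrite addr_ge0.
apply: (le_trans (lerXn2r m _ _ h)); rewrite ?nnegrE//.
  by rewrite mulr_ge0 ?expR_ge0// (le_trans ler01).
rewrite exprMn ler_wpM2l ?exprn_ge0 ?(le_trans ler01)// -expRM_natl ler_expR.
rewrite mulrA ler_wpM2r// /d mulrCA -[leRHS]mulr1 ler_wpM2l ?ltW//.
by rewrite ltr_pdivrMr// mul1r ltr_nat.
Qed.

Lemma powR_le_expX (x r : R) (m : nat) : 0 <= x -> 0 <= r -> r <= m%:R -> x `^ r <= (1 + x) ^+ m.
Proof.
move=> x0 r0 rm; rewrite -powR_mulrn ?addr_ge0//; apply: (@le_trans _ _ ((1 + x) `^ r)).
  by apply: ge0_ler_powR; rewrite ?nnegrE ?addr_ge0// lerDr.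
by apply: ler_powR; rewrite ?lerDl.
Qed.

(** Half of the decay $e^{-x}$ of the limit integrand; the other half is spent on polynomial factors
    coming from the differences of variables. *)
Definition gexp (a : R) (x : R) : R := if 0 < x then x `^ (a - 1) * expR (- (x / 2)) else 0.

Lemma gexp_ge0 a x : 0 <= gexp a x.
Proof. by rewrite /gexp; case: ifP => // _; rewrite mulr_ge0 ?powR_ge0 ?expR_ge0. Qed.

Lemma measurable_gexp a : measurable_fun [set: R] (gexp a).
Proof.
apply: measurable_fun_ifT; last exact: measurable_cst.
  by apply: measurable_fun_ltr; [exact: measurable_cst|exact: measurable_id].
apply: measurable_funM; first exact: measurable_powR.
apply: (measurableT_comp (@measurable_expR R)).
apply: (measurableT_comp (@oppr_measurable R setT)).
by apply: measurable_funM; [exact: measurable_id|exact: measurable_cst].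
Qed.

Lemma integrable_gexp a : 0 < a -> lam.-integrable setT (EFin \o gexp a).
Proof.
move=> a0; pose m := (Num.truncn a).+1; have am : a - 1 <= m%:R.
  by have := truncnS_gt a; rewrite -/m => /ltW h; apply: le_trans h; lra.
have q0 : 0 < 4^-1 :> R by lra.
have [B B1 hB] := expX_le_exp m q0.
have i1 := integrable_hpow 1 a0.
have q4 : 0 < 4^-1 :> R by lra.
(* The rate 1/4 leaves a factor $e^{-x/4}$ to beat the power for $x\ge1$; the 4 undoes the
   normalization of the density. *)
have i2 := integrableZl measurableT (B * 4) (integrable_exponential_pdf q4).
have i3 : lam.-integrable setT (EFin \o (fun x => hpow 1 a x + B * 4 * exponential_pdf 4^-1 x)).
  exact: (integrableD measurableT i1 i2).
apply: (le_integrable measurableT _ _ i3).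
- by apply/measurable_EFinP; exact: measurable_gexp.
- move=> x _; rewrite /= lee_fin ger0_norm ?gexp_ge0//.
  have p0 : 0 <= B * 4 * exponential_pdf 4^-1 x.
    by rewrite mulr_ge0 ?exponential_pdf_ge0// mulr_ge0// (le_trans ler01).
  rewrite ger0_norm ?addr_ge0 ?hpow_ge0//.
  rewrite /gexp; case: ifPn => [x0|_]; last by rewrite addr_ge0 ?hpow_ge0.
  have [x1|x1] := ltP x 1.
    apply: ler_wpDr => //; rewrite /hpow gtr0_norm// x1 ler_piMr ?powR_ge0//.
    by rewrite expR_le1; lra.
  apply: ler_wpDl; first exact: hpow_ge0.
  rewrite exponential_pdfE; last exact: ltW.
  have -> : B * 4 * (4^-1 * expR (- 4^-1 * x)) = B * expR (4^-1 * x) * expR (- (x / 2)).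
    rewrite -mulrA -[RHS]mulrA -expRD; congr (_ * _); rewrite mulrA mulfV ?mul1r; last by lra.
    by congr expR; lra.
  rewrite ler_wpM2r ?expR_ge0//; apply: le_trans (hB x (ltW x0)).
  have x1' : 0 <= 1 + x by rewrite addr_ge0// ltW.
  rewrite -(powR_mulrn m x1'); apply: (@le_trans _ _ (x `^ m%:R)).
    exact: ler_powR.
  by apply: ge0_ler_powR; rewrite ?nnegrE ?(ltW x0)// lerDr.
Qed.

Lemma one_sub_expn_le (u : R) (M : nat) : (0 < M)%N -> u <= M%:R -> (1 - u / M%:R) ^+ M <= expR (- u).
Proof.
move=> M0 uM; have M0' : 0 < M%:R :> R by rewrite ltr0n.
have h0 : 0 <= 1 - u / M%:R by rewrite subr_ge0 ler_pdivrMr// mul1r.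
apply: (le_trans (lerXn2r M _ _ (expR_ge1Dx (- (u / M%:R))))); rewrite ?nnegrE ?expR_ge0//.
rewrite -expRM_natl ler_expR mulrN [M%:R * _]mulrC mulrVK// unitfE gt_eqF//.
Qed.

Lemma one_sub_expn_cvg (u : R) : 0 <= u ->
  (fun N => (1 - u / N.+1%:R) ^+ N.+1) @ \oo --> expR (- u).
Proof.
move=> u0; have hv : (fun N => (N.+1%:R)^-1 : R) @ \oo --> (0 : R) by exact: cvg_harmonic.
(* Lower half of a squeeze. From $1-x\ge e^{-x}(1-x^2)$ with $x=u/M$ and Bernoulli, $(1-u/M)^M\ge
   e^{-u}(1-u^2/M)$. *)
have lo : (fun N => expR (- u) * (1 - u ^+ 2 * (N.+1%:R)^-1)) @ \oo --> expR (- u).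
  rewrite -[X in _ --> X]mulr1; apply: cvgM; first exact: cvg_cst.
  rewrite -[X in _ --> X]subr0; apply: cvgB; first exact: cvg_cst.
  by rewrite -(mulr0 (u ^+ 2)); apply: cvgM => //; exact: cvg_cst.
apply: (squeeze_cvgr _ lo (cvg_cst _)).
have uu : \forall N \near \oo, u <= N.+1%:R.
  near=> N; apply: (@le_trans _ _ N%:R); last by rewrite ler_nat.
  by near: N; exact: nbhs_infty_ger.
near=> N; have uN : u <= N.+1%:R by near: N.
rewrite one_sub_expn_le// andbT.
have M0 : 0 < N.+1%:R :> R by rewrite ltr0n.
pose x := u / N.+1%:R.
have x0 : 0 <= x by rewrite divr_ge0.
have x1 : x <= 1 by rewrite ler_pdivrMr// mul1r.
have e1 : expR (- u) = expR (- x) ^+ N.+1.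
  by rewrite -expRM_natl; congr expR; rewrite mulrN /x mulrC mulrVK// unitfE gt_eqF.
have h : (1 - x ^+ 2) <= expR x * (1 - x).
  have -> : 1 - x ^+ 2 = (1 + x) * (1 - x) by ring.
  by rewrite ler_wpM2r ?subr_ge0// expR_ge1Dx.
have bern k : 1 - k%:R * x ^+ 2 <= (1 - x ^+ 2) ^+ k.
  have y0 : 0 <= x ^+ 2 by rewrite sqr_ge0.
  have y1 : x ^+ 2 <= 1 by rewrite expr_le1.
  move: (x ^+ 2) y0 y1 => y y0 y1; elim: k => [|k IH]; first by rewrite mul0r subr0 expr0.
  rewrite exprS; apply: (@le_trans _ _ ((1 - y) * (1 - k%:R * y))); last by rewrite ler_wpM2l// subr_ge0.
  rewrite -natr1 -subr_ge0 (_ : _ - _ = k%:R * y ^+ 2); last by ring.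
  by rewrite mulr_ge0 ?sqr_ge0.
apply: (@le_trans _ _ (expR (- x) ^+ N.+1 * (1 - x ^+ 2) ^+ N.+1)).
  rewrite e1 ler_wpM2l ?exprn_ge0 ?expR_ge0//; apply: le_trans (bern _).
  rewrite lerD2l lerN2 /x (_ : N.+1%:R * _ = u ^+ 2 / N.+1%:R)//.
  by field; rewrite gt_eqF.
rewrite -exprMn; apply: lerXn2r; rewrite ?nnegrE ?mulr_ge0 ?expR_ge0 ?subr_ge0 ?expr_le1//.
by apply: le_trans (ler_wpM2l (expR_ge0 _) h) _; rewrite mulrA -expRD addNr expR0 mul1r.
Unshelve. all: by end_near.
Qed.

Lemma clim_cpow (h : nat -> R) (x : R) (a : R[i]) : x != 0 -> h @ \oo --> x ->
  clim (fun N => cpowR (h N) a) (cpowR x a).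
Proof.
move=> x0 hx; have x0' : x != 0 by [].
have [c1 c2] := cderiv_cont (cderiv_cpow a x0').
rewrite subr0 in c1 c2.
have s0 : (fun y => cpowR (y - 0) a) = (fun y => cpowR y a) by apply/funext => y; rewrite subr0.
have d1 : ReC (cpowR y a) @[y --> x] --> ReC (cpowR x a).
  by move: c1; under eq_fun do rewrite subr0.
have d2 : ImC (cpowR y a) @[y --> x] --> ImC (cpowR x a).
  by move: c2; under eq_fun do rewrite subr0.
split; [exact: (cvg_comp h (fun y => ReC (cpowR y a)) hx d1)|exact: (cvg_comp h (fun y => ImC (cpowR y a)) hx d2)].
Qed.

Lemma exp_scale_cvg0 (d : R) : 0 < d -> (fun N => expR (- (d * N.+1%:R))) @ \oo --> (0 : R).
Proof.
move=> d0; apply: (@squeeze_cvgr _ _ _ _ (fun=> 0) (fun N => d^-1 * (N.+1%:R)^-1)).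
- near=> N; rewrite expR_ge0 /= expRN -invfM lef_pV2 ?posrE ?expR_gt0 ?mulr_gt0 ?ltr0n//.
  by apply: le_trans (expR_ge1Dx _); rewrite lerDr.
- exact: cvg_cst.
- rewrite -[X in _ --> X](mulr0 d^-1); apply: cvgM; [exact: cvg_cst|exact: cvg_harmonic].
Unshelve. all: by end_near.
Qed.

End OneVariable.

Lemma prod_sq_const (C : comNzRingType) n (x : C) : \prod_(k <- sq n) x = x ^+ n.
Proof. by rewrite big_sq prodr_const card_ord. Qed.

(** Power extended by 0 to negative bases: it builds the order conditions of a cell into the
    integrand, which rescaling then respects automatically. *)
Definition pw {R : realType} (x : R) (a : R[i]) : R[i] := if 0 < x then cpowR x a else 0.

Lemma pw_ge {R : realType} (x : R) a : 0 <= x -> pw x a = cpowR x a.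
Proof. by rewrite /pw le_eqVlt => /orP[/eqP <-|->//]; rewrite ltxx cpow0. Qed.

Lemma cmeas_pw {R : realType} {d : measure_display} {T : measurableType d} (f : T -> R) a :
  measurable_fun [set: T] f -> cmeas (fun t => pw (f t) a).
Proof.
move=> mf; rewrite /pw.
rewrite (_ : (fun t => _) = (fun t => if `[< [set t | 0 < f t]%classic t >] then cpowR (f t) a else 0)); last first.
  by apply/funext => t; rewrite /mkset asboolb.
apply: cmeas_if; [|exact: cmeas_cpow|exact: cmeas_cst].
have m1 : measurable_fun [set: T] (fun t => 0 < f t).
  by apply: measurable_fun_ltr => //; exact: measurable_cst.
by have := m1 measurableT [set true]%classic; rewrite setTI; apply.
Qed.

(** * Rescaling at the left end points and dominated convergence *)

Section Limit.
Local Open Scope classical_set_scope.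
Context {R : realType}.
Variables (p n : nat) (z : nat -> R) (gam : R[i]) (al : nat -> R[i]) (b F : nat -> nat).
Local Notation E := (envT R).
Local Notation lam := (@lebesgue_measure R).
Local Notation uu := (uu z).
Local Notation colf := (col p z al).
Hypothesis p2 : (2 <= p)%N.
Hypothesis zlt : forall s, (1 <= s < p)%N -> z s < z s.+1.
Hypothesis gam0 : 0 < ReC gam.
Hypothesis pa : posal p al.
Hypothesis ob : okb p n b.
Hypothesis bm : forall j k, j \in sq n -> k \in sq n -> (k < j)%N -> (b k <= b j)%N.
Hypothesis oF : forall j, (F j <= p)%N.
Hypothesis F1 : forall j, j \in sq n -> (1 <= F j)%N.

Definition inI (s : nat) (x : R) : bool := z s <= x <= z s.+1.

(** The indicator of the cell factors: the order inside a block is encoded by [pw], and across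
    blocks it is automatic once every variable lies in its interval. *)
Lemma cut_prod al' (t : E) : cut n z b (term p n z gam al' F) t =
  (\prod_(j <- sq n) (if inI (b j) (t j) then uu (F j) (t j) * col p z al' (t j) else 0)) *
  \prod_(j <- sq n) \prod_(k <- sq n | (k < j)%N)
    (if b j == b k then pw (t j - t k) (2%:R * gam) else cpowR (t j - t k) (2%:R * gam)).
Proof.
rewrite /cut; case: asboolP => [[h1 h2]|hn].
  rewrite /term; congr (_ * _).
    by rewrite !big_seq; apply: eq_bigr => j /h1 h; rewrite /inI h.
  rewrite /prs !big_seq; apply: eq_bigr => j jn; rewrite big_seq_cond [RHS]big_seq_cond.
  apply: eq_bigr => k /andP[kn kj]; case: ifP => // _; rewrite pw_ge// subr_ge0; exact: h2.
have [/allP h1|] := boolP (all (fun j => inI (b j) (t j)) (sq n)); last first.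
  by rewrite -has_predC => /hasP[j jn /= /negbTE ij]; rewrite (bigD1_seq j) ?uniq_sq//= ij !mul0r.
have [j [k [jn kn kj tjk]]] : exists j k, [/\ j \in sq n, k \in sq n, (k < j)%N & t j < t k].
  apply: contrapT => h; apply: hn; split; first exact: h1.
  move=> j k jn kn jk; rewrite leNgt; apply/negP => tk; apply: h; exists k, j; split=> //.
have bb : b j = b k.
  apply/eqP; rewrite eqn_leq (bm jn kn kj) andbT leqNgt; apply/negP => lt.
  have /andP[a1 _] := h1 j jn; have /andP[_ a2] := h1 k kn; have := ob jn; have := ob kn => o1 o2.
  have : z (b k).+1 <= z (b j) by apply: (z_le p2 zlt) => //; lia.
  by lra.
rewrite [X in _ = _ * X](_ : _ = 0) ?mulr0// (bigD1_seq j) ?uniq_sq//=.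
rewrite -big_filter (bigD1_seq k) ?mem_filter ?kj ?filter_uniq ?uniq_sq//=.
by rewrite bb eqxx /pw subr_gt0 ltNge (ltW tjk) /= !mul0r.
Qed.

(** Scale for which $(t-z_p)/(z_s-z_p)=1-u/(N+1)$ when $t=z_s+c_Nu$, so that its power $N+1$ tends
    to $e^{-u}$. *)
Definition cN (s N : nat) : R := (z p - z s) / N.+1%:R.
(* [kap] is the leading behaviour of the integral under [al_p -> al_p + N]; a variable is
   rescaled only when its label equals its block ([sc]), the other terms being negligible. *)
Definition kap N : R[i] :=
  (\prod_(j <- sq n) ((z (b j) - z p)%:C ^+ N.+1 * cpowR (cN (b j) N) (al (b j)))) *
  \prod_(j <- sq n) \prod_(k <- sq n | (k < j)%N)
     (if b j == b k then cpowR (cN (b j) N) (2%:R * gam) else 1).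
Definition sc j := (j \in sq n) && (F j == b j).
Definition ca N j : R := if sc j then cN (b j) N else 1.
Definition da j : R := if sc j then z (b j) else 0.
Definition TT N j x : R := ca N j * x + da j.
Definition VV N j (x : R) : R[i] := if inI (b j) (TT N j x) then
  (ca N j)%:C * uu (F j) (TT N j x) * colf (TT N j x) *
  ((TT N j x - z p) / (z (b j) - z p))%:C ^+ N.+1 / cpowR (cN (b j) N) (al (b j)) else 0.
Definition WW N j k (t : E) : R[i] :=
  let d := TT N j (t j) - TT N k (t k) in
  if b j == b k then pw d (2%:R * gam) / cpowR (cN (b j) N) (2%:R * gam) else cpowR d (2%:R * gam).
Definition fN N (t : E) : R[i] := (\prod_(j <- sq n) VV N j (t j)) *
  \prod_(j <- sq n) \prod_(k <- sq n | (k < j)%N) WW N j k t.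

Lemma zbp j : j \in sq n -> z (b j) < z p.
Proof. by move=> /ob bj; apply: (z_lt p2 zlt); lia. Qed.
Lemma cN_gt0 j N : j \in sq n -> 0 < cN (b j) N.
Proof. by move=> jn; rewrite divr_gt0// subr_gt0 zbp. Qed.
Lemma ca_gt0 N j : 0 < ca N j.
Proof. by rewrite /ca /sc; case: ifP => // /andP[jn _]; exact: cN_gt0. Qed.

Lemma realC_neq0 (x : R) : x != 0 -> x%:C != 0 :> R[i].
Proof. by move=> x0; rewrite eq_complex /= eqxx andbT. Qed.

Lemma kap_neq0 N : kap N != 0.
Proof.
rewrite mulf_neq0//.
  rewrite prodf_seq_neq0; apply/allP => j jn /=; rewrite mulf_neq0//; last first.
    by rewrite cpow_neq0// gt_eqF// cN_gt0.
  by rewrite expf_neq0// realC_neq0// subr_eq0 lt_eqF// zbp.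
rewrite prodf_seq_neq0; apply/allP => j jn /=; rewrite prodf_seq_neq0; apply/allP => k kn.
by apply/implyP => _; case: ifP => _; rewrite ?oner_eq0// cpow_neq0// gt_eqF// cN_gt0.
Qed.

Lemma fN_eq N (t : E) :
  (\prod_(j <- sq n) (ca N j)%:C) * cut n z b (term p n z gam (shp p al N.+1) F) (aff (ca N) da (sq n) t) =
  kap N * fN N t.
Proof.
rewrite cut_prod /kap /fN [LHS]mulrA [RHS]mulrACA.
have affE j : j \in sq n -> aff (ca N) da (sq n) t j = TT N j (t j) by move=> jn; rewrite /aff jn.
congr (_ * _); rewrite -!big_split big_seq [RHS]big_seq; apply: eq_bigr => j jn /=.
  rewrite affE// /VV; case: ifP => _; last by rewrite !mulr0.
  have c0 : cpowR (cN (b j) N) (al (b j)) != 0 by rewrite cpow_neq0// gt_eqF// cN_gt0.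
  have z0 : (z (b j) - z p)%:C != 0 :> R[i] by rewrite realC_neq0// subr_eq0 lt_eqF// zbp.
  rewrite (col_shp z p2 gam0) realCM realCV exprMn exprVn.
  have z1 := expf_neq0 N.+1 z0.
  move: ((z (b j) - z p)%:C ^+ N.+1) z1 (cpowR (cN (b j) N) (al (b j))) c0 => X X0 Y Y0.
  by field; rewrite X0 Y0.
rewrite -big_split big_seq_cond [RHS]big_seq_cond; apply: eq_bigr => k /andP[kn kj] /=.
rewrite !affE// /WW; case: ifP => _; last by rewrite mul1r.
by rewrite mulrCA mulfV ?mulr1// cpow_neq0// gt_eqF// cN_gt0.
Qed.

(** The rescaled distance to the left end point, also for variables that are not rescaled; all decay
    is expressed through it. *)
Definition un N j x : R := (TT N j x - z (b j)) / cN (b j) N.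
Let g2 := ReC (2%:R * gam).
Let ma := (Num.truncn (\sum_(s <- iota 1 p) ReC (al s))).+1.
Let mg := (Num.truncn g2).+1.
(** Degree of a polynomial in $1+u$ that dominates all growth in one variable: [ma] for its own
    power, and [mg] for each of $2n$ occurrences in pairs, counting crudely all ordered pairs. *)
Let mm := (ma + mg * (n + n))%N.
Definition gD j (x : R) : R := if sc j then gexp (ReC (al (b j))) x else gl p z al (F j) x.
(** Residual decay of the variables that are not rescaled. It is dropped from the dominating
    function but makes the integrand tend to 0 pointwise. The absolute value keeps it at most 1
    outside the cell as well. *)
Definition ed N j (x : R) : R := if sc j then 1 else expR (- (`|un N j x| / 2)).

Lemma gD_ge0 j x : 0 <= gD j x.
Proof. by rewrite /gD; case: ifP => _; [exact: gexp_ge0|exact: gl_ge0]. Qed.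
Lemma gD_int j : lam.-integrable setT (EFin \o gD j).
Proof.
rewrite /gD; case: (boolP (sc j)) => [/andP[jn _]|_]; last exact: (gl_int z p2 pa (oF j)).
by apply: integrable_gexp; apply: pa; have := ob jn; lia.
Qed.
Lemma ed_ge0 N j x : 0 <= ed N j x.
Proof. by rewrite /ed; case: ifP => // _; exact: expR_ge0. Qed.
Lemma ed_le1 N j x : ed N j x <= 1.
Proof.
rewrite /ed; case: ifP => // _; rewrite expR_le1 oppr_le0.
Qed.

Lemma un_ge0 N j x : j \in sq n -> inI (b j) (TT N j x) -> 0 <= un N j x.
Proof. by move=> jn /andP[h _]; rewrite divr_ge0 ?subr_ge0// ltW// cN_gt0. Qed.

Lemma TT_un N j x : j \in sq n -> TT N j x - z (b j) = cN (b j) N * un N j x.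
Proof. by move=> jn; rewrite /un mulrC divfK// gt_eqF// cN_gt0. Qed.

Lemma un_sc N j x : sc j -> un N j x = x.
Proof.
move=> sj; have /andP[jn _] := sj; rewrite /un /TT /ca /da sj addrK mulrAC mulfV ?mul1r//.
by rewrite gt_eqF// cN_gt0.
Qed.

Lemma decay N j x : j \in sq n -> inI (b j) (TT N j x) ->
  nc (((TT N j x - z p) / (z (b j) - z p))%:C ^+ N.+1) <= expR (- un N j x).
Proof.
move=> jn ii; have zp := zbp jn; have c0 := cN_gt0 N jn.
have e : (TT N j x - z p) / (z (b j) - z p) = 1 - un N j x / N.+1%:R.
  have -> : TT N j x = z (b j) + cN (b j) N * un N j x by rewrite -TT_un//; ring.
  have h1 : z (b j) - z p != 0 by rewrite subr_eq0 lt_eqF.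
  have hM : N.+1%:R != 0 :> R by rewrite pnatr_eq0.
  rewrite /cN; move: (N.+1%:R) hM (un N j x) => M hM u.
  by field; rewrite ?h1 ?hM.
have tp : TT N j x <= z p.
  by case/andP: ii => _ /le_trans; apply; have := ob jn => bj; apply: (z_le p2 zlt); lia.
have e0 : 0 <= (TT N j x - z p) / (z (b j) - z p).
  by rewrite -mulrNN -invrN !opprB divr_ge0// subr_ge0// ltW.
rewrite ncX nc_real ger0_norm// e one_sub_expn_le//.
have : 0 <= 1 - un N j x / N.+1%:R by rewrite -e.
by rewrite subr_ge0 ler_pdivrMr// mul1r.
Qed.

Lemma colD1 s x : (1 <= s <= p)%N ->
  colf x = cpowR (x - z s) (al s) * \prod_(r <- iota 1 p | r != s) cpowR (x - z r) (al r).
Proof. by move=> sp; rewrite /col (bigD1_seq s) ?iota_uniq//= mem_iota; lia. Qed.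

Lemma inI_range j x : j \in sq n -> inI (b j) x -> z 1 <= x <= z p.
Proof.
move=> jn /andP[h1 h2]; have bj := ob jn.
by apply/andP; split; [apply: le_trans h1|apply: (le_trans h2)]; apply: (z_le p2 zlt); lia.
Qed.

Lemma Cs_ge1' r : r \in iota 1 p -> 1 <= Cs p z al r.
Proof. by rewrite mem_iota => rp; apply: (Cs_ge1 p2 zlt); rewrite ltW// pa//; lia. Qed.

Lemma cpow_Cs r x : r \in iota 1 p -> z 1 <= x <= z p -> nc (cpowR (x - z r) (al r)) <= Cs p z al r.
Proof.
rewrite mem_iota => rp xr; apply: (nc_cpow_ML p2 zlt).
  by apply: ltW; apply: (rangeML p2 zlt) => //; lia.
by rewrite ltW// pa//; lia.
Qed.

Lemma prodD1_le (P : pred nat) (G : nat -> R) : (forall r, r \in iota 1 p -> 0 <= G r <= Cs p z al r) ->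
  \prod_(r <- iota 1 p | P r) G r <= Ccol p z al.
Proof.
move=> h; rewrite /Ccol big_mkcond big_seq [leRHS]big_seq; apply: ler_prod => r rp.
have /andP[a1 a2] := h r rp; case: ifP => _; first by rewrite a1.
by rewrite ler01 Cs_ge1'.
Qed.

(** If the label is the block, the pole and the power at the same point combine to
    $x^{\Re\alpha-1}$, with the Jacobian cancelling the scale of the pole. Otherwise the power at
    the left end point grows only polynomially in the rescaled distance, and the pole at $z_{F(j)}$
    stays in [gl]. *)
Lemma VV_bound N j x : j \in sq n -> inI (b j) (TT N j x) ->
  nc (VV N j x) <= Ccol p z al * ((if sc j then (if 0 < x then x `^ (ReC (al (b j)) - 1) else 0)
     else un N j x `^ ReC (al (b j)) * gl p z al (F j) x) * expR (- un N j x)).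
Proof.
move=> jn ii; have rg := inI_range jn ii; have bj := ob jn.
have bp : (1 <= b j <= p)%N by lia.
have c0 := cN_gt0 N jn; have u0 := un_ge0 jn ii; have a0 := pa bp.
have dc := decay jn ii; have Tu := TT_un N x jn.
have cs0 (P : pred nat) (G : nat -> R[i]) : (forall r, r \in iota 1 p -> nc (G r) <= Cs p z al r) ->
   nc (\prod_(r <- iota 1 p | P r) G r) <= Ccol p z al.
  by move=> h; rewrite nc_prod; apply: prodD1_le => r rp; rewrite nc_ge0 h.
have Cc0 : 0 <= Ccol p z al by exact: Ccol_ge0.
have cpc : cpowR (cN (b j) N) (al (b j)) != 0 by rewrite cpow_neq0// gt_eqF.
rewrite /VV ii (colD1 _ bp).
have [T0|T0] := eqVneq (TT N j x) (z (b j)).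
  rewrite T0 subrr cpow0 mul0r !(mulr0, mul0r) nc0 mulr_ge0// mulr_ge0 ?expR_ge0//.
  by case: ifP => _; [case: ifP => // _; exact: powR_ge0|rewrite mulr_ge0 ?powR_ge0 ?gl_ge0].
have u1 : 0 < un N j x.
  rewrite lt_neqAle u0 andbT eq_sym; apply: contraNneq T0 => e.
  by rewrite -subr_eq0 Tu e mulr0.
have E1 : cpowR (TT N j x - z (b j)) (al (b j)) = cpowR (cN (b j) N) (al (b j)) * cpowR (un N j x) (al (b j)).
  by rewrite Tu cpowM// ltW.
set D := ((TT N j x - z p) / (z (b j) - z p))%:C ^+ N.+1 in dc *.
case sj: (sc j).
  have ux := un_sc N x sj; rewrite ux in u1 E1 dc *; rewrite u1.
  have /andP[_ /eqP Fb] := sj; rewrite Fb /uu gtn_eqF; last by case/andP: bp.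
  rewrite E1 Tu ux {1}/ca sj.
  have -> : (cN (b j) N)%:C * (cN (b j) N * x)%:C^-1 *
     (cpowR (cN (b j) N) (al (b j)) * cpowR x (al (b j)) *
      \prod_(r <- iota 1 p | r != b j) cpowR (TT N j x - z r) (al r)) * D / cpowR (cN (b j) N) (al (b j)) =
     (x%:C^-1 * cpowR x (al (b j))) * (\prod_(r <- iota 1 p | r != b j) cpowR (TT N j x - z r) (al r)) * D.
    rewrite realCM; field; rewrite cpc !realC_neq0 ?gt_eqF//.
  rewrite ncM ncM ncM ncV nc_real gtr0_norm// nc_cpow_pos// powRB; last by apply/implyP => _; rewrite gt_eqF.
  rewrite powRr1; last exact: ltW.
  rewrite [x^-1 * _]mulrC; have X0 : 0 <= x `^ ReC (al (b j)) / x by rewrite divr_ge0 ?powR_ge0// ltW.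
  rewrite [leRHS](_ : _ = x `^ ReC (al (b j)) / x * Ccol p z al * expR (- x)); last by ring.
  apply: ler_pM => //; [by rewrite mulr_ge0 ?nc_ge0|exact: nc_ge0|].
  by rewrite ler_wpM2l// cs0// => r rp; exact: cpow_Cs.
have rF : (1 <= F j <= p)%N by rewrite F1//= oF.
have Fb : F j != b j by move: sj; rewrite /sc jn /= => ->.
have TE : TT N j x = x by rewrite /TT /ca /da sj mul1r addr0.
rewrite {1}/ca sj mul1r E1.
have -> : uu (F j) (TT N j x) * (cpowR (cN (b j) N) (al (b j)) * cpowR (un N j x) (al (b j)) *
      \prod_(r <- iota 1 p | r != b j) cpowR (TT N j x - z r) (al r)) * D / cpowR (cN (b j) N) (al (b j)) =
   (uu (F j) (TT N j x) * \prod_(r <- iota 1 p | r != b j) cpowR (TT N j x - z r) (al r)) * cpowR (un N j x) (al (b j)) * D.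
  by field.
rewrite ncM ncM nc_cpow_pos// mulrA ler_pM ?mulr_ge0 ?nc_ge0 ?powR_ge0//.
rewrite mulrCA mulrC ler_wpM2l ?powR_ge0//.
have iF : F j \in [seq r <- iota 1 p | r != b j] by rewrite mem_filter Fb mem_iota add1n ltnS.
rewrite -big_filter (bigD1_seq (F j)) ?filter_uniq ?iota_uniq//= mulrA ncM mulrC.
rewrite big_filter_cond; apply: (@le_trans _ _ ((\prod_(r <- iota 1 p | (r != b j) && (r != F j)) Cs p z al r) *
   (Cs p z al (F j) * gl p z al (F j) x))).
  apply: ler_pM; rewrite ?nc_ge0//.
    rewrite nc_prod big_seq_cond [leRHS]big_seq_cond; apply: ler_prod => r /andP[rp _].
    by rewrite nc_ge0 cpow_Cs.
  rewrite /uu /gl TE gtn_eqF; last by case/andP: rF.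
  rewrite TE in rg; apply: (le_trans (nc_inv_cpow (al (F j)) (rangeML p2 zlt rg rF))).
  rewrite ler_wpM2r ?hpow_ge0// /Cs -[leLHS]mulr1 ler_wpM2l ?argc_ge0//.
  by rewrite -(powRr0 (ML p z)) ler_powR ?(ML1 p2 zlt)// ltW// pa.
rewrite mulrA ler_wpM2r ?gl_ge0// mulrC.
have iF' : F j \in iota 1 p by rewrite mem_iota add1n ltnS.
rewrite /Ccol [leRHS](bigD1_seq (F j)) ?iota_uniq//= ler_wpM2l ?(Cs_ge0)//.
rewrite big_mkcond [leRHS]big_mkcond big_seq [leRHS]big_seq; apply: ler_prod => r rp.
case: (r == F j) => /=; first by rewrite andbF ler01 lexx.
by case: (r == b j) => /=; rewrite ?ler01 ?lexx ?Cs_ge1' ?Cs_ge0.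
Qed.

Definition AA N j x : R := (1 + un N j x) ^+ mg.

Lemma AA_ge1 N j x : 0 <= un N j x -> 1 <= AA N j x.
Proof. by move=> u0; rewrite /AA exprn_ege1// lerDl. Qed.

Lemma g2_gt0 : 0 < g2. Proof. exact: (gam20 gam0). Qed.
Lemma g2_mg : g2 <= mg%:R. Proof. by apply: ltW; exact: truncnS_gt. Qed.
Lemma al_ma s : (1 <= s <= p)%N -> ReC (al s) <= ma%:R.
Proof.
move=> sp; apply: (@le_trans _ _ (\sum_(s <- iota 1 p) ReC (al s))); last by apply: ltW; exact: truncnS_gt.
rewrite (bigD1_seq s) ?iota_uniq//=; last by rewrite mem_iota; lia.
rewrite lerDl big_seq_cond; apply: sumr_ge0 => r /andP[]; rewrite mem_iota => rp _.
by rewrite ltW// pa//; lia.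
Qed.

(** Inside a block the scale cancels and $|u_j-u_k|^{2\Re\gamma}\le(1+u_j)^{mg}$ for ordered
    variables; across blocks the difference is bounded. One product form covers both cases. *)
Lemma WW_bound N j k (t : E) : j \in sq n -> k \in sq n -> 
  inI (b j) (TT N j (t j)) -> inI (b k) (TT N k (t k)) ->
  nc (WW N j k t) <= Cg p z gam * (AA N j (t j) * AA N k (t k)).
Proof.
move=> jn kn ij ik; have uj := un_ge0 jn ij; have uk := un_ge0 kn ik.
have A1j := AA_ge1 uj; have A1k := AA_ge1 uk.
have A0j := le_trans ler01 A1j; have A0k := le_trans ler01 A1k.
have G1 := Cg_ge1 p2 zlt gam0; have G0 := le_trans ler01 G1.
have AA1 : 1 <= AA N j (t j) * AA N k (t k) by rewrite mulr_ege1.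
rewrite /WW; case: eqP => [e|_]; last first.
  rewrite -[leLHS]mulr1 ler_pM ?nc_ge0//; apply: (nc_cpow_ML p2 zlt); last by rewrite ltW// g2_gt0.
  have /andP[a1 a2] := inI_range jn ij; have /andP[a3 a4] := inI_range kn ik.
  by rewrite ler_norml /ML; lra.
rewrite /pw; case: ifPn => [d0|_]; last by rewrite mul0r nc0 mulr_ge0// mulr_ge0.
have c0 := cN_gt0 N jn.
have dE : TT N j (t j) - TT N k (t k) = cN (b j) N * (un N j (t j) - un N k (t k)).
  rewrite mulrBr -TT_un// [in cN _ _ * _]e -TT_un// e; ring.
have ud : 0 < un N j (t j) - un N k (t k) by rewrite dE pmulr_rgt0// in d0.
rewrite dE (cpowM _ _ (ltW c0)) mulrAC mulfV ?mul1r; last by rewrite cpow_neq0// gt_eqF.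
rewrite nc_cpow_pos// -[leLHS]mul1r ler_pM ?powR_ge0//.
rewrite -[leLHS]mulr1 ler_pM ?powR_ge0//.
apply: (@le_trans _ _ (un N j (t j) `^ g2)).
  by apply: ge0_ler_powR; rewrite ?nnegrE ?(ltW g2_gt0) ?(ltW ud)// lerBlDr lerDl.
by apply: powR_le_expX => //; [rewrite ltW// g2_gt0|exact: g2_mg].
Qed.

(** Uniform in [N]: of the decay $e^{-u}$ in each variable, one half pays for the polynomial of
    degree [mm] and the other half remains, inside [gexp] or as [ed]. *)
Lemma fN_bound : exists2 C : R, 0 <= C & forall N t,
  nc (fN N t) <= C * \prod_(j <- sq n) (gD j (t j) * ed N j (t j)).
Proof.
have h2 : 0 < 2^-1 :> R by lra.
have [B B1 hB] := expX_le_exp mm h2.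
have B0 := le_trans ler01 B1.
have Cc0 : 0 <= Ccol p z al by exact: Ccol_ge0.
have G1 := Cg_ge1 p2 zlt gam0; have G0 := le_trans ler01 G1.
exists ((\prod_(j <- sq n) (Ccol p z al * B)) * \prod_(j <- sq n) \prod_(k <- sq n) Cg p z gam).
  rewrite mulr_ge0//; first by apply: prodr_ge0 => j _; rewrite mulr_ge0.
  by apply: prodr_ge0 => j _; apply: prodr_ge0.
move=> N t.
have [/allP h1|] := boolP (all (fun j => inI (b j) (TT N j (t j))) (sq n)); last first.
  rewrite -has_predC => /hasP[j jn /= /negbTE ij].
  rewrite /fN (bigD1_seq j) ?uniq_sq//= {1}/VV ij !mul0r nc0 mulr_ge0//; last first.
    by apply: prodr_ge0 => k _; rewrite mulr_ge0 ?gD_ge0 ?ed_ge0.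
  rewrite mulr_ge0//; first by apply: prodr_ge0 => k _; rewrite mulr_ge0.
  by apply: prodr_ge0 => k _; apply: prodr_ge0.
have u0 j : j \in sq n -> 0 <= un N j (t j) by move=> jn; apply: un_ge0 => //; exact: h1.
have A1 j : j \in sq n -> 1 <= AA N j (t j) by move=> /u0; exact: AA_ge1.
pose vv j := (if sc j then (if 0 < t j then t j `^ (ReC (al (b j)) - 1) else 0)
     else un N j (t j) `^ ReC (al (b j)) * gl p z al (F j) (t j)) * expR (- un N j (t j)).
have vv0 j : 0 <= vv j.
  rewrite /vv mulr_ge0 ?expR_ge0//; case: ifP => _; last by rewrite mulr_ge0 ?powR_ge0 ?gl_ge0.
  by case: ifP => // _; exact: powR_ge0.
rewrite /fN ncM; apply: (@le_trans _ _ ((\prod_(j <- sq n) (Ccol p z al * vv j)) *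
   \prod_(j <- sq n) \prod_(k <- sq n) (Cg p z gam * (AA N j (t j) * AA N k (t k))))).
  apply: ler_pM; rewrite ?nc_ge0//.
    rewrite nc_prod big_seq [leRHS]big_seq; apply: ler_prod => j jn; rewrite nc_ge0 /=.
    by apply: VV_bound => //; exact: h1.
  rewrite nc_prod big_seq [leRHS]big_seq; apply: ler_prod => j jn; rewrite nc_ge0 /=.
  rewrite nc_prod big_mkcond big_seq [leRHS]big_seq; apply: ler_prod => k kn.
  have bb : 1 <= Cg p z gam * (AA N j (t j) * AA N k (t k)).
    apply: mulr_ege1 => //; apply: mulr_ege1; exact: A1.
  case: ifP => _; last by rewrite ler01.
  by rewrite nc_ge0 WW_bound// h1.
have -> : \prod_(j <- sq n) \prod_(k <- sq n) (Cg p z gam * (AA N j (t j) * AA N k (t k))) =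
   (\prod_(j <- sq n) \prod_(k <- sq n) Cg p z gam) * \prod_(j <- sq n) AA N j (t j) ^+ (n + n).
  rewrite (eq_bigr (fun j => (\prod_(k <- sq n) Cg p z gam) * ((\prod_(k <- sq n) AA N j (t j)) * \prod_(k <- sq n) AA N k (t k)))); last first.
    by move=> j _; rewrite !big_split.
  rewrite !big_split /=; congr (_ * _).
  rewrite [X in _ * X]exchange_big -big_split; apply: eq_bigr => j _ /=.
  by rewrite prod_sq_const exprD.
rewrite mulrCA [leRHS]mulrAC [leRHS]mulrC; apply: ler_wpM2l.
  by apply: prodr_ge0 => j _; apply: prodr_ge0.
rewrite -!big_split big_seq [leRHS]big_seq; apply: ler_prod => j jn /=.
have AX : 0 <= AA N j (t j) ^+ (n + n) by rewrite exprn_ge0// (le_trans ler01)// A1.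
apply/andP; split; first by rewrite mulr_ge0 // mulr_ge0.
rewrite -[leLHS]mulrA -[leRHS]mulrA; apply: ler_wpM2l => //.
have uj := u0 j jn.
have AE : AA N j (t j) ^+ (n + n) = (1 + un N j (t j)) ^+ (mg * (n + n)) by rewrite /AA -exprM.
have u1 : 1 <= 1 + un N j (t j) by rewrite lerDl.
have eE : expR (2^-1 * un N j (t j)) * expR (- un N j (t j)) = expR (- (un N j (t j) / 2)).
  by rewrite -expRD; congr expR; lra.
rewrite AE /vv /gD /ed; case sj: (sc j).
  rewrite mulr1 un_sc// in uj u1 eE *; rewrite /gexp; case: ifP => x0; last by rewrite !mul0r mulr0.
  rewrite -eE [leRHS](_ : _ = t j `^ (ReC (al (b j)) - 1) * expR (- t j) * (B * expR (2^-1 * t j))); last by ring.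
  apply: ler_wpM2l; first by rewrite mulr_ge0 ?powR_ge0 ?expR_ge0.
  apply: le_trans (hB _ uj); rewrite ler_weXn2l//.
  by rewrite /mm leq_addl.
rewrite ger0_norm// -eE.
have -> : un N j (t j) `^ ReC (al (b j)) * gl p z al (F j) (t j) * expR (- un N j (t j)) *
    (1 + un N j (t j)) ^+ (mg * (n + n)) = gl p z al (F j) (t j) *
    (un N j (t j) `^ ReC (al (b j)) * (1 + un N j (t j)) ^+ (mg * (n + n))) * expR (- un N j (t j)) by ring.
have -> : B * (gl p z al (F j) (t j) * (expR (2^-1 * un N j (t j)) * expR (- un N j (t j)))) =
   gl p z al (F j) (t j) * (B * expR (2^-1 * un N j (t j))) * expR (- un N j (t j)) by ring.
rewrite ler_wpM2r ?expR_ge0// ler_wpM2l ?gl_ge0//; apply: le_trans (hB _ uj).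
rewrite /mm exprD ler_wpM2r ?exprn_ge0 ?(le_trans ler01)//.
have bj := ob jn; have bp : (1 <= b j <= p)%N by lia.
by apply: powR_le_expX => //; [rewrite ltW// pa|exact: al_ma].
Qed.

Lemma meas_TT N j : measurable_fun [set: R] (TT N j).
Proof. exact: measurable_affine. Qed.

Lemma meas_inI s : measurable [set x | inI s x].
Proof.
rewrite (_ : [set x | inI s x] = `[z s, z s.+1]%classic); first exact: measurable_itv.
by apply/seteqP; split => x /=; rewrite in_itv.
Qed.

Lemma cmeas_VV N j : cmeas (VV N j).
Proof.
rewrite /VV (_ : (fun x => _) = (fun x => if `[< [set x | inI (b j) (TT N j x)] x >] then
  (ca N j)%:C * uu (F j) (TT N j x) * colf (TT N j x) *
  ((TT N j x - z p) / (z (b j) - z p))%:C ^+ N.+1 / cpowR (cN (b j) N) (al (b j)) else 0)); last first.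
  by apply/funext => x; rewrite /mkset asboolb.
apply: cmeas_if; last exact: cmeas_cst.
  rewrite (_ : [set x | inI (b j) (TT N j x)] = [set: R] `&` TT N j @^-1` [set x | inI (b j) x]).
    by apply: meas_TT; [exact: measurableT|exact: meas_inI].
  by rewrite setTI.
apply: cmeasM; last exact: cmeas_cst.
apply: cmeasM; last first.
  under eq_fun do rewrite -rmorphXn; apply: cmeas_real.
  apply: measurable_funX; apply: measurable_funM; last exact: measurable_cst.
  by apply: measurable_funB; [exact: meas_TT|exact: measurable_cst].
apply: cmeasM; last exact: (cmeas_comp (cmeas_col _ _ _) (meas_TT N j)).
apply: cmeasM; first exact: cmeas_cst.
exact: (cmeas_comp (cmeas_uu _ _) (meas_TT N j)).
Qed.

Lemma cmeas_fN N : cmeas (fN N).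
Proof.
apply: cmeasM.
  by apply: cmeas_prod => j _; exact: (cmeas_comp (cmeas_VV N j) (meas_coord j)).
apply: cmeas_prod => j _; apply: cmeas_prod => k _.
have md : measurable_fun [set: E] (fun t : E => TT N j (t j) - TT N k (t k)).
  by apply: measurable_funB; [exact: (measurableT_comp (meas_TT N j) (meas_coord j))|
    exact: (measurableT_comp (meas_TT N k) (meas_coord k))].
rewrite /WW; case: (b j == b k); last exact: cmeas_cpow.
by apply: cmeasM; [exact: cmeas_pw|exact: cmeas_cst].
Qed.

Lemma fN_pdom : exists2 C : R, 0 <= C & forall N, pdom (sq n) (fN N) C gD.
Proof.
have [C C0 hC] := fN_bound; exists C => // N; split; [exact: cmeas_fN|exact: gD_ge0|exact: gD_int|].
move=> t; apply: (le_trans (hC N t)); rewrite ler_wpM2l//; apply: ler_prod => j _.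
by rewrite mulr_ge0 ?gD_ge0 ?ed_ge0//= ler_piMr ?gD_ge0 ?ed_le1.
Qed.

Lemma J_fN N : J p n z gam (shp p al N.+1) b F = kap N * CI (mu (sq n)) (fN N).
Proof.
have [C C0 hC] := fN_pdom.
have iN := pdom_integrable (uniq_sq n) (hC N).
have P0 : \prod_(j <- sq n) (ca N j)%:C != 0 :> R[i].
  by rewrite prodf_seq_neq0; apply/allP => j _ /=; rewrite realC_neq0// gt_eqF// ca_gt0.
have fE : (fun t : E => cut n z b (term p n z gam (shp p al N.+1) F) (aff (ca N) da (sq n) t)) =
    (fun t => (\prod_(j <- sq n) (ca N j)%:C)^-1 * kap N * fN N t).
  by apply/funext => t; rewrite -mulrA -fN_eq mulrA mulVf// mul1r.
have [_ h] : Cintegrable (mu (sq n)) (cut n z b (term p n z gam (shp p al N.+1) F)) /\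
    CI (mu (sq n)) (cut n z b (term p n z gam (shp p al N.+1) F)) =
    (\prod_(j <- sq n) `|ca N j|)%:C * CI (mu (sq n)) (fun t => (\prod_(j <- sq n) (ca N j)%:C)^-1 * kap N * fN N t).
  rewrite -fE; apply: CI_aff; first exact: uniq_sq.
  - by move=> j; rewrite gt_eqF// ca_gt0.
  - by apply: cmeas_cut; exact: cmeas_term.
  - by rewrite fE; exact: CintegrableZ.
rewrite /J h CIZ// mulrA; congr (_ * _); rewrite rmorph_prod /= mulrA.
rewrite (eq_bigr (fun j => (ca N j)%:C)) ?mulfV ?mul1r// => j _.
by rewrite gtr0_norm// ca_gt0.
Qed.

Definition Vinf s (x : R) : R[i] := pw x (al s - 1) * (expR (- x))%:C *
  \prod_(r <- iota 1 p | r != s) cpowR (z s - z r) (al r).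
Definition finf (t : E) : R[i] := (\prod_(j <- sq n) Vinf (b j) (t j)) *
  \prod_(j <- sq n) \prod_(k <- sq n | (k < j)%N)
    (if b j == b k then pw (t j - t k) (2%:R * gam) else cpowR (z (b j) - z (b k)) (2%:R * gam)).

Lemma cmeas_finf : cmeas finf.
Proof.
apply: cmeasM.
  apply: cmeas_prod => j _; apply: cmeasM; last exact: cmeas_cst.
  apply: cmeasM; first exact: (cmeas_pw _ (meas_coord j)).
  apply: cmeas_real; apply: (measurableT_comp (@measurable_expR R)).
  by apply: (measurableT_comp (@oppr_measurable R setT)); exact: meas_coord.
apply: cmeas_prod => j _; apply: cmeas_prod => k _; case: (b j == b k); last exact: cmeas_cst.
by apply: cmeas_pw; exact: meas_diff.
Qed.

(** A variable whose label differs from its block stays fixed in the integral, so its rescaled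
    distance to the left end point grows linearly in [N] and the factor [ed] kills the integrand. *)
Lemma fN_lim0 j0 (t : E) : j0 \in sq n -> ~~ sc j0 -> clim (fN ^~ t) 0.
Proof.
move=> jn sj; have [C C0 hC] := fN_bound.
have bj := ob jn; have bp : (1 <= b j0 <= p)%N by lia.
have sf : sc j0 = false by exact: negbTE.
have TE N : TT N j0 (t j0) = t j0 by rewrite /TT /ca /da sf mul1r addr0.
have [t0|t0] := leP (t j0) (z (b j0)).
  rewrite (_ : fN ^~ t = fun=> 0); first exact: clim_cst.
  apply/funext => N; rewrite /fN (bigD1_seq j0) ?uniq_sq//= (_ : VV N j0 (t j0) = 0) ?mul0r//.
  rewrite /VV TE; case: ifP => // /andP[t1 _].
  by rewrite (colD1 _ bp) (_ : t j0 - z (b j0) = 0) ?cpow0 ?(mul0r, mulr0)//; apply/eqP; rewrite subr_eq0 eq_le t0 t1.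
have zp := zbp jn; pose d := (t j0 - z (b j0)) / (z p - z (b j0)) / 2.
have d0 : 0 < d by rewrite !divr_gt0// subr_gt0.
apply: clim_nc0.
pose K := C * (gD j0 (t j0) * \prod_(j <- sq n | j != j0) gD j (t j)).
apply: (@squeeze_cvgr _ _ _ _ (fun=> 0) (fun N => K * expR (- (d * N.+1%:R)))).
- near=> N; rewrite nc_ge0 /=; apply: (le_trans (hC N t)).
  rewrite (bigD1_seq j0) ?uniq_sq//= /K -mulrA ler_wpM2l// -!mulrA ler_wpM2l ?gD_ge0//.
  rewrite mulrC; apply: ler_pM.
  + by apply: prodr_ge0 => j _; rewrite mulr_ge0 ?gD_ge0 ?ed_ge0.
  + exact: ed_ge0.
  + by apply: ler_prod => j _; rewrite mulr_ge0 ?gD_ge0 ?ed_ge0//= ler_piMr ?gD_ge0 ?ed_le1.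
  + rewrite /ed sf /un TE ger0_norm; last by rewrite divr_ge0 ?subr_ge0 ?(ltW t0)// ltW// cN_gt0.
    rewrite ler_expR lerN2 /d /cN le_eqVlt; apply/orP; left; apply/eqP.
    have h1 : z p - z (b j0) != 0 by rewrite subr_eq0 gt_eqF.
    have hM : N.+1%:R != 0 :> R by rewrite pnatr_eq0.
    by move: (N.+1%:R) hM => M hM; field; rewrite ?h1 ?hM.
- exact: cvg_cst.
- by rewrite -[X in _ --> X](mulr0 K); apply: cvgM; [exact: cvg_cst|exact: exp_scale_cvg0].
Unshelve. all: by end_near.
Qed.

Section AllScaled.
Hypothesis asc : forall j, j \in sq n -> sc j.

Lemma TT_lim j x : j \in sq n -> (fun N => TT N j x) @ \oo --> z (b j).
Proof.
move=> jn; rewrite /TT /ca /da asc// /cN -[X in _ --> X]add0r; apply: cvgD; last exact: cvg_cst.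
rewrite -[X in _ --> X](mul0r x); apply: cvgM; last exact: cvg_cst.
by rewrite -[X in _ --> X](mulr0 (z p - z (b j))); apply: cvgM; [exact: cvg_cst|exact: cvg_harmonic].
Qed.

Lemma VV_lim j x : j \in sq n -> clim (fun N => VV N j x) (Vinf (b j) x).
Proof.
move=> jn; have sj := asc jn; have /andP[_ /eqP Fb] := sj.
have bj := ob jn; have bp : (1 <= b j <= p)%N by lia.
have Tx N : TT N j x - z (b j) = cN (b j) N * x by rewrite TT_un// un_sc.
have [x0|x0] := leP x 0.
  rewrite (_ : (fun N => VV N j x) = fun=> 0); last first.
    apply/funext => N; rewrite /VV; case: ifP => // /andP[h _].
    have c0 := cN_gt0 N jn.
    have x00 : x = 0 by apply/eqP; rewrite eq_le x0 /= -(pmulr_rge0 _ c0) -Tx subr_ge0.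
    by rewrite (colD1 _ bp) Tx x00 mulr0 cpow0 ?(mul0r, mulr0).
  by rewrite /Vinf /pw ltNge x0 /= !mul0r; exact: clim_cst.
pose G N := (x%:C^-1 * cpowR x (al (b j))) * ((1 - x / N.+1%:R) ^+ N.+1)%:C *
   \prod_(r <- iota 1 p | r != b j) cpowR (TT N j x - z r) (al r).
apply: (@clim_near _ G).
  (* For large [N] the rescaled point has entered its interval and the upper bound of the cell
     disappears from the integrand. *)
  have nI : \forall N \near \oo, TT N j x < z (b j).+1.
    by apply: (cvgr_lt (z (b j)) (TT_lim x jn)); apply: zlt.
  near=> N; have tlt : TT N j x < z (b j).+1 by near: N.
  have c0 := cN_gt0 N jn.
  have cpc : cpowR (cN (b j) N) (al (b j)) != 0 by rewrite cpow_neq0// gt_eqF.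
  rewrite /VV /inI (ltW tlt) andbT -subr_ge0 Tx mulr_ge0 ?(ltW c0) ?(ltW x0)//.
  rewrite Fb /uu gtn_eqF; last by case/andP: bp.
  rewrite (colD1 _ bp) Tx (cpowM _ _ (ltW c0)) /ca sj /G.
  have -> : (TT N j x - z p) / (z (b j) - z p) = 1 - x / N.+1%:R.
    have -> : TT N j x = z (b j) + cN (b j) N * x by rewrite -Tx; ring.
    have h1 : z (b j) - z p != 0 by rewrite subr_eq0 lt_eqF// zbp.
    have hM : N.+1%:R != 0 :> R by rewrite pnatr_eq0.
    by rewrite /cN; move: (N.+1%:R) hM => M hM; field; rewrite ?h1 ?hM.
  rewrite rmorphXn realCM /=.
  move: (_ ^+ N.+1) (\prod_(r <- _ | _) _) => X Y; field.
  by rewrite cpc !realC_neq0 ?gt_eqF.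
have -> : Vinf (b j) x = (x%:C^-1 * cpowR x (al (b j))) * (expR (- x))%:C *
   \prod_(r <- iota 1 p | r != b j) cpowR (z (b j) - z r) (al r).
  by rewrite /Vinf /pw x0 cpowD cpowV ?gt_eqF// cpow1 [_ * x%:C^-1]mulrC.
apply: climM; first apply: climM; first exact: clim_cst.
  by apply: clim_real; apply: one_sub_expn_cvg; exact: ltW.
rewrite big_seq_cond; under eq_fun do rewrite big_seq_cond.
apply: clim_prod => r /andP[]; rewrite mem_iota => rp rb; apply: clim_cpow.
  rewrite subr_eq0; case: (ltngtP r (b j)) => [lt|lt|e]; last by rewrite e eqxx in rb.
    by rewrite gt_eqF//; apply: (z_lt p2 zlt); lia.
  by rewrite lt_eqF//; apply: (z_lt p2 zlt); lia.
by apply: cvgB; [exact: TT_lim|exact: cvg_cst].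
Unshelve. all: by end_near.
Qed.

Lemma fN_lim (t : E) : clim (fN ^~ t) (finf t).
Proof.
apply: climM.
  rewrite big_seq; under eq_fun do rewrite big_seq.
  by apply: clim_prod => j jn; exact: VV_lim.
rewrite big_seq; under eq_fun do rewrite big_seq.
apply: clim_prod => j jn; rewrite big_seq_cond; under eq_fun do rewrite big_seq_cond.
apply: clim_prod => k /andP[kn kj]; rewrite /WW; case: eqP => [e|ne]; last first.
  apply: clim_cpow; last by apply: cvgB; exact: TT_lim.
  have bkj : (b k < b j)%N by rewrite ltn_neqAle (bm jn kn kj) andbT; apply/eqP => e; apply: ne.
  rewrite subr_eq0 gt_eqF//; have o1 := ob jn; have o2 := ob kn.
  by apply: (z_lt p2 zlt); lia.
rewrite (_ : (fun N => _) = fun=> pw (t j - t k) (2%:R * gam)); first exact: clim_cst.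
apply/funext => N; have c0 := cN_gt0 N jn.
have -> : TT N j (t j) - TT N k (t k) = cN (b j) N * (t j - t k).
  by rewrite /TT /ca /da !asc// e; ring.
rewrite /pw pmulr_rgt0//; case: ifP => _; last by rewrite mul0r.
by rewrite (cpowM _ _ (ltW c0)) mulrAC mulfV ?mul1r// cpow_neq0// gt_eqF.
Qed.
End AllScaled.

(** The two cases share one dominating function, so a single theorem yields both the diagonal limit
    and the vanishing of the others. *)
Theorem J_lim : clim (fun N => (kap N)^-1 * J p n z gam (shp p al N.+1) b F)
  (if all sc (sq n) then CI (mu (sq n)) finf else 0).
Proof.
have -> : (fun N => (kap N)^-1 * J p n z gam (shp p al N.+1) b F) = (fun N => CI (mu (sq n)) (fN N)).
  by apply/funext => N; rewrite J_fN mulrA mulVf ?mul1r// kap_neq0.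
have [C C0 hC] := fN_pdom.
have [ig _] := pdom_integrable_prod C (uniq_sq n) gD_ge0 gD_int.
have bd N t : nc (fN N t) <= C * \prod_(j <- sq n) gD j (t j) by have [_ _ _] := hC N; exact.
case: ifPn => [/allP asc|].
  by apply: (CI_dct cmeas_fN cmeas_finf ig bd) => t; exact: fN_lim.
rewrite -has_predC => /hasP[j0 jn sj]; rewrite -[X in clim _ X](@CI0 _ _ _ (mu (sq n))).
apply: (CI_dct cmeas_fN _ ig bd); first exact: cmeas_cst.
by move=> t; exact: (fN_lim0 _ jn).
Qed.

End Limit.

(** * Factorization of the limit integral over the blocks *)

Section BlockFactor.
Context {R : realType}.
Local Notation E := (envT R).
Local Notation lam := (@lebesgue_measure R).

Definition Lagf (gam : R[i]) n (a : R[i]) (u : E) : R[i] :=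
  (\prod_(j <- sq n) (pw (u j) (a - 1) * (expR (- u j))%:C)) *
  \prod_(j <- sq n) \prod_(k <- sq n | (k < j)%N) pw (u j - u k) (2%:R * gam).
Definition LL gam n a : R[i] := CI (mu (sq n)) (Lagf gam n a).

Lemma cmeas_Lfun gam n a : cmeas (Lagf gam n a).
Proof.
apply: cmeasM.
  apply: cmeas_prod => j _; apply: cmeasM; first exact: (cmeas_pw _ (meas_coord j)).
  apply: cmeas_real; apply: (measurableT_comp (@measurable_expR R)).
  by apply: (measurableT_comp (@oppr_measurable R setT)); exact: meas_coord.
apply: cmeas_prod => j _; apply: cmeas_prod => k _.
by apply: cmeas_pw; exact: meas_diff.
Qed.

(* [Lagf] is a limit of the integrands [fN] for [p = 2], hence inherits their bound. *)
Lemma Lagf_pdom gam n a : 0 < ReC gam -> 0 < ReC a ->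
  exists2 C : R, 0 <= C & pdom (sq n) (Lagf gam n a) C (fun=> gexp (ReC a)).
Proof.
move=> gam0 a0; pose z (s : nat) : R := s%:R; pose al (s : nat) : R[i] := if s == 1%N then a else 1.
pose b (_ : nat) := 1%N.
have zlt s : (1 <= s < 2)%N -> z s < z s.+1 by rewrite /z ltr_nat.
have pa : posal 2 al by move=> s _; rewrite /al; case: ifP => // _; rewrite /ReC /= ltr01.
have ob : okb 2 n b by [].
have oF j : (b j <= 2)%N by [].
have bm j k : j \in sq n -> k \in sq n -> (k < j)%N -> (b k <= b j)%N by [].
have F1 j : j \in sq n -> (1 <= b j)%N by [].
have asc j : j \in sq n -> sc n b b j by move=> jn; rewrite /sc jn eqxx.
have [C C0 hC] := fN_pdom (isT : (2 <= 2)%N) zlt gam0 pa ob oF F1.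
pose c0 := \prod_(r <- iota 1 2 | r != 1%N) cpowR (z 1%N - z r) (al r).
have c0n : c0 != 0.
  rewrite /c0 prodf_seq_neq0; apply/allP => r; rewrite mem_iota => r2; apply/implyP => r1.
  by rewrite cpow_neq0// /z subr_eq0 eqr_nat; lia.
have LE t : Lagf gam n a t = (\prod_(j <- sq n) c0)^-1 * finf 2 n z gam al b t.
  have K0 : \prod_(j <- sq n) c0 != 0 by rewrite prodf_seq_neq0; apply/allP => j _.
  apply: (mulfI K0); rewrite [RHS]mulrA mulfV// mul1r /finf /Lagf mulrA -big_split; congr (_ * _).
    by apply: eq_bigr => j _; exact: mulrC.
exists (nc (\prod_(j <- sq n) c0)^-1 * C); first by rewrite mulr_ge0 ?nc_ge0.
split; [exact: cmeas_Lfun|by move=> j x; exact: gexp_ge0|by move=> j; exact: integrable_gexp|].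
move=> t; rewrite LE ncM -mulrA ler_wpM2l ?nc_ge0//.
have cv0 : clim (fN 2 n z gam al b b ^~ t) (finf 2 n z gam al b t) by apply: fN_lim.
have cv := clim_nc cv0.
have -> : \prod_(j <- sq n) gexp (ReC a) (t j) = \prod_(j <- sq n) gD 2 n z al b b j (t j).
  by rewrite !big_seq; apply: eq_bigr => j jn; rewrite /gD asc.
apply: (cvgr_to_le cv); apply: nearW => N.
by have [_ _ _] := hC N; apply.
Qed.

Lemma pdom_map (rho : nat -> nat) s (f : E -> R[i]) C (g : R -> R) : pdom s f C (fun=> g) ->
  pdom (map rho s) (fun t => f (fun j => t (rho j))) C (fun=> g).
Proof.
move=> [mf g0 ig fg]; split=> //.
  apply: (cmeas_comp (T := E) mf); apply: meas_env => j; exact: meas_coord.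
by move=> t; rewrite big_map; exact: fg.
Qed.

Lemma sq_cat a m : sq (a + m) = map (addn a) (sq m) ++ sq a.
Proof. by elim: m => [|m IH]; rewrite ?addn0// addnS /= IH addnS. Qed.

Variables (p n : nat) (z : nat -> R) (gam : R[i]) (al : nat -> R[i]) (l : Zc n p.-1).
Hypothesis p2 : (2 <= p)%N.
Hypothesis zlt : forall s, (1 <= s < p)%N -> z s < z s.+1.
Hypothesis gam0 : 0 < ReC gam.
Hypothesis pa : posal p al.
Local Notation b := (blk l).

Definition Zcol s : R[i] := \prod_(r <- iota 1 p | r != s) cpowR (z s - z r) (al r).
(** The limit integrand truncated to the first [k] blocks, so that blocks can be split off one at a
    time. *)
Definition Fk k (u : E) : R[i] := (\prod_(j <- sq (lsum l k)) Vinf p z al (b j) (u j)) *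
  \prod_(j <- sq (lsum l k)) \prod_(i <- sq (lsum l k) | (i < j)%N)
    (if b j == b i then pw (u j - u i) (2%:R * gam) else cpowR (z (b j) - z (b i)) (2%:R * gam)).
Definition Dk k : R[i] := \prod_(1 <= s < k.+1) (LL gam (cget l s) (al s) * Zcol s ^+ cget l s *
  \prod_(1 <= r < s) cpowR (z s - z r) (2%:R * gam) ^+ (cget l r * cget l s)).

Lemma blk_top k j : (k.+1 < p)%N -> j \in sq (cget l k.+1) -> b (lsum l k + j) = k.+1.
Proof. by move=> kp; rewrite mem_sq => jm; apply: blkE => //=; rewrite lsumS; lia. Qed.

Lemma prod_blk (G : nat -> R[i]) k : (k < p)%N ->
  \prod_(j <- sq (lsum l k)) G (b j) = \prod_(1 <= s < k.+1) G s ^+ cget l s.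
Proof.
elim: k => [|k IH] kp; first by rewrite lsum0 big_nil big_geq.
rewrite lsumS sq_cat big_cat big_map /= IH; last exact: ltnW.
rewrite [RHS]big_nat_recr//= mulrC; congr (_ * _).
rewrite -prod_sq_const !big_seq; apply: eq_bigr => j jm; by rewrite blk_top.
Qed.

Lemma blk_bot k i : (k < p)%N -> i \in sq (lsum l k) -> (b i <= k)%N.
Proof.
move=> kp; rewrite mem_sq => /andP[i1 ik].
have le : (lsum l k <= n)%N by rewrite -[leqRHS](lsum_n l); apply: lsum_mono; lia.
have i_n : (1 <= i <= n)%N by rewrite i1 (leq_trans ik).
have [_ /andP[h _]] := blkP p2 gam0 l i_n; rewrite leqNgt; apply/negP => kb.
have : (lsum l k <= lsum l (b i).-1)%N by apply: lsum_mono; lia.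
by lia.
Qed.

(** In the limit variables of different blocks no longer interact: their differences are the
    constants $z_s-z_r$, one for each of the $m_rm_s$ pairs. *)
Lemma Fk_step k : (k.+1 < p)%N -> forall u, Fk k.+1 u =
  (Zcol k.+1 ^+ cget l k.+1 * \prod_(1 <= r < k.+1) cpowR (z k.+1 - z r) (2%:R * gam) ^+ (cget l r * cget l k.+1)) *
  (Lagf gam (cget l k.+1) (al k.+1) (fun j => u (lsum l k + j)%N) * Fk k u).
Proof.
move=> kp u; have kp' : (k < p)%N by exact: ltnW.
set a := lsum l k; set m := cget l k.+1; set s := k.+1.
pose Q j i := if b j == b i then pw (u j - u i) (2%:R * gam) else cpowR (z (b j) - z (b i)) (2%:R * gam).
rewrite /Fk lsumS -/a -/m sq_cat !big_cat !big_map /=.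
have top j : j \in sq m -> b (a + j) = s by move=> jm; exact: blk_top.
have bot i : i \in sq a -> (b i < s)%N by move=> ia; rewrite ltnS; exact: blk_bot.
have e1 : \prod_(j <- sq m) Vinf p z al (b (a + j)) (u (a + j)%N) =
    Zcol s ^+ m * \prod_(j <- sq m) (pw (u (a + j)%N) (al s - 1) * (expR (- u (a + j)%N))%:C).
  rewrite -prod_sq_const -big_split !big_seq; apply: eq_bigr => j /top ->.
  by rewrite /Vinf mulrC.
have e2 : \prod_(j <- sq m) \prod_(i <- [seq (a + i)%N | i <- sq m] ++ sq a | (i < a + j)%N) Q (a + j)%N i =
   (\prod_(j <- sq m) \prod_(i <- sq m | (i < j)%N) pw (u (a + j)%N - u (a + i)%N) (2%:R * gam)) *
   \prod_(1 <= r < s) cpowR (z s - z r) (2%:R * gam) ^+ (cget l r * m).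
  have -> : \prod_(1 <= r < s) cpowR (z s - z r) (2%:R * gam) ^+ (cget l r * m) =
      \prod_(j <- sq m) \prod_(i <- sq a) cpowR (z s - z (b i)) (2%:R * gam).
    rewrite prod_sq_const (prod_blk (fun r => cpowR (z s - z r) (2%:R * gam)) kp') -prodrXl.
    by apply: eq_bigr => r _; rewrite exprM.
  rewrite -big_split !big_seq; apply: eq_bigr => j jm; rewrite big_cat big_map /=; congr (_ * _).
    rewrite big_seq_cond [RHS]big_seq_cond; apply: eq_big => [i|i /andP[im _]]; first by rewrite ltn_add2l.
    by rewrite /Q !top// eqxx.
  rewrite big_mkcond !big_seq; apply: eq_bigr => i ia; move: (ia); rewrite mem_sq => /andP[_ ia'].
  have j0 : (0 < j)%N by move: jm; rewrite mem_sq => /andP[].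
  rewrite ifT; last by apply: leq_ltn_trans ia' _; rewrite -[ltnLHS]addn0 ltn_add2l.
  by rewrite /Q top// ifN// neq_ltn bot// orbT.
have e3 : \prod_(j <- sq a) \prod_(i <- [seq (a + i)%N | i <- sq m] ++ sq a | (i < j)%N) Q j i =
    \prod_(j <- sq a) \prod_(i <- sq a | (i < j)%N) Q j i.
  rewrite !big_seq; apply: eq_bigr => j; rewrite mem_sq => /andP[_ ja].
  rewrite big_cat big_map /= [X in X * _]big1 ?mul1r// => i aij.
  by exfalso; move: aij ja; clear; lia.
rewrite e1 e2 e3 /Lagf; ring.
Qed.

Let gg (x : R) : R := \sum_(s : 'I_p.+1 | (0 < s)%N) gexp (ReC (al s)) x.

Lemma Fk_CI k : (k < p)%N -> (exists2 C : R, 0 <= C & pdom (sq (lsum l k)) (Fk k) C (fun=> gg)) /\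
  CI (mu (sq (lsum l k))) (Fk k) = Dk k.
Proof.
have gg0 x : 0 <= gg x by apply: sumr_ge0 => s _; exact: gexp_ge0.
have gg_int : lam.-integrable setT (EFin \o gg).
  rewrite (_ : EFin \o gg = (fun x => \sum_(s : 'I_p.+1 | (0 < s)%N) (EFin \o gexp (ReC (al s))) x)%E); last first.
    by apply/funext => x; rewrite /= -sumEFin.
  apply: integrable_sum => // s s0; apply: integrable_gexp; apply: pa.
  by rewrite s0 /= -ltnS ltn_ord.
elim: k => [|k IH] kp.
  have F0 : Fk 0 = fun=> 1 by apply/funext => u; rewrite /Fk lsum0 !big_nil mulr1.
  rewrite F0 lsum0; split.
    exists 1 => //; split; [exact: cmeas_cst|by move=> j x; exact: gg0|by []|].
    by move=> t; rewrite big_nil mulr1 nc1.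
  by rewrite CI_nil ?/Dk ?big_geq//; exact: cmeas_cst.
have kp' : (k < p)%N by exact: ltnW.
have [[C C0 pF] IHe] := IH kp'.
have ak : 0 < ReC (al k.+1) by apply: pa; rewrite /= ltnW.
have [C1 C10 pL] := Lagf_pdom (cget l k.+1) gam0 ak.
have gle (x : R) : gexp (ReC (al k.+1)) x <= gg x.
  have kin : (inord k.+1 : 'I_p.+1) = k.+1 :> nat by rewrite inordK// ltnS ltnW.
  rewrite /gg (bigD1 (inord k.+1)) /= kin//.
  by rewrite lerDl; apply: sumr_ge0 => s _; exact: gexp_ge0.
have pL' : pdom (sq (cget l k.+1)) (Lagf gam (cget l k.+1) (al k.+1)) C1 (fun=> gg).
  exact: (pdom_weaken C10 (fun _ x => gle x) (fun=> gg_int) pL).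
have pL2 := pdom_map (addn (lsum l k)) pL'.
set K := Zcol k.+1 ^+ cget l k.+1 * \prod_(1 <= r < k.+1) cpowR (z k.+1 - z r) (2%:R * gam) ^+ (cget l r * cget l k.+1).
have FS u : Fk k.+1 u = K * (Lagf gam (cget l k.+1) (al k.+1) (fun j => u (lsum l k + j)%N) * Fk k u) by exact: Fk_step.
have uc : uniq (map (addn (lsum l k)) (sq (cget l k.+1)) ++ sq (lsum l k)) by rewrite -sq_cat uniq_sq.
have us1 : uniq (map (addn (lsum l k)) (sq (cget l k.+1))) by move: uc; rewrite cat_uniq => /andP[].
have prodp : pdom (sq (lsum l k.+1)) (fun u => Lagf gam (cget l k.+1) (al k.+1) (fun j => u (lsum l k + j)%N) * Fk k u) (C1 * C) (fun=> gg).
  have [m1 _ _ b1] := pL2; have [m2 _ _ b2] := pF; split=> //; first exact: cmeasM.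
  move=> t; rewrite ncM lsumS sq_cat big_cat /= mulrACA ler_pM ?nc_ge0//.
split.
  exists (nc K * (C1 * C)); first by rewrite !mulr_ge0 ?nc_ge0.
  have [mp _ _ bp] := prodp; split=> //.
    by rewrite (_ : Fk k.+1 = fun u => K * (Lagf gam (cget l k.+1) (al k.+1) (fun j => u (lsum l k + j)%N) * Fk k u));
      [apply: cmeasM => //; exact: cmeas_cst|apply/funext].
  by move=> t; rewrite FS ncM -mulrA ler_wpM2l ?nc_ge0//; exact: bp.
rewrite (_ : Fk k.+1 = fun u => K * (Lagf gam (cget l k.+1) (al k.+1) (fun j => u (lsum l k + j)%N) * Fk k u)); last exact/funext.
rewrite CIZ; last exact: (pdom_integrable (uniq_sq _) prodp).
rewrite lsumS sq_cat (CI_factor uc pL2 pF C10 C0); first last.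
- move=> t i x im; rewrite /Fk; congr (_ * _).
    rewrite !big_seq; apply: eq_bigr => j ja; rewrite updN//; apply/eqP => e; subst j.
    by move: uc; rewrite cat_uniq => /and3P[_ /hasPn/(_ i ja)]; rewrite /= im.
  have ne j : j \in sq (lsum l k) -> upd t i x j = t j.
    move=> ja; rewrite updN//; apply/eqP => e; subst j.
    by move: uc; rewrite cat_uniq => /and3P[_ /hasPn/(_ i ja)]; rewrite /= im.
  rewrite !big_seq; apply: eq_bigr => j ja; rewrite big_seq_cond [RHS]big_seq_cond; apply: eq_bigr => i' /andP[ia _].
  by rewrite !ne.
- move=> t t' tt; rewrite /Lagf; congr (_ * _).
    rewrite !big_seq; apply: eq_bigr => j ja; rewrite tt//; apply: map_f => //.
  rewrite !big_seq; apply: eq_bigr => j ja; rewrite big_seq_cond [RHS]big_seq_cond; apply: eq_bigr => i' /andP[ia _].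
  by rewrite !tt//; apply: map_f.
have [_ rn] := CI_rename (@addnI (lsum l k)) (uniq_sq (cget l k.+1)) (cmeas_Lfun gam _ (al k.+1)) (pdom_integrable us1 pL2).
rewrite -rn IHe /Dk [RHS]big_nat_recr//= /K /LL; ring.
Qed.

Lemma CI_finf : CI (mu (sq n)) (finf p n z gam al b) = Dk p.-1.
Proof.
have pp : (p.-1 < p)%N by rewrite prednK// ltnW.
by have [_ <-] := Fk_CI pp; rewrite /Fk lsum_n.
Qed.
End BlockFactor.

(** * The Gamma function *)

Section GammaFunction.
Local Open Scope classical_set_scope.
Context {R : realType}.
Local Notation lam := (@lebesgue_measure R).
Implicit Types (a : R[i]) (N : nat).

Lemma climV (u : nat -> R[i]) w : w != 0 -> clim u w -> clim (fun n => (u n)^-1) w^-1.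
Proof.
move=> w0 [h1 h2].
have RV (v : R[i]) : ReC v^-1 = ReC v / (ReC v ^+ 2 + ImC v ^+ 2) by case: v.
have IV (v : R[i]) : ImC v^-1 = - (ImC v / (ReC v ^+ 2 + ImC v ^+ 2)) by case: v.
have n0 : ReC w ^+ 2 + ImC w ^+ 2 != 0.
  apply: contra_neq w0 => e; have := sqr_ge0 (ReC w); have := sqr_ge0 (ImC w) => i0 r0.
  have /eqP : ReC w ^+ 2 = 0 by lra.
  have /eqP : ImC w ^+ 2 = 0 by lra.
  by rewrite !sqrf_eq0 => /eqP i1 /eqP r1; apply: complex_eq.
have cd : (fun n => ReC (u n) ^+ 2 + ImC (u n) ^+ 2) @ \oo --> ReC w ^+ 2 + ImC w ^+ 2.
  by apply: cvgD; rewrite !expr2; apply: cvgM.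
split.
  by under eq_fun do rewrite RV; rewrite RV; apply: cvgM => //; apply: cvgV.
by under eq_fun do rewrite IV; rewrite IV; apply: cvgN; apply: cvgM => //; apply: cvgV.
Qed.

Lemma GammaE a : Gamma a = CI lam (fun x => pw x (a - 1) * (expR (- x))%:C).
Proof.
rewrite /Gamma /cint /CI; congr (_ +i* _); rewrite /Rintegral; congr fine;
  rewrite integral_mkcond; apply: eq_integral => x _; rewrite patchE /pw;
  case: ifPn; rewrite ?inE ?notin_setE /= in_itv /= andbT => x0.
- by rewrite x0.
- by move/negP/negbTE: x0 => ->; rewrite mul0r.
- by rewrite x0.
- by move/negP/negbTE: x0 => ->; rewrite mul0r.
Qed.

(** The Beta integral $B(a,N+1)$, which leads to the Gauss product for Gamma. *)
Definition AN N a := CI lam (ooC 0 1 (fun t => cpowR t (a - 1) * ((1 - t) ^+ N)%:C)).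

Lemma cmeas_ooC (x y : R) (f : R -> R[i]) : cmeas f -> cmeas (ooC x y f).
Proof.
move=> mf; rewrite (_ : ooC x y f = fun t => if `[< `]x, y[%classic t >] then f t else 0).
  by apply: cmeas_if => //; exact: cmeas_cst.
by apply/funext => t; rewrite /ooC /= in_itv /= asboolb.
Qed.

Lemma cmeas_AN N a : cmeas (fun t : R => cpowR t (a - 1) * ((1 - t) ^+ N)%:C).
Proof.
apply: cmeasM; first exact: (cmeas_cpow _ (@measurable_id _ _ setT)).
apply: cmeas_real; apply: measurable_funX; apply: measurable_funB; [exact: measurable_cst|exact: measurable_id].
Qed.

Lemma AN_int N a : 0 < ReC a -> Cintegrable lam (ooC 0 1 (fun t => cpowR t (a - 1) * ((1 - t) ^+ N)%:C)).
Proof.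
move=> a0; apply: (Cintegrable_dom _ (integrable_hpow 1 a0)).
  by apply: cmeas_ooC; exact: cmeas_AN.
move=> t; rewrite /ooC; case: ifPn => [/andP[t0 t1]|_]; last by rewrite nc0 hpow_ge0.
rewrite ncM nc_cpow_pos// nc_real /hpow (gtr0_norm t0) t1 ReCD ReCN.
have -> : ReC (1 : R[i]) = 1 by [].
rewrite ler_piMr ?powR_ge0// ger0_norm ?exprn_ge0 ?exprn_ile1 ?subr_ge0 ?(ltW t1)//.
by rewrite lerBlDr lerDl ltW.
Qed.

Lemma AN_0 a : 0 < ReC a -> AN 0 a = a^-1.
Proof.
move=> a0; have an0 := Re_neq0 a0.
have fE (x : R) : cpowR x (a - 1) * ((1 - x) ^+ 0)%:C = cpowR x (a - 1) by rewrite expr0 mulr1.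
have E1 : ooC 0 1 (fun t : R => cpowR t (a - 1) * ((1 - t) ^+ 0)%:C) = ooC 0 1 (fun t => cpowR (t - 0) (a - 1)).
  by apply/funext => x; rewrite /ooC fE subr0.
rewrite /AN E1 (@CFTC R _ (fun t => a^-1 * cpowR (t - 0) a) 0 1 0 a^-1)//.
- by rewrite subr0.
- move=> x /andP[x0 x1].
  have := cderivM (cderiv_cst a^-1 x) (cderiv_cpow a (negbT (gt_eqF x0))).
  rewrite mul0r add0r subr0; congr cderiv; rewrite cpowD cpowV ?gt_eqF// cpow1.
  by field; rewrite an0 /= eq_complex /= eqxx andbT gt_eqF.
- by move=> x /andP[x0 x1]; exact: cderiv_cont (cderiv_cpow (a - 1) (negbT (gt_eqF x0))).
- by rewrite -E1; exact: AN_int.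
- rewrite -(mulr0 a^-1); apply: climM; first exact: clim_cst.
  apply: clim_nc0; under eq_fun do rewrite subr0 add0r nc_cpow_pos ?inpt_gt0//.
  have h := @inpt_cvg R 0 1; apply/cvgrPdist_lt => e e0.
  have e1 : 0 < e `^ (ReC a)^-1 by rewrite powR_gt0.
  move/cvgrPdist_lt/(_ _ e1): h; apply: filterS => k; rewrite !sub0r !normrN => hk.
  rewrite (gtr0_norm (inpt_gt0 k ltr01)) in hk; rewrite (ger0_norm (powR_ge0 _ _)).
  rewrite [ltRHS](_ : e = (e `^ (ReC a)^-1) `^ ReC a); last first.
    by rewrite -powRrM mulVf ?gt_eqF// powRr1// ltW.
  by rewrite gt0_ltr_powR// ?nnegrE ?powR_ge0// ltW// inpt_gt0.
- rewrite -{2}[a^-1]mulr1 -(cpow1x a); apply: climM; first exact: clim_cst.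
  under eq_fun do rewrite subr0; apply: clim_cpow; first by rewrite oner_eq0.
  by rewrite -[X in _ --> X](subr0 1); apply: cvgB; [exact: cvg_cst|exact: inpt_cvg].
Qed.

Lemma AN_S N a : 0 < ReC a -> AN N.+1 a = AN N a - AN N (a + 1).
Proof.
move=> a0; have a1 : 0 < ReC (a + 1) by rewrite ReCD addr_gt0// /ReC /= ltr01.
have e1 := CIZ (-1) (AN_int N a1).
have e2 := CID (AN_int N a0) (CintegrableZ (-1) (AN_int N a1)).
rewrite e1 mulN1r in e2; rewrite /AN; apply: (etrans _ e2).
congr CI; apply/funext => x; rewrite /ooC; case: ifPn => [/andP[x0 x1]|_]; last by rewrite mulr0 addr0.
have -> : cpowR x (a + 1 - 1) = cpowR x (a - 1) * x%:C.
  by have := cpowD x (a - 1) 1; rewrite subrK cpow1 addrK.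
rewrite exprS realCM rmorphB /=; ring.
Qed.

Lemma addn_neq0 a (k : nat) : 0 < ReC a -> a + k%:R != 0.
Proof. by move=> a0; apply: Re_neq0; rewrite ReCD natC /ReC /= ltr_wpDr. Qed.

Lemma rising_neq0 a N : 0 < ReC a -> \prod_(0 <= k < N) (a + k%:R) != 0.
Proof. by move=> a0; rewrite big_mkord; apply/prodf_neq0 => k _; exact: addn_neq0. Qed.

(** Induction on [N] for all [a] at once, since $(1-t)^{N+1}=(1-t)^N-t(1-t)^N$ trades one power of
    $1-t$ for a shift of [a]. *)
Lemma AN_val N a : 0 < ReC a -> AN N a = (N`!)%:R / \prod_(0 <= k < N.+1) (a + k%:R).
Proof.
elim: N a => [|N IH] a a0; first by rewrite AN_0// big_nat1 addr0 mul1r.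
have a1 : 0 < ReC (a + 1) by rewrite ReCD addr_gt0// /ReC /= ltr01.
rewrite AN_S// IH// IH//.
have -> : \prod_(0 <= k < N.+1) (a + 1 + k%:R) = (\prod_(1 <= k < N.+1) (a + k%:R)) * (a + N.+1%:R).
  rewrite -(big_nat_recr N.+1 1 (fun k => a + k%:R))// big_add1 /=.
  by apply: eq_bigr => k _; rewrite -natr1 addrA addrAC.
rewrite big_ltn// addr0 [in RHS]big_nat_recr//= [in RHS]big_ltn// addr0.
have P0 : \prod_(1 <= k < N.+1) (a + k%:R) != 0.
  by rewrite big_add1 big_mkord; apply/prodf_neq0 => k _; exact: addn_neq0.
have A0 := Re_neq0 a0; have A1 := addn_neq0 N.+1 a0.
rewrite factS natrM.
move: (\prod_(1 <= k < N.+1) (a + k%:R)) P0 A1 => P P0.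
by rewrite -natr1 => A1; field; rewrite P0 A0 A1.
Qed.

Lemma CI_scale (c : R) (f : R -> R[i]) : 0 < c -> cmeas f -> Cintegrable lam (fun x => f (c * x)) ->
  CI lam f = c%:C * CI lam (fun x => f (c * x)).
Proof.
move=> c0 mf intf.
have [_ ->//] : Cintegrable lam f /\ CI lam f = c%:C * CI lam (fun x => f (c * x)).
  apply: (@CI_transport R _ _ _ _ lam lam (fun x : R => c * x) c (ltW c0) _ f mf intf).
  move=> h mh h0; rewrite (lebesgue_affine_pos 0 c0 mh h0); congr (_ * _)%E.
  by apply: eq_integral => x _; rewrite addr0.
Qed.

Definition hN a N (u : R) : R[i] :=
  if (0 < u < N.+1%:R) then cpowR u (a - 1) * ((1 - u / N.+1%:R) ^+ N.+1)%:C else 0.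

Lemma cmeas_hN a N : cmeas (hN a N).
Proof.
apply: (@cmeas_ooC 0 N.+1%:R (fun u => cpowR u (a - 1) * ((1 - u / N.+1%:R) ^+ N.+1)%:C)).
apply: cmeasM; first exact: (cmeas_cpow _ (@measurable_id _ _ setT)).
apply: cmeas_real; apply: measurable_funX; apply: measurable_funB; first exact: measurable_cst.
by apply: measurable_funM; [exact: measurable_id|exact: measurable_cst].
Qed.

Lemma hN_bound a N u : nc (hN a N u) <= gexp (ReC a) u.
Proof.
rewrite /hN; case: ifPn => [/andP[u0 uN]|_]; last by rewrite nc0 gexp_ge0.
rewrite /gexp u0 ncM nc_cpow_pos// ReCD ReCN (_ : ReC (1 : R[i]) = 1)// ler_wpM2l ?powR_ge0//.
have M0 : 0 < N.+1%:R :> R by [].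
rewrite nc_real ger0_norm; last by rewrite exprn_ge0// subr_ge0 ler_pdivrMr// mul1r ltW.
apply: (le_trans (one_sub_expn_le (ltn0Sn N) (ltW uN))); rewrite ler_expR; lra.
Qed.

Definition QN a N : R[i] := cpowR N.+1%:R a * ((N.+1)`!)%:R / \prod_(0 <= k < N.+2) (a + k%:R).

(** Substituting $t=u/(N+1)$ in the Beta integral turns Gauss' quotient into an integral whose
    integrand tends to that of Gamma. *)
Lemma QN_CI a N : 0 < ReC a -> QN a N = CI lam (hN a N).
Proof.
move=> a0; rewrite /QN -mulrA -AN_val// /AN.
have M0 : 0 < N.+1%:R :> R by [].
have Mi : 0 < N.+1%:R^-1 :> R by rewrite invr_gt0.
have fE (x : R) : ooC 0 1 (fun t : R => cpowR t (a - 1) * ((1 - t) ^+ N.+1)%:C) (N.+1%:R^-1 * x) =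
   cpowR N.+1%:R^-1 (a - 1) * hN a N x.
  rewrite /ooC /hN pmulr_rgt0// [_^-1 * x]mulrC ltr_pdivrMr// mul1r.
  case: ifP => _; last by rewrite mulr0.
  by rewrite [x / _]mulrC (cpowM _ _ (ltW Mi)) mulrA.
rewrite (CI_scale Mi).
- under eq_fun do rewrite fE; rewrite CIZ; last first.
    by apply: (Cintegrable_dom _ (integrable_gexp a0)); [exact: cmeas_hN|move=> x; exact: hN_bound].
  have e : (N.+1%:R^-1)%:C * cpowR N.+1%:R^-1 (a - 1) = cpowR N.+1%:R^-1 a.
    by rewrite -{1}(cpow1 N.+1%:R^-1) -cpowD addrC subrK.
  rewrite [X in _ * X]mulrA e mulrA -(cpowM _ _ (ltW M0)) mulfV ?cpow1x ?mul1r// gt_eqF//.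
- by apply: cmeas_ooC; exact: cmeas_AN.
- under eq_fun do rewrite fE; apply: CintegrableZ.
  by apply: (Cintegrable_dom _ (integrable_gexp a0)); [exact: cmeas_hN|move=> x; exact: hN_bound].
Qed.

Lemma QN_lim a : 0 < ReC a -> clim (QN a) (Gamma a).
Proof.
move=> a0; have -> : QN a = fun N => CI lam (hN a N) by apply/funext => N; exact: QN_CI.
rewrite GammaE; apply: (CI_dct _ _ (integrable_gexp a0)); [exact: cmeas_hN| |by move=> N x; exact: hN_bound|].
  apply: cmeasM; first exact: (cmeas_pw _ (@measurable_id _ _ setT)).
  apply: cmeas_real; apply: (measurableT_comp (@measurable_expR R)).
  by apply: (measurableT_comp (@oppr_measurable R setT)); exact: measurable_id.
move=> u; rewrite /pw; case: ifPn => [u0|u0]; last first.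
  rewrite mul0r (_ : hN a ^~ u = fun=> 0); first exact: clim_cst.
  by apply/funext => N; rewrite /hN (negbTE u0).
apply: (@clim_near _ (fun N => cpowR u (a - 1) * ((1 - u / N.+1%:R) ^+ N.+1)%:C)).
  near=> N; rewrite /hN u0 /= ifT//; apply: (@le_lt_trans _ _ N%:R); last by rewrite ltr_nat.
  by near: N; exact: nbhs_infty_ger.
by apply: climM; [exact: clim_cst|apply: clim_real; apply: one_sub_expn_cvg; exact: ltW].
Unshelve. all: by end_near.
Qed.

(** Squaring gives $|a+k|^2=k^2(1+2y)$ with $y=\Re a/k+|a|^2/(2k^2)$, and $1+2y\le e^{2y}$. The two
    terms of the exponent produce a harmonic sum and a convergent one. *)
Lemma nc_addn_le a (k : nat) : (0 < k)%N -> 0 <= ReC a ->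
  nc (a + k%:R) <= k%:R * expR (ReC a / k%:R + nc a ^+ 2 / 2 / k%:R ^+ 2).
Proof.
move=> k0 a0; have K0 : 0 < k%:R :> R by rewrite ltr0n.
have ncE (w : R[i]) : nc w ^+ 2 = ReC w ^+ 2 + ImC w ^+ 2.
  by case: w => x y; rewrite /nc /ReC /ImC /= sqr_sqrtr// addr_ge0 ?sqr_ge0.
have r0 : 0 <= k%:R * expR (ReC a / k%:R + nc a ^+ 2 / 2 / k%:R ^+ 2) by rewrite mulr_ge0 ?expR_ge0// ltW.
rewrite -ler_sqr ?nnegrE ?nc_ge0//.
rewrite [leLHS]ncE exprMn -expRM_natl ReCD ImCD natC /ReC /ImC /= addr0 -/(ReC a) -/(ImC a).
apply: (@le_trans _ _ (k%:R ^+ 2 * (1 + 2 * (ReC a / k%:R + nc a ^+ 2 / 2 / k%:R ^+ 2)))).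
  rewrite ncE le_eqVlt; apply/orP; left; apply/eqP; field.
  by rewrite gt_eqF.
by rewrite ler_wpM2l ?sqr_ge0// expR_ge1Dx.
Qed.

Lemma exp_harmonic M : expR (\sum_(1 <= k < M.+2) (k%:R)^-1) <= expR 1 * M.+1%:R :> R.
Proof.
elim: M => [|M IH]; first by rewrite big_nat1 invr1 mulr1.
rewrite big_nat_recr//= expRD.
have M0 : 0 < M.+2%:R :> R by []. have M1 : 0 < M.+1%:R :> R by [].
have h : expR (M.+2%:R^-1) <= M.+2%:R / M.+1%:R :> R.
  rewrite -[leLHS]invrK -expRN -[leRHS]invrK lef_pV2 ?posrE ?expR_gt0 ?invr_gt0 ?divr_gt0// invf_div.
  apply: le_trans (expR_ge1Dx _); rewrite -[X in 1 - X]mul1r.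
  rewrite -[X in X - _](mulfV (negbT (gt_eqF M0))) -mulrBl ler_wpM2r ?invr_ge0 ?(ltW M0)//.
  by rewrite -[M.+2%:R]natr1 addrK.
apply: (le_trans (ler_pM (expR_ge0 _) (expR_ge0 _) IH h)).
rewrite le_eqVlt; apply/orP; left; apply/eqP.
by move: (M.+1%:R : R) (M.+2%:R : R) M1 => x y x0; field; rewrite gt_eqF.
Qed.

Lemma sum_inv_sqr M : \sum_(1 <= k < M.+2) (k%:R ^+ 2)^-1 <= 2 - M.+1%:R^-1 :> R.
Proof.
elim: M => [|M IH]; first by rewrite big_nat1 expr1n invr1; lra.
rewrite big_nat_recr//=; apply: (le_trans (lerD IH (lexx _))).
have -> : 2 - M.+1%:R^-1 + (M.+2%:R ^+ 2)^-1 = 2 - M.+2%:R^-1 - (M.+1%:R^-1 - M.+2%:R^-1 - (M.+2%:R ^+ 2)^-1) :> R by ring.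
rewrite lerBlDr lerDl.
have -> : M.+1%:R^-1 - M.+2%:R^-1 - (M.+2%:R ^+ 2)^-1 = (M.+1%:R * M.+2%:R ^+ 2)^-1 :> R.
  have M1 : M.+1%:R != 0 :> R by rewrite pnatr_eq0.
  have e : M.+2%:R = M.+1%:R + 1 :> R by rewrite natr1.
  have M2 : M.+1%:R + 1 != 0 :> R by rewrite natr1 pnatr_eq0.
  by rewrite e; move: (M.+1%:R) M1 M2 => x x0 x1; field; rewrite x0 x1.
by rewrite invr_ge0 mulr_ge0 ?sqr_ge0.
Qed.

(** A positive lower bound on Gauss' quotients shows that Gamma has no zero in the right half-plane.
    The harmonic sum in the exponent of the denominator costs at most $e^{\Re a}(N+1)^{\Re a}$,
    which the numerator provides up to a constant. *)
Lemma QN_lower a : 0 < ReC a -> exists2 e : R, 0 < e & forall N, e <= nc (QN a N).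
Proof.
move=> a0; have n0 : 0 < nc a.
  by rewrite lt_neqAle nc_ge0 eq_sym andbT; apply/eqP => h; have := ReC_le_nc a; rewrite h gtr0_norm//; lra.
exists (nc a * expR (ReC a + nc a ^+ 2))^-1; first by rewrite invr_gt0 mulr_gt0 ?expR_gt0.
move=> N; rewrite /QN ncM ncM ncV nc_cpow_pos// nc_prod big_ltn// addr0.
have M0 : 0 < N.+1%:R :> R by [].
have bd : \prod_(1 <= k < N.+2) nc (a + k%:R) <= ((N.+1)`!)%:R * (expR (ReC a + nc a ^+ 2) * N.+1%:R `^ ReC a).
  apply: (@le_trans _ _ (\prod_(1 <= k < N.+2) (k%:R * expR (ReC a / k%:R + nc a ^+ 2 / 2 / k%:R ^+ 2)))).
    rewrite big_nat [leRHS]big_nat; apply: ler_prod => k /andP[k1 _].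
    by rewrite nc_ge0 nc_addn_le// ltW.
  rewrite big_split /= -natr_prod -fact_prod ler_wpM2l// -expR_sum big_split /= -!mulr_sumr.
  apply: (@le_trans _ _ (expR (ReC a * \sum_(1 <= k < N.+2) k%:R^-1) *
      expR (nc a ^+ 2 / 2 * \sum_(1 <= k < N.+2) (k%:R ^+ 2)^-1))); first by rewrite -expRD.
  have -> : expR (ReC a + nc a ^+ 2) * N.+1%:R `^ ReC a = (expR (ReC a) * N.+1%:R `^ ReC a) * expR (nc a ^+ 2).
    by rewrite [X in X * _]expRD; ring.
  apply: ler_pM; rewrite ?expR_ge0//.
    have -> : expR (ReC a * \sum_(1 <= k < N.+2) k%:R^-1) = expR (\sum_(1 <= k < N.+2) k%:R^-1) `^ ReC a.
      by rewrite /powR gt_eqF ?expR_gt0// expRK.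
    have -> : expR (ReC a) = expR 1 `^ ReC a by rewrite /powR gt_eqF ?expR_gt0// expRK mulr1.
    rewrite -powRM ?expR_ge0//; apply: ge0_ler_powR; rewrite ?nnegrE ?expR_ge0 ?mulr_ge0 ?expR_ge0 ?(ltW a0)//.
    exact: exp_harmonic.
  rewrite ler_expR -[leRHS]mulr1 -mulrA ler_wpM2l ?sqr_ge0//.
  have := sum_inv_sqr N; have : 0 <= N.+1%:R^-1 :> R by rewrite invr_ge0.
  by move: (\sum_(1 <= i < N.+2) _) (N.+1%:R^-1) => x y; lra.
rewrite natC nc_real ger0_norm// -invf_div lef_pV2 ?posrE.
- rewrite ler_pdivrMr; last by rewrite mulr_gt0 ?powR_gt0// ltr0n fact_gt0.
  rewrite -mulrA ler_wpM2l ?nc_ge0//; apply: (le_trans bd); rewrite le_eqVlt; apply/orP; left; apply/eqP; ring.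
- by rewrite mulr_gt0 ?expR_gt0.
- rewrite divr_gt0 ?mulr_gt0 ?powR_gt0// ?ltr0n ?fact_gt0//.
  rewrite big_nat; apply: prodr_gt0 => k _; rewrite lt_neqAle nc_ge0 eq_sym andbT.
  by apply/eqP => h; have := ReC_le_nc (a + k%:R); rewrite h ReCD natC /ReC /= -/(ReC a) gtr0_norm ?ltr_wpDr//; have : 0 <= k%:R :> R by []; lra.
Qed.

Lemma Gamma_neq0 a : 0 < ReC a -> Gamma a != 0.
Proof.
move=> a0; have [e e0 he] := QN_lower a0; apply/eqP => G0.
have := clim_nc (QN_lim a0); rewrite G0 nc0 => cv.
have : e <= 0 by apply: (cvgr_to_ge cv); apply: nearW => N; exact: he.
by rewrite leNgt e0.
Qed.

(* Gauss' approximation of [1 / Gamma a]. *)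
Definition PN a N : R[i] := (\prod_(0 <= k < N.+1) (a + k%:R)) / ((N`!)%:R * cpowR N.+1%:R a).

Lemma inv_succ_lim a : clim (fun N => a / N.+1%:R) 0.
Proof.
rewrite -(mulr0 a); apply: climM; first exact: clim_cst.
rewrite (_ : (fun N => _) = fun N => ((N.+1%:R)^-1 : R)%:C); last by apply/funext => N; rewrite realCV natC.
by apply: clim_real; exact: cvg_harmonic.
Qed.

Lemma PN_lim a : 0 < ReC a -> clim (PN a) (Gamma a)^-1.
Proof.
move=> a0; have G0 := Gamma_neq0 a0.
have -> : PN a = fun N => (QN a N)^-1 * (1 + a / N.+1%:R)^-1.
  apply/funext => N; rewrite /PN /QN [in RHS]big_nat_recr//= factS natrM.
  have P0 := rising_neq0 N.+1 a0; have A1 := addn_neq0 N.+1 a0.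
  have c0 : cpowR N.+1%:R a != 0 by rewrite cpow_neq0// pnatr_eq0.
  have f0 : (N`!)%:R != 0 :> R[i] by rewrite pnatr_eq0 -lt0n fact_gt0.
  have N0 : N.+1%:R != 0 :> R[i] by rewrite pnatr_eq0.
  have -> : 1 + a / N.+1%:R = (a + N.+1%:R) / N.+1%:R by rewrite mulrDl mulfV// addrC.
  move: (\prod_(0 <= k < N.+1) _) P0 (cpowR _ _) c0 ((N`!)%:R) f0 (N.+1%:R) N0 A1 => P P0 c c0 f f0 M M0 A1.
  by field; rewrite P0 A1 c0 f0 M0.
rewrite -[X in clim _ X]mulr1; apply: climM; first exact: climV (QN_lim a0).
rewrite -[X in clim _ X]invr1; apply: climV; first exact: oner_neq0.
by rewrite -[X in clim _ X]addr0; apply: climD; [exact: clim_cst|exact: inv_succ_lim].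
Qed.

(** Compares Gauss' products at [a] and $a+1$, which differ by the factor $a^{-1}(1+a/(N+1))$, and
    uses uniqueness of limits. *)
Lemma GammaS a : 0 < ReC a -> Gamma (a + 1) = a * Gamma a.
Proof.
move=> a0; have a1 : 0 < ReC (a + 1) by rewrite ReCD addr_gt0// /ReC /= ltr01.
have an := Re_neq0 a0; have G0 := Gamma_neq0 a0; have G1 := Gamma_neq0 a1.
have h1 := PN_lim a1.
have h2 : clim (PN (a + 1)) ((Gamma a)^-1 * (a^-1 * (1 + 0))).
  have -> : PN (a + 1) = fun N => PN a N * (a^-1 * (1 + a / N.+1%:R)).
    apply/funext => N; rewrite /PN cpowD cpow1.
    have -> : \prod_(0 <= k < N.+1) (a + 1 + k%:R) = (\prod_(0 <= k < N.+1) (a + k%:R)) * (a + N.+1%:R) / a.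
      apply: (mulIf an); rewrite divfK// -big_nat_recr//= [RHS]big_ltn// addr0 [LHS]mulrC; congr (_ * _).
      by rewrite big_add1 /=; apply: eq_bigr => k _; rewrite -natr1 addrA addrAC.
    have c0 : cpowR N.+1%:R a != 0 by rewrite cpow_neq0// pnatr_eq0.
    have f0 : (N`!)%:R != 0 :> R[i] by rewrite pnatr_eq0 -lt0n fact_gt0.
    have N0 : N.+1%:R != 0 :> R[i] by rewrite pnatr_eq0.
    rewrite -natC.
    move: (\prod_(0 <= k < N.+1) _) (cpowR _ _) c0 ((N`!)%:R) f0 (N.+1%:R) N0 => P c c0 f f0 M M0.
    by field; rewrite an c0 f0 M0.
  apply: climM; first exact: PN_lim.
  apply: climM; first exact: clim_cst.
  by apply: climD; [exact: clim_cst|exact: inv_succ_lim].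
have e := clim_unique h1 h2; rewrite addr0 mulr1 -invfM in e.
by apply: invr_inj; rewrite e mulrC.
Qed.

Lemma Gamma1 : Gamma (1 : R[i]) = 1.
Proof.
have o1 : 0 < ReC (1 : R[i]) by rewrite /ReC /= ltr01.
have h1 := PN_lim o1.
have h2 : clim (PN (1 : R[i])) 1.
  rewrite (_ : PN _ = fun=> 1); first exact: clim_cst.
  apply/funext => N; rewrite /PN cpow1.
  have -> : \prod_(0 <= k < N.+1) (1 + k%:R) = ((N.+1)`!)%:R :> R[i].
    by rewrite fact_prod natr_prod big_add1 /=; apply: eq_bigr => k _; rewrite nat1r.
  have d0 : N.+1%:R * N`!%:R != 0 :> R[i].
    by apply: mulf_neq0; rewrite pnatr_eq0// -lt0n fact_gt0.
  by rewrite factS natrM -natC [N`!%:R * _]mulrC mulfV.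
by apply: invr_inj; rewrite invr1; exact: clim_unique h1 h2.
Qed.

End GammaFunction.

(** * Sums over compositions *)

Section Compositions.
Variable q : nat.
Implicit Types (n : nat) (s : 'I_q.+1).

Lemma Zc_le n k (m : Zc n k) i : (val m i <= n)%N.
Proof. by rewrite -ltnS. Qed.

Lemma sum_Zc n k (m : Zc n k) : (\sum_i (val m i : nat))%N = n.
Proof. exact/eqP/(valP m). Qed.

Definition incf n s (m : Zc n q.+1) : {ffun 'I_q.+1 -> 'I_n.+2} := [ffun i => inord (val m i + (i == s))].
Lemma incfE n s (m : Zc n q.+1) i : incf s m i = (val m i + (i == s))%N :> nat.
Proof. by rewrite ffunE inordK// ltnS; have := Zc_le m i; case: (i == s); lia. Qed.
Lemma incP n s (m : Zc n q.+1) : compb (incf s m).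
Proof.
have e : (\sum_i (val m i + (i == s)) = n.+1)%N.
  rewrite big_split /= sum_Zc (bigD1 s)//= eqxx big1 ?addn0 ?addn1// => i /negbTE ->//.
by apply/eqP; apply: (etrans _ e); apply: eq_bigr => i _; rewrite incfE.
Qed.
Definition incZ n s (m : Zc n q.+1) : Zc n.+1 q.+1 := Sub (incf s m) (incP s m).

Definition decf n s (m : Zc n.+1 q.+1) : {ffun 'I_q.+1 -> 'I_n.+1} := [ffun i => inord (val m i - (i == s))].

Lemma decfE n s (m : Zc n.+1 q.+1) i : (0 < val m s)%N -> decf s m i = (val m i - (i == s))%N :> nat.
Proof.
move=> ms; rewrite ffunE inordK// ltnS.
have [->|ne] := eqVneq i s; first by have := Zc_le m s; lia.
have h : (val m s + val m i <= n.+1)%N.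
  by rewrite -[leqRHS](sum_Zc m) (bigD1 s)//= (bigD1 i)//= addnA leq_addr.
by rewrite subn0 -ltnS; apply: leq_trans h; rewrite -[ltnLHS]add0n ltn_add2r.
Qed.
Lemma decP n s (m : Zc n.+1 q.+1) : (0 < val m s)%N -> compb (decf s m).
Proof.
move=> ms; have e : (\sum_i (val m i - (i == s)) = n)%N.
  apply: succn_inj; rewrite -[RHS](sum_Zc m) (bigD1 s)//= [in RHS](bigD1 s)//= eqxx -addSn.
  by congr (_ + _)%N; [rewrite subn1 prednK|apply: eq_bigr => i /negbTE ->; rewrite subn0].
by apply/eqP; apply: (etrans _ e); apply: eq_bigr => i _; rewrite decfE.
Qed.

(** Subtracting 1 from a positive part is a bijection onto the compositions of [n]; the sums below
    are all evaluated by repeating this step. *)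
Lemma sum_Zc_inc (V : nmodType) n s (g : ('I_q.+1 -> nat) -> V) :
  \sum_(m : Zc n.+1 q.+1 | (0 < val m s)%N) g (fun i => val m i) =
  \sum_(m : Zc n q.+1) g (fun i => (val m i + (i == s))%N).
Proof.
have [[m0 _]|none] := pselect (exists m : Zc n q.+1, True); last first.
  rewrite [RHS]big1 => [|m _]; last by case: none; exists m.
  by rewrite big1// => m ms; case: none; exists (Sub (decf s m) (decP ms)).
rewrite (reindex_onto (@incZ n s) (fun m => insubd m0 (decf s m))).
  apply: eq_big => [m|m _]; last by congr g; apply/funext => i; rewrite SubK incfE.
  have pos : (0 < val (incZ s m) s)%N by rewrite SubK incfE eqxx addn1.
  rewrite pos /=; apply/eqP; apply: val_inj; rewrite val_insubd decP//.
  by apply/ffunP => i; apply: ord_inj; rewrite decfE// SubK incfE addnK.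
move=> m ms; apply: val_inj; rewrite SubK; apply/ffunP => i; apply: ord_inj.
rewrite incfE val_insubd decP// decfE// subnK//.
by case: eqP => // ->.
Qed.

Lemma card_Zc n : #|{: Zc n q.+1}| = 'C(q + n, q).
Proof.
rewrite -card_ord_partitions card_sig.
pose h (f : {ffun 'I_q.+1 -> 'I_n.+1}) := [tuple f i | i < q.+1].
have hi : injective h.
  by move=> f g e; apply/ffunP => i; have := congr1 (fun t => tnth t i) e; rewrite !tnth_mktuple.
rewrite -(card_imset _ hi); apply: eq_card => t; rewrite inE.
apply/imsetP/idP => [[f]|tn].
  by rewrite unfold_in => /eqP fn ->; rewrite big_tuple -[X in _ == X]fn; apply/eqP; apply: eq_bigr => i _; rewrite tnth_mktuple.
exists [ffun i => tnth t i].
  rewrite unfold_in /compb; apply/eqP; rewrite -[RHS](eqP tn) big_tuple; apply: eq_bigr => i _; by rewrite ffunE.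
by apply: eq_from_tnth => i; rewrite tnth_mktuple ffunE.
Qed.

Lemma sum_Zc_pos (V : nmodType) n s (g : ('I_q.+1 -> nat) -> V) :
  (forall f, f s = 0%N -> g f = 0) ->
  \sum_(m : Zc n.+1 q.+1) g (fun i => val m i) = \sum_(m : Zc n q.+1) g (fun i => (val m i + (i == s))%N).
Proof.
move=> g0; rewrite -sum_Zc_inc [RHS]big_mkcond; apply: eq_bigr => m _.
by case: posnP => // h; exact: g0.
Qed.

Lemma Zc0 (m : Zc 0 q.+1) i : val m i = 0%N :> nat.
Proof. by apply/eqP; rewrite -leqn0; exact: Zc_le. Qed.

(** Lowering part [s], the total and [k] together by 1 reduces the count to the number of all
    compositions. These are the binomial exponents of the Gamma factors in the final formula. *)
Lemma count_gt n s k : (\sum_(m : Zc n q.+1) (k < val m s))%N = if (k < n)%N then 'C(q + n - k - 1, q) else 0%N.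
Proof.
elim: k n => [|k IH] [|n] /=.
- by rewrite big1// => m _; rewrite Zc0.
- rewrite (@sum_Zc_pos _ n s (fun f => nat_of_bool (0 < f s)%N)); last by move=> f ->.
  rewrite (eq_bigr (fun=> 1%N)); last by move=> m _; rewrite eqxx addn1.
  by rewrite sum_nat_const muln1 card_Zc; congr 'C(_, _); lia.
- by rewrite big1// => m _; rewrite Zc0.
- rewrite (@sum_Zc_pos _ n s (fun f => nat_of_bool (k.+1 < f s)%N)); last by move=> f ->.
  rewrite (eq_bigr (fun m : Zc n q.+1 => nat_of_bool (k < val m s)%N)); last by move=> m _; rewrite eqxx addn1.
  by rewrite IH ltnS; case: ifP => // _; congr 'C(_, _); lia.
Qed.

Lemma sum_part n s : (\sum_(m : Zc n q.+1) (val m s : nat))%N = 'C(q + n, q.+1).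
Proof.
elim: n => [|n IH]; first by rewrite addn0 bin_small// big1// => m _; rewrite Zc0.
rewrite (@sum_Zc_pos _ n s (fun f => f s))//.
rewrite big_split /= IH (eq_bigr (fun=> 1%N)); last by rewrite eqxx.
by rewrite sum_nat_const muln1 card_Zc addnS binS.
Qed.

Lemma sum_part2 n s s' : s != s' ->
  (\sum_(m : Zc n q.+1) (val m s * val m s'))%N = 'C(q + n, q.+2).
Proof.
move=> ss; elim: n => [|n IH]; first by rewrite addn0 bin_small// big1// => m _; rewrite Zc0.
rewrite (@sum_Zc_pos _ n s (fun f => (f s * f s')%N)); last by move=> f ->.
rewrite (eq_bigr (fun m : Zc n q.+1 => (val m s * val m s' + val m s')%N)); last first.
  by move=> m _; rewrite eqxx eq_sym (negbTE ss) addn0 addn1 mulSn addnC.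
by rewrite big_split /= IH sum_part addnS [RHS]binS.
Qed.

End Compositions.

Section CompositionSums.
Variables (n p : nat).
Hypothesis p2 : (2 <= p)%N.

Lemma cget_val (s : nat) : (1 <= s < p)%N -> exists q (e : p = q.+2) (i : 'I_q.+1), s = i.+1.
Proof.
move=> /andP[s1 sp]; have pq : p = p.-2.+2 by case: p p2 => [|[|q]].
have sq1 : (s.-1 < p.-2.+1)%N by lia.
by exists p.-2, pq, (Ordinal sq1); rewrite /= prednK.
Qed.

Lemma sum_cget_s s : (1 <= s < p)%N -> (\sum_(m : Zc n p.-1) cget m s)%N = 'C(p + n - 2, p - 1).
Proof.
move=> /cget_val [q [-> [i ->]]]; rewrite (eq_bigr (fun m : Zc n q.+1 => val m i : nat)); last first.
  by move=> m _; rewrite cgetE.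
by rewrite sum_part; congr 'C(_, _); lia.
Qed.

Lemma sum_cget_2 s r : (1 <= s < p)%N -> (1 <= r < p)%N -> s != r ->
  (\sum_(m : Zc n p.-1) (cget m s * cget m r))%N = 'C(p + n - 2, p).
Proof.
move=> /cget_val [q [e [i ->]]]; rewrite e => rp; have rq : (r.-1 < q.+1)%N by lia.
have -> : r = (Ordinal rq).+1 by rewrite /= prednK//; lia.
move: (Ordinal rq) => j; rewrite eqSS => ij.
rewrite (eq_bigr (fun m : Zc n q.+1 => (val m i * val m j)%N)); last first.
  by move=> m _; rewrite !cgetE.
by rewrite sum_part2//; congr 'C(_, _); lia.
Qed.

Lemma sum_cget_bin s : (1 <= s < p)%N -> (\sum_(m : Zc n p.-1) 'C(cget m s, 2))%N = 'C(p + n - 2, p).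
Proof.
move=> /cget_val [q [-> [i ->]]]; rewrite (eq_bigr (fun m : Zc n q.+1 => 'C(val m i, 2))); last first.
  by move=> m _; rewrite cgetE.
have -> : 'C(q.+2 + n - 2, q.+2) = 'C(q + n, q.+2) by congr 'C(_, _); lia.
elim: n => [|k IH]; first by rewrite addn0 bin_small// big1// => m _; rewrite Zc0.
rewrite (@sum_Zc_pos q _ k i (fun f => 'C(f i, 2))); last by move=> f ->.
rewrite (eq_bigr (fun m : Zc k q.+1 => ('C(val m i, 2) + val m i)%N)); last first.
  by move=> m _; rewrite eqxx addn1 binS bin1.
by rewrite big_split /= IH sum_part addnS [RHS]binS.
Qed.

(** The factor [G k] occurs once for every composition whose part [s] exceeds [k], so its exponent
    is given by [count_gt]. *)
Lemma prod_cget_below (C : comNzRingType) s (G : nat -> C) : (1 <= s < p)%N ->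
  \prod_(m : Zc n p.-1) \prod_(0 <= k < cget m s) G k = \prod_(0 <= k < n) G k ^+ 'C(p + n - k - 3, p - 2).
Proof.
move=> /cget_val [q [-> [i ->]]].
rewrite (eq_bigr (fun m : Zc n q.+1 => \prod_(0 <= k < n) G k ^+ (k < val m i)%N)); last first.
  move=> m _; rewrite cgetE [RHS](@big_cat_nat _ _ _ (val m i))//=; last exact: Zc_le.
  rewrite [X in _ = _ * X]big1_seq ?mulr1; last first.
    by move=> k /=; rewrite mem_index_iota => /andP[h _]; rewrite ltnNge h.
  by rewrite !big_nat; apply: eq_bigr => k /andP[_ ->].
rewrite exchange_big !big_nat; apply: eq_bigr => k /andP[_ kn].
rewrite -expr_sum count_gt kn; congr (_ ^+ 'C(_, _)); lia.
Qed.

(** The identity behind the cancellation of all powers of [N] in the limit. *)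
Lemma binom_balance : (n * 'C(p + n - 2, p - 1) = 'C(p + n - 2, p - 1) + p * 'C(p + n - 2, p))%N.
Proof.
have p1 : p = (p - 1).+1 by lia.
have := mul_bin_left (p + n - 2) (p - 1); rewrite -p1 => ->.
case: n => [|k]; first by rewrite addn0 bin_small ?muln0; lia.
have -> : (p + k.+1 - 2 - (p - 1) = k)%N by lia.
by rewrite mulSn.
Qed.
End CompositionSums.

(** * The determinant in terms of Laguerre-type integrals *)

Section DetLimit.
Context {R : realType}.

Lemma clim_det k (M : nat -> 'M[R[i]]_k) (L : 'M[R[i]]_k) :
  (forall i j, clim (fun N => M N i j) (L i j)) -> clim (fun N => \det (M N)) (\det L).
Proof.
move=> h; rewrite /determinant; apply: clim_sum => s _; apply: climM; first exact: clim_cst.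
by apply: clim_prod => i _; exact: h.
Qed.

Lemma det_rowscale (C : comNzRingType) (I : finType) (A B : I -> I -> C) (c : I -> C) :
  (forall l m, A l m = c l * B l m) -> \det (fmx A) = (\prod_m c m) * \det (fmx B).
Proof.
move=> h; rewrite -[\det (fmx A)]det_tr -[\det (fmx B)]det_tr.
have e (D : I -> I -> C) : (fmx D)^T = fmx (fun l m => D m l) by apply/matrixP => a b; rewrite !mxE.
by rewrite !e; apply: det_colscale => l m; exact: h.
Qed.

Lemma det_fmx_diag (C : comNzRingType) (I : finType) (d : I -> C) :
  \det (fmx (fun l m => if l == m then d l else 0)) = \prod_l d l.
Proof.
rewrite (@det_colscale _ _ _ (fun l m => (l == m)%:R) d); last first.
  by move=> l m; case: eqP => [->|_]; rewrite ?mulr1 ?mulr0.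
rewrite (_ : fmx _ = 1%:M) ?det1 ?mulr1//.
by apply/matrixP => a b; rewrite !mxE (inj_eq enum_val_inj).
Qed.

Lemma cpow_inv (x : R) a : 0 < x -> cpowR x^-1 a = (cpowR x a)^-1.
Proof.
move=> x0; apply: (mulfI (cpow_neq0 a (lt0r_neq0 x0))).
by rewrite mulfV ?cpow_neq0 ?gt_eqF// -(cpowM _ _ (ltW x0)) mulfV ?cpow1x// gt_eqF.
Qed.

Variables (p n : nat) (z : nat -> R) (gam : R[i]) (al : nat -> R[i]).
Local Notation E := (envT R).
Local Notation L := 'I_p.+1.
Local Notation FF := {ffun 'I_n -> L}.
Hypothesis p2 : (2 <= p)%N.
Hypothesis zlt : forall s, (1 <= s < p)%N -> z s < z s.+1.
Hypothesis gam0 : 0 < ReC gam.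
Hypothesis pa : posal p al.
Local Notation bl := (fun l : Zc n p.-1 => blk l).
Local Notation kapl N l := (kap p n z gam al (blk l) N).

Lemma obl (l : Zc n p.-1) : okb p n (blk l).
Proof. by move=> j; exact: (okb_blk p2 gam0). Qed.

(** Among all labellings only the one giving each variable the label of its own block survives, and
    its type is that of [l]. Hence the rescaled matrix has a diagonal limit. *)
Lemma entry_lim (l m : Zc n p.-1) : clim (fun N => (kapl N l)^-1 * OmJ n z gam (shp p al N.+1) (blk l) (tyM (i1 p) m))
  (if l == m then Dk z gam al l p.-1 else 0).
Proof.
rewrite /OmJ /Om; under eq_fun do rewrite mulr_sumr.
have -> : (if l == m then Dk z gam al l p.-1 else 0) =
    \sum_(f : FF | ty f == tyM (i1 p) m) (if all (sc n (blk l) (lab f)) (sq n) then CI (mu (sq n)) (finf p n z gam al (blk l)) else 0).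
  have scE (f : FF) : all (sc n (blk l) (lab f)) (sq n) = (f == bf l).
    apply/allP/eqP => [h|-> j jn].
      apply/ffunP => o; apply: val_inj => /=; rewrite (bfE p2 gam0).
      by have /andP[_ /eqP <-] := h _ (sq_ord o); rewrite labE.
    rewrite /sc jn andTb; move: jn; rewrite mem_sq; case: j => // j jn'; have jn : (j < n)%N by [].
    by rewrite (labE (bf l) (Ordinal jn)) (bfE p2 gam0).
  have cif : CI (mu (sq n)) (finf p n z gam al (blk l)) = Dk z gam al l p.-1 by apply: CI_finf.
  rewrite cif [RHS]big_mkcond (bigD1 (bf l))//= big1 ?addr0; last first.
    by move=> f /negbTE fl; rewrite scE fl; case: ifP.
  by rewrite scE eqxx (ty_bf p2 gam0) (inj_eq (@tyM1_inj n p p2)).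
apply: clim_sum => f /eqP tf; apply: (J_lim p2 zlt gam0 pa (@obl l)).
- by move=> j k _ _ kj; apply: blk_mono; exact: ltnW.
- exact: okF_lab.
- move=> j; rewrite mem_sq; case: j => // j jn'; have jn : (j < n)%N by [].
  rewrite (labE f (Ordinal jn)) lt0n.
  apply/negP => /eqP e; have e0 : f (Ordinal jn) = ord0 by exact: val_inj.
  have : ty f ord0 = 0%N by rewrite tf tyM1E.
  by rewrite ffunE => /eqP; rewrite cards_eq0 => /eqP/setP/(_ (Ordinal jn)); rewrite !inE e0 eqxx.
Qed.

Theorem lim_det : clim (fun N => (\prod_(l : Zc n p.-1) kapl N l)^-1 * Dal z gam bl (shp p al N.+1))
  (\prod_(l : Zc n p.-1) Dk z gam al l p.-1).
Proof.
rewrite -det_fmx_diag.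
have -> : (fun N => (\prod_(l : Zc n p.-1) kapl N l)^-1 * Dal z gam bl (shp p al N.+1)) =
  (fun N => \det (fmx (fun l m : Zc n p.-1 => (kapl N l)^-1 * OmJ n z gam (shp p al N.+1) (blk l) (tyM (i1 p) m)))).
  apply/funext => N; rewrite (@det_rowscale _ _ _ (fun l m : Zc n p.-1 => OmJ n z gam (shp p al N.+1) (blk l) (tyM (i1 p) m)) (fun l : Zc n p.-1 => (kapl N l)^-1))//.
  by rewrite prodfV.
by apply: clim_det => i j; under eq_fun do rewrite mxE; rewrite mxE; exact: entry_lim.
Qed.

Let A := \sum_(s <- iota 1 p) al s.
Definition xk (k : nat) : R[i] := 1 + \sum_(s <- iota 1 p) al s + (2 * n - 2 - k)%:R * gam.
Definition yk (k : nat) : R[i] := 1 + al p + k%:R * gam.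

Lemma shift_iter N :
  (\prod_(m : Zc n p.-1) \prod_(0 <= k < cget m 1) \prod_(0 <= j < N) (xk k + j%:R)) * Dal z gam bl (shp p al N) =
  (\prod_(m : Zc n p.-1) ((\prod_(0 <= k < cget m 1) \prod_(0 <= j < N) (yk k + j%:R)) *
     \prod_(1 <= s < p) (((z s)%:C - (z p)%:C) ^+ N) ^+ cget m s)) * Dal z gam bl al.
Proof.
elim: N => [|N IH].
  rewrite big1; last by move=> m _; rewrite big1// => k _; rewrite big_geq.
  rewrite big1; last first.
    move=> m _; rewrite [X in X * _]big1 ?mul1r; last by move=> k _; rewrite big_geq.
    by rewrite big1// => s _; rewrite expr0 expr1n.
  have -> : shp p al 0 = al by apply/funext => s; rewrite /shp addr0; case: (s == p).
  by rewrite !mul1r.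
have sS : shp p al N.+1 = shp p (shp p al N) 1.
  by apply/funext => s; rewrite /shp; case: (s == p); [rewrite -natr1 addrA|].
have sr := shift_relation p2 zlt gam0 (bl := bl) obl (posal_shp N pa).
rewrite -sS in sr.
have SA : \sum_(s <- iota 1 p) shp p al N s = \sum_(s <- iota 1 p) al s + N%:R.
  have pin : p \in iota 1 p by rewrite mem_iota add1n ltnSn ltnW.
  rewrite (bigD1_seq p pin (iota_uniq 1 p)) [in RHS](bigD1_seq p pin (iota_uniq 1 p)) /= {1}/shp eqxx addrAC; congr (_ + _ + _).
  by apply: eq_bigr => s /negbTE sp; rewrite /shp sp.
have xE : \prod_(m : Zc n p.-1) \prod_(0 <= k < cget m 1) \prod_(0 <= j < N.+1) (xk k + j%:R) =
   (\prod_(m : Zc n p.-1) \prod_(0 <= k < cget m 1) \prod_(0 <= j < N) (xk k + j%:R)) *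
   \prod_(m : Zc n p.-1) \prod_(0 <= k < cget m 1) (1 + \sum_(s <- iota 1 p) shp p al N s + (2 * n - 2 - k)%:R * gam).
  rewrite -big_split; apply: eq_bigr => m _ /=; rewrite -big_split; apply: eq_bigr => k _ /=.
  rewrite big_nat_recr; last by []. rewrite SA /xk; congr (_ * _); ring.
rewrite xE -mulrA sr mulrCA IH mulrA -big_split; congr (_ * _); apply: eq_bigr => m _ /=.
rewrite mulrACA -!big_split; congr (_ * _).
  apply: eq_bigr => k _ /=; rewrite big_nat_recr; last by []. rewrite [LHS]mulrC; congr (_ * _).
  by rewrite /yk /shp eqxx; ring.
by apply: eq_bigr => s _ /=; rewrite exprS exprMn.
Qed.

Lemma pairs_const (x : R[i]) m : \prod_(j <- sq m) \prod_(i <- sq m | (i < j)%N) x = x ^+ 'C(m, 2).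
Proof.
elim: m => [|m IH]; first by rewrite big_nil.
rewrite /= big_cons big_cons ltnn binS bin1 addnC exprD; congr (_ * _).
  rewrite -prod_sq_const big_seq_cond [RHS]big_seq; apply: eq_bigl => i; rewrite mem_sq ltnS.
  by case: (i <= m)%N; rewrite ?andbF ?andbT.
rewrite -IH !big_seq; apply: eq_bigr => j; rewrite mem_sq => /andP[_ jm].
by rewrite big_cons ltnNge (leqW jm).
Qed.

Lemma prod_blk_pairs (G : nat -> R[i]) (l : Zc n p.-1) k : (k < p)%N ->
  \prod_(j <- sq (lsum l k)) \prod_(i <- sq (lsum l k) | (i < j)%N) (if blk l j == blk l i then G (blk l j) else 1) =
  \prod_(1 <= s < k.+1) G s ^+ 'C(cget l s, 2).
Proof.
elim: k => [|k IH] kp; first by rewrite lsum0 big_nil big_geq.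
have kp' : (k < p)%N by exact: ltnW.
set a := lsum l k; set m := cget l k.+1.
pose Q j i := if blk l j == blk l i then G (blk l j) else 1.
have top j : j \in sq m -> blk l (a + j) = k.+1 by move=> jm; exact: (blk_top p2 gam0).
have bot i : i \in sq a -> (blk l i < k.+1)%N by move=> ia; rewrite ltnS; exact: (blk_bot p2 gam0).
rewrite lsumS -/a -/m sq_cat big_cat big_map /= [RHS]big_nat_recr//= -IH// [RHS]mulrC; congr (_ * _).
  rewrite -pairs_const !big_seq; apply: eq_bigr => j jm; rewrite big_cat big_map /=.
    rewrite [X in _ * X](_ : _ = 1) ?mulr1; last first.
      by apply: big1_seq => i /andP[_ ia]; rewrite top// ifN// neq_ltn bot// orbT.
    rewrite big_seq_cond [RHS]big_seq_cond; apply: eq_big => [i|i /andP[im _]]; first by rewrite ltn_add2l.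
    by rewrite !top// eqxx.
rewrite !big_seq; apply: eq_bigr => j; rewrite mem_sq => /andP[_ ja].
rewrite big_cat big_map /= [X in X * _]big1 ?mul1r// => i aij.
by exfalso; move: aij ja; clear; lia.
Qed.

(** Total exponent of the scale of block [s] in the leading behaviour: $\alpha_s$ for each variable
    and $2\gamma$ for each pair inside the block. *)
Definition els (l : Zc n p.-1) s : R[i] := (cget l s)%:R * al s + ('C(cget l s, 2))%:R * (2%:R * gam).

Lemma kapE (l : Zc n p.-1) N : kapl N l = \prod_(1 <= s < p) ((((z s)%:C - (z p)%:C) ^+ N.+1) ^+ cget l s *
  (cpowR (z p - z s) (els l s) / cpowR N.+1%:R (els l s))).
Proof.
have pp : (p.-1 < p)%N by rewrite prednK// ltnW.
have p1 : p.-1.+1 = p by rewrite prednK// ltnW.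
have h1 := prod_blk l p2 gam0 (fun s => (z s - z p)%:C ^+ N.+1 * cpowR (cN p z s N) (al s)) pp.
have h2 := prod_blk_pairs (fun s => cpowR (cN p z s N) (2%:R * gam)) l pp.
rewrite lsum_n p1 in h1 h2; rewrite /kap h1 h2 -big_split big_nat [RHS]big_nat.
apply: eq_bigr => s sp /=; have zp : 0 < z p - z s by rewrite subr_gt0; apply: (z_lt p2 zlt); lia.
have M0 : 0 < N.+1%:R :> R by [].
have c0 : cN p z s N != 0 by rewrite gt_eqF// divr_gt0.
rewrite rmorphB exprMn -mulrA; congr (_ * _).
rewrite -!cpowX// -cpowD -/(els l s) /cN (cpowM _ _ (ltW zp)) cpow_inv//.
Qed.

(** Compares the powers of $N+1$: on the left those of the rising factorials in the denominator of
    the iterated shift, on the right those of its numerator and those of the scales of the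
    blocks. *)
Lemma power_balance :
  \sum_(m : Zc n p.-1) \sum_(0 <= k < cget m 1) xk k =
  \sum_(m : Zc n p.-1) \sum_(0 <= k < cget m 1) yk k + \sum_(l : Zc n p.-1) \sum_(1 <= s < p) els l s.
Proof.
set EE := 'C(p + n - 2, p - 1); set XX := 'C(p + n - 2, p).
pose B := \sum_(1 <= s < p) al s.
have AB : \sum_(s <- iota 1 p) al s = B + al p.
  have -> : iota 1 p = index_iota 1 p.+1 by rewrite /index_iota subn1.
  by rewrite big_nat_recr//= ltnW.
have s1 (m : Zc n p.-1) : (cget m 1 <= n)%N.
  rewrite -[leqRHS](sum_tyM1 p2 m) (bigD1 (i1 p))//= tyM1E// i1E// p2 leq_addr//.
have inner (M : nat) : (M <= n)%N -> \sum_(0 <= k < M) xk k =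
    \sum_(0 <= k < M) yk k + (M%:R * (B + (2 * n - 2)%:R * gam) - 2%:R * ('C(M, 2))%:R * gam).
  elim: M => [|M IH] Mn; first by rewrite !big_geq// mul0r !mulr0 mul0r subr0 addr0.
  rewrite big_nat_recr//= [in RHS]big_nat_recr//= IH; last exact: ltnW.
  have mE : (2 * n - 2 - M)%:R = (2 * n - 2)%:R - M%:R :> R[i] by rewrite natrB//; lia.
  rewrite binS bin1 natrD /xk /yk AB mE -(@natr1 _ M).
  by move: (\sum_(0 <= i < M) _) => ?; ring.
rewrite (eq_bigr (fun m : Zc n p.-1 => \sum_(0 <= k < cget m 1) yk k +
   ((cget m 1)%:R * (B + (2 * n - 2)%:R * gam) - 2%:R * ('C(cget m 1, 2))%:R * gam))); last by move=> m _; exact: inner.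
rewrite big_split /=; congr (_ + _); rewrite sumrB -!mulr_suml -mulr_sumr -!natr_sum.
have p1 : (1 <= 1 < p)%N by [].
rewrite (sum_cget_s n p2 p1) (sum_cget_bin n p2 p1) -/EE -/XX.
rewrite exchange_big /= (eq_big_nat _ _ (F2 := fun s => EE%:R * al s + XX%:R * (2%:R * gam))); last first.
  by move=> s sp; rewrite big_split /= -!mulr_suml -!natr_sum sum_cget_s// sum_cget_bin.
rewrite big_split /= -mulr_sumr -/B sumr_const_nat.
have hb := binom_balance n p2; rewrite -/EE -/XX in hb.
have hR : n%:R * EE%:R = EE%:R + p%:R * XX%:R :> R[i] by rewrite -!natrM -natrD hb.
(* The case $n=0$ is separate because the subtraction $2n-2$ is truncated there; both binomials then
   give 0. *)
have nE : (2 * n - 2)%:R * EE%:R = 2%:R * p%:R * XX%:R :> R[i].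
  case: (posnP n) => [n0|n1].
    have X0 : p%:R * XX%:R = - EE%:R :> R[i].
      by apply/eqP; rewrite -addr_eq0 addrC -hR n0 mul0r.
    have E0 : EE = 0%N by rewrite /EE n0 addn0 bin_small//; lia.
    by rewrite E0 mulr0 -mulrA X0 E0 oppr0 mulr0.
  have -> : (2 * n - 2)%:R = 2%:R * n%:R - 2%:R :> R[i] by rewrite natrB ?natrM//; lia.
  transitivity (2%:R * (n%:R * EE%:R) - 2%:R * EE%:R : R[i]); first by ring.
  by rewrite hR; ring.
rewrite mulrDr.
have -> : EE%:R * ((2 * n - 2)%:R * gam) = 2%:R * p%:R * XX%:R * gam by rewrite mulrA [EE%:R * _]mulrC nE.
by rewrite -[X in _ = _ + X]mulr_natr (natrB _ (ltnW p2)); ring.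
Qed.

(** An exact identity holds for every [N], with Gauss' approximations [PN] in place of $1/\Gamma$
    and the rescaled determinant in place of its limit. Both sides converge, and limits are
    unique. *)
Theorem Dal_formula :
  Dal z gam bl al * \prod_(m : Zc n p.-1) \prod_(0 <= k < cget m 1) (Gamma (yk k))^-1 =
  (\prod_(l : Zc n p.-1) Dk z gam al l p.-1) * (\prod_(l : Zc n p.-1) \prod_(1 <= s < p) cpowR (z p - z s) (els l s)) *
   \prod_(m : Zc n p.-1) \prod_(0 <= k < cget m 1) (Gamma (xk k))^-1.
Proof.
have xpos k : 0 < ReC (xk k).
  rewrite /xk !ReCD ReC_natM; apply: ltr_wpDr; first by rewrite mulr_ge0// ltW.
  apply: ltr_wpDr; last by rewrite /ReC /= ltr01.
  have -> : ReC (\sum_(s <- iota 1 p) al s) = \sum_(s <- iota 1 p) ReC (al s).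
    by elim: (iota 1 p) => [|x r IH]; rewrite ?big_nil// !big_cons ReCD IH.
  rewrite big_seq; apply: sumr_ge0 => i; rewrite mem_iota add1n ltnS => ip; apply: ltW; exact: pa.
have ypos k : 0 < ReC (yk k).
  rewrite /yk !ReCD ReC_natM; apply: ltr_wpDr; first by rewrite mulr_ge0// ltW.
  apply: ltr_wpDr; last by rewrite /ReC /= ltr01.
  by apply: ltW; apply: pa; rewrite leqnn ltnW.
set D := Dal z gam bl al; set Ze := \prod_(l : Zc n p.-1) \prod_(1 <= s < p) cpowR (z p - z s) (els l s).
pose u N := (\prod_(l : Zc n p.-1) kapl N l)^-1 * Dal z gam bl (shp p al N.+1).
have key N : D * \prod_(m : Zc n p.-1) \prod_(0 <= k < cget m 1) PN (yk k) N =
    u N * Ze * \prod_(m : Zc n p.-1) \prod_(0 <= k < cget m 1) PN (xk k) N.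
  have M0 : 0 < N.+1%:R :> R by [].
  have f0 : (N`!)%:R != 0 :> R[i] by rewrite pnatr_eq0 -lt0n fact_gt0.
  have cM a : cpowR (N.+1%:R : R) a != 0 by rewrite cpow_neq0// gt_eqF.
  have PE a : \prod_(0 <= j < N.+1) (a + j%:R) = PN a N * N`!%:R * cpowR (N.+1%:R : R) a.
    by rewrite /PN -mulrA divfK// mulf_neq0.
  have it := shift_iter N.+1.
  have prodE (g : nat -> R[i]) : \prod_(m : Zc n p.-1) \prod_(0 <= k < cget m 1) \prod_(0 <= j < N.+1) (g k + j%:R) =
     (\prod_(m : Zc n p.-1) \prod_(0 <= k < cget m 1) PN (g k) N) *
     (\prod_(m : Zc n p.-1) \prod_(0 <= k < cget m 1) N`!%:R) *
     cpowR (N.+1%:R : R) (\sum_(m : Zc n p.-1) \sum_(0 <= k < cget m 1) g k).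
    rewrite cpow_pos// mulr_suml cexp_sum -!big_split; apply: eq_bigr => m _ /=.
    rewrite mulr_suml cexp_sum -!big_split; apply: eq_bigr => k _ /=.
    by rewrite PE cpow_pos.
  rewrite big_split /= !prodE in it.
  set F := \prod_(m : Zc n p.-1) \prod_(0 <= k < cget m 1) N`!%:R in it.
  have F0 : F != 0 by apply/prodf_neq0 => m _; rewrite big_mkord; apply/prodf_neq0.
  set Zs := \prod_(m : Zc n p.-1) \prod_(1 <= s < p) _ in it.
  have kE : \prod_(l : Zc n p.-1) kapl N l = Zs * (Ze / cpowR (N.+1%:R : R) (\sum_(l : Zc n p.-1) \sum_(1 <= s < p) els l s)).
    rewrite (eq_bigr _ (fun l _ => kapE l N)) cpow_pos// mulr_suml cexp_sum -prodfV -!big_split.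
    apply: eq_bigr => l _ /=; rewrite mulr_suml cexp_sum -prodfV -!big_split; apply: eq_bigr => s _ /=.
    by rewrite (cpow_pos (els l s) M0).
  have k0 : \prod_(l : Zc n p.-1) kapl N l != 0.
    by apply/prodf_neq0 => l _; apply: (kap_neq0 al p2 zlt gam0 (@obl l)).
  have DE : Dal z gam bl (shp p al N.+1) = u N * \prod_(l : Zc n p.-1) kapl N l.
    by rewrite /u mulrAC mulVf// mul1r.
  rewrite DE kE power_balance cpowD in it.
  have Zs0 : Zs != 0.
    by move: k0; rewrite kE mulf_eq0 negb_or => /andP[].
  set c1 := cpowR _ (\sum_(m : Zc n p.-1) _) in it.
  set c2 := cpowR _ (\sum_(l : Zc n p.-1) _) in it.
  have c10 : c1 != 0 by exact: cM. have c20 : c2 != 0 by exact: cM.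
  have c12 : F * c1 * Zs != 0 by rewrite !mulf_neq0.
  apply: (mulfI c12); move: it; rewrite -/D.
  move: (\prod_(m : Zc n p.-1) \prod_(0 <= k < cget m 1) PN (xk k) N) (\prod_(m : Zc n p.-1) \prod_(0 <= k < cget m 1) PN (yk k) N) => X Y.
  clear -c20; clearbody c2; move: c1 (u N) D Ze F Zs => C U D' Ze' F' Zs' it.
  have -> : F' * C * Zs' * (D' * Y) = Y * F' * C * Zs' * D' by ring.
  rewrite -it; field => //.
have lhs : clim (fun N => D * \prod_(m : Zc n p.-1) \prod_(0 <= k < cget m 1) PN (yk k) N)
    (D * \prod_(m : Zc n p.-1) \prod_(0 <= k < cget m 1) (Gamma (yk k))^-1).
  apply: climM; first exact: clim_cst.
  by apply: clim_prod => m _; apply: clim_prod => k _; exact: PN_lim.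
have rhs : clim (fun N => u N * Ze * \prod_(m : Zc n p.-1) \prod_(0 <= k < cget m 1) PN (xk k) N)
    ((\prod_(l : Zc n p.-1) Dk z gam al l p.-1) * Ze * \prod_(m : Zc n p.-1) \prod_(0 <= k < cget m 1) (Gamma (xk k))^-1).
  apply: climM; first by apply: climM; [exact: lim_det|exact: clim_cst].
  by apply: clim_prod => m _; apply: clim_prod => k _; exact: PN_lim.
apply: clim_unique lhs _; by under eq_fun do rewrite key.
Qed.

End DetLimit.

(** * Laguerre-type Selberg integrals *)

Section Permute.
Context {R : realType}.
Local Notation E := (envT R).

Lemma mu_perm (s s' : seq nat) (B : set E) : uniq s -> perm_eq s s' -> measurable B -> mu s B = mu s' B.
Proof.
elim: s' s B => [|i s' IH] s B us pe mB; first by move/perm_nilP: pe => ->.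
have is' : i \in s by rewrite (perm_mem pe) mem_head.
have pe' : perm_eq (rem i s) s'.
  by rewrite -(perm_cons i) perm_sym (perm_trans _ (perm_to_rem is'))// perm_sym.
have ur : uniq (rem i s) by rewrite rem_uniq.
have ir : i \notin rem i s by rewrite mem_rem_uniq// inE eqxx.
have is2 : i \notin s' by rewrite -(perm_mem pe').
rewrite (mu_front is' us mB) (mu_cons _ ir) (mu_cons _ is2) /= /pushm_fun /pushforward /product_measure1.
by apply: eq_measure_integral => D mD _; exact: IH.
Qed.

Lemma CI_perm (s s' : seq nat) (f : E -> R[i]) : uniq s -> perm_eq s s' -> CI (mu s) f = CI (mu s') f.
Proof. by move=> us pe; apply: CI_meas_eq => B mB; exact: mu_perm. Qed.

Lemma Cintegrable_perm (s s' : seq nat) (f : E -> R[i]) : uniq s -> perm_eq s s' ->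
  Cintegrable (mu s') f -> Cintegrable (mu s) f.
Proof. by move=> us pe; apply: Cintegrable_meas_eq => B mB; exact: mu_perm. Qed.

Lemma pdom_perm (s s' : seq nat) (f : E -> R[i]) C g : perm_eq s s' -> pdom s f C g -> pdom s' f C g.
Proof. by move=> pe [mf g0 ig fg]; split=> // t; rewrite -(perm_big _ pe). Qed.
End Permute.

Section Laguerre.
Context {R : realType}.
Variable gam : R[i].
Hypothesis gam0 : 0 < ReC gam.
Local Notation E := (envT R).
Local Notation lam := (@lebesgue_measure R).

(** The smallest variable is [x] and the others are $w_j+x$. At $a=1$ the only power of a single
    variable that remains is $(t_j-x)^{2\gamma}=w_j^{2\gamma}$, which is the same integrand with
    $a=2\gamma+1$, while the shift of the $n+1$ exponentials gives $e^{-(n+1)x}$. *)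
Lemma Lagf_split n x (w : E) :
  Lagf gam n.+1 1 (upd (aff (fun=> 1) (fun=> x) (map (addn 1) (sq n)) w) 1 x) =
  pw x 0 * (expR (- x))%:C ^+ n.+1 * Lagf gam n (2%:R * gam + 1) (fun i => w (1 + i)%N).
Proof.
set s := map (addn 1) (sq n); set v := upd _ _ _.
have v1 : v 1%N = x by rewrite /v updE.
have ns : 1%N \notin s.
  by apply/mapP => -[k]; rewrite mem_sq => /andP[k1 _] e; lia.
have vs j : j \in s -> v j = w j + x.
  move=> js; rewrite /v updN; last by apply: contraNneq ns => <-.
  by rewrite /aff js mul1r.
have [x0|x0] := leP x 0.
  have -> : pw x 0 = 0 by rewrite /pw ltNge x0.
  rewrite !mul0r /Lagf -[n.+1]add1n sq_cat big_cat /= big_seq1 v1 subrr.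
  by rewrite (_ : pw x 0 = 0) ?mul0r ?mulr0 ?mul0r// /pw ltNge x0.
rewrite {1}/Lagf -[n.+1 in LHS]add1n sq_cat -/s !big_cat /= !big_seq1 v1 subrr.
have lt1 i : i \in s -> (1 < i)%N by move=> /mapP[j]; rewrite mem_sq => /andP[j1 _] ->; rewrite add1n ltnS.
have -> : \prod_(k <- s ++ [:: 1%N] | (k < 1)%N) pw (x - v k) (2%:R * gam) = 1.
  rewrite big_cat /= big_seq_cond big1; last by move=> i /andP[/lt1 i1]; rewrite ltnNge ltnW.
  by rewrite big_mkcond big_seq1 /= mulr1.
have -> : \prod_(j <- s) \prod_(k <- s ++ [:: 1%N] | (k < j)%N) pw (v j - v k) (2%:R * gam) =
   (\prod_(j <- s) \prod_(k <- s | (k < j)%N) pw (w j - w k) (2%:R * gam)) * \prod_(j <- s) pw (w j) (2%:R * gam).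
  rewrite -big_split !big_seq; apply: eq_bigr => j js; rewrite big_cat /=; congr (_ * _).
    rewrite big_seq_cond [RHS]big_seq_cond; apply: eq_bigr => k /andP[ks _]; rewrite !vs//.
    by congr pw; ring.
  by rewrite big_mkcond big_seq1 (lt1 _ js) v1 vs// addrK.
have eX : (expR (- x))%:C ^+ n.+1 = (expR (- x))%:C * \prod_(j <- s) (expR (- x))%:C :> R[i].
  by rewrite big_map prod_sq_const exprS.
rewrite eX /Lagf -(big_map (addn 1) predT (fun j => pw (w j) (2%:R * gam + 1 - 1) * (expR (- w j))%:C)) -/s.
have -> : \prod_(j <- sq n) \prod_(k <- sq n | (k < j)%N) pw (w (1 + j)%N - w (1 + k)%N) (2%:R * gam) =
    \prod_(j <- s) \prod_(k <- s | (k < j)%N) pw (w j - w k) (2%:R * gam).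
  rewrite big_map; apply: eq_bigr => j _; rewrite big_map; apply: eq_bigl => k.
  by rewrite ltn_add2l.
have -> : \prod_(j <- s) (pw (v j) 0 * (expR (- v j))%:C) * (pw x 0 * (expR (- x))%:C) *
   ((\prod_(j <- s) \prod_(k <- s | (k < j)%N) pw (w j - w k) (2%:R * gam)) * (\prod_(j <- s) pw (w j) (2%:R * gam)) * 1) =
   (\prod_(j <- s) (pw (v j) 0 * (expR (- v j))%:C * pw (w j) (2%:R * gam))) * (pw x 0 * (expR (- x))%:C) *
   \prod_(j <- s) \prod_(k <- s | (k < j)%N) pw (w j - w k) (2%:R * gam).
  by rewrite [in RHS]big_split /=; ring.
have -> : \prod_(j <- s) (pw (v j) 0 * (expR (- v j))%:C * pw (w j) (2%:R * gam)) =
   (\prod_(j <- s) (expR (- x))%:C) * \prod_(j <- s) (pw (w j) (2%:R * gam + 1 - 1) * (expR (- w j))%:C).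
  rewrite -big_split !big_seq; apply: eq_bigr => j js; rewrite vs// addrK /= opprD expRD realCM.
  have [w0|w0] := leP (w j) 0; first by rewrite /pw [0 < w j]ltNge w0 /= !(mulr0, mul0r).
  have wx : 0 < w j + x by rewrite addr_gt0.
  rewrite [pw (w j + x) _]/pw wx cpow_x0 ?gt_eqF//; ring.
ring.
Qed.

Lemma CI_exp_scaled (n : nat) : CI lam (fun x => pw x 0 * (expR (- x))%:C ^+ n.+1) = (n.+1%:R)^-1 :> R[i].
Proof.
have c0 : 0 < n.+1%:R :> R by [].
have o1 : 0 < ReC (1 : R[i]) by rewrite /ReC /= ltr01.
have := @Gamma1 R; rewrite GammaE subrr => G1.
pose f (x : R) : R[i] := pw x 0 * (expR (- x))%:C.
have fE : (fun x : R => f (n.+1%:R * x)) = (fun x => pw x 0 * (expR (- x))%:C ^+ n.+1).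
  apply/funext => x; rewrite /f /pw pmulr_rgt0//; case: ifP => x0; last by rewrite !mul0r.
  rewrite !cpow_x0 ?gt_eqF ?mulr_gt0// -rmorphXn -expRM_natl /=.
  by rewrite mulrN.
have mE : cmeas (fun x : R => (expR (- x))%:C : R[i]).
  apply: cmeas_real; apply: (measurableT_comp (@measurable_expR R)).
  by apply: (measurableT_comp (@oppr_measurable R setT)); exact: measurable_id.
have mf : cmeas f.
  by apply: cmeasM => //; exact: (cmeas_pw _ (@measurable_id _ _ setT)).
have intf : Cintegrable lam (fun x : R => f (n.+1%:R * x)).
  rewrite fE; have g1 : 0 < 1 :> R by []; apply: (Cintegrable_dom _ (integrable_gexp g1)).
    apply: cmeasM; first exact: (cmeas_pw _ (@measurable_id _ _ setT)).
    under eq_fun do rewrite -prod_sq_const; by apply: cmeas_prod => i _.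
  move=> x; rewrite /pw /gexp; case: ifPn => x0; last by rewrite mul0r nc0.
  rewrite cpow_x0 ?gt_eqF// mul1r subrr powRr0 mul1r ncX nc_real ger0_norm ?expR_ge0//.
  rewrite -expRM_natl ler_expR mulrN lerN2.
  apply: (@le_trans _ _ (1 * x)); first by lra.
  by rewrite ler_wpM2r ?(ltW x0)// ler1n.
have h := CI_scale c0 mf intf; rewrite fE -[LHS]/(CI lam f) G1 in h.
have n0 : n.+1%:R != 0 :> R[i] by rewrite pnatr_eq0.
by apply: (mulfI n0); rewrite mulfV// [RHS]h natC.
Qed.

(** Integrates the splitting: the translation by [x] preserves the measure of the other variables,
    and $\int_0^\infty e^{-(n+1)x}dx=1/(n+1)$. *)
Lemma LL_rec n : n.+1%:R * LL gam n.+1 1 = LL gam n (2%:R * gam + 1).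
Proof.
have a1 : 0 < ReC (1 : R[i]) by rewrite /ReC /= ltr01.
have a2 : 0 < ReC (2%:R * gam + 1) by rewrite ReCD addr_gt0// (gam20 gam0).
have [C1 C10 p1] := Lagf_pdom n.+1 gam0 a1; have [C2 C20 pd2] := Lagf_pdom n gam0 a2.
set s := map (addn 1) (sq n).
have pe : perm_eq (sq n.+1) (1%N :: s) by rewrite -[n.+1]add1n sq_cat perm_catC.
have ucs : uniq (1%N :: s) by rewrite -(perm_uniq pe) uniq_sq.
have /andP[ns us] := ucs.
have p1' := pdom_perm pe p1; have pm := pdom_map (addn 1) pd2.
have [m1 _ _ _] := p1.
rewrite /LL (CI_perm _ (uniq_sq n.+1) pe) (CI_consG2 ns (pdom_integrable ucs p1')); last first.
  by move=> x; apply: (pdom_integrable us) (pdom_slice x ns p1').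
have inner x : CI (mu s) (fun t => Lagf gam n.+1 1 (upd t 1 x)) =
    LL gam n (2%:R * gam + 1) * (pw x 0 * (expR (- x))%:C ^+ n.+1).
  have fE : (fun t : E => Lagf gam n.+1 1 (upd (aff (fun=> 1) (fun=> x) s t) 1 x)) =
     (fun w => pw x 0 * (expR (- x))%:C ^+ n.+1 * Lagf gam n (2%:R * gam + 1) (fun i => w (1 + i)%N)).
    by apply/funext => w; exact: Lagf_split.
  have iZ : Cintegrable (mu s) (fun t : E => Lagf gam n.+1 1 (upd (aff (fun=> 1) (fun=> x) s t) 1 x)).
    by rewrite fE; apply: CintegrableZ; exact: (pdom_integrable us pm).
  have [||_ ->] := @CI_aff R (fun=> 1) (fun=> x) s (fun t => Lagf gam n.+1 1 (upd t 1 x)) us _ _ iZ.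
  - by move=> _; exact: oner_neq0.
  - exact: cmeas_upd_env.
  rewrite fE CIZ; last exact: (pdom_integrable us pm).
  have [_ rn] := CI_rename (@addnI 1) (uniq_sq n) (cmeas_Lfun gam n (2%:R * gam + 1)) (pdom_integrable us pm).
  rewrite -rn big1 ?mul1r; last by move=> j _; rewrite normr1.
  by rewrite mulrC.
rewrite (_ : (fun x => _) = fun x => LL gam n (2%:R * gam + 1) * (pw x 0 * (expR (- x))%:C ^+ n.+1)); last by apply/funext.
rewrite CIZ; first by rewrite CI_exp_scaled mulrCA mulfV ?mulr1// pnatr_eq0.
have g1 : 0 < 1 :> R by []; apply: (Cintegrable_dom _ (integrable_gexp g1)).
  apply: cmeasM; first exact: (cmeas_pw _ (@measurable_id _ _ setT)).
  under eq_fun do rewrite -prod_sq_const; apply: cmeas_prod => i _.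
  apply: cmeas_real; apply: (measurableT_comp (@measurable_expR R)).
  by apply: (measurableT_comp (@oppr_measurable R setT)); exact: measurable_id.
move=> x; rewrite /pw /gexp; case: ifPn => x0; last by rewrite mul0r nc0.
rewrite cpow_x0 ?gt_eqF// mul1r subrr powRr0 mul1r ncX nc_real ger0_norm ?expR_ge0//.
rewrite -expRM_natl ler_expR mulrN lerN2.
apply: (@le_trans _ _ (1 * x)); first by lra.
by rewrite ler_wpM2r ?(ltW x0)// ler1n.
Qed.

Section Selberg.
Variable n : nat.
Let z (s : nat) : R := s.-1%:R.
Let zlt s : (1 <= s < 2)%N -> z s < z s.+1.
Proof. by case: s => [|[|s]]// _; rewrite /z ltr_nat. Qed.
Let ab (a b : R[i]) (s : nat) : R[i] := if s == 1%N then a else b.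
Let b1 (_ : nat) := 1%N.
(** A Selberg integral over $0\le t_1\le\dots\le t_n\le1$, with the form $u_x$ in every variable. *)
Let Sx a b x := J 2 n z gam (ab a b) b1 (fun=> x).

Let ob1 : okb 2 n b1. Proof. by []. Qed.
Let pab a b : 0 < ReC a -> 0 < ReC b -> posal 2 (ab a b).
Proof. by move=> a0 b0 s _; rewrite /ab; case: (s == 1%N). Qed.

(** The substitution $t\mapsto1-t$ reverses the order of the variables; reversing the indices as
    well brings the simplex back to itself. *)
Definition rho (j : nat) : nat := if (1 <= j <= n)%N then (n.+1 - j)%N else j.
Lemma rhoK : involutive rho.
Proof. by move=> j; rewrite /rho; case: (boolP (1 <= j <= n)%N) => h; case: ifP => h2; lia. Qed.
Lemma rho_sq j : (rho j \in sq n) = (j \in sq n).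
Proof. by rewrite !mem_sq /rho; case: (boolP (1 <= j <= n)%N) => h //; lia. Qed.
Lemma rho_perm : perm_eq (map rho (sq n)) (sq n).
Proof.
apply: uniq_perm; rewrite ?uniq_sq ?(map_inj_uniq (inv_inj rhoK)) ?uniq_sq// => j.
apply/mapP/idP => [[i ii ->]|jn]; first by rewrite rho_sq.
by exists (rho j); rewrite ?rho_sq ?rhoK.
Qed.
Lemma rho_lt j k : j \in sq n -> k \in sq n -> (rho k < rho j)%N = (j < k)%N.
Proof. by rewrite !mem_sq /rho => jn kn; rewrite jn kn; lia. Qed.

Lemma prod_rho (T : comNzRingType) (G : nat -> T) : \prod_(j <- sq n) G (rho j) = \prod_(j <- sq n) G j.
Proof. by rewrite -(big_map rho predT G); exact: (perm_big _ rho_perm). Qed.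

(** For each variable, $u_2(1-x)=-u_1(x)$, and the phases come from $(-x)^b$ on one side and
    $(x-1)^a$ on the other. The pair factors are invariant. *)
Lemma reflect_integrand a b (u : E) :
  cut n z b1 (term 2 n z gam (ab a b) (fun=> 2%N)) (fun j => aff (fun=> -1) (fun=> 1) (sq n) u (rho j)) =
  ((- cexp (b * (0 +i* pi)) / cexp (a * (0 +i* pi)))^+ n) *
  cut n z b1 (term 2 n z gam (ab b a) (fun=> 1%N)) u.
Proof.
set v := (fun j : nat => aff _ _ _ _ (rho j)).
have vE j : j \in sq n -> v j = 1 - u (rho j).
  by move=> jn; rewrite /v /aff rho_sq jn mulN1r addrC.
have z1 : z 1 = 0 by []. have z2 : z 2 = 1 by [].
have cellE : cell n z b1 v <-> cell n z b1 u.
  split=> -[h1 h2]; split.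
  - move=> j jn; have := h1 (rho j); rewrite rho_sq => /(_ jn); rewrite vE ?rho_sq// rhoK /b1 z1 z2.
    by move=> /andP[? ?]; apply/andP; split; lra.
  - move=> j k jn kn jk; have := h2 (rho k) (rho j); rewrite !rho_sq rho_lt// => /(_ kn jn jk).
    by rewrite !vE ?rho_sq// !rhoK; lra.
  - move=> j jn; rewrite vE//; have := h1 (rho j); rewrite rho_sq => /(_ jn); rewrite /b1 z1 z2.
    by move=> /andP[? ?]; apply/andP; split; lra.
  - move=> j k jn kn jk; rewrite !vE//; have := h2 (rho k) (rho j); rewrite !rho_sq rho_lt// => /(_ kn jn jk).
    by lra.
rewrite /cut (asbool_equiv_eq cellE); case: asboolP => [cu|_]; last by rewrite mulr0.
have ur j : j \in sq n -> 0 <= u j <= 1 by move=> jn; have [h _] := cu; have := h j jn; rewrite /b1 z1 z2.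
rewrite /term mulrA; congr (_ * _); last first.
  rewrite /prs; under eq_bigr do rewrite big_mkcond; under [RHS]eq_bigr do rewrite big_mkcond.
  rewrite (eq_big_seq (fun j => \prod_(k <- sq n) (if (rho j < rho k)%N then cpowR (u (rho k) - u (rho j)) (2%:R * gam) else 1))); last first.
    move=> j jn; apply: eq_big_seq => k kn; rewrite rho_lt//; case: ifP => // _.
    by rewrite !vE//; congr cpowR; ring.
  rewrite (prod_rho (fun j => \prod_(k <- sq n) (if (j < rho k)%N then cpowR (u (rho k) - u j) (2%:R * gam) else 1))).
  under eq_bigr => j _ do rewrite (prod_rho (fun k => if (j < k)%N then cpowR (u k - u j) (2%:R * gam) else 1)).
  by rewrite exchange_big.
rewrite -prod_sq_const -big_split.
rewrite (eq_big_seq (fun j => (fun x => uu z 2 (1 - x) * col 2 z (ab a b) (1 - x)) (u (rho j)))); last first.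
  by move=> j jn; rewrite vE.
rewrite (prod_rho (fun j => uu z 2 (1 - u j) * col 2 z (ab a b) (1 - u j))).
apply: eq_big_seq => j /ur; move: (u j) => x /andP[x0 x1].
rewrite /uu /col /= !big_cons !big_nil !mulr1 /ab /= z1 z2 !subr0.
have -> : 1 - x - 1 = - x by ring.
have ea := cexp_neq0 (a * (0 +i* pi)).
have e1 : cpowR (x - 1) a = cexp (a * (0 +i* pi)) * cpowR (1 - x) a.
  have [->|xn] := eqVneq x 1; first by rewrite subrr !cpow0 mulr0.
  by rewrite cpow_neg ?opprB// subr_lt0 lt_neqAle xn.
have e2 : cpowR (- x) b = cexp (b * (0 +i* pi)) * cpowR x b.
  have [->|xn] := eqVneq x 0; first by rewrite oppr0 !cpow0 mulr0.
  by rewrite cpow_neg ?opprK// oppr_lt0 lt_neqAle eq_sym xn.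
rewrite e1 e2 rmorphN invrN; have [->|xn0] := eqVneq x 0; first by rewrite !cpow0 !(mulr0, mul0r).
by field; rewrite ea fmorph_eq0 xn0.
Qed.

Lemma Sx_reflect a b : 0 < ReC a -> 0 < ReC b ->
  Sx a b 2 = ((- cexp (b * (0 +i* pi)) / cexp (a * (0 +i* pi)))^+ n) * Sx b a 1.
Proof.
move=> a0 b0; rewrite /Sx /J.
set f := cut n z b1 (term 2 n z gam (ab a b) (fun=> 2%N)).
set G := cut n z b1 (term 2 n z gam (ab b a) (fun=> 1%N)).
have iG : Cintegrable (mu (sq n)) G by apply: (term_int (isT : (2 <= 2)%N) zlt gam0 (pab b0 a0) ob1).
have mf : cmeas f by apply: cmeas_cut; exact: cmeas_term.
have mr : cmeas (fun t : E => f (fun j => t (rho j))).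
  by apply: (cmeas_comp (T := E) mf); apply: meas_env => j; exact: meas_coord.
have fE : (fun u : E => (fun t : E => f (fun j => t (rho j))) (aff (fun=> -1) (fun=> 1) (sq n) u)) =
  (fun u => ((- cexp (b * (0 +i* pi)) / cexp (a * (0 +i* pi)))^+ n) * G u).
  by apply/funext => u; exact: reflect_integrand.
have iZ : Cintegrable (mu (sq n)) (fun u : E => (fun t : E => f (fun j => t (rho j))) (aff (fun=> -1) (fun=> 1) (sq n) u)).
  by rewrite fE; exact: CintegrableZ.
have m1 (j : nat) : (-1 : R) != 0 by rewrite oppr_eq0 oner_eq0.
have [i2 e2] := CI_aff (uniq_sq n) m1 mr iZ.
have ur : uniq (map rho (sq n)) by rewrite (perm_uniq rho_perm) uniq_sq.
have [_ ->] := CI_rename (inv_inj rhoK) (uniq_sq n) mf (Cintegrable_perm ur rho_perm i2).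
rewrite (CI_perm _ ur rho_perm) e2 fE CIZ// big1 ?mul1r// => j _.
by rewrite normrN normr1.
Qed.

Lemma Zc1_unique : exists m0 : Zc n 1, forall m : Zc n 1, m = m0.
Proof.
have := card_Zc 0 n; rewrite bin0 => /fintype1 [m0 h]; by exists m0 => m; exact: h.
Qed.

Lemma det_fmx1 (I : finType) (i0 : I) (A : I -> I -> R[i]) : (forall i, i = i0) -> \det (fmx A) = A i0 i0.
Proof.
move=> h; have -> : \det (fmx A) = \det (fmx (fun l m => if l == m then A l l else 0)).
  by congr (\det (fmx _)); apply/funext => l; apply/funext => m; rewrite (h l) (h m) eqxx.
rewrite det_fmx_diag (bigD1 i0)//= big1 ?mulr1// => i; by rewrite (h i) eqxx.
Qed.

Lemma OmJ_const a b (m0 : Zc n 1) (x : 'I_3) : ~~ (1 < x < 2)%N ->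
  OmJ n z gam (ab a b) (blk (p := 2) m0) (tyM x m0) = Sx a b x.
Proof.
move=> x12; have c1 : cget m0 1 = n by have := sum_cget m0; rewrite big_nat1.
have tyE (s : 'I_3) : tyM x m0 s = if s == x then n else 0%N.
  rewrite ffunE c1; case: eqP => // _; case: ifP => //; lia.
rewrite /OmJ /Om (big_pred1 [ffun=> x]); last first.
  move=> f /=; apply/eqP/eqP => [e|->]; last first.
    apply/ffunP => s; rewrite tyE ffunE; have [->|sx] := eqVneq s x.
      rewrite -[RHS](card_ord n) -cardsT; congr #|pred_of_set _|; apply/setP => o; by rewrite !inE ffunE eqxx.
    by apply/eqP; rewrite cards_eq0; apply/eqP/setP => o; rewrite !inE ffunE eq_sym (negbTE sx).
  apply/ffunP => o; rewrite ffunE; apply/eqP/negPn/negP => fo.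
  have : ty f (f o) = 0%N by rewrite e tyE (negbTE fo).
  by rewrite ffunE => /eqP; rewrite cards_eq0 => /eqP/setP/(_ o); rewrite !inE eqxx.
have bE j : j \in sq n -> blk (p := 2) m0 j = 1%N.
  by move=> jn; have := okb_blk (isT : (2 <= 2)%N) gam0 m0 jn; lia.
have cE : cell n z (blk (p := 2) m0) = cell n z b1.
  by apply/seteqP; split => t [h1 h2]; split=> // j jn; have := h1 j jn; rewrite bE.
rewrite /Jf /Sx /J; congr CI; apply/funext => t; rewrite /cut cE; case: asboolP => // _.
rewrite /term; congr (_ * _); apply: eq_big_seq => j; rewrite mem_sq; case: j => // j jn'.
by have jn : (j < n)%N by []; rewrite (labE _ (Ordinal jn)) ffunE.
Qed.

(** The case $p=2$ expresses the Selberg integral with label 1 through [LL gam n a] ([F1]), the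
    relations pass from label 1 to label 2 ([F2]), and the reflection returns to label 1 with [a]
    and [b] exchanged. The factor with $1+a+b$ is symmetric and cancels. *)
Lemma LL_sym a b : 0 < ReC a -> 0 < ReC b ->
  LL gam n b * \prod_(0 <= k < n) Gamma (a + k%:R * gam) = LL gam n a * \prod_(0 <= k < n) Gamma (b + k%:R * gam).
Proof.
have [m0 h0] := Zc1_unique.
have c1 : cget m0 1 = n by have := sum_cget m0; rewrite big_nat1.
have bigm (G : Zc n 1 -> R[i]) : \prod_(m : Zc n 1) G m = G m0.
  by rewrite (bigD1 m0)//= big1 ?mulr1// => m; rewrite (h0 m) eqxx.
have i1E2 : (i1 2 : nat) = 1%N by rewrite i1E.
pose xg a b k : R[i] := 1 + (a + b) + (2 * n - 2 - k)%:R * gam.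
have F1 a' b' : 0 < ReC a' -> 0 < ReC b' ->
   Sx a' b' 1 * \prod_(0 <= k < n) (Gamma (1 + b' + k%:R * gam))^-1 =
   LL gam n a' * cexp (b' * (0 +i* pi)) ^+ n * \prod_(0 <= k < n) (Gamma (xg a' b' k))^-1.
  move=> a0 b0; have := Dal_formula n (isT : (2 <= 2)%N) zlt gam0 (pab a0 b0).
  rewrite /= !bigm c1 /Dal /DO (det_fmx1 _ h0) OmJ_const ?i1E2//.
  have z21 : z 2 - z 1 = 1 by rewrite /z /= subr0.
  have z12 : z 1 - z 2 = -1 by rewrite -opprB z21.
  have ZE : Zcol 2 z (ab a' b') 1 = cexp (b' * (0 +i* pi)).
    rewrite /Zcol /= !big_cons big_nil /= mulr1 z12 cpow_neg ?oppr_lt0//.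
    by rewrite opprK cpow1x mulr1.
  have DkE : Dk (p := 2) z gam (ab a' b') m0 1 = LL gam n a' * cexp (b' * (0 +i* pi)) ^+ n.
    by rewrite /Dk big_nat1 c1 ZE [X in _ * X = _]big_geq// mulr1.
  rewrite big_nat1 z21 cpow1x mulr1 DkE.
  move=> e; apply: (etrans e); congr (_ * _); apply: eq_bigr => k _.
  by rewrite /xk /xg /= !big_cons big_nil addr0.
have F2 a' b' : 0 < ReC a' -> 0 < ReC b' ->
   (\prod_(0 <= k < n) (b' + k%:R * gam)) * Sx a' b' 2 = (-1) ^+ n * (\prod_(0 <= k < n) (a' + k%:R * gam)) * Sx a' b' 1.
  move=> a0 b0.
  have ob (l : Zc n 1) : okb 2 n (blk (p := 2) l) by move=> j; exact: (okb_blk (isT : (2 <= 2)%N) gam0).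
  have := DO_ratio (isT : (2 <= 2)%N) gam0 (bl := fun l : Zc n 1 => blk (p := 2) l) ob (pab a0 b0) (lp1 2)
     (fun b ob => relwp (isT : (2 <= 2)%N) zlt gam0 (pab a0 b0) ob).
  by rewrite !bigm c1 /Dal /DO !(det_fmx1 _ h0) !OmJ_const ?i1E2//=.
have G0 a' k : 0 < ReC a' -> 0 < ReC (a' + k%:R * gam).
  by move=> a0; rewrite ReCD ReC_natM ltr_wpDr// mulr_ge0// ltW.
have GS a' : 0 < ReC a' -> \prod_(0 <= k < n) Gamma (1 + a' + k%:R * gam) =
   (\prod_(0 <= k < n) (a' + k%:R * gam)) * \prod_(0 <= k < n) Gamma (a' + k%:R * gam).
  move=> a0; rewrite -big_split; apply: eq_bigr => k _ /=; rewrite -GammaS; last exact: G0.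
  by congr Gamma; ring.
have N0 a' : 0 < ReC a' -> \prod_(0 <= k < n) (a' + k%:R * gam) != 0.
  by move=> a0; rewrite big_mkord; apply/prodf_neq0 => k _; apply: Re_neq0; exact: G0.
have P0 a' : 0 < ReC a' -> \prod_(0 <= k < n) Gamma (a' + k%:R * gam) != 0.
  by move=> a0; rewrite big_mkord; apply/prodf_neq0 => k _; apply: Gamma_neq0; exact: G0.
move=> a0 b0.
have X0 : \prod_(0 <= k < n) (Gamma (xg a b k))^-1 != 0.
  rewrite big_mkord; apply/prodf_neq0 => k _; rewrite invr_eq0; apply: Gamma_neq0.
  apply: G0; rewrite !ReCD addr_gt0 ?addr_gt0//.
have xC : \prod_(0 <= k < n) (Gamma (xg b a k))^-1 = \prod_(0 <= k < n) (Gamma (xg a b k))^-1.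
  by apply: eq_bigr => k _; rewrite /xg [b + a]addrC.
have f1 := F1 a b a0 b0; have f2 := F1 b a b0 a0; have g := F2 a b a0 b0.
rewrite (Sx_reflect a0 b0) in g.
rewrite xC !prodfV GS// in f2; rewrite !prodfV GS// in f1; rewrite prodfV in X0; clear xC.
have ea := expf_neq0 n (cexp_neq0 (a * (0 +i* pi))); have eb := expf_neq0 n (cexp_neq0 (b * (0 +i* pi))).
have m1 : (-1 : R[i]) ^+ n != 0 by rewrite expf_neq0// oppr_eq0 oner_eq0.
rewrite expr_div_n (exprNn (cexp (b * (0 +i* pi)))) in g.
move: (Sx a b 1) (Sx b a 1) (LL gam n a) (LL gam n b) f1 f2 g X0 (N0 a a0) (N0 b b0) (P0 a a0) (P0 b b0) ea eb.
move: (\prod_(0 <= k < n) (a + k%:R * gam)) (\prod_(0 <= k < n) (b + k%:R * gam))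
  (\prod_(0 <= k < n) Gamma (a + k%:R * gam)) (\prod_(0 <= k < n) Gamma (b + k%:R * gam))
  (cexp (a * (0 +i* pi)) ^+ n) (cexp (b * (0 +i* pi)) ^+ n) (\prod_(0 <= k < n) Gamma (xg a b k)).
move=> A B GA GB ca cb X S1 S2 La Lb f1 f2 g; rewrite invr_eq0 => X0 A0 B0 GA0 GB0 ca0 cb0.
have s1 : S1 = La * cb * (B * GB) / X.
  by rewrite -[LHS](divfK (mulf_neq0 B0 GB0)) f1; ring.
have s2 : S2 = Lb * ca * (A * GA) / X.
  by rewrite -[LHS](divfK (mulf_neq0 A0 GA0)) f2; ring.
have K0 : (-1) ^+ n * A * B * cb / X != 0 by rewrite !mulf_neq0 ?invr_eq0.
apply: (mulfI K0); move: g; rewrite s1 s2; move: ((-1) ^+ n) => e g.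
have -> : e * A * B * cb / X * (Lb * GA) = B * (e * cb / ca * (Lb * ca * (A * GA) / X)) by field; rewrite ca0 X0.
by rewrite g; ring.
Qed.
End Selberg.

(** Comparison with the value at 1 by [LL_sym] determines the integral up to a constant independent
    of [a]; [LL_rec] gives that value from the induction hypothesis at $2\gamma+1$. *)
Theorem LL_val n a : 0 < ReC a ->
  LL gam n a = \prod_(0 <= k < n) (Gamma (k.+1%:R * gam) / Gamma gam * Gamma (a + k%:R * gam)).
Proof.
elim: n a => [|n IH] a a0.
  rewrite /LL big_geq// CI_nil; last exact: cmeas_Lfun.
  by rewrite /Lagf !big_nil mulr1.
have o1 : 0 < ReC (1 : R[i]) by rewrite /ReC /= ltr01.
have a2 : 0 < ReC (2%:R * gam + 1) by rewrite ReCD addr_gt0// (gam20 gam0).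
have s := LL_sym n.+1 a0 o1; have r := LL_rec n; rewrite IH// in r.
have G0 a' k : 0 < ReC a' -> Gamma (a' + k%:R * gam) != 0.
  by move=> h; apply: Gamma_neq0; rewrite ReCD ReC_natM ltr_wpDr// mulr_ge0// ltW.
have gk0 k : 0 < ReC (k.+1%:R * gam) by rewrite ReC_natM mulr_gt0.
pose g k := Gamma (1 + k%:R * gam).
have g0 : g 0%N = 1 by rewrite /g mul0r addr0 Gamma1.
have gS k : g k.+1 = k.+1%:R * gam * Gamma (k.+1%:R * gam) by rewrite /g [1 + _]addrC GammaS.
(* The factors on the left are $g(2),\dots,g(n+1)$; supplying $g(1)$ and $g(0)=1$ completes the
   product from 0 to $n+1$. *)
have e : (\prod_(0 <= k < n) Gamma (2%:R * gam + 1 + k%:R * gam)) * g 1%N = (\prod_(0 <= k < n.+1) g k) * g n.+1.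
  have -> : (\prod_(0 <= k < n.+1) g k) * g n.+1 = \prod_(0 <= k < n.+2) g k by rewrite [RHS]big_nat_recr.
  rewrite [RHS]big_ltn// [X in _ = _ * X]big_ltn// g0 mul1r mulrC; congr (_ * _).
  rewrite !big_add1 /=; apply: eq_bigr => k _; rewrite /g; congr Gamma.
  have -> : k.+2%:R = k%:R + 2%:R :> R[i] by rewrite -addn2 natrD.
  by ring.
have P0 : \prod_(0 <= k < n.+1) g k != 0.
  by rewrite big_mkord; apply/prodf_neq0 => k _; exact: G0.
have n0 : n.+1%:R != 0 :> R[i] by rewrite pnatr_eq0.
have gn : gam != 0 by exact: Re_neq0.
have Gg : Gamma gam != 0 by exact: Gamma_neq0.
rewrite big_split /= in r; rewrite [RHS]big_split /= [in RHS]big_nat_recr//=.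
set c := \prod_(0 <= k < n) (Gamma (k.+1%:R * gam) / Gamma gam) in r *.
rewrite -/(g) in s.
have s' : LL gam n.+1 1 * \prod_(0 <= k < n.+1) Gamma (a + k%:R * gam) = LL gam n.+1 a * \prod_(0 <= k < n.+1) g k by exact: s.
apply: (mulIf P0); rewrite -s'; apply: (mulfI n0).
transitivity (n.+1%:R * LL gam n.+1 1 * \prod_(0 <= k < n.+1) Gamma (a + k%:R * gam)); first by rewrite mulrA.
rewrite r.
have g1 : g 1%N = gam * Gamma gam by rewrite gS mul1r.
have g1n : g 1%N != 0 by rewrite g1 mulf_neq0.
apply: (mulIf g1n).
move: e; rewrite g1 gS.
move: (\prod_(0 <= k < n) Gamma (2%:R * gam + 1 + k%:R * gam)) (\prod_(0 <= k < n.+1) g k) => X Y e.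
move: (\prod_(0 <= k < n.+1) Gamma (a + k%:R * gam)) (Gamma (n.+1%:R * gam)) e => Z W e.
have -> : c * X * Z * (gam * Gamma gam) = c * Z * (X * (gam * Gamma gam)) by ring.
rewrite e; move: (n.+1%:R) => m; field.
by rewrite Gg.
Qed.

End Laguerre.

(** * The explicit formula *)

Section TriangularProducts.
Context {C : comNzRingType}.
Implicit Type f : nat -> nat -> C.

Lemma tri_swap f q : \prod_(1 <= s < q) \prod_(1 <= r < s) f r s = \prod_(1 <= a < q) \prod_(a.+1 <= b < q) f a b.
Proof.
elim: q => [|q IH]; first by rewrite !big_geq.
case: q IH => [|q] IH; first by rewrite !big_geq.
rewrite big_nat_recr//= IH [in RHS]big_nat_recr//= [X in _ = _ * X]big_geq// mulr1 -big_split.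
rewrite big_nat [RHS]big_nat; apply: eq_bigr => a ap /=.
by rewrite [RHS]big_nat_recr//=; lia.
Qed.

Lemma tri_drop f q : (0 < q)%N ->
  \prod_(1 <= a < q.+1) \prod_(a.+1 <= b < q.+1) f a b = \prod_(1 <= a < q) \prod_(a.+1 <= b < q.+1) f a b.
Proof. by move=> q0; rewrite big_nat_recr//= [X in _ * X]big_geq// mulr1. Qed.

Lemma tri_top f q : (0 < q)%N ->
  \prod_(1 <= a < q.+1) \prod_(a.+1 <= b < q.+1) f a b =
  (\prod_(1 <= a < q) \prod_(a.+1 <= b < q) f a b) * \prod_(1 <= a < q) f a q.
Proof.
move=> q0; rewrite tri_drop// -big_split big_nat [RHS]big_nat; apply: eq_bigr => a /andP[_ aq] /=.
by rewrite big_nat_recr.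
Qed.
End TriangularProducts.

Lemma cancel_aux (C : fieldType) (a b x y : C) : y != 0 -> a * b * x = a * (y * b) * x / y.
Proof. by move=> y0; field. Qed.

Section ExplicitFormula.
Context {R : realType}.
Variables (p n : nat) (z : nat -> R) (gam : R[i]) (al : nat -> R[i]).
Hypothesis p2 : (2 <= p)%N.
Hypothesis zlt : forall s, (1 <= s < p)%N -> z s < z s.+1.
Hypothesis gam0 : 0 < ReC gam.
Hypothesis pa : posal p al.
Let p0 : (0 < p)%N := ltnW p2.
Let EE := 'C(p + n - 2, p - 1).
Let XX := 'C(p + n - 2, p).
Let BB k := 'C(p + n - k - 3, p - 2).
Let ph s : R[i] := cexp (al s * (0 +i* pi)).
Let q a b x : R[i] := cpowR (z b - z a) x.

Let zab a b : (1 <= a)%N -> (a < b <= p)%N -> 0 < z b - z a.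
Proof. by move=> a1 ab; rewrite subr_gt0; apply: (z_lt p2 zlt); lia. Qed.

Lemma cexp_natM N (w : R[i]) : cexp (N%:R * w) = cexp w ^+ N.
Proof.
have := cexp_sum (iota 0 N) predT (fun=> w).
by rewrite !big_const_seq count_predT size_iota iter_addr_0 iter_mulr_1 mulr_natl.
Qed.

(** Only the points to the right of $z_s$ give negative differences, hence phases. *)
Lemma Zcol_split s : (1 <= s < p)%N -> Zcol p z al s =
  (\prod_(1 <= r < s) q r s (al r)) * \prod_(s.+1 <= r < p.+1) (ph r * q s r (al r)).
Proof.
move=> /andP[s1 sp]; rewrite /Zcol big_mkcond.
have -> : iota 1 p = index_iota 1 p.+1 by rewrite /index_iota subn1.
rewrite (@big_cat_nat _ _ _ s)//=; last by lia.
congr (_ * _); first by apply: eq_big_nat => r h; rewrite ifT//; lia.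
rewrite big_ltn; last by lia.
rewrite eqxx /= mul1r; apply: eq_big_nat => r h; rewrite ifT; last by lia.
have zr : z s - z r < 0 by rewrite -opprB oppr_lt0 zab//; lia.
by rewrite cpow_neg// opprB.
Qed.

(** For $a<b$, the factor [f a b] arises in block [b], or for $b=p$ from the scale $z_p-z_a$, where
    the pairs inside block [a] replace the pairs of two blocks; both counts give the same [XX]. The
    factor [g a b] with its phase arises in block [a]. *)
Let f a b := q a b (al a) ^+ EE * q a b (2%:R * gam) ^+ XX.
Let g a b := ph b ^+ EE * q a b (al b) ^+ EE.

Lemma prod_els s : (1 <= s < p)%N -> \prod_(l : Zc n p.-1) cpowR (z p - z s) (els gam al l s) = f s p.
Proof.
move=> sp; have zp : 0 < z p - z s by apply: zab; lia.
have zn : z p - z s != 0 by rewrite gt_eqF.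
rewrite /f /q -!cpowX// -cpowD.
under eq_bigr do rewrite (cpow_pos _ zp).
rewrite -cexp_sum -mulr_suml -cpow_pos//; congr cpowR.
by rewrite big_split /= -!mulr_suml -!natr_sum sum_cget_s// sum_cget_bin.
Qed.

Lemma phase_prod : \prod_(1 <= a < p.+1) \prod_(a.+1 <= b < p.+1) ph b ^+ EE =
  cexp (Complex 0 1 * (pi : R)%:C * EE%:R * \sum_(1 <= s < p.+1) (s.-1)%:R * al s).
Proof.
rewrite -(tri_swap (fun=> fun b => ph b ^+ EE)) mulr_sumr cexp_sum; apply: eq_bigr => s _.
rewrite prodr_const_nat subn1 -exprM -cexp_natM; congr cexp.
have -> : Complex 0 1 * (pi : R)%:C = 0 +i* (pi : R) :> R[i].
  by apply: complex_eq; rewrite /ReC /ImC /=; ring.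
by rewrite natrM; ring.
Qed.

(** All factors are regrouped by pairs $a<b$: [f] supplies $\alpha_a$ and $2\gamma$, [g] supplies
    $\alpha_b$. The phase of $\alpha_b$ occurs once for each $a<b$, hence the weights $b-1$ in the
    exponential. *)
Lemma position_prod :
  (\prod_(1 <= s < p) (Zcol p z al s ^+ EE * \prod_(1 <= r < s) q r s (2%:R * gam) ^+ XX)) * \prod_(1 <= s < p) f s p =
  cexp (Complex 0 1 * (pi : R)%:C * EE%:R * \sum_(1 <= s < p.+1) (s.-1)%:R * al s) *
  \prod_(1 <= a < p.+1) \prod_(a.+1 <= b < p.+1) cpowR (z b - z a) ((al a + al b) * EE%:R + 2%:R * gam * XX%:R).
Proof.
rewrite (eq_big_nat _ _ (F2 := fun s => (\prod_(1 <= r < s) f r s) * \prod_(s.+1 <= r < p.+1) g s r)); last first.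
  move=> s sp; rewrite Zcol_split// exprMn mulrAC; congr (_ * _); first by rewrite -prodrXl -big_split.
  by rewrite -prodrXl; apply: eq_bigr => r _; rewrite exprMn.
rewrite big_split /= tri_swap mulrAC -tri_top// -(tri_drop _ p0) -phase_prod -!big_split /=.
apply: eq_big_nat => a ap; rewrite -!big_split; apply: eq_big_nat => b bp /=.
have zn : z b - z a != 0 by rewrite gt_eqF// zab//; lia.
have -> : cpowR (z b - z a) ((al a + al b) * EE%:R + 2%:R * gam * XX%:R) =
    q a b (al a) ^+ EE * q a b (al b) ^+ EE * q a b (2%:R * gam) ^+ XX.
  by rewrite /q -!cpowX// -!cpowD; congr cpowR; ring.
by rewrite /f /g mulrCA (mulrAC (q a b (al a) ^+ EE)).
Qed.

Lemma prod_LL s : (1 <= s < p)%N -> \prod_(l : Zc n p.-1) LL gam (cget l s) (al s) =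
  \prod_(0 <= k < n) (Gamma (k.+1%:R * gam) / Gamma gam * Gamma (al s + k%:R * gam)) ^+ BB k.
Proof.
move=> sp; have as0 : 0 < ReC (al s) by apply: pa; lia.
by rewrite (eq_bigr _ (fun l _ => LL_val gam0 (cget l s) as0)); exact: prod_cget_below.
Qed.

Lemma prod_Dk : \prod_(l : Zc n p.-1) Dk z gam al l p.-1 =
  (\prod_(0 <= k < n) (Gamma (k.+1%:R * gam) ^+ p.-1 / Gamma gam ^+ p.-1 *
     \prod_(1 <= j < p) Gamma (al j + k%:R * gam)) ^+ BB k) *
  \prod_(1 <= s < p) (Zcol p z al s ^+ EE * \prod_(1 <= r < s) q r s (2%:R * gam) ^+ XX).
Proof.
rewrite /Dk exchange_big /= prednK//.
rewrite (eq_big_nat _ _ (F2 := fun s => (\prod_(0 <= k < n) (Gamma (k.+1%:R * gam) / Gamma gam * Gamma (al s + k%:R * gam)) ^+ BB k) *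
   (Zcol p z al s ^+ EE * \prod_(1 <= r < s) q r s (2%:R * gam) ^+ XX))); last first.
  move=> s sp; rewrite !big_split /= prod_LL// prodrXr sum_cget_s// -mulrA; congr (_ * (_ * _)).
  rewrite exchange_big /=; apply: eq_big_nat => r rs; rewrite prodrXr sum_cget_2//; lia.
rewrite big_split /=; congr (_ * _); rewrite exchange_big /=; apply: eq_bigr => k _.
by rewrite prodrXl big_split /= prodr_const_nat subn1 expr_div_n.
Qed.

Theorem det_period_matrix : \det (period_matrix p n z al gam) =
    (\prod_(0 <= s < n)
       ((Gamma (s.+1%:R * gam) ^+ p.-1 / Gamma gam ^+ p.-1)
        * (Gamma (1 + al p + s%:R * gam) * \prod_(1 <= j < p) Gamma (al j + s%:R * gam))
        / Gamma (1 + (\sum_(1 <= j < p.+1) al j) + (2 * n - 2 - s)%N%:R * gam)) ^+ BB s)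
    * cexp (Complex 0 1 * (pi : R)%:C * EE%:R * \sum_(1 <= s < p.+1) (s.-1)%:R * al s)
    * \prod_(1 <= a < p.+1) \prod_(a.+1 <= b < p.+1)
        cpowR (z b - z a) ((al a + al b) * EE%:R + 2%:R * gam * XX%:R).
Proof.
rewrite (period_matrix_Dal n p2 zlt gam0 pa).
have := Dal_formula n p2 zlt gam0 pa.
have p11 : (1 <= 1 < p)%N by rewrite p2.
rewrite !(prod_cget_below n p2 _ p11) prod_Dk exchange_big /=.
have -> : \prod_(1 <= j < p) \prod_(l : Zc n p.-1) cpowR (z p - z j) (els gam al l j) = \prod_(1 <= s < p) f s p.
  by apply: eq_big_nat => s sp; exact: prod_els.
move=> e; rewrite -(mulrA (\prod_(0 <= k < n) _)) position_prod [RHS]mulrAC in e.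
rewrite -[RHS]mulrA.
have y0 k : Gamma (yk p gam al k) != 0.
  apply: Gamma_neq0; rewrite /yk !ReCD ReC_natM; apply: ltr_wpDr; first by rewrite mulr_ge0// ltW.
  apply: ltr_wpDr; last by rewrite /ReC /= ltr01.
  by apply: ltW; apply: pa; rewrite leqnn ltnW.
have Y0 : \prod_(0 <= k < n) (Gamma (yk p gam al k))^-1 ^+ 'C(p + n - k - 3, p - 2) != 0.
  by rewrite big_mkord; apply/prodf_neq0 => k _; rewrite expf_neq0// invr_eq0.
apply: (mulIf Y0); apply: (etrans e); rewrite [RHS]mulrAC; congr (_ * _).
rewrite -!big_split; apply: eq_bigr => k _ /=; rewrite /BB -!exprMn; congr (_ ^+ _).
rewrite /xk; have -> : iota 1 p = index_iota 1 p.+1 by rewrite /index_iota subn1.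
exact: (@cancel_aux R[i] _ _ _ _ (y0 k)).
Qed.
End ExplicitFormula.

Theorem theorem4 (R : realType) (p n : nat) (z : nat -> R)
  (alpha : nat -> R[i]) (gamma : R[i]) :
  (2 <= p)%N ->
  (forall s, (1 <= s < p)%N -> z s < z s.+1) ->
  (forall s, (1 <= s <= p)%N -> 0 < ReC (alpha s)) ->
  0 < ReC gamma ->
  \det (period_matrix p n z alpha gamma) =
    (\prod_(0 <= s < n)
       ((Gamma (s.+1%:R * gamma) ^+ p.-1 / Gamma gamma ^+ p.-1)
        * (Gamma (1 + alpha p + s%:R * gamma)
           * \prod_(1 <= j < p) Gamma (alpha j + s%:R * gamma))
        / Gamma (1 + (\sum_(1 <= j < p.+1) alpha j)
                   + (2 * n - 2 - s)%N%:R * gamma))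
       ^+ 'C(p + n - s - 3, p - 2))
    * cexp (Complex 0 1 * (pi : R)%:C * ('C(p + n - 2, p - 1))%:R
            * \sum_(1 <= s < p.+1) (s.-1)%:R * alpha s)
    * \prod_(1 <= a < p.+1) \prod_(a.+1 <= b < p.+1)
        cpowR (z b - z a)
          ((alpha a + alpha b) * ('C(p + n - 2, p - 1))%:R
           + 2%:R * gamma * ('C(p + n - 2, p))%:R).
Proof.
move=> p2 zlt pa gam0.
exact: (det_period_matrix n p2 zlt gam0 pa).
Qed.
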